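(* Fix an integer $m\ge 1$. There exist constants $\alpha,\beta>0$ such that for every even integer $k=12\ell+k'$ with $k'\in\{0,4,6,8,10,14\}$ and $\ell>\alpha m+\beta$, all the zeros of $g_{k,m}$ in the fundamental domain $\mathcal{F}$ lie on the arc $\mathcal{A}=\{e^{i\theta}:\frac{\pi}{2}\le\theta\le\frac{2\pi}{3}\}$. Moreover, these zeros become uniformly distributed on $\mathcal{A}$ as $k\to\infty$: for every $\frac{\pi}{2}\le a<b\le\frac{2\pi}{3}$, the proportion of the zeros of $g_{k,m}$ in $\mathcal{F}$ (counted with multiplicity) of the form $e^{i\theta}$ with $\theta\in[a,b]$ tends to $\frac{b-a}{2\pi/3-\pi/2}$ as $k\to\infty$.
   Context: $\mathbb{H}$ is the upper half plane and $q=e^{2\pi i\tau}$. For an even integer $k\ge0$, $M_k$ denotes the space of holomorphic modular forms of weight $k$ for $\mathrm{PSL}_2(\mathbb{Z})$. Every even $k\ge 0$ with $k\neq 2$ is written uniquely as $k=12\ell+k'$ with $\ell\ge0$ an integer and $k'\in\{0,4,6,8,10,14\}$. For $1\le m\le\ell$, $g_{k,m}$ denotes the unique form in $M_k$ whose $q$-expansion is $g_{k,m}(\tau)=q^m+O(q^{\ell+1})$ (the cusp forms of the Miller basis). The fundamental domain is $\mathcal{F}=\{z\in\mathbb{H}:|z|\ge1,\,-\frac12\le\operatorname{Re}z\le0\}\cup\{z\in\mathbb{H}:|z|>1,\,0<\operatorname{Re}z<\frac12\}$. ''Zeros in $\mathcal{F}$'' means zeros at points of $\mathcal{F}\subset\mathbb{H}$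 (not the vanishing at infinity). *)

(* Defs.v *)
From Stdlib Require Import Reals Lra List ClassicalEpsilon.
From Coquelicot Require Import Coquelicot.
Open Scope R_scope.

Definition inH (z : C) : Prop := 0 < Im z.

Definition Cpow (z : C) (n : nat) : C := pow_n (K := C_Ring) z n.

(** q = e^{2 pi i tau} = e^{-2 pi Im tau} (cos(2 pi Re tau) + i sin(2 pi Re tau)). *)
Definition qexp (tau : C) : C :=
  (exp (- 2 * PI * Im tau) * cos (2 * PI * Re tau),
   exp (- 2 * PI * Im tau) * sin (2 * PI * Re tau)).

Definition holo_on_H (f : C -> C) : Prop :=
  forall z : C, inH z -> ex_derive (K := C_AbsRing) (V := C_NormedModule) f z.

(** Holomorphic modular form of weight k for PSL_2(Z) (functions are only
    relevant on H; values off H are irrelevant). Holomorphy at infinity: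
    f is bounded on {Im tau >= 1}. *)
Definition is_modular_form (k : nat) (f : C -> C) : Prop :=
  holo_on_H f /\
  (forall (a b c d : Z) (tau : C), (a * d - b * c)%Z = 1%Z -> inH tau ->
     f (Cdiv (Cplus (Cmult (IZR a) tau) (IZR b)) (Cplus (Cmult (IZR c) tau) (IZR d)))
     = Cmult (Cpow (Cplus (Cmult (IZR c) tau) (IZR d)) k) (f tau)) /\
  (exists M : R, forall tau : C, 1 <= Im tau -> Cmod (f tau) <= M).

Definition kprime_ok (k' : nat) : Prop :=
  k' = 0%nat \/ k' = 4%nat \/ k' = 6%nat \/ k' = 8%nat \/ k' = 10%nat \/ k' = 14%nat.

(** f is the Miller basis form g_{k,m} for k = 12 l + k' (1 <= m <= l):
    f in M_k with q-expansion q^m + O(q^{l+1}). *)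
Definition is_g (l k' m : nat) (f : C -> C) : Prop :=
  (1 <= m)%nat /\ (m <= l)%nat /\
  is_modular_form (12 * l + k') f /\
  exists c : nat -> C,
    (forall n : nat, (n <= l)%nat -> c n = ((if Nat.eqb n m then 1%R else 0%R) : C)) /\
    (forall tau : C, inH tau ->
       is_series (K := C_AbsRing) (V := C_NormedModule)
                 (fun n => Cmult (c n) (Cpow (qexp tau) n)) (f tau)).

Definition inF (z : C) : Prop :=
  inH z /\
  ((1 <= Cmod z /\ -1/2 <= Re z <= 0) \/ (1 < Cmod z /\ 0 < Re z < 1/2)).

Definition on_arc (a b : R) (z : C) : Prop :=
  exists theta : R, a <= theta <= b /\ z = (cos theta, sin theta).

Definition arcA (z : C) : Prop := on_arc (PI / 2) (2 * PI / 3) z.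

Definition zero_order (f : C -> C) (z0 : C) (n : nat) : Prop :=
  exists r : R, 0 < r /\ exists h : C -> C,
    continuous (T := C_UniformSpace) (U := C_UniformSpace) h z0 /\ h z0 <> (0 : C) /\
    forall w : C, Cmod (Cminus w z0) < r -> f w = Cmult (Cpow (Cminus w z0) n) (h w).

Definition zeros_in_F (f : C -> C) (s : list (C * nat)) : Prop :=
  NoDup (map fst s) /\
  (forall p, In p s -> inF (fst p) /\ (1 <= snd p)%nat /\ zero_order f (fst p) (snd p)) /\
  (forall z, inF z -> f z = (0 : C) -> In z (map fst s)).

Definition indicator (P : Prop) : R :=
  if excluded_middle_informative P then 1 else 0.

Definition count_mult (s : list (C * nat)) : R :=
  fold_right (fun p acc => INR (snd p) + acc) 0 s.

Definition count_mult_arc (a b : R) (s : list (C * nat)) : R :=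
  fold_right (fun p acc => indicator (on_arc a b (fst p)) * INR (snd p) + acc) 0 s.

(* Main.v *)
(* Write k = 12 l + k' and g = g_{k,m}. The sum of (z+d)^{-k} exp(-2 pi i m/(z+d)) over all integers d, plus q^m, is modular
   up to small errors, and by the Lipschitz formula its q-coefficients up to q^l are small except for the one of q^m. It
   therefore approximates g: the difference vanishes to order l+1 at infinity, and after division by Delta^l a contraction
   argument with the maximum principle (along the line Im z = 3/4, using z -> -1/z) bounds it by its modular defect, so it is
   exponentially small on the arc. The terms q^m and d = 0 are complex conjugate up to a factor on the arc, d = 1 is bounded
   by 1, and the others are negligible, so that
     e^{i k t/2} e^{2 pi m sin t} g(e^{it}) = 2 cos(k t/2 + 2 pi m cos t) + (an error of modulus less than 2)
   at the points where the cosine is +1 or -1. This gives l - m sign changes on the open arc. On the other hand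
   g = E4^a E6^b Delta^l P(j) with P of degree l - m and k' = 4a + 6b, so these zeros account for all roots of P. Finally j is
   injective on the arc, and by the maximum principle Im j > 0 in the interior of the left half of the fundamental domain, so
   every point of the domain with j in [0, 1728] is on the arc. The interlacing with the sample points gives the equidistribution. *)

Require Import Defs.
From Stdlib Require Import Reals Lra Lia List ZArith.
From Coquelicot Require Import Coquelicot.
Open Scope R_scope.

(** * Complex derivatives *)

(** No contour integral occurs. Holomorphy enters through difference quotients and termwise
    differentiation of absolutely convergent series, the maximum principle through a second
    derivative test, and the valence formula is replaced by the contraction itself: a form of weight
    12 N + s with s <= 10 that vanishes to order N + 1 is zero. In the sum over d the exponential is
    truncated to a Taylor polynomial, so that only finitely many powers of 1/(z + d) occur and each
    falls under the Lipschitz formula; the truncation order is chosen after the weight. The low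
    modes are then subtracted exactly. The contraction breaks down for k' = 14. There the product
    with E4 is estimated instead, and on the arc one has to divide by E4, which vanishes at rho. The
    sample points keep a distance of order 1/l from rho, so this costs a factor linear in l against
    an exponentially small error. Real coefficients make the twisted values on the arc real, so that
    sign changes make sense. Since m is fixed, everything reduces to one threshold for l. *)

Definition cderiv (f : C -> C) (z l : C) : Prop :=
  forall eps, 0 < eps -> exists d, 0 < d /\ forall h, Cmod h < d ->
    Cmod (f (z + h) - f z - l * h)%C <= eps * Cmod h.

(** For complex-valued functions along curves: segments, vertical lines and the unit circle. *)
Definition rderiv (g : R -> C) (t : R) (v : C) : Prop :=
  forall eps, 0 < eps -> exists d, 0 < d /\ forall h : R, Rabs h < d ->
    Cmod (g (t + h)%R - g t - v * h)%C <= eps * Rabs h.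

Lemma Cmod_pos (a : C) : a <> 0%C -> 0 < Cmod a.
Proof. apply Cmod_gt_0. Qed.

Lemma Cmod_neq0 (a : C) : 0 < Cmod a -> a <> 0%C.
Proof. apply Cmod_gt_0. Qed.

Lemma Cmod_sub_comm (a b : C) : Cmod (a - b)%C = Cmod (b - a)%C.
Proof. rewrite <- Cmod_opp. f_equal. ring. Qed.

Lemma Cmod_tri3 (a b c : C) : Cmod (a + b + c)%C <= Cmod a + Cmod b + Cmod c.
Proof. generalize (Cmod_triangle (a+b)%C c) (Cmod_triangle a b). lra. Qed.

Lemma Cmod_tri_minus (a b : C) : Cmod (a - b)%C <= Cmod a + Cmod b.
Proof. unfold Cminus. rewrite <- (Cmod_opp b). apply Cmod_triangle. Qed.

Lemma Cmod_ge_minus (a b : C) : Cmod a - Cmod b <= Cmod (a - b)%C.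
Proof.
  generalize (Cmod_triangle (a - b)%C b).
  replace (a - b + b)%C with a by ring. lra.
Qed.

Lemma Cmod_ge_minus_plus (a b : C) : Cmod a - Cmod b <= Cmod (a + b)%C.
Proof.
  generalize (Cmod_ge_minus a (-b)%C). rewrite Cmod_opp.
  replace (a - - b)%C with (a + b)%C by ring. auto.
Qed.

Lemma Cmod_small (a : C) : (forall eps, 0 < eps -> Cmod a <= eps) -> a = 0%C.
Proof.
  intros H. apply Cmod_eq_0. apply Rle_antisym; [|apply Cmod_ge_0].
  apply Rnot_lt_le. intro H0. specialize (H (Cmod a / 2)). lra.
Qed.

Lemma Re_le_Cmod (c : C) : Re c <= Cmod c.
Proof. eapply Rle_trans; [apply Rle_abs|apply re_le_Cmod]. Qed.

Lemma Rabs_Im_le_Cmod (c : C) : Rabs (Im c) <= Cmod c.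
Proof.
  eapply Rle_trans; [|apply Rmax_Cmod]. apply Rmax_r.
Qed.

Lemma Im_le_Cmod (c : C) : Im c <= Cmod c.
Proof. eapply Rle_trans; [apply Rle_abs|apply Rabs_Im_le_Cmod]. Qed.

Lemma Cmod_le_ReIm (c : C) : Cmod c <= Rabs (Re c) + Rabs (Im c).
Proof.
  destruct c as [x y]; simpl.
  replace (x, y) with (RtoC x + RtoC y * Ci)%C.
  2:{ unfold Cplus, Cmult, RtoC, Ci; simpl. f_equal; ring. }
  eapply Rle_trans; [apply Cmod_triangle|].
  rewrite Cmod_mult, Cmod_Ci, !Cmod_R. lra.
Qed.

Lemma Ceq (a b : C) : Re a = Re b -> Im a = Im b -> a = b.
Proof. destruct a, b; simpl; intros; subst; auto. Qed.

Lemma inH_neq0 z : inH z -> z <> 0%C.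
Proof. intros H E. rewrite E in H. unfold inH in H; simpl in H. lra. Qed.

Lemma inH_near z h : inH z -> Cmod h < Im z -> inH (z + h)%C.
Proof.
  unfold inH; intros H Hh. destruct z as [x y], h as [a b]; simpl in *.
  generalize (Rabs_Im_le_Cmod (a, b)); simpl. intros.
  assert (Rabs b < y) by lra. apply Rabs_def2 in H1. lra.
Qed.

(** Quadratic remainder bounds can be summed over a series, so termwise differentiation passes
    through this criterion. *)
Lemma cderiv_quad f z l d M : 0 < d ->
  (forall h, Cmod h < d -> Cmod (f (z + h) - f z - l * h)%C <= M * (Cmod h)^2) ->
  cderiv f z l.
Proof.
  intros Hd H eps He.
  assert (HM : 0 < Rabs M + 1) by (generalize (Rabs_pos M); lra).
  exists (Rmin d (eps / (Rabs M + 1))). split.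
  - apply Rmin_glb_lt; auto. apply Rdiv_lt_0_compat; auto.
  - intros h Hh. eapply Rle_trans; [apply H; eapply Rlt_le_trans; [apply Hh|apply Rmin_l]|].
    assert (Hle : Cmod h <= eps / (Rabs M + 1)) by (left; eapply Rlt_le_trans; [apply Hh|apply Rmin_r]).
    replace (M * Cmod h ^ 2) with ((M * Cmod h) * Cmod h) by ring.
    apply Rmult_le_compat_r; [apply Cmod_ge_0|].
    generalize (Cmod_ge_0 h); intros.
    apply Rle_trans with ((Rabs M + 1) * Cmod h).
    + apply Rmult_le_compat_r; auto. generalize (Rle_abs M); lra.
    + apply Rle_trans with ((Rabs M + 1) * (eps / (Rabs M + 1))).
      * apply Rmult_le_compat_l; lra.
      * right; field; lra.
Qed.

Lemma cderiv_lip f z l : cderiv f z l ->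
  exists d, 0 < d /\ forall h, Cmod h < d -> Cmod (f (z + h) - f z)%C <= (Cmod l + 1) * Cmod h.
Proof.
  intros H. destruct (H 1 Rlt_0_1) as (d & Hd & H1). exists d; split; auto.
  intros h Hh. specialize (H1 h Hh).
  replace (f (z + h) - f z)%C with ((f (z + h) - f z - l * h) + l * h)%C by ring.
  eapply Rle_trans; [apply Cmod_triangle|]. rewrite Cmod_mult. lra.
Qed.

Lemma cderiv_cont f z l : cderiv f z l -> forall eps, 0 < eps ->
  exists d, 0 < d /\ forall h, Cmod h < d -> Cmod (f (z + h) - f z)%C < eps.
Proof.
  intros H eps He. destruct (cderiv_lip _ _ _ H) as (d & Hd & H1).
  generalize (Cmod_ge_0 l); intro Hl.
  exists (Rmin d (eps / (Cmod l + 1))). split.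
  - apply Rmin_glb_lt; auto. apply Rdiv_lt_0_compat; lra.
  - intros h Hh.
    assert (Cmod h < d) by (eapply Rlt_le_trans; [apply Hh|apply Rmin_l]).
    assert (Cmod h < eps / (Cmod l + 1)) by (eapply Rlt_le_trans; [apply Hh|apply Rmin_r]).
    eapply Rle_lt_trans; [apply H1; auto|].
    apply Rlt_le_trans with ((Cmod l + 1) * (eps / (Cmod l + 1))).
    + apply Rmult_lt_compat_l; lra.
    + right; field; lra.
Qed.

Lemma cderiv_ext_loc f g z l d : 0 < d ->
  (forall h, Cmod h < d -> f (z + h)%C = g (z + h)%C) -> cderiv f z l -> cderiv g z l.
Proof.
  intros Hd E H eps He. destruct (H eps He) as (d' & Hd' & H').
  exists (Rmin d d'). split; [apply Rmin_glb_lt; auto|].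
  intros h Hh.
  assert (Cmod h < d) by (eapply Rlt_le_trans; [apply Hh|apply Rmin_l]).
  assert (Cmod h < d') by (eapply Rlt_le_trans; [apply Hh|apply Rmin_r]).
  rewrite <- E by auto.
  assert (E0 : f z = g z).
  { generalize (E 0%C). rewrite Cplus_0_r. intro E0; apply E0. rewrite Cmod_0; auto. }
  rewrite <- E0. auto.
Qed.

Lemma cderiv_ext f g z l : (forall w, f w = g w) -> cderiv f z l -> cderiv g z l.
Proof. intros E. apply cderiv_ext_loc with 1. lra. intros; apply E. Qed.

Lemma cderiv_ext_H f g z l : inH z -> (forall w, inH w -> f w = g w) ->
  cderiv f z l -> cderiv g z l.
Proof.
  intros Hz E. apply cderiv_ext_loc with (Im z); auto.
  intros h Hh. apply E, inH_near; auto.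
Qed.

Lemma cderiv_eq f z l l' : l = l' -> cderiv f z l -> cderiv f z l'.
Proof. intros ->; auto. Qed.

Lemma cderiv_unique f z l l' : cderiv f z l -> cderiv f z l' -> l = l'.
Proof.
  intros H H'. apply Ceq_minus. apply Cmod_small. intros eps He.
  destruct (H (eps / 2)) as (d & Hd & H1); [lra|].
  destruct (H' (eps / 2)) as (d' & Hd' & H1'); [lra|].
  set (h := RtoC (Rmin d d' / 2)).
  assert (Hm : 0 < Rmin d d') by (apply Rmin_glb_lt; auto).
  assert (Hh : Cmod h = Rmin d d' / 2) by (unfold h; rewrite Cmod_R, Rabs_pos_eq; lra).
  assert (Cmod h < d) by (rewrite Hh; generalize (Rmin_l d d'); lra).
  assert (Cmod h < d') by (rewrite Hh; generalize (Rmin_r d d'); lra).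
  specialize (H1 h H0). specialize (H1' h H2).
  assert (Cmod ((l - l') * h)%C <= eps * Cmod h).
  { replace ((l - l') * h)%C with ((f (z + h) - f z - l' * h) - (f (z + h) - f z - l * h))%C by ring.
    eapply Rle_trans; [apply Cmod_tri_minus|]. lra. }
  rewrite Cmod_mult in H3. apply Rmult_le_reg_r with (Cmod h); lra.
Qed.

Lemma cderiv_const c z : cderiv (fun _ => c) z 0%C.
Proof.
  apply cderiv_quad with 1 0; [lra|]. intros.
  replace (c - c - 0 * h)%C with (RtoC 0) by ring. rewrite Cmod_0. lra.
Qed.

Lemma cderiv_id z : cderiv (fun w => w) z 1%C.
Proof.
  apply cderiv_quad with 1 0; [lra|]. intros.
  replace (z + h - z - 1 * h)%C with (RtoC 0) by ring. rewrite Cmod_0. lra.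
Qed.

Lemma cderiv_plus f g z l m : cderiv f z l -> cderiv g z m ->
  cderiv (fun w => f w + g w)%C z (l + m)%C.
Proof.
  intros H H' eps He.
  destruct (H (eps / 2)) as (d & Hd & H1); [lra|].
  destruct (H' (eps / 2)) as (d' & Hd' & H1'); [lra|].
  exists (Rmin d d'). split; [apply Rmin_glb_lt; auto|].
  intros h Hh.
  assert (Cmod h < d) by (eapply Rlt_le_trans; [apply Hh|apply Rmin_l]).
  assert (Cmod h < d') by (eapply Rlt_le_trans; [apply Hh|apply Rmin_r]).
  specialize (H1 h H0). specialize (H1' h H2).
  replace (f (z + h) + g (z + h) - (f z + g z) - (l + m) * h)%C with
   ((f (z + h) - f z - l * h) + (g (z + h) - g z - m * h))%C by ring.
  eapply Rle_trans; [apply Cmod_triangle|]. lra.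
Qed.

Lemma cderiv_mult f g z l m : cderiv f z l -> cderiv g z m ->
  cderiv (fun w => f w * g w)%C z (l * g z + f z * m)%C.
Proof.
  intros H H' eps He.
  assert (P0 := Cmod_ge_0 (g z)). assert (P1 := Cmod_ge_0 (f z)).
  assert (P2 := Cmod_ge_0 l).
  destruct (cderiv_cont _ _ _ H' 1 Rlt_0_1) as (d0 & Hd0 & H0).
  assert (Hp : 0 < eps / 3 / (Cmod l + 1)) by (repeat apply Rdiv_lt_0_compat; lra).
  destruct (cderiv_cont _ _ _ H' _ Hp) as (d3 & Hd3 & H3).
  destruct (H (eps / 3 / (Cmod (g z) + 1))) as (d1 & Hd1 & H1).
  { repeat apply Rdiv_lt_0_compat; lra. }
  destruct (H' (eps / 3 / (Cmod (f z) + 1))) as (d2 & Hd2 & H2).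
  { repeat apply Rdiv_lt_0_compat; lra. }
  exists (Rmin (Rmin d0 d3) (Rmin d1 d2)). split; [repeat apply Rmin_glb_lt; auto|].
  intros h Hh.
  assert (E0 : Cmod h < d0 /\ Cmod h < d3 /\ Cmod h < d1 /\ Cmod h < d2).
  { generalize (Rmin_l (Rmin d0 d3) (Rmin d1 d2)) (Rmin_r (Rmin d0 d3) (Rmin d1 d2))
     (Rmin_l d0 d3) (Rmin_r d0 d3) (Rmin_l d1 d2) (Rmin_r d1 d2); lra. }
  destruct E0 as (E0 & E3 & E1 & E2).
  specialize (H0 h E0). specialize (H1 h E1). specialize (H2 h E2). specialize (H3 h E3).
  replace (f (z + h) * g (z + h) - f z * g z - (l * g z + f z * m) * h)%C with
   ((f (z + h) - f z - l * h) * g (z + h) + f z * (g (z + h) - g z - m * h)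
     + l * h * (g (z + h) - g z))%C by ring.
  eapply Rle_trans; [apply Cmod_tri3|]. rewrite !Cmod_mult.
  assert (Hg : Cmod (g (z + h)%C) <= Cmod (g z) + 1).
  { generalize (Cmod_ge_minus (g (z+h)%C) (g z)). lra. }
  assert (P3 := Cmod_ge_0 h). assert (P4 := Cmod_ge_0 (g (z+h)%C)).
  assert (Q1 : Cmod (f (z + h) - f z - l * h)%C * Cmod (g (z + h)%C) <= eps / 3 * Cmod h).
  { eapply Rle_trans; [apply Rmult_le_compat; [apply Cmod_ge_0|auto|apply H1|apply Hg]|].
    right; field; lra. }
  assert (Q2 : Cmod (f z) * Cmod (g (z + h) - g z - m * h)%C <= eps / 3 * Cmod h).
  { apply Rle_trans with ((Cmod (f z) + 1) * (eps / 3 / (Cmod (f z) + 1) * Cmod h)).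
    apply Rmult_le_compat; auto; try apply Cmod_ge_0; lra.
    right; field; lra. }
  assert (Q3 : Cmod l * Cmod h * Cmod (g (z + h) - g z)%C <= eps / 3 * Cmod h).
  { apply Rle_trans with ((Cmod l + 1) * Cmod h * (eps / 3 / (Cmod l + 1))).
    { apply Rmult_le_compat; [apply Rmult_le_pos; auto|apply Cmod_ge_0| |lra].
      apply Rmult_le_compat_r; lra. }
    right; field; lra. }
  lra.
Qed.

Lemma cderiv_scal c f z l : cderiv f z l -> cderiv (fun w => c * f w)%C z (c * l)%C.
Proof.
  intros H. eapply cderiv_eq; [|apply cderiv_mult; [apply cderiv_const|apply H]].
  simpl. ring.
Qed.

Lemma cderiv_opp f z l : cderiv f z l -> cderiv (fun w => - f w)%C z (- l)%C.
Proof.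
  intros H. apply cderiv_ext with (fun w => (-(1)) * f w)%C. intros; ring.
  eapply cderiv_eq; [|apply cderiv_scal, H]. ring.
Qed.

Lemma cderiv_minus f g z l m : cderiv f z l -> cderiv g z m ->
  cderiv (fun w => f w - g w)%C z (l - m)%C.
Proof. intros. apply cderiv_plus; auto. apply cderiv_opp; auto. Qed.

Lemma cderiv_pow f z l n : cderiv f z l ->
  cderiv (fun w => f w ^ n)%C z (INR n * f z ^ (n - 1) * l)%C.
Proof.
  intros H. induction n as [|n IH].
  - eapply cderiv_eq; [|apply (cderiv_const 1%C)]. simpl; ring.
  - eapply cderiv_eq; [|apply (cderiv_mult f (fun w => f w ^ n)%C); [apply H|apply IH]].
    rewrite S_INR, RtoC_plus. destruct n as [|n].
    + simpl; ring.
    + replace (S (S n) - 1)%nat with (S n) by lia.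
      replace (S n - 1)%nat with n by lia. rewrite !Cpow_S. ring.
Qed.

Lemma cderiv_comp f g z l m : cderiv f z l -> cderiv g (f z) m ->
  cderiv (fun w => g (f w)) z (m * l)%C.
Proof.
  intros H H' eps He.
  assert (P2 := Cmod_ge_0 l). assert (P3 := Cmod_ge_0 m).
  destruct (cderiv_lip _ _ _ H) as (d0 & Hd0 & H0).
  destruct (H (eps / 2 / (Cmod m + 1))) as (d1 & Hd1 & H1).
  { repeat apply Rdiv_lt_0_compat; lra. }
  destruct (H' (eps / 2 / (Cmod l + 1))) as (d2 & Hd2 & H2).
  { repeat apply Rdiv_lt_0_compat; lra. }
  exists (Rmin (Rmin d0 d1) (d2 / (Cmod l + 1))). split.
  { repeat apply Rmin_glb_lt; auto. apply Rdiv_lt_0_compat; lra. }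
  intros h Hh.
  assert (E : Cmod h < d0 /\ Cmod h < d1 /\ Cmod h < d2 / (Cmod l + 1)).
  { generalize (Rmin_l (Rmin d0 d1) (d2 / (Cmod l + 1))) (Rmin_r (Rmin d0 d1) (d2 / (Cmod l + 1)))
     (Rmin_l d0 d1) (Rmin_r d0 d1); lra. }
  destruct E as (E0 & E1 & E2).
  specialize (H0 h E0). specialize (H1 h E1).
  set (k := (f (z + h) - f z)%C) in *.
  assert (Ek : f (z + h)%C = (f z + k)%C) by (unfold k; ring).
  assert (Hk : Cmod k < d2).
  { eapply Rle_lt_trans; [apply H0|].
    apply Rlt_le_trans with ((Cmod l + 1) * (d2 / (Cmod l + 1))).
    apply Rmult_lt_compat_l; lra. right; field; lra. }
  specialize (H2 k Hk).
  rewrite Ek.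
  replace (g (f z + k) - g (f z) - m * l * h)%C with
    ((g (f z + k) - g (f z) - m * k) + m * (k - l * h))%C by ring.
  eapply Rle_trans; [apply Cmod_triangle|]. rewrite Cmod_mult.
  assert (P4 := Cmod_ge_0 h).
  assert (Q1 : eps / 2 / (Cmod l + 1) * Cmod k <= eps / 2 * Cmod h).
  { apply Rle_trans with (eps / 2 / (Cmod l + 1) * ((Cmod l + 1) * Cmod h)).
    apply Rmult_le_compat_l; auto. left; repeat apply Rdiv_lt_0_compat; lra.
    right; field; lra. }
  assert (Q2 : Cmod m * Cmod (k - l * h)%C <= eps / 2 * Cmod h).
  { apply Rle_trans with ((Cmod m + 1) * (eps / 2 / (Cmod m + 1) * Cmod h)).
    apply Rmult_le_compat; auto; try apply Cmod_ge_0; lra.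
    right; field; lra. }
  lra.
Qed.

Lemma cderiv_inv_id (z : C) : z <> 0%C -> cderiv (fun w => / w)%C z (- / (z ^ 2))%C.
Proof.
  intros Hz. assert (Hm : 0 < Cmod z). apply Cmod_pos, Hz.
  apply cderiv_quad with (Cmod z / 2) (2 / (Cmod z)^3); [lra|].
  intros h Hh.
  assert (Hzh : Cmod z / 2 <= Cmod (z + h)%C) by (generalize (Cmod_ge_minus_plus z h); lra).
  assert (Hn : (z + h)%C <> 0%C) by (apply Cmod_neq0; lra).
  replace (/ (z + h) - / z - - / z ^ 2 * h)%C with (h ^ 2 * / (z ^ 2 * (z + h)))%C.
  2:{ field; split; auto. }
  rewrite Cmod_mult, Cmod_inv, Cmod_mult, !Cmod_pow.
  2:{ apply Cmult_neq_0; auto. apply Cpow_nz; auto. }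
  rewrite Rmult_comm. apply Rmult_le_compat_r; [apply pow2_ge_0|].
  apply Rle_trans with (/ (Cmod z ^ 2 * (Cmod z / 2))).
  - apply Rinv_le_contravar. apply Rmult_lt_0_compat; [apply pow_lt|]; lra.
    apply Rmult_le_compat_l; auto. apply pow2_ge_0.
  - right; field. lra.
Qed.

Lemma cderiv_inv (f : C -> C) z l : f z <> 0%C -> cderiv f z l ->
  cderiv (fun w => / f w)%C z (- l / (f z ^ 2))%C.
Proof.
  intros Hz H. eapply cderiv_eq; [|apply (cderiv_comp f Cinv); [apply H|apply cderiv_inv_id, Hz]].
  unfold Cdiv. ring.
Qed.

Lemma cderiv_div (f g : C -> C) z l m : g z <> 0%C -> cderiv f z l -> cderiv g z m ->
  cderiv (fun w => f w / g w)%C z ((l * g z - f z * m) / (g z ^ 2))%C.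
Proof.
  intros Hz H H'. eapply cderiv_eq; [|apply cderiv_mult; [apply H|apply cderiv_inv; [apply Hz|apply H']]].
  simpl. field. auto.
Qed.

(** The bridge to real calculus: the constant [c] selects the direction on which the curve is
    projected. *)
Lemma rderiv_Re g t v c : rderiv g t v -> is_derive (fun t => Re (c * g t)%C) t (Re (c * v)%C).
Proof.
  intros H. apply is_derive_Reals. intros eps He.
  assert (P := Cmod_ge_0 c).
  destruct (H (eps / 2 / (Cmod c + 1))) as (d & Hd & H1).
  { repeat apply Rdiv_lt_0_compat; lra. }
  exists (mkposreal d Hd). intros h Hh0 Hh. simpl in Hh.
  specialize (H1 h Hh).
  replace ((Re (c * g (t + h)%R) - Re (c * g t)) / h - Re (c * v))%R with
    (Re (c * (g (t + h)%R - g t - v * h))%C / h).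
  2:{ destruct c, (g (t + h)), (g t), v; simpl. field. auto. }
  unfold Rdiv. rewrite Rabs_mult, Rabs_inv.
  assert (Hp : 0 < Rabs h) by (apply Rabs_pos_lt; auto).
  apply Rmult_lt_reg_r with (Rabs h); auto.
  rewrite Rmult_assoc, Rinv_l, Rmult_1_r by lra.
  eapply Rle_lt_trans; [apply re_le_Cmod|]. rewrite Cmod_mult.
  apply Rle_lt_trans with ((Cmod c + 1) * (eps / 2 / (Cmod c + 1) * Rabs h)).
  - apply Rmult_le_compat; auto; try apply Cmod_ge_0; lra.
  - replace ((Cmod c + 1) * (eps / 2 / (Cmod c + 1) * Rabs h)) with (eps / 2 * Rabs h) by (field; lra).
    apply Rmult_lt_compat_r; lra.
Qed.

Lemma rderiv_comp f g t v l : rderiv g t v -> cderiv f (g t) l ->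
  rderiv (fun t => f (g t)) t (l * v)%C.
Proof.
  intros H H' eps He.
  assert (P2 := Cmod_ge_0 l). assert (P3 := Cmod_ge_0 v).
  destruct (H 1 Rlt_0_1) as (d0 & Hd0 & H0).
  destruct (H (eps / 2 / (Cmod l + 1))) as (d1 & Hd1 & H1).
  { repeat apply Rdiv_lt_0_compat; lra. }
  destruct (H' (eps / 2 / (Cmod v + 1))) as (d2 & Hd2 & H2).
  { repeat apply Rdiv_lt_0_compat; lra. }
  exists (Rmin (Rmin d0 d1) (d2 / (Cmod v + 1))). split.
  { repeat apply Rmin_glb_lt; auto. apply Rdiv_lt_0_compat; lra. }
  intros h Hh.
  assert (E : Rabs h < d0 /\ Rabs h < d1 /\ Rabs h < d2 / (Cmod v + 1)).
  { generalize (Rmin_l (Rmin d0 d1) (d2 / (Cmod v + 1))) (Rmin_r (Rmin d0 d1) (d2 / (Cmod v + 1)))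
     (Rmin_l d0 d1) (Rmin_r d0 d1); lra. }
  destruct E as (E0 & E1 & E2).
  specialize (H0 h E0). specialize (H1 h E1).
  set (k := (g (t + h)%R - g t)%C) in *.
  assert (Ek : g (t + h) = (g t + k)%C) by (unfold k; ring).
  assert (P4 := Rabs_pos h).
  assert (Hk0 : Cmod k <= (Cmod v + 1) * Rabs h).
  { replace k with ((k - v * h) + v * h)%C by ring.
    eapply Rle_trans; [apply Cmod_triangle|]. rewrite Cmod_mult, Cmod_R. lra. }
  assert (Hk : Cmod k < d2).
  { eapply Rle_lt_trans; [apply Hk0|].
    apply Rlt_le_trans with ((Cmod v + 1) * (d2 / (Cmod v + 1))).
    apply Rmult_lt_compat_l; lra. right; field; lra. }
  specialize (H2 k Hk).
  rewrite Ek.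
  replace (f (g t + k) - f (g t) - l * v * h)%C with
    ((f (g t + k) - f (g t) - l * k) + l * (k - v * h))%C by ring.
  eapply Rle_trans; [apply Cmod_triangle|]. rewrite Cmod_mult.
  assert (Q1 : eps / 2 / (Cmod v + 1) * Cmod k <= eps / 2 * Rabs h).
  { apply Rle_trans with (eps / 2 / (Cmod v + 1) * ((Cmod v + 1) * Rabs h)).
    apply Rmult_le_compat_l; auto. left; repeat apply Rdiv_lt_0_compat; lra.
    right; field; lra. }
  assert (Q2 : Cmod l * Cmod (k - v * h)%C <= eps / 2 * Rabs h).
  { apply Rle_trans with ((Cmod l + 1) * (eps / 2 / (Cmod l + 1) * Rabs h)).
    apply Rmult_le_compat; auto; try apply Cmod_ge_0; lra.
    right; field; lra. }
  lra.
Qed.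

Lemma rderiv_line (z e : C) t : rderiv (fun t => z + e * RtoC t)%C t e.
Proof.
  intros eps He. exists 1; split; [lra|]. intros h _.
  replace (z + e * (t + h)%R - (z + e * t) - e * h)%C with (RtoC 0).
  2:{ rewrite RtoC_plus; ring. }
  rewrite Cmod_0. apply Rmult_le_pos; [lra|apply Rabs_pos].
Qed.

Lemma rderiv_pair (a b : R -> R) t a' b' : is_derive a t a' -> is_derive b t b' ->
  rderiv (fun t => (a t, b t)) t (a', b').
Proof.
  intros Ha Hb eps He. apply is_derive_Reals in Ha. apply is_derive_Reals in Hb.
  destruct (Ha (eps / 2)) as (d1 & H1); [lra|].
  destruct (Hb (eps / 2)) as (d2 & H2); [lra|].
  exists (Rmin d1 d2). split; [apply Rmin_glb_lt; apply cond_pos|].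
  intros h Hh.
  destruct (Req_dec h 0) as [->|Hn].
  - rewrite Rplus_0_r.
    replace ((a t, b t) - (a t, b t) - (a', b') * 0)%C with (RtoC 0).
    rewrite Cmod_0, Rabs_R0; lra. 
    apply Ceq; simpl; ring.
  - specialize (H1 h Hn). specialize (H2 h Hn).
    assert (Rabs h < d1) by (eapply Rlt_le_trans; [apply Hh|apply Rmin_l]).
    assert (Rabs h < d2) by (eapply Rlt_le_trans; [apply Hh|apply Rmin_r]).
    specialize (H1 H). specialize (H2 H0).
    assert (Hp : 0 < Rabs h) by (apply Rabs_pos_lt; auto).
    eapply Rle_trans; [apply Cmod_le_ReIm|]. simpl.
    replace (a (t + h) + - a t + - (a' * h - b' * 0)) with (((a (t + h) - a t) / h - a') * h) by (field; auto).
    replace (b (t + h) + - b t + - (a' * 0 + b' * h)) with (((b (t + h) - b t) / h - b') * h) by (field; auto).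
    rewrite !Rabs_mult. 
    assert (Rabs ((a (t + h) - a t) / h - a') * Rabs h <= eps / 2 * Rabs h) by (apply Rmult_le_compat_r; lra).
    assert (Rabs ((b (t + h) - b t) / h - b') * Rabs h <= eps / 2 * Rabs h) by (apply Rmult_le_compat_r; lra).
    lra.
Qed.

(* The mean value theorem for the real function [t => Re (conj(u) f(a + t(b-a)))] with [u = f b - f a]. *)
Lemma C_mean_value f f' (a b : C) B :
  (forall t, 0 <= t <= 1 -> cderiv f (a + (b - a) * RtoC t)%C (f' t)) ->
  (forall t, 0 <= t <= 1 -> Cmod (f' t) <= B) ->
  Cmod (f b - f a)%C <= B * Cmod (b - a)%C.
Proof.
  intros H HB. set (u := (f b - f a)%C).
  set (g := fun t => Re (Cconj u * f (a + (b - a) * RtoC t))%C).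
  assert (Hg : forall t, 0 <= t <= 1 -> is_derive g t (Re (Cconj u * (f' t * (b - a)))%C)).
  { intros t Ht. unfold g.
    apply (rderiv_Re (fun t => f (a + (b - a) * RtoC t)%C)).
    apply (rderiv_comp f (fun t => a + (b - a) * RtoC t)%C). apply rderiv_line. auto. }
  destruct (MVT_gen g 0 1 (fun t => Re (Cconj u * (f' t * (b - a)))%C)) as (c & Hc & E).
  - intros x Hx. apply Hg. rewrite Rmin_left, Rmax_right in Hx; lra.
  - intros x Hx. rewrite Rmin_left, Rmax_right in Hx by lra.
    apply continuity_pt_filterlim. apply (ex_derive_continuous g). eexists. apply Hg. lra.
  - rewrite Rmin_left, Rmax_right in Hc by lra.
    assert (E1 : g 1 - g 0 = (Cmod u) ^ 2).
    { unfold g. replace (a + (b - a) * 1)%C with b by ring. replace (a + (b - a) * 0)%C with a by ring.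
      rewrite Cmod2_alt. unfold u. destruct (f b), (f a); simpl. ring. }
    rewrite E1 in E.
    assert (E2 : Cmod u ^ 2 <= Cmod u * (B * Cmod (b - a)%C)).
    { rewrite E. rewrite Rminus_0_r, Rmult_1_r. eapply Rle_trans; [apply Re_le_Cmod|].
      rewrite !Cmod_mult, Cmod_conj. apply Rmult_le_compat_l; [apply Cmod_ge_0|].
      apply Rmult_le_compat_r; [apply Cmod_ge_0|auto]. }
    destruct (Req_dec (Cmod u) 0) as [E0|E0].
    + rewrite E0. apply Rmult_le_pos; [|apply Cmod_ge_0].
      eapply Rle_trans; [apply Cmod_ge_0|apply (HB 0); lra].
    + assert (0 < Cmod u) by (generalize (Cmod_ge_0 u); lra).
      apply Rmult_le_reg_l with (Cmod u); auto. simpl in E2. lra.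
Qed.

Lemma cderiv0_const f : (forall z, inH z -> cderiv f z 0%C) ->
  forall z w, inH z -> inH w -> f z = f w.
Proof.
  intros H z w Hz Hw. apply Ceq_minus.
  apply Cmod_eq_0. apply Rle_antisym; [|apply Cmod_ge_0].
  replace 0 with (0 * Cmod (z - w)%C) by ring.
  apply (C_mean_value f (fun _ => 0%C)).
  - intros t Ht. apply H. unfold inH in *. destruct z, w; simpl in *.
    destruct (Req_dec t 0); [subst; lra|].
    assert (0 < t) by lra. replace (r2 + ((r + - r1) * 0 + (r0 + - r2) * t)) with (r2 * (1 - t) + r0 * t) by ring.
    apply Rplus_le_lt_0_compat; [apply Rmult_le_pos|apply Rmult_lt_0_compat]; lra.
  - intros. rewrite Cmod_0; lra.
Qed.

(** * Complex series and the exponential *)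

(** Index [n] is excluded, whereas [sum_n] includes it. *)
Fixpoint Csum (a : nat -> C) (n : nat) : C :=
  match n with O => 0%C | S n => (Csum a n + a n)%C end.

Definition Clim (u : nat -> C) (l : C) : Prop :=
  forall eps, 0 < eps -> exists N, forall n, (N <= n)%nat -> Cmod (u n - l)%C < eps.

(** A total function; its value is meaningful for [summable] families, that is, under absolute
    convergence. *)
Definition CS (a : nat -> C) : C :=
  (Series (fun n => Re (a n)), Series (fun n => Im (a n))).

Definition summable (a : nat -> C) : Prop := ex_series (fun n => Cmod (a n)).

Lemma Clim_unique u l l' : Clim u l -> Clim u l' -> l = l'.
Proof.
  intros H H'. apply Ceq_minus, Cmod_small. intros eps He.
  destruct (H (eps / 2)) as (N & HN); [lra|].
  destruct (H' (eps / 2)) as (N' & HN'); [lra|].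
  specialize (HN (max N N') (Nat.le_max_l _ _)).
  specialize (HN' (max N N') (Nat.le_max_r _ _)).
  replace (l - l')%C with ((u (max N N') - l') - (u (max N N') - l))%C by ring.
  eapply Rle_trans; [apply Cmod_tri_minus|]. lra.
Qed.

Lemma Clim_ext u v l : (forall n, u n = v n) -> Clim u l -> Clim v l.
Proof.
  intros E H eps He. destruct (H eps He) as (N & HN). exists N. intros n Hn.
  rewrite <- E. auto.
Qed.

Lemma Clim_const c : Clim (fun _ => c) c.
Proof.
  intros eps He. exists 0%nat. intros. replace (c - c)%C with (RtoC 0) by ring.
  rewrite Cmod_0; auto.
Qed.

Lemma Clim_plus u v l m : Clim u l -> Clim v m -> Clim (fun n => u n + v n)%C (l + m)%C.
Proof.
  intros H H' eps He.
  destruct (H (eps / 2)) as (N & HN); [lra|].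
  destruct (H' (eps / 2)) as (N' & HN'); [lra|].
  exists (max N N'). intros n Hn. 
  specialize (HN n ltac:(lia)). specialize (HN' n ltac:(lia)).
  replace (u n + v n - (l + m))%C with ((u n - l) + (v n - m))%C by ring.
  eapply Rle_lt_trans; [apply Cmod_triangle|]. lra.
Qed.

Lemma Clim_scal c u l : Clim u l -> Clim (fun n => c * u n)%C (c * l)%C.
Proof.
  intros H eps He. assert (P := Cmod_ge_0 c).
  destruct (H (eps / (Cmod c + 1))) as (N & HN).
  { apply Rdiv_lt_0_compat; lra. }
  exists N. intros n Hn. specialize (HN n Hn).
  replace (c * u n - c * l)%C with (c * (u n - l))%C by ring.
  rewrite Cmod_mult.
  apply Rle_lt_trans with ((Cmod c) * (eps / (Cmod c + 1))).
  - apply Rmult_le_compat_l; lra.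
  - apply Rlt_le_trans with ((Cmod c + 1) * (eps / (Cmod c + 1))).
    apply Rmult_lt_compat_r. apply Rdiv_lt_0_compat; lra. lra. right; field; lra.
Qed.

Lemma Clim_minus u v l m : Clim u l -> Clim v m -> Clim (fun n => u n - v n)%C (l - m)%C.
Proof.
  intros H H'. apply Clim_ext with (fun n => u n + (-(1)) * v n)%C. intros; ring.
  replace (l - m)%C with (l + (-(1)) * m)%C by ring.
  apply Clim_plus; auto. apply Clim_scal; auto.
Qed.

Lemma Clim_subseq u l (f : nat -> nat) : (forall n, (n <= f n)%nat) -> Clim u l ->
  Clim (fun n => u (f n)) l.
Proof.
  intros Hf H eps He. destruct (H eps He) as (N & HN). exists N. intros n Hn.
  apply HN. specialize (Hf n). lia.
Qed.

Lemma Clim_bound u l B : Clim u l -> (forall n, Cmod (u n) <= B) -> Cmod l <= B.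
Proof.
  intros H HB. apply Rnot_lt_le. intros Hlt.
  destruct (H (Cmod l - B)) as (N & HN); [lra|].
  specialize (HN N (Nat.le_refl _)). specialize (HB N).
  rewrite Cmod_sub_comm in HN. generalize (Cmod_ge_minus l (u N)). lra.
Qed.

Lemma Clim_0_le u (v : nat -> R) : is_lim_seq v 0 -> (forall n, Cmod (u n) <= v n) ->
  Clim u 0%C.
Proof.
  intros H HB eps He. apply is_lim_seq_spec in H.
  destruct (H (mkposreal eps He)) as (N & HN). exists N. intros n Hn.
  specialize (HN n Hn). simpl in HN. rewrite Rminus_0_r in HN.
  replace (u n - 0)%C with (u n) by ring.
  eapply Rle_lt_trans; [apply HB|]. eapply Rle_lt_trans; [apply Rle_abs|auto].
Qed.

Lemma ex_series_le_pos (a b : nat -> R) : (forall n, 0 <= a n <= b n) -> ex_series b -> ex_series a.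
Proof.
  intros H Hb. apply (ex_series_le a b); auto. intros n. specialize (H n).
  unfold norm; simpl. unfold abs; simpl. rewrite Rabs_pos_eq; lra.
Qed.

Lemma ex_series_scalR (c : R) a : ex_series a -> ex_series (fun n => c * a n).
Proof. apply (ex_series_scal_l c a). Qed.

Lemma summable_le a (b : nat -> R) : (forall n, Cmod (a n) <= b n) -> ex_series b -> summable a.
Proof.
  intros H Hb. apply (ex_series_le_pos _ b); auto. intros n; split; auto. apply Cmod_ge_0.
Qed.

Lemma summable_Re a : summable a -> ex_series (fun n => Re (a n)).
Proof.
  intros H. apply ex_series_Rabs. eapply ex_series_le_pos; [|apply H].
  intros n; split; [apply Rabs_pos|apply re_le_Cmod].
Qed.

Lemma summable_Im a : summable a -> ex_series (fun n => Im (a n)).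
Proof.
  intros H. apply ex_series_Rabs. eapply ex_series_le_pos; [|apply H].
  intros n; split; [apply Rabs_pos|apply Rabs_Im_le_Cmod].
Qed.

Lemma summable_plus a b : summable a -> summable b -> summable (fun n => a n + b n)%C.
Proof.
  intros Ha Hb. eapply summable_le; [|apply (ex_series_plus _ _ Ha Hb)].
  intros; apply Cmod_triangle.
Qed.

Lemma summable_scal c a : summable a -> summable (fun n => c * a n)%C.
Proof.
  intros Ha. eapply summable_le; [|apply (ex_series_scal (Cmod c) _ Ha)].
  intros; rewrite Cmod_mult. apply Rle_refl.
Qed.

Lemma summable_ext a b : (forall n, a n = b n) -> summable a -> summable b.
Proof. intros E. apply ex_series_ext. intros; rewrite E; auto. Qed.

Lemma summable_minus a b : summable a -> summable b -> summable (fun n => a n - b n)%C.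
Proof.
  intros. apply summable_ext with (fun n => a n + (-(1)) * b n)%C. intros; ring.
  apply summable_plus; auto. apply summable_scal; auto.
Qed.

Lemma summable_incr_n a N : summable a <-> summable (fun n => a (N + n)%nat).
Proof. apply (ex_series_incr_n (fun n => Cmod (a n))). Qed.

Lemma summable_incr_1 a : summable a <-> summable (fun n => a (S n)).
Proof. apply (ex_series_incr_1 (fun n => Cmod (a n))). Qed.

Lemma CS_ext a b : (forall n, a n = b n) -> CS a = CS b.
Proof. intros E. unfold CS. f_equal; apply Series_ext; intros; rewrite E; auto. Qed.

Lemma CS_plus a b : summable a -> summable b -> CS (fun n => a n + b n)%C = (CS a + CS b)%C.
Proof.
  intros Ha Hb. apply Ceq; simpl.
  - rewrite <- Series_plus; auto using summable_Re.
  - rewrite <- Series_plus; auto using summable_Im.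
Qed.

Lemma CS_scal c a : summable a -> CS (fun n => c * a n)%C = (c * CS a)%C.
Proof.
  intros Ha. assert (HR := summable_Re _ Ha). assert (HI := summable_Im _ Ha).
  apply Ceq; simpl.
  - rewrite <- !Series_scal_l, <- Series_minus by (apply ex_series_scalR; auto).
    apply Series_ext; auto.
  - rewrite <- !Series_scal_l, <- Series_plus by (apply ex_series_scalR; auto).
    apply Series_ext; auto.
Qed.

Lemma CS_minus a b : summable a -> summable b -> CS (fun n => a n - b n)%C = (CS a - CS b)%C.
Proof.
  intros Ha Hb. rewrite (CS_ext _ (fun n => a n + (-(1)) * b n)%C) by (intros; ring).
  rewrite CS_plus, CS_scal; auto. ring. apply summable_scal; auto.
Qed.

Lemma CS_0 : CS (fun _ => 0%C) = 0%C.
Proof.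
  assert (summable (fun _ => 0%C)).
  { apply summable_le with (fun n => (/2) ^ n).
    intros; rewrite Cmod_0; apply pow_le; lra.
    apply ex_series_geom. rewrite Rabs_pos_eq; lra. }
  rewrite (CS_ext _ (fun n => 0 * 0)%C) by (intros; ring).
  rewrite CS_scal; auto. ring.
Qed.

Lemma CS_incr_1 a : summable a -> CS a = (a 0%nat + CS (fun n => a (S n)))%C.
Proof.
  intros Ha. apply Ceq; simpl; rewrite Series_incr_1; auto using summable_Re, summable_Im.
Qed.

Lemma Csum_S a n : Csum a (S n) = (a 0%nat + Csum (fun n => a (S n)) n)%C.
Proof.
  induction n; simpl; [ring|]. simpl in IHn. rewrite IHn. ring.
Qed.

Lemma CS_split a N : summable a -> CS a = (Csum a N + CS (fun n => a (N + n)%nat))%C.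
Proof.
  revert a; induction N; intros a Ha.
  { simpl. rewrite Cplus_0_l. reflexivity. }
  rewrite CS_incr_1 by auto. rewrite Csum_S. rewrite (IHN (fun n => a (S n))).
  - rewrite Cplus_assoc. reflexivity.
  - apply (proj1 (summable_incr_1 a)); auto.
Qed.

Lemma Csum_ext a b N : (forall n, (n < N)%nat -> a n = b n) -> Csum a N = Csum b N.
Proof.
  induction N; intros H; simpl; auto. rewrite IHN by (intros; apply H; lia). rewrite H by lia; auto.
Qed.

Lemma Csum_plus a b N : Csum (fun n => a n + b n)%C N = (Csum a N + Csum b N)%C.
Proof. induction N; simpl; [ring|]. rewrite IHN; ring. Qed.

Lemma Csum_scal c a N : Csum (fun n => c * a n)%C N = (c * Csum a N)%C.
Proof. induction N; simpl; [ring|]. rewrite IHN; ring. Qed.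

(** The term [b N] is taken off because [sum_n b N] runs up to the index [N] included. *)
Lemma Cmod_Csum_le a (b : nat -> R) N : (forall n, (n < N)%nat -> Cmod (a n) <= b n) ->
  Cmod (Csum a N) <= sum_n b N - b N.
Proof.
  induction N; intros H.
  - simpl. rewrite Cmod_0, sum_O. lra.
  - rewrite sum_Sn. simpl Csum. eapply Rle_trans; [apply Cmod_triangle|].
    assert (H1 := H N ltac:(lia)). assert (H2 := IHN (fun n Hn => H n ltac:(lia))).
    unfold plus; simpl. lra.
Qed.

Lemma Csum_Re a N : Re (Csum a (S N)) = sum_n (fun n => Re (a n)) N.
Proof.
  induction N. rewrite sum_O. simpl. unfold Re, Im. ring.
  rewrite sum_Sn, <- IHN. reflexivity.
Qed.

Lemma Csum_Im a N : Im (Csum a (S N)) = sum_n (fun n => Im (a n)) N.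
Proof.
  induction N. rewrite sum_O. simpl. unfold Re, Im. ring.
  rewrite sum_Sn, <- IHN. reflexivity.
Qed.

Lemma CS_lim a : summable a -> Clim (Csum a) (CS a).
Proof.
  intros Ha eps He.
  assert (HR := Series_correct _ (summable_Re _ Ha)).
  assert (HI := Series_correct _ (summable_Im _ Ha)).
  apply (is_lim_seq_spec _ (Finite _)) in HR. apply (is_lim_seq_spec _ (Finite _)) in HI.
  assert (He2 : 0 < eps / 2) by lra.
  destruct (HR (mkposreal _ He2)) as (N & HN). destruct (HI (mkposreal _ He2)) as (N' & HN').
  exists (S (max N N')). intros n Hn. destruct n as [|n]; [lia|].
  specialize (HN n ltac:(lia)). specialize (HN' n ltac:(lia)). simpl in HN, HN'.
  eapply Rle_lt_trans; [apply Cmod_le_ReIm|].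
  rewrite <- Csum_Re in HN. rewrite <- Csum_Im in HN'.
  change (Re (Csum a (S n) - CS a)%C) with (Re (Csum a (S n)) - Series (fun n => Re (a n))).
  change (Im (Csum a (S n) - CS a)%C) with (Im (Csum a (S n)) - Series (fun n => Im (a n))).
  lra.
Qed.

Lemma Series_nonneg (b : nat -> R) : (forall n, 0 <= b n) -> ex_series b -> 0 <= Series b.
Proof.
  intros H Hb. rewrite <- (Rmult_0_l (Series b)), <- Series_scal_l.
  apply Series_le; auto. intros n. specialize (H n). lra.
Qed.

Lemma Cmod_Csum_Series a (b : nat -> R) n : (forall n, Cmod (a n) <= b n) -> ex_series b ->
  Cmod (Csum a n) <= Series b.
Proof.
  intros H Hb. assert (Hp : forall n, 0 <= b n).
  { intros k. eapply Rle_trans; [apply Cmod_ge_0|apply H]. }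
  destruct n.
  - simpl. rewrite Cmod_0. apply Series_nonneg; auto.
  - eapply Rle_trans; [apply (Cmod_Csum_le a b); auto|].
    rewrite sum_Sn. unfold plus; simpl.
    rewrite sum_n_Reals. 
    assert (E := Series_incr_n b (S n) ltac:(lia) Hb). simpl pred in E. rewrite E.
    assert (0 <= Series (fun k => b (S n + k)%nat)).
    { apply Series_nonneg; auto. apply (ex_series_incr_n b (S n)); auto. }
    lra.
Qed.

Lemma Cmod_CS_le a (b : nat -> R) : (forall n, Cmod (a n) <= b n) -> ex_series b ->
  Cmod (CS a) <= Series b.
Proof.
  intros H Hb. apply Clim_bound with (Csum a). apply CS_lim, summable_le with b; auto.
  intros n. apply Cmod_Csum_Series; auto.
Qed.

Lemma Series_tail (b : nat -> R) : (forall n, 0 <= b n) -> ex_series b ->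
  forall eps, 0 < eps -> exists N, Series (fun n => b (N + n)%nat) < eps.
Proof.
  intros Hp Hb eps He.
  assert (HR := Series_correct _ Hb).
  apply (is_lim_seq_spec _ (Finite _)) in HR. destruct (HR (mkposreal _ He)) as (N & HN).
  exists (S N). specialize (HN N (Nat.le_refl _)). simpl in HN.
  rewrite sum_n_Reals in HN.
  assert (E := Series_incr_n b (S N) ltac:(lia) Hb). simpl pred in E. rewrite E in HN.
  replace (sum_f_R0 b N - (sum_f_R0 b N + Series (fun k => b (S N + k)%nat))) with
    (- Series (fun k => b (S N + k)%nat)) in HN by ring.
  rewrite Rabs_Ropp in HN. eapply Rle_lt_trans; [apply Rle_abs|apply HN].
Qed.

(* Tannery's theorem: dominated convergence for series. *)
Lemma CS_dominated (a : nat -> nat -> C) (l : nat -> C) (b : nat -> R) :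
  (forall n, Clim (fun M => a M n) (l n)) -> (forall M n, Cmod (a M n) <= b n) -> ex_series b ->
  Clim (fun M => CS (a M)) (CS l).
Proof.
  intros Hl Hb Hs eps He.
  assert (Hp : forall n, 0 <= b n).
  { intros n. eapply Rle_trans; [apply Cmod_ge_0|apply (Hb 0%nat)]. }
  assert (Hlb : forall n, Cmod (l n) <= b n).
  { intros n. apply Clim_bound with (fun M => a M n); auto. }
  destruct (Series_tail b Hp Hs (eps / 4)) as (N & HN); [lra|].
  assert (HF : Clim (fun M => Csum (a M) N) (Csum l N)).
  { clear HN. induction N; simpl. apply Clim_const. apply Clim_plus; auto. }
  destruct (HF (eps / 4)) as (M0 & HM0); [lra|].
  exists M0. intros M HM. specialize (HM0 M HM).
  assert (Sa : summable (a M)) by (apply summable_le with b; auto).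
  assert (Sl : summable l) by (apply summable_le with b; auto).
  rewrite (CS_split (a M) N), (CS_split l N) by auto.
  assert (Hb' : ex_series (fun n => b (N + n)%nat)) by (apply (ex_series_incr_n b N); auto).
  assert (Q1 : Cmod (CS (fun n => a M (N + n)%nat)) <= Series (fun n => b (N + n)%nat))
   by (apply Cmod_CS_le; auto).
  assert (Q2 : Cmod (CS (fun n => l (N + n)%nat)) <= Series (fun n => b (N + n)%nat))
   by (apply Cmod_CS_le; auto).
  match goal with |- Cmod (?x + ?y - (?u + ?v))%C < _ => 
    replace (x + y - (u + v))%C with ((x - u) + (y - v))%C by ring end.
  eapply Rle_lt_trans; [apply Cmod_triangle|].
  match goal with |- _ + Cmod (?y - ?v)%C < _ => assert (Q3 := Cmod_tri_minus y v) end.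
  lra.
Qed.

Lemma CS_Csum (a : nat -> nat -> C) M : (forall m, (m < M)%nat -> summable (a m)) ->
  summable (fun n => Csum (fun m => a m n) M) /\
  CS (fun n => Csum (fun m => a m n) M) = Csum (fun m => CS (a m)) M.
Proof.
  induction M; intros H; simpl.
  - split; [|apply CS_0]. apply summable_le with (fun n => (/2) ^ n).
    intros; rewrite Cmod_0; apply pow_le; lra.
    apply ex_series_geom. rewrite Rabs_pos_eq; lra.
  - destruct IHM as [S1 E1]; [intros; apply H; lia|].
    assert (S2 := H M ltac:(lia)). split; [apply summable_plus; auto|].
    rewrite CS_plus; auto. rewrite E1; auto.
Qed.

Lemma sum_f_R0_Csum_Re a N : sum_f_R0 (fun n => Re (a n)) N = Re (Csum a (S N)).
Proof. rewrite <- sum_n_Reals, Csum_Re; auto. Qed.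

Definition conv (a b : nat -> C) (n : nat) : C := Csum (fun k => a k * b (n - k)%nat)%C (S n).

(** The real Cauchy product theorem, applied to the moduli for summability and to the four products
    of real and imaginary parts for the value. *)
Lemma CS_mult a b : summable a -> summable b ->
  summable (conv a b) /\ CS (conv a b) = (CS a * CS b)%C.
Proof.
  intros Ha Hb.
  assert (Habs : forall c : nat -> C, summable c -> ex_series (fun n => Rabs (Cmod (c n)))).
  { intros c Hc. eapply ex_series_ext; [|apply Hc]. intros; simpl; rewrite Rabs_pos_eq; auto; apply Cmod_ge_0. }
  split.
  - assert (H := is_series_mult _ _ _ _ (Series_correct _ Ha) (Series_correct _ Hb)
      (Habs _ Ha) (Habs _ Hb)).
    eapply summable_le; [|eexists; apply H].
    intros n. cbv beta. unfold conv. 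
    eapply Rle_trans; [apply (Cmod_Csum_le _ (fun k => Cmod (a k) * Cmod (b (n - k)%nat)))|].
    + intros; rewrite Cmod_mult; lra.
    + rewrite sum_Sn. unfold plus; simpl. rewrite sum_n_Reals. lra.
  - assert (HR : forall c : nat -> C, summable c -> ex_series (fun n => Rabs (Re (c n)))).
    { intros c Hc. eapply ex_series_le_pos; [|apply Hc]. intros; split; [apply Rabs_pos|apply re_le_Cmod]. }
    assert (HI : forall c : nat -> C, summable c -> ex_series (fun n => Rabs (Im (c n)))).
    { intros c Hc. eapply ex_series_le_pos; [|apply Hc]. intros; split; [apply Rabs_pos|apply Rabs_Im_le_Cmod]. }
    assert (RR := is_series_mult _ _ _ _ (Series_correct _ (summable_Re _ Ha)) (Series_correct _ (summable_Re _ Hb)) (HR _ Ha) (HR _ Hb)).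
    assert (II := is_series_mult _ _ _ _ (Series_correct _ (summable_Im _ Ha)) (Series_correct _ (summable_Im _ Hb)) (HI _ Ha) (HI _ Hb)).
    assert (RI := is_series_mult _ _ _ _ (Series_correct _ (summable_Re _ Ha)) (Series_correct _ (summable_Im _ Hb)) (HR _ Ha) (HI _ Hb)).
    assert (IR := is_series_mult _ _ _ _ (Series_correct _ (summable_Im _ Ha)) (Series_correct _ (summable_Re _ Hb)) (HI _ Ha) (HR _ Hb)).
    apply Ceq; simpl.
    + apply is_series_unique. eapply is_series_ext; [|apply (is_series_minus _ _ _ _ RR II)].
      intros n. cbv beta. unfold conv.
      match goal with |- _ = ?r => change r with (Re (Csum (fun k => a k * b (n - k)%nat)%C (S n))) end.
      rewrite <- sum_f_R0_Csum_Re.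
      assert (E : forall u v N, sum_f_R0 u N + - sum_f_R0 v N = sum_f_R0 (fun k => u k - v k) N).
      { intros u v N. induction N; simpl; lra. }
      etransitivity; [apply E|]. apply sum_eq. intros; unfold Re, Im; simpl; ring.
    + apply is_series_unique. eapply is_series_ext; [|apply (is_series_plus _ _ _ _ RI IR)].
      intros n. cbv beta. unfold conv.
      match goal with |- _ = ?r => change r with (Im (Csum (fun k => a k * b (n - k)%nat)%C (S n))) end.
      rewrite Csum_Im, sum_n_Reals.
      assert (E : forall u v N, sum_f_R0 u N + sum_f_R0 v N = sum_f_R0 (fun k => u k + v k) N).
      { intros u v N. induction N; simpl; lra. }
      etransitivity; [apply E|]. apply sum_eq. intros; unfold Re, Im; simpl; ring.
Qed.

(** * The complex exponential and its Taylor remainder *)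

Definition Cexp (w : C) : C := (exp (Re w) * cos (Im w), exp (Re w) * sin (Im w)).

Lemma Cexp_add a b : Cexp (a + b)%C = (Cexp a * Cexp b)%C.
Proof.
  destruct a as [x y], b as [u v]. unfold Cexp; simpl. rewrite exp_plus, cos_plus, sin_plus.
  apply Ceq; simpl; ring.
Qed.

Lemma Cexp_0 : Cexp 0%C = 1%C.
Proof. unfold Cexp; simpl. rewrite exp_0, cos_0, sin_0. apply Ceq; simpl; ring. Qed.

Lemma Cmod_Cexp w : Cmod (Cexp w) = exp (Re w).
Proof.
  unfold Cexp, Cmod; simpl. 
  replace (exp (Re w) * cos (Im w) * (exp (Re w) * cos (Im w) * 1) +
    exp (Re w) * sin (Im w) * (exp (Re w) * sin (Im w) * 1)) with
    ((exp (Re w))² * ((sin (Im w))² + (cos (Im w))²)) by (unfold Rsqr; ring).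
  rewrite sin2_cos2, Rmult_1_r. apply sqrt_Rsqr. left; apply exp_pos.
Qed.

Lemma Cexp_neq0 w : Cexp w <> 0%C.
Proof. apply Cmod_neq0. rewrite Cmod_Cexp. apply exp_pos. Qed.

Lemma Cexp_opp w : Cexp (- w)%C = (/ Cexp w)%C.
Proof.
  apply Ceq_minus. assert (H := Cexp_neq0 w).
  assert (E : (Cexp (-w) * Cexp w)%C = 1%C).
  { rewrite <- Cexp_add. replace (- w + w)%C with (RtoC 0) by ring. apply Cexp_0. }
  replace (Cexp (- w) - / Cexp w)%C with ((Cexp (-w) * Cexp w - 1) / Cexp w)%C by (field; auto).
  rewrite E. unfold Cdiv. ring.
Qed.

Lemma Cexp_pow w n : (Cexp w ^ n)%C = Cexp (INR n * w)%C.
Proof.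
  induction n.
  - simpl. rewrite Cmult_0_l, Cexp_0; auto.
  - rewrite Cpow_S, IHn, <- Cexp_add, S_INR, RtoC_plus. f_equal. ring.
Qed.

Lemma Cexp_conj w : Cconj (Cexp w) = Cexp (Cconj w).
Proof.
  destruct w; unfold Cexp, Cconj; simpl. rewrite cos_neg, sin_neg. f_equal; ring.
Qed.

(** [J] terms, hence degree [J - 1]. *)
Definition Eser (J : nat) (w : C) : C := Csum (fun j => w ^ j / INR (fact j))%C J.

Lemma RtoC_neq0 r : r <> 0 -> RtoC r <> 0%C.
Proof. intros H E. apply H. apply RtoC_inj; auto. Qed.

Lemma Eser_deriv J w : cderiv (Eser (S J)) w (Eser J w).
Proof.
  induction J.
  - apply cderiv_ext with (fun _ => 1%C).
    + intros; unfold Eser; simpl. field.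
    + apply cderiv_const.
  - apply cderiv_ext with (fun w => Eser (S J) w + / INR (fact (S J)) * w ^ S J)%C.
    { intros v; unfold Eser. change (Csum (fun j => v ^ j / INR (fact j)) (S (S J)))%C with
       (Csum (fun j => v ^ j / INR (fact j)) (S J) + v ^ S J / INR (fact (S J)))%C.
      unfold Cdiv. ring. }
    replace (Eser (S J) w) with (Eser J w + w ^ J / INR (fact J))%C by reflexivity.
    apply cderiv_plus; auto.
    eapply cderiv_eq; [|apply cderiv_scal, (cderiv_pow (fun w => w) w 1%C), cderiv_id].
    replace (S J - 1)%nat with J by lia.
    rewrite fact_simpl, mult_INR, RtoC_mult. field. 
    split; apply RtoC_neq0; [apply INR_fact_neq_0|apply not_0_INR; lia].
Qed.

Lemma rderiv_Cexp w t : rderiv (fun t => Cexp (0 + w * RtoC t)%C) t (w * Cexp (0 + w * RtoC t))%C.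
Proof.
  destruct w as [x y]. unfold Cexp; simpl.
  set (f := fun t : R => exp (0 + (x * t - y * 0)) * cos (0 + (x * 0 + y * t))).
  set (g := fun t : R => exp (0 + (x * t - y * 0)) * sin (0 + (x * 0 + y * t))).
  change (rderiv (fun t : R => (f t, g t)) t ((x,y) * (f t, g t))%C).
  apply (rderiv_pair f g); unfold f, g; simpl; auto_derive; auto; unfold Rminus; ring.
Qed.

Lemma nonincr_of_deriv (g g' : R -> R) a b : a <= b ->
  (forall t, a <= t <= b -> is_derive g t (g' t)) -> (forall t, a <= t <= b -> g' t <= 0) ->
  g b <= g a.
Proof.
  intros Hab H H'. destruct (MVT_gen g a b g') as (c & Hc & E).
  - intros x Hx. apply H. rewrite Rmin_left, Rmax_right in Hx; lra.
  - intros x Hx. rewrite Rmin_left, Rmax_right in Hx by lra.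
    apply continuity_pt_filterlim. apply (ex_derive_continuous g). eexists. apply H. lra.
  - rewrite Rmin_left, Rmax_right in Hc by lra.
    assert (g' c * (b - a) <= 0).
    { rewrite <- (Rmult_0_l (b - a)). apply Rmult_le_compat_r; [lra|auto]. }
    lra.
Qed.

(** Induction on [J] along the segment [t -> w t]: the derivative of each remainder is [w] times the
    previous one. Projecting on the direction [u] of the remainder at the end point reduces the
    claim to the monotonicity of a real function. *)
Lemma Cexp_taylor w J :
  Cmod (Cexp w - Eser J w)%C <= Cmod w ^ J / INR (fact J) * exp (Cmod w).
Proof.
  assert (H : forall t, 0 <= t <= 1 -> Cmod (Cexp (0 + w * t) - Eser J (0 + w * t))%C
    <= Cmod w ^ J * t ^ J / INR (fact J) * exp (Cmod w)).
  { induction J as [|J IH]; intros t0 Ht0.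
    - simpl. replace (1 * 1 / 1 * exp (Cmod w)) with (exp (Cmod w)) by field.
      replace (Cexp (0 + w * t0) - Eser 0 (0 + w * t0))%C with (Cexp (0 + w * t0)).
      2:{ unfold Eser; simpl; ring. }
      rewrite Cmod_Cexp. replace (0 + w * t0)%C with (w * t0)%C by ring. 
      rewrite re_scal_r.
      assert (Re w * t0 <= Cmod w).
      { apply Rle_trans with (Cmod w * t0).
        apply Rmult_le_compat_r; [lra|apply Re_le_Cmod].
        rewrite <- (Rmult_1_r (Cmod w)) at 2. apply Rmult_le_compat_l; [apply Cmod_ge_0|lra]. }
      destruct (Rle_lt_or_eq_dec _ _ H) as [H1|H1]; [left; apply exp_increasing; auto|rewrite H1; lra].
    - set (r := fun t : R => (Cexp (0 + w * t) - Eser (S J) (0 + w * t))%C).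
      assert (Hr : forall t, rderiv r t (w * (Cexp (0 + w * t) - Eser J (0 + w * t)))%C).
      { intros t eps He.
        destruct (rderiv_Cexp w t (eps / 2)) as (d1 & Hd1 & H1); [lra|].
        destruct (rderiv_comp (Eser (S J)) (fun t => 0 + w * RtoC t)%C t w _ (rderiv_line 0 w t)
          (Eser_deriv J _) (eps / 2)) as (d2 & Hd2 & H2); [lra|].
        exists (Rmin d1 d2). split; [apply Rmin_glb_lt; auto|]. intros h Hh.
        specialize (H1 h (Rlt_le_trans _ _ _ Hh (Rmin_l _ _))).
        specialize (H2 h (Rlt_le_trans _ _ _ Hh (Rmin_r _ _))).
        cbv beta in H1, H2. unfold r.
        match type of H1 with Cmod ?A <= _ => match type of H2 with Cmod ?B <= _ =>
          match goal with |- Cmod ?G <= _ => replace G with (A - B)%C by ring end end end.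
        eapply Rle_trans; [apply Cmod_tri_minus|]. lra. }
      set (u := r t0). 
      set (B := Cmod w ^ S J / INR (fact (S J)) * exp (Cmod w)).
      set (g := fun t : R => Re (Cconj u * r t)%C - Cmod u * B * t ^ S J).
      set (g' := fun t : R => Re (Cconj u * (w * (Cexp (0 + w * t) - Eser J (0 + w * t))))%C
          - Cmod u * B * (INR (S J) * t ^ J)).
      assert (Hg : g t0 <= g 0).
      { apply (nonincr_of_deriv g g'); [lra| |].
        - intros t Ht. unfold g, g'. apply (is_derive_minus (fun t => Re (Cconj u * r t)%C)).
          apply (rderiv_Re r), Hr. auto_derive; auto. rewrite S_INR. destruct J; simpl; ring.
        - intros t Ht. unfold g'.
          assert (P : Re (Cconj u * (w * (Cexp (0 + w * t) - Eser J (0 + w * t))))%C <=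
            Cmod u * B * (INR (S J) * t ^ J)).
          { eapply Rle_trans; [apply Re_le_Cmod|]. rewrite !Cmod_mult, Cmod_conj.
            rewrite Rmult_assoc. apply Rmult_le_compat_l; [apply Cmod_ge_0|].
            eapply Rle_trans; [apply Rmult_le_compat_l; [apply Cmod_ge_0|apply IH; lra]|].
            right. unfold B. rewrite fact_simpl, mult_INR. simpl pow. field.
            split; [apply INR_fact_neq_0|apply not_0_INR; lia]. }
          lra. }
      assert (Hg0 : g 0 = 0).
      { unfold g. assert (E : r 0 = 0%C).
        { unfold r. replace (0 + w * 0)%C with (RtoC 0) by ring. rewrite Cexp_0.
          unfold Eser. rewrite Csum_S.
          rewrite (Csum_ext _ (fun _ => 0 * 0)%C).
          - rewrite Csum_scal. simpl. field.
          - intros n _. rewrite Cpow_S. unfold Cdiv. ring. }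
        rewrite E. rewrite pow_i by lia. simpl. ring. }
      assert (Hgt : g t0 = Cmod u ^ 2 - Cmod u * B * t0 ^ S J).
      { unfold g. f_equal. fold u. rewrite Cmod2_alt. destruct u; simpl; ring. }
      replace (Cmod w ^ S J * t0 ^ S J / INR (fact (S J)) * exp (Cmod w)) with (B * t0 ^ S J).
      2:{ unfold B. field. apply INR_fact_neq_0. }
      fold (r t0). fold u.
      destruct (Req_dec (Cmod u) 0) as [E0|E0].
      + rewrite E0. apply Rmult_le_pos; [|apply pow_le; lra].
        unfold B. apply Rmult_le_pos; [|left; apply exp_pos].
        apply Rdiv_le_0_compat; [apply pow_le, Cmod_ge_0|apply lt_0_INR, lt_O_fact].
      + assert (0 < Cmod u) by (generalize (Cmod_ge_0 u); lra).
        apply Rmult_le_reg_l with (Cmod u); auto. rewrite Hg0, Hgt in Hg. simpl in *. lra. }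
  specialize (H 1 ltac:(lra)). rewrite pow1, Rmult_1_r in H.
  replace (0 + w * 1)%C with w in H by ring. auto.
Qed.

Lemma Cexp_quad w : Cmod (Cexp w - 1 - w)%C <= Cmod w ^ 2 * exp (Cmod w).
Proof.
  assert (H := Cexp_taylor w 2). 
  replace (Cexp w - 1 - w)%C with (Cexp w - Eser 2 w)%C.
  2:{ unfold Eser; simpl. field. }
  eapply Rle_trans; [apply H|]. apply Rmult_le_compat_r; [left; apply exp_pos|].
  simpl fact. simpl INR. assert (0 <= Cmod w ^ 2) by apply pow2_ge_0. lra.
Qed.

Lemma exp_le a b : a <= b -> exp a <= exp b.
Proof. intros [H| -> ]; [left; apply exp_increasing; auto|lra]. Qed.

Lemma Cexp_deriv z : cderiv Cexp z (Cexp z).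
Proof.
  apply cderiv_quad with 1 (exp (Re z) * exp 1); [lra|]. intros h Hh.
  rewrite Cexp_add. replace (Cexp z * Cexp h - Cexp z - Cexp z * h)%C with
    (Cexp z * (Cexp h - 1 - h))%C by ring.
  rewrite Cmod_mult, Cmod_Cexp, Rmult_assoc. apply Rmult_le_compat_l; [left; apply exp_pos|].
  eapply Rle_trans; [apply Cexp_quad|]. rewrite Rmult_comm.
  apply Rmult_le_compat_r; [apply pow2_ge_0|]. apply exp_le; lra.
Qed.

(** * Power series in q *)

Lemma ex_series_extR (a b : nat -> R) : (forall n, a n = b n) -> ex_series a -> ex_series b.
Proof. apply (ex_series_ext a b). Qed.

Lemma PI_pos : 0 < PI.
Proof. apply PI_RGT_0. Qed.

Definition qq (z : C) : C := Cexp (2 * PI * Ci * z)%C.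

Lemma Cmod_qq z : Cmod (qq z) = exp (- 2 * PI * Im z).
Proof.
  unfold qq. rewrite Cmod_Cexp. f_equal. destruct z; simpl. ring.
Qed.

Lemma qq_qexp z : qq z = qexp z.
Proof.
  unfold qq, qexp, Cexp. destruct z as [x y]; simpl.
  f_equal; f_equal; f_equal; ring.
Qed.

Lemma qq_neq0 z : qq z <> 0%C.
Proof. apply Cexp_neq0. Qed.

Lemma qq_period z : qq (z + 1)%C = qq z.
Proof.
  unfold qq. replace (2 * PI * Ci * (z + 1))%C with (2 * PI * Ci * z + 2 * PI * Ci)%C by ring.
  rewrite Cexp_add. replace (Cexp (2 * PI * Ci)%C) with (RtoC 1). ring.
  assert (E : (2 * PI * Ci)%C = (0, 2 * PI)) by (apply Ceq; simpl; ring).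
  rewrite E. unfold Cexp; simpl.
  rewrite exp_0, cos_2PI, sin_2PI. apply Ceq; simpl; ring.
Qed.

Lemma qq_lt1 z : inH z -> 0 < Cmod (qq z) < 1.
Proof.
  intros H. rewrite Cmod_qq. split; [apply exp_pos|].
  rewrite <- exp_0. apply exp_increasing. unfold inH in H.
  assert (0 < PI * Im z) by (apply Rmult_lt_0_compat; auto using PI_pos). lra.
Qed.

Lemma Cmod_qq_le y z : y <= Im z -> Cmod (qq z) <= exp (- 2 * PI * y).
Proof.
  intros H. rewrite Cmod_qq. apply exp_le.
  assert (0 <= PI * (Im z - y)) by (apply Rmult_le_pos; [left; apply PI_pos|lra]). lra.
Qed.

(** Radius of convergence at least 1, in terms of moduli so that it passes to products and
    derivatives. *)
Definition qgood (c : nat -> C) : Prop :=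
  forall r, 0 <= r < 1 -> ex_series (fun n => Cmod (c n) * r ^ n).

Definition qs (c : nat -> C) (z : C) : C := CS (fun n => c n * qq z ^ n)%C.

Lemma qgood_summable_pt c (q : C) : qgood c -> Cmod q < 1 -> summable (fun n => c n * q ^ n)%C.
Proof.
  intros H Hz. apply summable_le with (fun n => Cmod (c n) * (Cmod q) ^ n).
  intros; rewrite Cmod_mult, Cmod_pow; lra. apply H. split; auto. apply Cmod_ge_0.
Qed.

Lemma qgood_summable c z : qgood c -> inH z -> summable (fun n => c n * qq z ^ n)%C.
Proof. intros H Hz. apply qgood_summable_pt; auto. apply qq_lt1; auto. Qed.

Lemma qgood_le c d : (forall n, Cmod (c n) <= Cmod (d n)) -> qgood d -> qgood c.
Proof.
  intros H Hd r Hr. eapply ex_series_le_pos; [|apply (Hd r Hr)].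
  intros n. assert (0 <= r ^ n) by (apply pow_le; lra). split.
  apply Rmult_le_pos; auto; apply Cmod_ge_0. apply Rmult_le_compat_r; auto.
Qed.

Lemma qgood_ext c d : (forall n, c n = d n) -> qgood d -> qgood c.
Proof. intros H. apply qgood_le. intros; rewrite H; lra. Qed.

Lemma qgood_plus c d : qgood c -> qgood d -> qgood (fun n => c n + d n)%C.
Proof.
  intros Hc Hd r Hr. eapply ex_series_le_pos; [|apply (ex_series_plus _ _ (Hc r Hr) (Hd r Hr))].
  intros n. unfold plus; simpl. assert (0 <= r ^ n) by (apply pow_le; lra). split.
  apply Rmult_le_pos; auto; apply Cmod_ge_0. rewrite <- Rmult_plus_distr_r.
  apply Rmult_le_compat_r; auto. apply Cmod_triangle.
Qed.

Lemma qgood_scal a c : qgood c -> qgood (fun n => a * c n)%C.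
Proof.
  intros Hc r Hr. eapply ex_series_extR; [|apply (ex_series_scalR (Cmod a) _ (Hc r Hr))].
  intros n. simpl. rewrite Cmod_mult. ring.
Qed.

Lemma qgood_minus c d : qgood c -> qgood d -> qgood (fun n => c n - d n)%C.
Proof.
  intros Hc Hd. apply qgood_ext with (fun n => c n + (-(1)) * d n)%C. intros; ring.
  apply qgood_plus; auto. apply qgood_scal; auto.
Qed.

Lemma qgood_one : qgood (fun _ => 1%C).
Proof.
  intros r Hr. apply ex_series_extR with (fun n => r ^ n). intros; rewrite Cmod_1; ring.
  apply ex_series_geom. rewrite Rabs_pos_eq; lra.
Qed.

Lemma qgood_fin (c : nat -> C) N : (forall n, (N <= n)%nat -> c n = 0%C) -> qgood c.
Proof.
  intros H r Hr. apply (ex_series_incr_n _ N).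
  apply ex_series_extR with (fun n => 0 * r ^ n).
  - intros n. rewrite H by lia. rewrite Cmod_0. ring.
  - apply ex_series_scalR, ex_series_geom. rewrite Rabs_pos_eq; lra.
Qed.

(** Bernoulli's inequality for [/ s]. *)
Lemma INR_pow_bound s n : 0 < s < 1 -> INR n * s ^ n <= s / (1 - s).
Proof.
  intros Hs. assert (H : forall n, 1 + INR n * (/ s - 1) <= (/ s) ^ n).
  { intros k. assert (Hi : 1 < / s) by (rewrite <- Rinv_1; apply Rinv_lt_contravar; lra).
    generalize (poly k (/ s - 1)). replace (1 + (/ s - 1)) with (/ s) by ring. intros P; apply P; lra. }
  assert (H1 := H n). rewrite pow_inv in H1.
  assert (Hp : 0 < s ^ n) by (apply pow_lt; lra).
  assert (H2 : (1 + INR n * (/ s - 1)) * s ^ n <= 1).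
  { apply Rle_trans with (/ s ^ n * s ^ n). apply Rmult_le_compat_r; lra. right; field; lra. }
  apply Rmult_le_reg_r with (/ s - 1). 
  assert (1 < / s) by (rewrite <- Rinv_1; apply Rinv_lt_contravar; lra). lra.
  replace (s / (1 - s) * (/ s - 1)) with 1 by (field; lra). lra.
Qed.

(** Writing [r = s * s], one factor [s ^ n] absorbs [INR n] and the other keeps the series
    convergent. *)
Lemma qgood_INR c : qgood c -> qgood (fun n => INR n * c n)%C.
Proof.
  intros Hc r Hr. destruct (Req_dec r 0) as [->|Hr0].
  { eapply ex_series_le_pos; [|apply (Hc 0); lra]. intros n. destruct n.
    simpl. rewrite Cmult_0_l, Cmod_0. generalize (Cmod_ge_0 (c 0%nat)); lra.
    simpl. rewrite Rmult_0_l, !Rmult_0_r; lra. }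
  set (s := sqrt r).
  assert (Hs : s * s = r) by (apply sqrt_sqrt; lra).
  assert (Hs0 : 0 < s) by (apply sqrt_lt_R0; lra).
  assert (Hs1 : s < 1) by (unfold s; rewrite <- sqrt_1; apply sqrt_lt_1; lra).
  eapply ex_series_le_pos; [|apply (ex_series_scalR (s / (1 - s)) _ (Hc s ltac:(lra)))].
  intros n. simpl. assert (0 <= r ^ n) by (apply pow_le; lra). split.
  apply Rmult_le_pos; auto; apply Cmod_ge_0.
  rewrite Cmod_mult, Cmod_R, Rabs_pos_eq by apply pos_INR.
  rewrite <- Hs, Rpow_mult_distr.
  replace (INR n * Cmod (c n) * (s ^ n * s ^ n)) with ((INR n * s ^ n) * (Cmod (c n) * s ^ n)) by ring.
  apply Rmult_le_compat_r. apply Rmult_le_pos; [apply Cmod_ge_0|apply pow_le; lra].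
  apply INR_pow_bound; lra.
Qed.

Lemma qgood_pow k : qgood (fun n => INR n ^ k)%C.
Proof.
  induction k. apply qgood_one. 
  apply qgood_ext with (fun n => INR n * INR n ^ k)%C. intros; apply Cpow_S.
  apply qgood_INR; auto.
Qed.

Lemma conv_pow a b (x : C) n : conv (fun n => a n * x ^ n)%C (fun n => b n * x ^ n)%C n = (conv a b n * x ^ n)%C.
Proof.
  unfold conv. rewrite Cmult_comm, <- Csum_scal. apply Csum_ext. intros k Hk.
  replace (x ^ n)%C with (x ^ k * x ^ (n - k))%C. ring.
  rewrite <- Cpow_add_r. f_equal. lia.
Qed.

Lemma conv_0 a b : conv a b 0 = (a 0%nat * b 0%nat)%C.
Proof. unfold conv; simpl. ring. Qed.

Lemma conv_1 a b : conv a b 1 = (a 0%nat * b 1%nat + a 1%nat * b 0%nat)%C.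
Proof. unfold conv; simpl. ring. Qed.

Lemma qgood_conv a b : qgood a -> qgood b -> qgood (conv a b).
Proof.
  intros Ha Hb r Hr.
  assert (S : forall c, qgood c -> summable (fun n => c n * r ^ n)%C).
  { intros c Hc. apply qgood_summable_pt; auto. rewrite Cmod_R, Rabs_pos_eq; lra. }
  destruct (CS_mult _ _ (S a Ha) (S b Hb)) as [H _].
  eapply ex_series_extR; [|apply H].
  intros n. cbv beta. rewrite conv_pow, Cmod_mult. rewrite <- RtoC_pow, Cmod_R, Rabs_pos_eq; auto.
  apply pow_le; lra.
Qed.

Lemma qs_ext c d z : (forall n, c n = d n) -> qs c z = qs d z.
Proof. intros H. apply CS_ext. intros; rewrite H; auto. Qed.

Lemma qs_plus c d z : qgood c -> qgood d -> inH z -> qs (fun n => c n + d n)%C z = (qs c z + qs d z)%C.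
Proof.
  intros. unfold qs. rewrite <- CS_plus by (apply qgood_summable; auto). apply CS_ext; intros; ring.
Qed.

Lemma qs_scal a c z : qgood c -> inH z -> qs (fun n => a * c n)%C z = (a * qs c z)%C.
Proof.
  intros. unfold qs. rewrite <- CS_scal by (apply qgood_summable; auto). apply CS_ext; intros; ring.
Qed.

Lemma qs_minus c d z : qgood c -> qgood d -> inH z -> qs (fun n => c n - d n)%C z = (qs c z - qs d z)%C.
Proof.
  intros. unfold qs. rewrite <- CS_minus by (apply qgood_summable; auto). apply CS_ext; intros; ring.
Qed.

Lemma qs_mult c d z : qgood c -> qgood d -> inH z -> qs (conv c d) z = (qs c z * qs d z)%C.
Proof.
  intros. unfold qs.
  rewrite <- (proj2 (CS_mult _ _ (qgood_summable c z H H1) (qgood_summable d z H0 H1))).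
  apply CS_ext. intros; rewrite conv_pow; auto.
Qed.

Lemma qs_period c z : qs c (z + 1)%C = qs c z.
Proof. apply CS_ext. intros. rewrite qq_period; auto. Qed.

Lemma qq_conj z : Cconj (qq z) = qq (- Cconj z)%C.
Proof.
  unfold qq. rewrite Cexp_conj. f_equal. destruct z; apply Ceq; simpl; ring.
Qed.

Lemma CS_conj a : Cconj (CS a) = CS (fun n => Cconj (a n)).
Proof.
  unfold CS, Cconj; simpl. f_equal. rewrite <- Series_opp. apply Series_ext; auto.
Qed.

Lemma qs_conj c z : (forall n, Im (c n) = 0) -> Cconj (qs c z) = qs c (- Cconj z)%C.
Proof.
  intros H. unfold qs. rewrite CS_conj. apply CS_ext. intros n.
  rewrite Cmult_conj, Cpow_conj, qq_conj. f_equal. specialize (H n).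
  destruct (c n); simpl in *; subst. unfold Cconj; simpl. f_equal; ring.
Qed.

Lemma qs_shift c N z : qgood c -> inH z -> (forall n, (n < N)%nat -> c n = 0%C) ->
  qs c z = (qq z ^ N * qs (fun n => c (N + n)%nat) z)%C.
Proof.
  intros Hc Hz H0. unfold qs. rewrite (CS_split _ N) by (apply qgood_summable; auto).
  rewrite (Csum_ext _ (fun _ => 0 * 0)%C), Csum_scal by (intros; rewrite H0 by auto; ring).
  rewrite <- CS_scal.
  - rewrite Cmult_0_l, Cplus_0_l. apply CS_ext. intros n. rewrite Cpow_add_r. ring.
  - assert (S := proj1 (summable_incr_n _ N) (qgood_summable c z Hc Hz)).
    apply summable_ext with (fun n => / (qq z ^ N) * (c (N + n)%nat * qq z ^ (N + n)))%C.
    + intros n. rewrite Cpow_add_r. field. apply Cpow_nz, qq_neq0.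
    + apply summable_scal. auto.
Qed.

Lemma qgood_shift c N : qgood c -> qgood (fun n => c (N + n)%nat).
Proof.
  intros Hc r Hr. destruct (Req_dec r 0) as [->|Hr0].
  { apply (ex_series_incr_n _ 1). apply ex_series_extR with (fun n => 0 * (/2) ^ n).
    intros n. simpl. ring. apply ex_series_scalR, ex_series_geom. rewrite Rabs_pos_eq; lra. }
  apply ex_series_extR with (fun n => (/ r ^ N) * (Cmod (c (N + n)%nat) * r ^ (N + n))).
  - intros n. rewrite pow_add. field. apply pow_nonzero; auto.
  - apply ex_series_scalR. apply (ex_series_incr_n (fun n => Cmod (c n) * r ^ n) N). auto.
Qed.

Lemma qs_bounded c y : qgood c -> 0 < y -> exists B, 0 <= B /\ forall z, y <= Im z -> Cmod (qs c z) <= B.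
Proof.
  intros Hc Hy. set (r := exp (- 2 * PI * y)).
  assert (Hr : 0 <= r < 1).
  { split. left; apply exp_pos. unfold r. rewrite <- exp_0. apply exp_increasing.
    assert (0 < PI * y) by (apply Rmult_lt_0_compat; auto using PI_pos). lra. }
  exists (Series (fun n => Cmod (c n) * r ^ n)). split.
  - apply Series_nonneg; auto. intros; apply Rmult_le_pos; [apply Cmod_ge_0|apply pow_le; lra].
  - intros z Hz. apply Cmod_CS_le; auto. intros n. rewrite Cmod_mult, Cmod_pow.
    apply Rmult_le_compat_l; [apply Cmod_ge_0|]. apply pow_incr. split; [apply Cmod_ge_0|].
    apply Cmod_qq_le; auto.
Qed.

Lemma qs_Obound c N y : qgood c -> 0 < y -> (forall n, (n < N)%nat -> c n = 0%C) ->
  exists B, 0 <= B /\ forall z, y <= Im z -> Cmod (qs c z) <= B * Cmod (qq z) ^ N.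
Proof.
  intros Hc Hy H0. destruct (qs_bounded _ y (qgood_shift c N Hc) Hy) as (B & HB0 & HB).
  exists B; split; auto. intros z Hz. rewrite (qs_shift c N) by (auto; unfold inH; lra).
  rewrite Cmod_mult, Cmod_pow, Rmult_comm. apply Rmult_le_compat_r; auto.
  apply pow_le, Cmod_ge_0.
Qed.

(** The constants [M n] of the quadratic remainders are summable, so the remainder of the sum is
    quadratic too. *)
Lemma CS_deriv (a : nat -> C -> C) (a' : nat -> C) z d (M : nat -> R) : 0 < d ->
  (forall n h, Cmod h < d -> Cmod (a n (z + h) - a n z - a' n * h)%C <= M n * Cmod h ^ 2) ->
  ex_series M -> (forall h, Cmod h < d -> summable (fun n => a n (z + h)%C)) -> summable a' ->
  cderiv (fun w => CS (fun n => a n w)) z (CS a').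
Proof.
  intros Hd H HM HS HS'. apply cderiv_quad with d (Series M); auto.
  intros h Hh.
  assert (S0 : summable (fun n => a n z)).
  { apply summable_ext with (fun n => a n (z + 0)%C). intros; rewrite Cplus_0_r; auto.
    apply HS. rewrite Cmod_0; auto. }
  assert (S1 := HS h Hh).
  replace (CS (fun n => a n (z + h)) - CS (fun n => a n z) - CS a' * h)%C with
    (CS (fun n => a n (z + h)%C - a n z - h * a' n)%C).
  2:{ rewrite CS_minus, CS_minus, CS_scal; auto. ring. apply summable_minus; auto.
      apply summable_scal; auto. }
  rewrite Rmult_comm, <- Series_scal_l. apply Cmod_CS_le.
  - intros n. rewrite Rmult_comm. rewrite (Cmult_comm h). apply H; auto.
  - apply ex_series_scalR; auto.
Qed.

Lemma qq_deriv z : cderiv qq z (2 * PI * Ci * qq z)%C.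
Proof.
  eapply cderiv_eq; [|apply (cderiv_comp (fun w => 2 * PI * Ci * w)%C Cexp z)].
  2: apply cderiv_scal, cderiv_id. 2: apply Cexp_deriv. unfold qq. ring.
Qed.

Definition dq (c : nat -> C) (n : nat) : C := (2 * PI * Ci * (INR n * c n))%C.

Lemma qgood_dq c : qgood c -> qgood (dq c).
Proof. intros. apply qgood_scal, qgood_INR; auto. Qed.

Lemma qs_deriv c z : qgood c -> inH z -> cderiv (qs c) z (qs (dq c) z).
Proof.
  intros Hc Hz. set (y := Im z). assert (Hy : 0 < y) by exact Hz.
  (* Half of the decay of |q|^n is kept; the other half pays for [exp (Cmod w)] when
     [|h| < y / 2]. *)
  set (r := exp (- PI * y)).
  assert (HPy : 0 < PI * y) by (apply Rmult_lt_0_compat; auto using PI_pos).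
  assert (Hr : 0 <= r < 1).
  { split. left; apply exp_pos. unfold r. rewrite <- exp_0. apply exp_increasing. lra. }
  unfold qs. apply (CS_deriv (fun n w => c n * qq w ^ n)%C (fun n => dq c n * qq z ^ n)%C z (y/2)
    (fun n => (2 * PI) ^ 2 * (Cmod (INR n * (INR n * c n))%C * r ^ n))); [lra| | | |].
  - intros n h Hh. unfold qq. rewrite !Cexp_pow.
    replace (INR n * (2 * PI * Ci * (z + h)))%C with (INR n * (2 * PI * Ci * z) + INR n * (2 * PI * Ci * h))%C by ring.
    rewrite Cexp_add. set (E := Cexp (INR n * (2 * PI * Ci * z))%C). set (w := (INR n * (2 * PI * Ci * h))%C).
    replace (c n * (E * Cexp w) - c n * E - dq c n * E * h)%C with (c n * E * (Cexp w - 1 - w))%C.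
    2:{ unfold dq, w. ring. }
    rewrite !Cmod_mult.
    assert (Ew : Cmod w = 2 * PI * INR n * Cmod h).
    { unfold w. rewrite !Cmod_mult, !Cmod_R, Cmod_Ci.
      rewrite !Rabs_pos_eq; try ring; try lra. left; apply PI_pos. apply pos_INR. }
    assert (decay : Cmod E * exp (Cmod w) <= r ^ n).
    { unfold E. rewrite Cmod_Cexp, <- exp_plus. unfold r.
      rewrite <- (Rpower_pow n (exp _)) by apply exp_pos. unfold Rpower. rewrite ln_exp.
      apply exp_le. rewrite Ew. 
      replace (Re (INR n * (2 * PI * Ci * z))%C) with (- 2 * PI * INR n * y).
      2:{ unfold y; destruct z; simpl; ring. }
      assert (PI * INR n * Cmod h <= PI * INR n * (y / 2)).
      { apply Rmult_le_compat_l. apply Rmult_le_pos; [left; apply PI_pos|apply pos_INR]. lra. }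
      lra. }
    rewrite Cmod_R, (Rabs_pos_eq (INR n)) by apply pos_INR.
    assert (HQ := Cexp_quad w).
    apply Rle_trans with (Cmod (c n) * Cmod E * (Cmod w ^ 2 * exp (Cmod w))).
    { apply Rmult_le_compat_l; auto. apply Rmult_le_pos; apply Cmod_ge_0. }
    replace (Cmod (c n) * Cmod E * (Cmod w ^ 2 * exp (Cmod w))) with
      ((Cmod E * exp (Cmod w)) * (Cmod (c n) * Cmod w ^ 2)) by ring.
    apply Rle_trans with (r ^ n * (Cmod (c n) * Cmod w ^ 2)).
    { apply Rmult_le_compat_r; auto. apply Rmult_le_pos. apply Cmod_ge_0. apply pow2_ge_0. }
    rewrite Ew. right; ring.
  - apply ex_series_scalR. apply (qgood_INR _ (qgood_INR _ Hc)); auto.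
  - intros h Hh. apply qgood_summable; auto. apply inH_near; auto. fold y. lra.
  - apply qgood_summable; auto. apply qgood_dq; auto.
Qed.

Lemma is_series_C_Csum a (l : C) :
  is_series (K := C_AbsRing) (V := C_NormedModule) a l -> Clim (Csum a) l.
Proof.
  intros H eps He.
  assert (Hb : locally (T := C_UniformSpace) l (fun x => Cmod (x - l)%C < eps)).
  { apply (locally_le_locally_norm (K := C_AbsRing) (V := C_NormedModule)). exists (mkposreal _ He).
    intros y Hy. exact Hy. }
  destruct (H _ Hb) as (N & HN). exists (S N). intros n Hn. destruct n as [|n]; [lia|].
  specialize (HN n ltac:(lia)). 
  assert (E : forall m, Csum a (S m) = sum_n (G := C_AbelianMonoid) a m).
  { induction m. rewrite sum_O. simpl. apply Cplus_0_l. rewrite sum_Sn, <- IHm. reflexivity. }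
  rewrite E. exact HN.
Qed.

Lemma Cpow_eq (x : C) n : Defs.Cpow x n = (x ^ n)%C.
Proof. induction n; auto. Qed.

(** Abel's lemma: it turns the mere convergence demanded in [is_g] into absolute convergence. *)
Lemma is_series_C_qgood c : (forall z, inH z -> exists l : C,
    is_series (K := C_AbsRing) (V := C_NormedModule) (fun n => Cmult (c n) (Defs.Cpow (qexp z) n)) l) ->
  qgood c.
Proof.
  intros H r Hr.
  (* convergence at radius (1+r)/2 bounds the terms there *)
  set (s := (1 + r) / 2).
  set (z := (0, - ln s / (2 * PI))).
  assert (HP := PI_pos).
  assert (Hl : ln s < 0) by (rewrite <- ln_1; apply ln_increasing; unfold s; lra).
  assert (Hz : inH z).
  { unfold inH, z; simpl. apply Rdiv_lt_0_compat; lra. }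
  assert (Hq : Cmod (qq z) = s).
  { rewrite Cmod_qq. unfold z; simpl. replace (-2 * PI * (- ln s / (2 * PI))) with (ln s) by (field; lra).
    apply exp_ln. unfold s; lra. }
  destruct (H z Hz) as (l & Hl').
  apply is_series_C_Csum in Hl'.
  destruct (Hl' 1 Rlt_0_1) as (N & HN).
  assert (Hb : forall n, (N <= n)%nat -> Cmod (c n) * s ^ n <= 2).
  { intros n Hn. assert (H1 := HN n Hn). assert (H2 := HN (S n) ltac:(lia)). simpl in H2.
    assert (E : Defs.Cpow (qexp z) n = (qq z ^ n)%C).
    { rewrite qq_qexp. apply Cpow_eq. }
    rewrite E in *.
    rewrite <- Hq, <- Cmod_pow, <- Cmod_mult.
    match type of H1 with Cmod (?a - _)%C < _ => 
      replace (c n * qq z ^ n)%C with ((a + c n * qq z ^ n - l) - (a - l))%C by ring end.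
    eapply Rle_trans; [apply Cmod_tri_minus|]. lra. }
  apply (ex_series_incr_n _ N).
  assert (Hs : 0 < s < 1) by (unfold s; lra).
  apply ex_series_le_pos with (fun n => (2 * (r / s) ^ N) * (r / s) ^ n).
  - intros n. split.
    apply Rmult_le_pos; [apply Cmod_ge_0|apply pow_le; lra].
    specialize (Hb (N + n)%nat ltac:(lia)).
    rewrite Rmult_assoc, <- pow_add. unfold Rdiv. rewrite Rpow_mult_distr, pow_inv.
    assert (0 < s ^ (N + n)) by (apply pow_lt; lra).
    apply Rle_trans with ((Cmod (c (N + n)%nat) * s ^ (N + n)) * (r ^ (N + n) * / s ^ (N + n))).
    right; field; lra. apply Rmult_le_compat_r; auto.
    apply Rmult_le_pos. apply pow_le; lra. left; apply Rinv_0_lt_compat; auto.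
  - apply ex_series_scalR, ex_series_geom. rewrite Rabs_pos_eq.
    apply Rmult_lt_reg_r with s; [lra|]. unfold Rdiv. rewrite Rmult_assoc, Rinv_l by lra. unfold s; lra.
    apply Rdiv_le_0_compat; lra.
Qed.

Lemma is_series_C_qs c z (l : C) : qgood c -> inH z ->
  is_series (K := C_AbsRing) (V := C_NormedModule) (fun n => Cmult (c n) (Defs.Cpow (qexp z) n)) l ->
  l = qs c z.
Proof.
  intros Hc Hz H. apply is_series_C_Csum in H. eapply Clim_unique; [apply H|].
  apply Clim_ext with (Csum (fun n => c n * qq z ^ n)%C).
  - intros n. apply Csum_ext. intros k _. f_equal. rewrite qq_qexp. symmetry; apply Cpow_eq.
  - apply CS_lim, qgood_summable; auto.
Qed.

(** * The Lipschitz formula *)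

Lemma PI_bounds : 3.14 < PI < 3.15.
Proof.
  assert (H := PI_2_3_7_ineq 2). unfold sum_f_R0, tg_alt, PI_2_3_7_tg, Ratan_seq in H. simpl in H.
  lra.
Qed.

Lemma is_series_telescope :
  is_series (fun n => / (INR (S n) * INR (S (S n)))) 1.
Proof.
  assert (E : forall N, sum_n (fun n => / (INR (S n) * INR (S (S n)))) N = 1 - / INR (S (S N))).
  { induction N. rewrite sum_O. simpl. field.
    rewrite sum_Sn, IHN. unfold plus; simpl plus. 
    assert (INR (S (S N)) <> 0) by (apply not_0_INR; lia).
    rewrite (S_INR (S (S N))) in *. assert (INR (S (S N)) + 1 <> 0) by (rewrite <- S_INR; apply not_0_INR; lia).
    simpl. unfold Hierarchy.plus; simpl. field. split; auto. }
  change (is_lim_seq (sum_n (fun n => / (INR (S n) * INR (S (S n))))) (Finite 1)).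
  apply (is_lim_seq_ext (fun N => 1 - / INR (S (S N)))).
  { intros; rewrite E; auto. }
  replace (Finite 1) with (Finite (1 - 0)) by (f_equal; ring).
  apply is_lim_seq_minus'. apply is_lim_seq_const.
  apply (is_lim_seq_incr_1 (fun n => / INR (S n))).
  apply (is_lim_seq_incr_1 (fun n => / INR n)).
  replace (Finite 0) with (Rbar_inv p_infty) by reflexivity.
  apply is_lim_seq_inv. apply is_lim_seq_INR. discriminate.
Qed.

Lemma inv2_term n : 0 <= / INR (S n) ^ 2 <= 2 * / (INR (S n) * INR (S (S n))).
Proof.
  assert (0 < INR (S n)) by (apply lt_0_INR; lia). rewrite (S_INR (S n)).
  assert (1 <= INR (S n)) by (apply (le_INR 1); lia).
  split. left; apply Rinv_0_lt_compat, pow_lt; auto.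
  apply Rmult_le_reg_r with (INR (S n) ^ 2 * (INR (S n) + 1)).
  apply Rmult_lt_0_compat; [apply pow_lt; auto|lra].
  replace (/ INR (S n) ^ 2 * (INR (S n) ^ 2 * (INR (S n) + 1))) with (INR (S n) + 1) by (field; lra).
  replace (2 * / (INR (S n) * (INR (S n) + 1)) * (INR (S n) ^ 2 * (INR (S n) + 1))) with (2 * INR (S n)) by (field; lra).
  lra.
Qed.

Lemma ex_series_inv2 : ex_series (fun n => / INR (S n) ^ 2).
Proof.
  eapply ex_series_le_pos; [apply inv2_term|]. apply ex_series_scalR. eexists; apply is_series_telescope.
Qed.

Lemma Series_inv2_le : Series (fun n => / INR (S n) ^ 2) <= 2.
Proof.
  apply Rle_trans with (Series (fun n => 2 * / (INR (S n) * INR (S (S n))))).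
  apply Series_le. apply inv2_term. apply ex_series_scalR. eexists; apply is_series_telescope.
  rewrite Series_scal_l, (is_series_unique _ _ is_series_telescope). lra.
Qed.

Lemma is_lim_seq_KN K : is_lim_seq (fun N => K / (1 + INR N)) 0.
Proof.
  apply is_lim_seq_ext with (fun N => K * / INR (S N)).
  { intros; rewrite S_INR; unfold Rdiv; f_equal; f_equal; ring. }
  replace (Finite 0) with (Rbar_mult K 0) by (simpl; f_equal; ring).
  apply is_lim_seq_scal_l. apply (is_lim_seq_incr_1 (fun n => / INR n)).
  replace (Finite 0) with (Rbar_inv p_infty) by reflexivity.
  apply is_lim_seq_inv. apply is_lim_seq_INR. discriminate.
Qed.

Lemma inH_shift z d : inH z -> inH (z + RtoC d)%C.
Proof. unfold inH. destruct z; simpl. rewrite Rplus_0_r; auto. Qed.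

(** The triangle inequality gives [1 + |d| <= |z + d| + (1 + |z|)], and [|z + d| >= Im z] turns the
    last term into a multiple of [|z + d|]. *)
Lemma inv_shift_bound z : inH z -> exists K, 0 < K /\
  forall d : R, Cmod (/ (z + d))%C <= K / (1 + Rabs d).
Proof.
  intros Hz. unfold inH in Hz. set (y := Im z) in *.
  exists (1 + (1 + Cmod z) / y). assert (P := Cmod_ge_0 z).
  assert (0 < (1 + Cmod z) / y) by (apply Rdiv_lt_0_compat; lra).
  split; [lra|]. intros d. assert (Pd := Rabs_pos d).
  assert (Hd : inH (z + d)%C) by (apply inH_shift; auto).
  assert (Hy : y <= Cmod (z + d)%C).
  { replace y with (Im (z + d)%C). apply Im_le_Cmod. unfold y; destruct z; simpl; ring. }
  rewrite Cmod_inv by (apply inH_neq0; auto).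
  apply Rmult_le_reg_r with (Cmod (z + d)%C * (1 + Rabs d)).
  apply Rmult_lt_0_compat; lra.
  replace (/ Cmod (z + d) * (Cmod (z + d) * (1 + Rabs d))) with (1 + Rabs d) by (field; lra).
  replace ((1 + (1 + Cmod z) / y) / (1 + Rabs d) * (Cmod (z + d) * (1 + Rabs d))) with
    (Cmod (z + d)%C + (1 + Cmod z) * (Cmod (z + d)%C / y)) by (field; lra).
  assert (1 <= Cmod (z + d)%C / y) by (apply Rmult_le_reg_r with y; auto; unfold Rdiv; rewrite Rmult_assoc, Rinv_l; lra).
  assert ((1 + Cmod z) * 1 <= (1 + Cmod z) * (Cmod (z + d)%C / y)) by (apply Rmult_le_compat_l; lra).
  assert (Rabs d <= Cmod (z + d)%C + Cmod z).
  { eapply Rle_trans; [|apply Cmod_tri_minus]. replace (z + d - z)%C with (RtoC d) by ring.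
    rewrite Cmod_R; lra. }
  lra.
Qed.

(* [LS s z] is the sum of [(z + d)^-s] over all integers [d]; [lterm s z n] groups [d = n + 1] and [d = - (n + 1)]. *)
Definition lterm (s : nat) (z : C) (n : nat) : C :=
  (/ (z + INR (S n)) ^ s + / (z - INR (S n)) ^ s)%C.
Definition LS (s : nat) (z : C) : C := (/ z ^ s + CS (lterm s z))%C.
Definition LSP (s : nat) (z : C) (N : nat) : C := (/ z ^ s + Csum (lterm s z) N)%C.

Lemma RtoC_neg_shift z r : (z - RtoC r)%C = (z + RtoC (- r))%C.
Proof. rewrite RtoC_opp. ring. Qed.

Lemma inH_shift_neq0 z d : inH z -> (z + RtoC d)%C <> 0%C.
Proof. intros. apply inH_neq0, inH_shift; auto. Qed.

Lemma lterm_bound z s : inH z -> (2 <= s)%nat -> exists K, 0 < K /\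
  forall n, Cmod (lterm s z n) <= K * / INR (S n) ^ 2.
Proof.
  intros Hz Hs. destruct (inv_shift_bound z Hz) as (K & HK & H).
  exists (2 * K ^ s). split. { assert (0 < K ^ s) by (apply pow_lt; auto). lra. }
  assert (B : forall (n : nat) (d : R), Rabs d = INR (S n) -> Cmod (/ (z + d) ^ s)%C <= K ^ s * / INR (S n) ^ 2).
  { intros n d Hd. rewrite <- Cpow_inv by (apply inH_shift_neq0; auto).
    rewrite Cmod_pow. eapply Rle_trans; [apply pow_incr; split; [apply Cmod_ge_0|apply H]|].
    unfold Rdiv. rewrite Rpow_mult_distr. apply Rmult_le_compat_l. apply pow_le; lra.
    rewrite Hd. assert (H1 : 1 <= INR (S n)) by (apply (le_INR 1); lia).
    rewrite pow_inv. apply Rinv_le_contravar. apply pow_lt; lra.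
    apply Rle_trans with ((1 + INR (S n)) ^ 2). apply pow_incr; lra. apply Rle_pow; [lra|auto]. }
  intros n. unfold lterm. eapply Rle_trans; [apply Cmod_triangle|].
  rewrite RtoC_neg_shift. assert (Pn := pos_INR (S n)).
  assert (B1 := B n (INR (S n)) (Rabs_pos_eq _ Pn)).
  assert (B2 := B n (- INR (S n)) ltac:(rewrite Rabs_Ropp; apply Rabs_pos_eq, Pn)).
  lra.
Qed.

Lemma lterm_summable z s : inH z -> (2 <= s)%nat -> summable (lterm s z).
Proof.
  intros Hz Hs. destruct (lterm_bound z s Hz Hs) as (K & HK & H).
  eapply summable_le; [apply H|]. apply ex_series_scalR, ex_series_inv2.
Qed.

Lemma LSP_lim z s : inH z -> (2 <= s)%nat -> Clim (LSP s z) (LS s z).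
Proof.
  intros. apply Clim_plus. apply Clim_const. apply CS_lim, lterm_summable; auto.
Qed.

Lemma shift_inv_lim z s (d : nat -> R) : inH z -> (1 <= s)%nat -> (forall n, INR n <= Rabs (d n)) ->
  Clim (fun n => / (z + d n) ^ s)%C 0%C.
Proof.
  intros Hz Hs Hd. destruct (inv_shift_bound z Hz) as (K & HK & H).
  apply Clim_0_le with (fun n => (1 + K) ^ s * / (1 + INR n)).
  { apply (is_lim_seq_KN ((1 + K) ^ s)). }
  intros n. rewrite <- Cpow_inv by (apply inH_shift_neq0; auto). rewrite Cmod_pow.
  assert (Pn := pos_INR n). specialize (Hd n).
  assert (H1 : Cmod (/ (z + d n))%C <= K / (1 + INR n)).
  { eapply Rle_trans; [apply H|]. apply Rmult_le_compat_l; [lra|]. apply Rinv_le_contravar; lra. }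
  eapply Rle_trans; [apply pow_incr; split; [apply Cmod_ge_0|apply H1]|].
  unfold Rdiv. rewrite Rpow_mult_distr. apply Rmult_le_compat.
  apply pow_le; lra. apply pow_le. left; apply Rinv_0_lt_compat; lra.
  apply pow_incr; lra.
  destruct s as [|s]; [lia|]. simpl.
  assert (I : 0 < / (1 + INR n) <= 1).
  { split. apply Rinv_0_lt_compat; lra. apply Rle_trans with (/ 1); [apply Rinv_le_contravar; lra|lra]. }
  assert (Q : (/ (1 + INR n)) ^ s <= 1) by (apply Rle_trans with (1 ^ s); [apply pow_incr; lra|rewrite pow1; lra]).
  apply Rle_trans with (/ (1 + INR n) * 1); [apply Rmult_le_compat_l|]; lra.
Qed.

(** Shifting a symmetric partial sum by 1 changes only its two end terms, which tend to zero. *)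
Lemma LS_period z s : inH z -> (2 <= s)%nat -> LS s (z + 1)%C = LS s z.
Proof.
  intros Hz Hs.
  assert (E : forall N, LSP s (z + 1)%C N = (LSP s z N + / (z + (INR N + 1)%R) ^ s - / (z + (- INR N)%R) ^ s)%C).
  { induction N.
    - unfold LSP; simpl. rewrite Rplus_0_l, Ropp_0, !Cplus_0_r. ring.
    - unfold LSP in *. simpl Csum.
      transitivity ((/ (z + 1) ^ s + Csum (lterm s (z + 1)) N) + lterm s (z + 1) N)%C; [ring|].
      rewrite IHN. unfold lterm. rewrite S_INR.
      replace (z + 1 + (INR N + 1)%R)%C with (z + (INR N + 1 + 1)%R)%C by (rewrite !RtoC_plus; ring).
      replace (z + 1 - (INR N + 1)%R)%C with (z + (- INR N)%R)%C by (rewrite !RtoC_plus, !RtoC_opp; ring).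
      replace (z - (INR N + 1)%R)%C with (z + (- (INR N + 1))%R)%C by (rewrite !RtoC_opp; ring).
      ring. }
  apply Clim_unique with (LSP s (z + 1)%C). apply LSP_lim; auto. apply (inH_shift z 1); auto.
  eapply Clim_ext; [intros n; symmetry; apply E|].
  replace (LS s z) with (LS s z + 0 - 0)%C by ring.
  apply Clim_minus. apply Clim_plus. apply LSP_lim; auto.
  apply shift_inv_lim; auto; try lia. intros n. rewrite Rabs_pos_eq; generalize (pos_INR n); lra.
  apply shift_inv_lim; auto; try lia. intros n. rewrite Rabs_Ropp. apply Rle_abs.
Qed.

(** The points [z/2 + d] and [(z+1)/2 + d] are the halves of the points [z + n] with [n] even and
    odd. At finite level a single end term is left over. *)
Lemma LS2_double z : inH z -> (LS 2 (z / 2) + LS 2 ((z + 1) / 2) = 4 * LS 2 z)%C.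
Proof.
  intros Hz.
  assert (Hh : inH (z / 2)%C).
  { unfold inH in *. destruct z as [x y]; simpl in *. lra. }
  assert (Hh1 : inH ((z + 1) / 2)%C).
  { unfold inH in *. destruct z as [x y]; simpl in *. lra. }
  assert (E : forall N, (LSP 2 (z / 2) N + LSP 2 ((z + 1) / 2) N = 4 * (LSP 2 z (2 * N) + / (z + (2 * INR N + 1)%R) ^ 2))%C).
  { assert (NZ : forall d : R, (z + d)%C <> 0%C) by (intros; apply inH_shift_neq0; auto).
    induction N.
    - unfold LSP. simpl Csum. simpl INR. rewrite Rmult_0_r, Rplus_0_l.
      field. split. apply (NZ 1). apply inH_neq0; auto.
    - assert (CSs : forall a n, Csum a (S n) = (Csum a n + a n)%C) by reflexivity.
      assert (LT : forall w n, lterm 2 w n = (/ (w + INR (S n)) ^ 2 + / (w - INR (S n)) ^ 2)%C) by reflexivity.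
      replace (2 * S N)%nat with (S (S (2 * N))) by lia.
      assert (EN : INR (2 * N) = 2 * INR N) by (rewrite mult_INR; reflexivity).
      set (NN := (2 * N)%nat) in *.
      unfold LSP in *. rewrite !CSs.
      transitivity ((/ (z / 2) ^ 2 + Csum (lterm 2 (z / 2)) N + (/ ((z + 1) / 2) ^ 2 + Csum (lterm 2 ((z + 1) / 2)) N))
         + lterm 2 (z / 2) N + lterm 2 ((z + 1) / 2) N)%C; [ring|].
      rewrite IHN, !LT, !S_INR, EN. set (r := INR N).
      assert (N1 := NZ (2 * r + 1)). assert (N2 := NZ (2 * r + 2)). assert (N3 := NZ (2 * r + 3)).
      assert (N4 := NZ (- (2 * r + 1))). assert (N5 := NZ (- (2 * r + 2))).
      rewrite ?RtoC_plus, ?RtoC_opp, ?RtoC_mult, ?RtoC_plus, ?RtoC_mult in *.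
      assert (M1 : (z / 2 + (r + 1))%C <> 0%C).
      { intro A. apply N2. replace (z + (2 * r + 2))%C with (2 * (z / 2 + (r + 1)))%C by field. rewrite A; ring. }
      assert (M2 : (z / 2 - (r + 1))%C <> 0%C).
      { intro A. apply N5. replace (z + - (2 * r + 2))%C with (2 * (z / 2 - (r + 1)))%C by field. rewrite A; ring. }
      assert (M3 : ((z + 1) / 2 + (r + 1))%C <> 0%C).
      { intro A. apply N3. replace (z + (2 * r + 3))%C with (2 * ((z + 1) / 2 + (r + 1)))%C by field. rewrite A; ring. }
      assert (M4 : ((z + 1) / 2 - (r + 1))%C <> 0%C).
      { intro A. apply N4. replace (z + - (2 * r + 1))%C with (2 * ((z + 1) / 2 - (r + 1)))%C by field. rewrite A; ring. }
      replace (z / 2 + (r + 1))%C with ((z + (2 * r + 2)) / 2)%C by field.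
      replace (z / 2 - (r + 1))%C with ((z + - (2 * r + 2)) / 2)%C by field.
      replace ((z + 1) / 2 + (r + 1))%C with ((z + (2 * r + 3)) / 2)%C by field.
      replace ((z + 1) / 2 - (r + 1))%C with ((z + - (2 * r + 1)) / 2)%C by field.
      replace (z + (2 * (r + 1) + 1))%C with (z + (2 * r + 3))%C by ring.
      replace (z + (2 * r + 1 + 1))%C with (z + (2 * r + 2))%C by ring.
      replace (z - (2 * r + 1))%C with (z + - (2 * r + 1))%C by ring.
      replace (z - (2 * r + 1 + 1))%C with (z + - (2 * r + 2))%C by ring.
      set (a1 := (z + (2 * r + 1))%C) in *. set (a2 := (z + (2 * r + 2))%C) in *.
      set (a3 := (z + (2 * r + 3))%C) in *. set (a4 := (z + - (2 * r + 1))%C) in *.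
      set (a5 := (z + - (2 * r + 2))%C) in *.
      assert (F : forall a : C, a <> 0%C -> (/ (a / 2) ^ 2 = 4 * / a ^ 2)%C) by (intros; field; auto).
      rewrite !F by auto. ring. }
  apply Clim_unique with (fun N => LSP 2 (z / 2) N + LSP 2 ((z + 1) / 2) N)%C.
  apply Clim_plus; apply LSP_lim; auto.
  eapply Clim_ext; [intros n; symmetry; apply E|].
  apply Clim_scal. replace (LS 2 z) with (LS 2 z + 0)%C by ring.
  apply Clim_plus. apply (Clim_subseq (LSP 2 z) _ (fun N => 2 * N)%nat). intros; lia. apply LSP_lim; auto.
  apply (shift_inv_lim z 2 (fun n => 2 * INR n + 1)); auto.
  intros n. generalize (pos_INR n); intros. rewrite Rabs_pos_eq; lra.
Qed.

(** This is [- PI^2 / sin(PI z)^2], written in q. *)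
Definition kern (z : C) : C := (4 * PI ^ 2 * (qq z / (1 - qq z) ^ 2))%C.

Lemma one_minus_qq z : inH z -> (1 - qq z)%C <> 0%C.
Proof.
  intros Hz E. assert (H := qq_lt1 z Hz). assert (E1 : qq z = 1%C).
  { transitivity (1 - (1 - qq z))%C; [ring|]. rewrite E; ring. }
  rewrite E1, Cmod_1 in H. lra.
Qed.

(** With [x = q(z/2)] the two halves correspond to [x] and [- x], and the identity is rational in
    [x]. *)
Lemma kern_double z : inH z -> (kern (z / 2) + kern ((z + 1) / 2) = 4 * kern z)%C.
Proof.
  intros Hz. unfold kern. set (x := qq (z / 2)%C).
  assert (E1 : qq z = (x * x)%C).
  { unfold x, qq. rewrite <- Cexp_add. f_equal. field. }
  assert (E2 : qq ((z + 1) / 2)%C = (- x)%C).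
  { unfold x, qq. replace (2 * PI * Ci * ((z + 1) / 2))%C with (2 * PI * Ci * (z / 2) + PI * Ci)%C by field.
    rewrite Cexp_add. replace (PI * Ci)%C with ((0, PI) : C) by (apply Ceq; simpl; ring).
    unfold Cexp at 2; simpl. rewrite exp_0, cos_PI, sin_PI. 
    replace (1 * -1, 1 * 0) with (- (1))%C by (apply Ceq; simpl; ring). ring. }
  assert (N := one_minus_qq z Hz). rewrite E1 in *. rewrite E2.
  assert (N1 : (1 - x)%C <> 0%C). { intro A. apply N. replace (1 - x * x)%C with ((1 - x) * (1 + x))%C by ring. rewrite A; ring. }
  assert (N2 : (1 + x)%C <> 0%C). { intro A. apply N. replace (1 - x * x)%C with ((1 - x) * (1 + x))%C by ring. rewrite A; ring. }
  replace (1 - - x)%C with (1 + x)%C by ring.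
  field. repeat split; auto.
Qed.

Lemma kern_period z : kern (z + 1)%C = kern z.
Proof. unfold kern. rewrite qq_period; auto. Qed.

Lemma sin_half_bound b : 0 <= b <= PI / 2 -> b / 2 <= sin b.
Proof.
  intros Hb. assert (HP := PI_bounds).
  destruct (Rle_dec b (PI / 3)) as [H|H].
  - assert (G : b / 2 - sin b <= 0 / 2 - sin 0).
    { apply (nonincr_of_deriv (fun t => t / 2 - sin t) (fun t => / 2 - cos t)); [lra| |].
      intros; auto_derive; auto; field.
      intros t Ht. assert (cos (PI / 3) <= cos t).
      { destruct (Rle_lt_or_eq_dec t (PI/3)) as [L|L]; [lra| |rewrite L; lra].
        left; apply cos_decreasing_1; lra. }
      rewrite cos_PI3 in H0. lra. }
    rewrite sin_0 in G. lra.
  - assert (sin (PI / 3) <= sin b) by (left; apply sin_increasing_1; lra).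
    rewrite sin_PI3 in H0. assert (1.6 <= sqrt 3).
    { rewrite <- (sqrt_pow2 1.6) by lra. apply sqrt_le_1; lra. }
    lra.
Qed.

Lemma sinh_half_bound a : Rabs a / 2 <= Rabs ((exp a - exp (- a)) / 2).
Proof.
  assert (P : forall a, 0 <= a -> a / 2 <= (exp a - exp (- a)) / 2).
  { intros x Hx. assert (1 + x <= exp x) by (destruct (Req_dec x 0); [subst; rewrite exp_0; lra|left; apply exp_ineq1; auto]).
    assert (exp (- x) <= 1) by (rewrite <- exp_0; apply exp_le; lra). lra. }
  destruct (Rle_dec 0 a) as [H|H].
  - specialize (P a H). rewrite !Rabs_pos_eq; lra.
  - specialize (P (- a) ltac:(lra)). rewrite Ropp_involutive in P.
    rewrite (Rabs_left a), (Rabs_left1 (_ / _)); lra.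
Qed.

(** Rests on |sinh(a + i b)|^2 = sinh(a)^2 + sin(b)^2, each part being bounded below by its linear
    term. *)
Lemma Csh_lower u : Rabs (Im u) <= PI / 2 -> Cmod u / 2 <= Cmod ((Cexp u - Cexp (- u)) / 2)%C.
Proof.
  intros Hu.
  assert (E : (Cmod ((Cexp u - Cexp (- u)) / 2)%C) ^ 2 = ((exp (Re u) - exp (- Re u)) / 2) ^ 2 + (sin (Im u)) ^ 2).
  { rewrite Cmod2_alt. destruct u as [a b]; unfold Cexp; simpl. rewrite cos_neg, sin_neg.
    assert (S : sin b ^ 2 + cos b ^ 2 = 1).
    { generalize (sin2_cos2 b). unfold Rsqr. lra. }
    assert (X : exp a * exp (- a) = 1) by (rewrite <- exp_plus, Rplus_opp_r, exp_0; auto).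
    assert (C1 : cos b ^ 2 = 1 - sin b ^ 2) by lra.
    field_simplify. replace (cos b ^ 2) with (1 - sin b ^ 2).
    replace (exp (-a)) with (/ exp a) by (rewrite exp_Ropp; auto). field. apply Rgt_not_eq, exp_pos. }
  assert (B1 := sinh_half_bound (Re u)).
  assert (B2 : Rabs (Im u) / 2 <= Rabs (sin (Im u))).
  { destruct (Rle_dec 0 (Im u)) as [H|H].
    - rewrite Rabs_pos_eq in Hu |- * by auto. eapply Rle_trans; [apply sin_half_bound|apply Rle_abs]. lra.
    - rewrite Rabs_left in Hu |- * by lra. rewrite <- Rabs_Ropp, <- sin_neg.
      eapply Rle_trans; [apply sin_half_bound|apply Rle_abs]. lra. }
  apply Rsqr_incr_0_var; [|apply Cmod_ge_0]. unfold Rsqr.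
  replace (Cmod u / 2 * (Cmod u / 2)) with (Cmod u ^ 2 / 4) by field.
  replace (Cmod ((Cexp u - Cexp (- u)) / 2)%C * Cmod ((Cexp u - Cexp (- u)) / 2)%C) with
    (Cmod ((Cexp u - Cexp (- u)) / 2)%C ^ 2) by ring.
  rewrite E, Cmod2_alt.
  assert (Q : forall x y, Rabs x / 2 <= Rabs y -> x ^ 2 / 4 <= y ^ 2).
  { intros x y H. rewrite <- (pow2_abs x), <- (pow2_abs y).
    replace (Rabs x ^ 2 / 4) with ((Rabs x / 2) ^ 2) by field. apply pow_incr.
    split; auto. generalize (Rabs_pos x); lra. }
  assert (Q1 := Q _ _ B1). assert (Q2 := Q _ _ B2). lra.
Qed.

Lemma LS2_near z : inH z -> Rabs (Re z) <= / 2 -> Cmod (LS 2 z - / z ^ 2)%C <= 16.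
Proof.
  intros Hz Hx. unfold LS. replace (/ z ^ 2 + CS (lterm 2 z) - / z ^ 2)%C with (CS (lterm 2 z)) by ring.
  apply Rle_trans with (Series (fun n => 8 * / INR (S n) ^ 2)).
  - apply Cmod_CS_le; [|apply ex_series_scalR, ex_series_inv2].
    assert (B : forall (n : nat) (d : R), Rabs d = INR (S n) -> Cmod (/ (z + d) ^ 2)%C <= 4 * / INR (S n) ^ 2).
    { intros n d Hd. rewrite <- Cpow_inv by (apply inH_shift_neq0; auto).
      assert (H1 : 1 <= INR (S n)) by (apply (le_INR 1); lia).
      assert (H2 : INR (S n) / 2 <= Cmod (z + d)%C).
      { eapply Rle_trans; [|apply re_le_Cmod]. replace (Re (z + d)%C) with (d - - Re z) by (destruct z; simpl; ring).
        eapply Rle_trans; [|apply Rabs_triang_inv]. rewrite Rabs_Ropp, Hd. lra. }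
      rewrite Cmod_pow, Cmod_inv by (apply inH_shift_neq0; auto).
      apply Rle_trans with ((/ (INR (S n) / 2)) ^ 2).
      - apply pow_incr. split. left; apply Rinv_0_lt_compat; lra. apply Rinv_le_contravar; lra.
      - right. field. lra. }
    intros n. unfold lterm. eapply Rle_trans; [apply Cmod_triangle|].
    rewrite RtoC_neg_shift. assert (Pn := pos_INR (S n)).
    assert (B1 := B n (INR (S n)) (Rabs_pos_eq _ Pn)).
    assert (B2 := B n (- INR (S n)) ltac:(rewrite Rabs_Ropp; apply Rabs_pos_eq, Pn)).
    lra.
  - rewrite Series_scal_l. generalize Series_inv2_le. lra.
Qed.

Lemma kern_sinh z : inH z ->
  kern z = (PI ^ 2 / ((Cexp (PI * Ci * z) - Cexp (- (PI * Ci * z))) / 2) ^ 2)%C.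
Proof.
  intros Hz. unfold kern. rewrite Cexp_opp. set (E := Cexp (PI * Ci * z)%C).
  assert (NE : E <> 0%C) by apply Cexp_neq0.
  assert (E1 : qq z = (E * E)%C).
  { unfold E, qq. rewrite <- Cexp_add. f_equal. ring. }
  assert (N := one_minus_qq z Hz). rewrite E1 in *.
  assert (N2 : (E * E - 1)%C <> 0%C).
  { intro A. apply N. replace (1 - E * E)%C with (- (E * E - 1))%C by ring. rewrite A; ring. }
  replace (E - / E)%C with ((E * E - 1) / E)%C by (field; auto).
  field. repeat split; auto.
Qed.

Lemma sinh_sub_bound u : Cmod u <= 4 ->
  Cmod ((Cexp u - Cexp (- u)) / 2 - u)%C <= Cmod u ^ 3 * exp 4.
Proof.
  intros Hu.
  replace ((Cexp u - Cexp (- u)) / 2 - u)%C with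
    (/ 2 * ((Cexp u - Eser 3 u) - (Cexp (- u) - Eser 3 (- u))))%C.
  2:{ unfold Eser, Csum. assert (E2 : INR (fact 2) = 2) by (simpl; ring).
      assert (E1 : INR (fact 1) = 1) by (simpl; ring).
      assert (E0 : INR (fact 0) = 1) by (simpl; ring).
      rewrite E0, E1, E2. simpl Cpow. field. }
  rewrite Cmod_mult. replace (Cmod (/ 2)%C) with (/ 2).
  2:{ rewrite <- RtoC_inv by lra. rewrite Cmod_R, Rabs_pos_eq; lra. }
  assert (T1 := Cexp_taylor u 3). assert (T2 := Cexp_taylor (- u)%C 3). rewrite Cmod_opp in T2.
  eapply Rle_trans; [apply Rmult_le_compat_l; [lra|apply Cmod_tri_minus]|].
  assert (X : Cmod u ^ 3 / INR (fact 3) * exp (Cmod u) <= Cmod u ^ 3 * exp 4).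
  { apply Rmult_le_compat. apply Rdiv_le_0_compat. apply pow_le, Cmod_ge_0. apply lt_0_INR, lt_O_fact.
    left; apply exp_pos. simpl fact. simpl INR. assert (0 <= Cmod u ^ 3) by (apply pow_le, Cmod_ge_0). lra.
    apply exp_le; auto. }
  lra.
Qed.

(** With [u = PI i z] and [s = sinh u] the sum is [PI^2 (u - s)(u + s) / (s u)^2]. Its numerator is
    O(u^4), so the double poles at 0 cancel. *)
Lemma kern_near z : inH z -> Rabs (Re z) <= / 2 -> Im z <= 1 ->
  Cmod (kern z + / z ^ 2)%C <= 4 * PI ^ 2 * exp 4 * (2 + 16 * exp 4).
Proof.
  intros Hz Hx Hy. rewrite kern_sinh by auto. assert (HP := PI_bounds).
  set (u := (PI * Ci * z)%C). set (s := ((Cexp u - Cexp (- u)) / 2)%C).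
  assert (Nz : z <> 0%C) by (apply inH_neq0; auto).
  assert (NP : RtoC PI <> 0%C) by (apply RtoC_neq0; lra).
  assert (Nu : u <> 0%C).
  { unfold u. repeat apply Cmult_neq_0; auto. apply Ci_nz. }
  assert (Mu : Cmod u = PI * Cmod z).
  { unfold u. rewrite !Cmod_mult, Cmod_R, Cmod_Ci, Rabs_pos_eq; lra. }
  assert (Mz : Cmod z <= 1.2).
  { apply Rsqr_incr_0_var; [|lra]. unfold Rsqr. replace (Cmod z * Cmod z) with (Cmod z ^ 2) by ring.
    rewrite Cmod2_alt. unfold inH in Hz.
    assert (Re z ^ 2 <= (/2) ^ 2) by (rewrite <- (pow2_abs (Re z)); apply pow_incr; split; [apply Rabs_pos|auto]).
    assert (Im z ^ 2 <= 1 ^ 2) by (apply pow_incr; lra). lra. }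
  assert (Mu4 : Cmod u <= 4).
  { rewrite Mu. apply Rle_trans with (3.15 * 1.2); [|lra]. apply Rmult_le_compat; try lra. apply Cmod_ge_0. }
  assert (Ls : Cmod u / 2 <= Cmod s).
  { apply Csh_lower. unfold u. replace (Im (PI * Ci * z)%C) with (PI * Re z).
    2:{ destruct z; simpl; ring. }
    rewrite Rabs_mult, (Rabs_pos_eq PI) by lra.
    apply Rle_trans with (PI * / 2); [apply Rmult_le_compat_l; lra|lra]. }
  assert (Us : Cmod (s - u)%C <= Cmod u ^ 3 * exp 4) by (apply sinh_sub_bound; auto).
  assert (Pu : 0 < Cmod u) by (apply Cmod_pos; auto).
  assert (Ns : s <> 0%C) by (apply Cmod_neq0; lra).
  replace (PI ^ 2 / s ^ 2 + / z ^ 2)%C with (PI ^ 2 * ((u - s) * (u + s)) / (s ^ 2 * u ^ 2))%C.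
  2:{ replace (/ z ^ 2)%C with (- PI ^ 2 / u ^ 2)%C. field; auto.
      unfold u. replace (- PI ^ 2 / (PI * Ci * z) ^ 2)%C with (/ (- (Ci * Ci) * z ^ 2))%C.
      replace (- (Ci * Ci))%C with (RtoC 1) by (apply Ceq; simpl; ring). f_equal; ring.
      assert (NN := Ci_nz). field. auto. }
  rewrite Cmod_div by (apply Cmult_neq_0; apply Cpow_nz; auto).
  rewrite !Cmod_mult, !Cmod_pow, Cmod_R, (Rabs_pos_eq PI) by lra.
  assert (E4 : 1 < exp 4) by (rewrite <- exp_0; apply exp_increasing; lra).
  assert (Up : Cmod (u + s)%C <= Cmod u * (2 + 16 * exp 4)).
  { replace (u + s)%C with (2 * u + (s - u))%C by ring. eapply Rle_trans; [apply Cmod_triangle|].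
    rewrite Cmod_mult, Cmod_R, Rabs_pos_eq by lra.
    assert (Cmod u ^ 3 * exp 4 <= Cmod u * 16 * exp 4).
    { apply Rmult_le_compat_r; [lra|]. simpl. apply Rmult_le_compat_l; [lra|]. rewrite Rmult_1_r.
      replace 16 with (4 * 4) by ring. apply Rmult_le_compat; lra. }
    lra. }
  rewrite (Cmod_sub_comm u s).
  assert (Ps : Cmod u ^ 2 / 4 <= Cmod s ^ 2).
  { replace (Cmod u ^ 2 / 4) with ((Cmod u / 2) ^ 2) by field. apply pow_incr; lra. }
  assert (Pu2 : 0 < Cmod u ^ 2) by (apply pow_lt; auto).
  apply Rle_trans with ((PI ^ 2 * ((Cmod u ^ 3 * exp 4) * (Cmod u * (2 + 16 * exp 4)))) / (Cmod u ^ 2 / 4 * Cmod u ^ 2)).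
  - unfold Rdiv. apply Rmult_le_compat.
    + apply Rmult_le_pos. apply pow2_ge_0. apply Rmult_le_pos; apply Cmod_ge_0.
    + left; apply Rinv_0_lt_compat, Rmult_lt_0_compat; lra.
    + apply Rmult_le_compat_l. apply pow2_ge_0. apply Rmult_le_compat; auto; apply Cmod_ge_0.
    + apply Rinv_le_contravar. apply Rmult_lt_0_compat; lra. apply Rmult_le_compat_r; lra.
  - right. field. lra.
Qed.

Lemma kern_high z : 1 <= Im z -> Cmod (kern z) <= 8 * PI ^ 2.
Proof.
  intros Hz. assert (HP := PI_bounds). unfold kern.
  assert (Hq : Cmod (qq z) <= / 2).
  { eapply Rle_trans; [apply (Cmod_qq_le 1); auto|].
    replace (-2 * PI * 1) with (- (2 * PI)) by ring. rewrite exp_Ropp.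
    apply Rinv_le_contravar; [lra|]. assert (1 + 2 * PI < exp (2 * PI)) by (apply exp_ineq1; lra). lra. }
  assert (Hi : inH z) by (unfold inH; lra).
  assert (H1 : / 2 <= Cmod (1 - qq z)%C).
  { generalize (Cmod_ge_minus 1%C (qq z)). rewrite Cmod_1. lra. }
  rewrite !Cmod_mult, Cmod_div, !Cmod_pow, !Cmod_R, !Rabs_pos_eq by (try apply Cpow_nz, one_minus_qq; auto; lra).
  assert (H2 : (/2) ^ 2 <= Cmod (1 - qq z)%C ^ 2) by (apply pow_incr; lra).
  assert (H3 : Cmod (qq z) / Cmod (1 - qq z)%C ^ 2 <= 2).
  { apply Rle_trans with (/ 2 / (/ 2) ^ 2). unfold Rdiv. apply Rmult_le_compat; auto. apply Cmod_ge_0.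
    left; apply Rinv_0_lt_compat; lra. apply Rinv_le_contravar; lra. right; field. }
  assert (0 <= PI ^ 2) by apply pow2_ge_0.
  replace (8 * PI ^ 2) with (4 * PI ^ 2 * 2) by ring. apply Rmult_le_compat_l; lra.
Qed.

Lemma periodic_int (h : C -> C) : (forall z, inH z -> h (z + 1)%C = h z) ->
  forall z, inH z -> exists z', h z = h z' /\ Rabs (Re z') <= / 2 /\ Im z' = Im z.
Proof.
  intros H z Hz.
  assert (HN : forall (n : nat) z, inH z -> h (z + INR n)%C = h z).
  { induction n; intros w Hw. simpl. rewrite Cplus_0_r; auto.
    rewrite S_INR, RtoC_plus, Cplus_assoc. rewrite H. auto. apply inH_shift; auto. }
  assert (HZ : forall (k : Z) z, inH z -> h (z + IZR k)%C = h z).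
  { intros k w Hw. destruct (Z_le_dec 0 k) as [Hk|Hk].
    - rewrite <- (Z2Nat.id k Hk), <- INR_IZR_INZ. auto.
    - rewrite <- (HN (Z.to_nat (- k)) (w + IZR k)%C) by (apply inH_shift; auto).
      f_equal. rewrite INR_IZR_INZ, Z2Nat.id by lia. rewrite opp_IZR, RtoC_opp. ring. }
  set (k := (up (Re z - / 2))%Z). destruct (archimed (Re z - / 2)) as [A1 A2]. fold k in A1, A2.
  exists (z + IZR (- k))%C. split; [|split].
  - rewrite HZ; auto.
  - replace (Re (z + IZR (- k))%C) with (Re z - IZR k).
    apply Rabs_le. lra. rewrite opp_IZR. destruct z; simpl; ring.
  - destruct z; simpl; ring.
Qed.

(* Herglotz trick: the difference is bounded and satisfies h(z/2) + h((z+1)/2) = 4 h(z). *)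
Lemma lipschitz2 z : inH z -> LS 2 z = (- kern z)%C.
Proof.
  set (h := fun z => (LS 2 z + kern z)%C).
  assert (HP := PI_bounds). assert (E4 : 0 < exp 4) by apply exp_pos.
  assert (HB : exists B, 0 <= B /\ forall z, inH z -> Cmod (h z) <= B).
  { set (B1 := 4 * PI ^ 2 * exp 4 * (2 + 16 * exp 4)). set (B2 := 8 * PI ^ 2).
    assert (P2 : 0 <= PI ^ 2) by apply pow2_ge_0.
    assert (0 <= B1) by (unfold B1; apply Rmult_le_pos; [apply Rmult_le_pos|]; lra).
    exists (17 + B1 + B2). split; [unfold B2; lra|].
    intros w Hw. destruct (periodic_int h) with (z := w) as (w' & E & X & Y); auto.
    { intros v Hv. unfold h. rewrite kern_period, LS_period; auto. }
    rewrite E. assert (Hw' : inH w') by (unfold inH in *; rewrite Y; auto).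
    assert (L := LS2_near w' Hw' X).
    destruct (Rle_dec (Im w') 1) as [Hle|Hgt].
    - assert (K := kern_near w' Hw' X Hle). fold B1 in K. unfold h.
      replace (LS 2 w' + kern w')%C with ((LS 2 w' - / w' ^ 2) + (kern w' + / w' ^ 2))%C by ring.
      eapply Rle_trans; [apply Cmod_triangle|]. unfold B2; lra.
    - assert (K := kern_high w' ltac:(lra)). fold B2 in K. unfold h.
      replace (LS 2 w' + kern w')%C with ((LS 2 w' - / w' ^ 2) + / w' ^ 2 + kern w')%C by ring.
      eapply Rle_trans; [apply Cmod_tri3|].
      assert (Cmod (/ w' ^ 2)%C <= 1).
      { assert (1 <= Cmod w') by (generalize (Im_le_Cmod w'); lra).
        rewrite Cmod_inv, Cmod_pow by (apply Cpow_nz, inH_neq0; auto).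
        rewrite <- Rinv_1. apply Rinv_le_contravar; [lra|]. replace 1 with (1 ^ 2) by ring. apply pow_incr; lra. }
      lra. }
  destruct HB as (B & HB0 & HB).
  (* Each value is a quarter of the sum of two others, so the uniform bound is halved at every
     step. *)
  assert (HI : forall n z, inH z -> Cmod (h z) <= B * (/ 2) ^ n).
  { induction n; intros w Hw. simpl; specialize (HB w Hw); lra.
    assert (E : h w = (/ 4 * (h (w / 2) + h ((w + 1) / 2)))%C).
    { unfold h. assert (A1 := LS2_double w Hw). assert (A2 := kern_double w Hw).
      replace (LS 2 (w / 2) + kern (w / 2) + (LS 2 ((w + 1) / 2) + kern ((w + 1) / 2)))%C with
        (LS 2 (w / 2) + LS 2 ((w + 1) / 2) + (kern (w / 2) + kern ((w + 1) / 2)))%C by ring.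
      rewrite A1, A2. field. }
    rewrite E, Cmod_mult. replace (Cmod (/ 4)%C) with (/ 4).
    2:{ rewrite <- RtoC_inv by lra. rewrite Cmod_R, Rabs_pos_eq; lra. }
    assert (I1 := IHn (w / 2)%C). assert (I2 := IHn ((w + 1) / 2)%C).
    assert (inH (w / 2)%C). { unfold inH in *. destruct w as [x y]; simpl in *. lra. }
    assert (inH ((w + 1) / 2)%C). { unfold inH in *. destruct w as [x y]; simpl in *. lra. }
    specialize (I1 H). specialize (I2 H0).
    assert (T := Cmod_triangle (h (w / 2)%C) (h ((w + 1) / 2)%C)). simpl. lra. }
  intros Hz.
  assert (h z = 0%C).
  { apply Cmod_small. intros eps He.
    destruct (pow_lt_1_zero (/ 2) ltac:(rewrite Rabs_pos_eq; lra) (eps / (B + 1))) as (N & HN).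
    apply Rdiv_lt_0_compat; lra.
    specialize (HN N (Nat.le_refl _)). assert (Pp : 0 < (/ 2) ^ N) by (apply pow_lt; lra).
    rewrite Rabs_pos_eq in HN by lra.
    eapply Rle_trans; [apply (HI N z Hz)|].
    apply Rle_trans with ((B + 1) * (eps / (B + 1))). apply Rmult_le_compat; lra. right; field; lra. }
  unfold h in H. transitivity (LS 2 z + kern z - kern z)%C; [ring|]. rewrite H. ring.
Qed.

Lemma CS_geom (q : C) : Cmod q < 1 -> (CS (fun n => q ^ n) = / (1 - q))%C.
Proof.
  intros Hq.
  assert (S : summable (fun n => q ^ n)%C).
  { apply summable_ext with (fun n => 1 * q ^ n)%C. intros; ring.
    apply (qgood_summable_pt (fun _ => 1%C)); auto. apply qgood_one. }
  assert (E : (CS (fun n => q ^ n) = 1 + q * CS (fun n => q ^ n))%C).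
  { rewrite CS_incr_1 at 1 by auto. rewrite <- CS_scal by auto. f_equal. }
  assert (N : (1 - q)%C <> 0%C).
  { intro A. assert (q = 1%C). { transitivity (1 - (1 - q))%C; [ring|]. rewrite A; ring. }
    rewrite H, Cmod_1 in Hq. lra. }
  apply Ceq_minus. transitivity (((CS (fun n => q ^ n) - (1 + q * CS (fun n => q ^ n))) / (1 - q))%C).
  field; auto. rewrite <- E. unfold Cdiv. ring.
Qed.

Lemma qs_one z : inH z -> qs (fun _ => 1%C) z = (/ (1 - qq z))%C.
Proof.
  intros Hz. rewrite <- CS_geom by (apply qq_lt1; auto). apply CS_ext. intros; ring.
Qed.

Lemma qgood_id : qgood (fun n => INR n : C).
Proof. apply qgood_ext with (fun n => INR n * 1)%C. intros; ring. apply qgood_INR, qgood_one. Qed.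

Lemma qs_INR z : inH z -> qs (fun n => INR n : C) z = (qq z / (1 - qq z) ^ 2)%C.
Proof.
  intros Hz. rewrite (qs_shift _ 1); auto. 2: apply qgood_id.
  2:{ intros n Hn. replace n with 0%nat by lia. reflexivity. }
  rewrite (qs_ext _ (conv (fun _ => 1%C) (fun _ => 1%C))).
  - rewrite qs_mult by (auto; apply qgood_one). rewrite qs_one by auto.
    field. apply one_minus_qq; auto.
  - intros n. unfold conv. assert (E : forall N, Csum (fun _ => 1 * 1)%C N = INR N).
    { induction N. reflexivity. simpl Csum. rewrite IHN, S_INR, RtoC_plus. ring. }
    rewrite E. reflexivity.
Qed.

Lemma ginv_deriv (s : nat) (w : C) : w <> 0%C -> cderiv (fun w => / w ^ s)%C w (- INR s / w ^ (S s))%C.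
Proof.
  intros Hw. assert (Hp : forall n, (w ^ n)%C <> 0%C) by (intros; apply Cpow_nz; auto).
  eapply cderiv_eq; [|apply (cderiv_inv (fun w => w ^ s)%C); [auto|apply cderiv_pow, cderiv_id]].
  destruct s as [|s]. simpl. field. auto.
  replace (S s - 1)%nat with s by lia. rewrite !Cpow_S. field. split; auto.
Qed.

(** The mean value inequality, used twice on the segment from [w] to [w + h], where the modulus
    stays above [|w| / 2]. *)
Lemma ginv_quad (s : nat) (w h : C) : w <> 0%C -> Cmod h <= Cmod w / 2 ->
  Cmod (/ (w + h) ^ s - / w ^ s - - INR s / w ^ (S s) * h)%C <=
    INR s * INR (S s) * (2 / Cmod w) ^ (S (S s)) * Cmod h ^ 2.
Proof.
  intros Hw Hh. assert (Pw : 0 < Cmod w) by (apply Cmod_pos; auto).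
  assert (Seg : forall (x : C) (t : R), Cmod x <= Cmod h -> 0 <= t <= 1 -> Cmod w / 2 <= Cmod (w + (w + x - w) * t)%C).
  { intros x t Hx Ht. replace (w + (w + x - w) * t)%C with (w + x * t)%C by ring.
    eapply Rle_trans; [|apply Cmod_ge_minus_plus]. rewrite Cmod_mult, Cmod_R, Rabs_pos_eq by lra.
    assert (Cmod x * t <= Cmod x * 1) by (apply Rmult_le_compat_l; [apply Cmod_ge_0|lra]). lra. }
  assert (G2 : forall x : C, Cmod x <= Cmod h ->
    Cmod (- INR s / (w + x) ^ (S s) - - INR s / w ^ (S s))%C <= INR s * INR (S s) * (2 / Cmod w) ^ (S (S s)) * Cmod x).
  { intros x Hx. replace x with (w + x - w)%C at 2 by ring.
    apply (C_mean_value (fun v => - INR s / v ^ (S s))%C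
      (fun t => - INR s * (- INR (S s) / (w + (w + x - w) * t) ^ (S (S s))))%C).
    - intros t Ht. apply cderiv_scal, ginv_deriv. apply Cmod_neq0. generalize (Seg x t Hx Ht); lra.
    - intros t Ht. assert (Q := Seg x t Hx Ht).
      assert (Nv : (w + (w + x - w) * t)%C <> 0%C) by (apply Cmod_neq0; lra).
      unfold Cdiv. rewrite !Cmod_mult, !Cmod_opp, !Cmod_R, !(Rabs_pos_eq (INR _)) by apply pos_INR.
      rewrite Cmod_inv by (apply Cpow_nz; auto). rewrite Cmod_pow, Rmult_assoc.
      apply Rmult_le_compat_l; [apply pos_INR|]. apply Rmult_le_compat_l; [apply pos_INR|].
      rewrite <- pow_inv. apply pow_incr. split. left; apply Rinv_0_lt_compat; lra.
      unfold Rdiv. replace (2 * / Cmod w) with (/ (Cmod w / 2)) by (field; lra).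
      apply Rinv_le_contravar; lra. }
  set (M := INR s * INR (S s) * (2 / Cmod w) ^ (S (S s))) in *.
  assert (HM : 0 <= M).
  { unfold M. apply Rmult_le_pos. apply Rmult_le_pos; apply pos_INR. apply pow_le, Rlt_le, Rdiv_lt_0_compat; lra. }
  replace (/ (w + h) ^ s - / w ^ s - - INR s / w ^ (S s) * h)%C with
   ((/ (w + h) ^ s - - INR s / w ^ (S s) * (w + h)) - (/ w ^ s - - INR s / w ^ (S s) * w))%C by ring.
  replace (M * Cmod h ^ 2) with (M * Cmod h * Cmod (w + h - w)%C).
  2:{ replace (w + h - w)%C with h by ring. ring. }
  apply (C_mean_value (fun v => / v ^ s - - INR s / w ^ (S s) * v)%C
    (fun t => - INR s / (w + (w + h - w) * t) ^ (S s) - - INR s / w ^ (S s))%C).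
  - intros t Ht. apply cderiv_minus. apply ginv_deriv, Cmod_neq0. generalize (Seg h t (Rle_refl _) Ht); lra.
    eapply cderiv_eq; [|apply cderiv_scal, cderiv_id]. ring.
  - intros t Ht. replace (w + (w + h - w) * t)%C with (w + h * t)%C by ring.
    assert (Q : Cmod (h * t)%C <= Cmod h).
    { rewrite Cmod_mult, Cmod_R, Rabs_pos_eq by lra. rewrite <- (Rmult_1_r (Cmod h)) at 2.
      apply Rmult_le_compat_l; [apply Cmod_ge_0|lra]. }
    eapply Rle_trans; [apply G2; auto|]. apply Rmult_le_compat_l; auto.
Qed.

Lemma lterm_quad z s : inH z -> (1 <= s)%nat -> exists K, 0 <= K /\ forall n h, Cmod h < Im z / 2 ->
  Cmod (lterm s (z + h) n - lterm s z n - - INR s * lterm (S s) z n * h)%C <= K * / INR (S n) ^ 2 * Cmod h ^ 2.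
Proof.
  intros Hz Hs. destruct (inv_shift_bound z Hz) as (K & HK & H).
  set (A := INR s * INR (S s)). assert (HA : 0 <= A) by (apply Rmult_le_pos; apply pos_INR).
  exists (2 * (A * (2 * K) ^ S (S s))). split.
  { apply Rmult_le_pos; [lra|]. apply Rmult_le_pos; auto. apply pow_le; lra. }
  assert (B : forall (n : nat) (d : R) h, Rabs d = INR (S n) -> Cmod h < Im z / 2 ->
    Cmod (/ (z + d + h) ^ s - / (z + d) ^ s - - INR s / (z + d) ^ (S s) * h)%C <=
      (A * (2 * K) ^ S (S s)) * / INR (S n) ^ 2 * Cmod h ^ 2).
  { intros n d h Hd Hh.
    assert (Nz : (z + d)%C <> 0%C) by (apply inH_shift_neq0; auto).
    assert (Pz : 0 < Cmod (z + d)%C) by (apply Cmod_pos; auto).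
    assert (Hd1 : 1 <= INR (S n)) by (apply (le_INR 1); lia).
    eapply Rle_trans; [apply ginv_quad; auto|].
    { assert (Im z <= Cmod (z + d)%C); [|lra].
      replace (Im z) with (Im (z + d)%C) by (destruct z; simpl; ring). apply Im_le_Cmod. }
    apply Rmult_le_compat_r; [apply pow2_ge_0|]. fold A. rewrite Rmult_assoc.
    apply Rmult_le_compat_l; auto.
    assert (I := H d). rewrite Cmod_inv in I by auto.
    apply Rle_trans with ((2 * K * / (1 + INR (S n))) ^ S (S s)).
    - apply pow_incr. split. left; apply Rdiv_lt_0_compat; lra.
      unfold Rdiv. rewrite Rmult_assoc. apply Rmult_le_compat_l; [lra|]. rewrite <- Hd. exact I.
    - rewrite Rpow_mult_distr. apply Rmult_le_compat_l. apply pow_le; lra.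
      rewrite pow_inv. apply Rinv_le_contravar. apply pow_lt; lra.
      apply Rle_trans with ((1 + INR (S n)) ^ 2). apply pow_incr; lra. apply Rle_pow; [lra|lia]. }
  intros n h Hh. unfold lterm.
  assert (Pn := pos_INR (S n)).
  assert (B1 := B n (INR (S n)) h (Rabs_pos_eq _ Pn) Hh).
  assert (B2 := B n (- INR (S n)) h ltac:(rewrite Rabs_Ropp; apply Rabs_pos_eq, Pn) Hh).
  rewrite RtoC_opp in B2.
  match type of B1 with Cmod ?X <= _ => match type of B2 with Cmod ?Y <= _ =>
    match goal with |- Cmod ?G <= _ => replace G with (X + Y)%C end end end.
  - eapply Rle_trans; [apply Cmod_triangle|]. lra.
  - replace (z + h + INR (S n))%C with (z + INR (S n) + h)%C by ring.
    replace (z + h - INR (S n))%C with (z + - INR (S n) + h)%C by ring.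
    replace (z - INR (S n))%C with (z + - INR (S n))%C by ring.
    unfold Cdiv. ring.
Qed.

Lemma inH_half z h : inH z -> Cmod h < Im z / 2 -> inH (z + h)%C.
Proof. intros Hz Hh. apply inH_near; auto. unfold inH in Hz. lra. Qed.

Lemma LS_deriv z s : inH z -> (2 <= s)%nat -> cderiv (LS s) z (- INR s * LS (S s) z)%C.
Proof.
  intros Hz Hs. unfold LS.
  destruct (lterm_quad z s Hz ltac:(lia)) as (K & HK & H).
  eapply cderiv_eq; [|apply cderiv_plus].
  2: apply ginv_deriv, inH_neq0; auto.
  2: apply (CS_deriv (fun n w => lterm s w n) (fun n => - INR s * lterm (S s) z n)%C z (Im z / 2)
     (fun n => K * / INR (S n) ^ 2)).
  - rewrite CS_scal by (apply lterm_summable; auto; lia). unfold Cdiv; ring.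
  - unfold inH in Hz; lra.
  - apply H.
  - apply ex_series_scalR, ex_series_inv2.
  - intros h Hh. apply lterm_summable; auto. apply inH_half; auto.
  - apply summable_scal, lterm_summable; auto.
Qed.

(** The Lipschitz constant for the exponent [s + 2]; the shift leaves out the exponents without
    absolute convergence. *)
Definition beta (s : nat) : C := ((- (2 * PI * Ci)) ^ (S (S s)) / INR (fact (S s)))%C.

(** Both sides of the formula for exponent 2 are differentiated repeatedly; derivatives are
    unique. *)
Lemma lipschitz s z : inH z -> LS (S (S s)) z = (beta s * qs (fun n => INR n ^ S s) z)%C.
Proof.
  revert z; induction s; intros z Hz.
  - rewrite lipschitz2 by auto. unfold kern. rewrite <- qs_INR by auto.
    rewrite (qs_ext (fun n => INR n ^ 1)%C (fun n => INR n : C)) by (intros; ring).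
    unfold beta. simpl fact. simpl INR. 
    replace ((- (2 * PI * Ci)) ^ 2)%C with ((Ci * Ci) * (4 * PI ^ 2))%C by ring.
    replace (Ci * Ci)%C with (-(1))%C by (apply Ceq; simpl; ring). field.
  - assert (D1 := LS_deriv z (S (S s)) Hz ltac:(lia)).
    assert (G : qgood (fun n => INR n ^ S s)%C) by apply qgood_pow.
    assert (D2 := cderiv_scal (beta s) _ _ _ (qs_deriv _ z G Hz)).
    assert (D3 := cderiv_ext_H _ _ z _ Hz (fun w Hw => eq_sym (IHs w Hw)) D2).
    assert (E := cderiv_unique _ _ _ _ D1 D3).
    assert (E2 : qs (dq (fun n => INR n ^ S s)%C) z = (2 * PI * Ci * qs (fun n => INR n ^ S (S s)) z)%C).
    { unfold dq. rewrite <- qs_scal; auto. apply qgood_pow. }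
    rewrite E2 in E.
    assert (NI : RtoC (INR (S (S s))) <> 0%C) by (apply RtoC_neq0, not_0_INR; lia).
    assert (NF : RtoC (INR (fact (S s))) <> 0%C) by (apply RtoC_neq0, INR_fact_neq_0).
    transitivity ((- INR (S (S s)) * LS (S (S (S s))) z) / (- INR (S (S s))))%C.
    { field; auto. }
    rewrite E. unfold beta. rewrite (Cpow_S _ (S (S s))). rewrite (fact_simpl (S s)), mult_INR, RtoC_mult.
    field. auto.
Qed.

(** * Eisenstein series of weight 2 *)

Lemma inH_S z : inH z -> inH (- / z)%C.
Proof.
  unfold inH. intros Hz. destruct z as [x y]; simpl in *.
  assert (0 < x * (x * 1) + y * (y * 1)) by nra.
  replace (- (- y / (x * (x * 1) + y * (y * 1)))) with (y / (x * (x * 1) + y * (y * 1))) by (field; lra).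
  apply Rdiv_lt_0_compat; lra.
Qed.

Lemma inH_scal r z : 0 < r -> inH z -> inH (RtoC r * z)%C.
Proof. unfold inH. intros Hr Hz. destruct z; simpl in *. nra. Qed.

(* [divc n N] is the coefficient of [q^N] in [sum_d d q^{(n+1)d}]. *)
Definition divc (n N : nat) : R := if Nat.eqb (N mod S n) 0 then INR (N / S n) else 0.

(** The divisor sum sigma_1(N), kept as a sum of Lambert coefficients. *)
Definition sig (N : nat) : C := Csum (fun n => RtoC (divc n N)) N.

Lemma divc_zero n N : (N < S n)%nat -> divc n N = 0.
Proof.
  intros H. unfold divc. rewrite Nat.mod_small by auto.
  destruct N; simpl; auto. all: try (rewrite Nat.sub_diag; auto).
Qed.

Lemma divc_bound n N : 0 <= divc n N <= INR N.
Proof.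
  unfold divc. destruct (Nat.eqb _ _); split; try apply pos_INR; try lra.
  apply le_INR. apply Nat.Div0.div_le_upper_bound. simpl. lia.
Qed.

Lemma Csum_add a p r : Csum a (p + r) = (Csum a p + Csum (fun i => a (p + i)%nat) r)%C.
Proof.
  induction r. rewrite Nat.add_0_r; simpl; ring.
  rewrite Nat.add_succ_r. simpl. rewrite IHr. ring.
Qed.

Lemma Csum_minus a b N : Csum (fun n => a n - b n)%C N = (Csum a N - Csum b N)%C.
Proof. induction N; simpl; [ring|]. rewrite IHN; ring. Qed.

(** Each block of [n + 1] consecutive indices contains one multiple of [n + 1], its first
    element. *)
Lemma divc_partial n (x : C) D :
  Csum (fun N => divc n N * x ^ N)%C (S n * D) = Csum (fun d => INR d * (x ^ S n) ^ d)%C D.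
Proof.
  induction D. rewrite Nat.mul_0_r; auto.
  rewrite Nat.mul_succ_r, Csum_add, IHD. change (Csum (fun d => INR d * (x ^ S n) ^ d)%C (S D)) with
   (Csum (fun d => INR d * (x ^ S n) ^ d) D + INR D * (x ^ S n) ^ D)%C. f_equal.
  rewrite Csum_S. rewrite (Csum_ext _ (fun _ => 0 * 0)%C).
  - rewrite Csum_scal, Nat.add_0_r. unfold divc.
    rewrite Nat.mul_comm, Nat.Div0.mod_mul, Nat.div_mul by lia. simpl Nat.eqb. cbv iota.
    rewrite Nat.mul_comm, Cpow_mult_r, Cmult_0_l, Cplus_0_r. reflexivity.
  - intros i Hi. unfold divc.
    assert (E : ((S n * D + S i) mod S n = S i)%nat).
    { rewrite Nat.add_comm, Nat.mul_comm, Nat.Div0.mod_add. apply Nat.mod_small; lia. }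
    rewrite E. simpl Nat.eqb. cbv iota. rewrite !Cmult_0_l. reflexivity.
Qed.

Lemma qgood_divc n : qgood (fun N => RtoC (divc n N)).
Proof.
  apply qgood_le with (fun N => INR N : C); [|apply qgood_id].
  intros N. destruct (divc_bound n N). rewrite !Cmod_R, !Rabs_pos_eq; auto. apply pos_INR.
Qed.

Lemma qq_mul n z : qq (INR n * z)%C = (qq z ^ n)%C.
Proof. unfold qq. rewrite Cexp_pow. f_equal. ring. Qed.

Lemma qs_divc n z : inH z -> qs (fun N => RtoC (divc n N)) z = qs (fun N => INR N : C) (INR (S n) * z)%C.
Proof.
  intros Hz.
  assert (Hn : inH (INR (S n) * z)%C) by (apply inH_scal; auto; apply lt_0_INR; lia).
  apply Clim_unique with (fun D => Csum (fun N => divc n N * qq z ^ N)%C (S n * D)).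
  - apply (Clim_subseq (Csum (fun N => divc n N * qq z ^ N)%C) _ (fun D => S n * D)%nat).
    intros; nia. apply CS_lim, qgood_summable; auto. apply qgood_divc.
  - eapply Clim_ext; [intros D; symmetry; apply divc_partial|].
    rewrite <- qq_mul. apply CS_lim. apply (qgood_summable _ (INR (S n) * z)%C); auto. apply qgood_id.
Qed.

Lemma Csum_divc_sig M N : (N <= M)%nat -> Csum (fun n => RtoC (divc n N)) M = sig N.
Proof.
  intros H. unfold sig. replace M with (N + (M - N))%nat by lia. rewrite Csum_add.
  rewrite (Csum_ext (fun i => RtoC (divc (N + i) N)) (fun _ => 0 * 0)%C).
  - rewrite Csum_scal, Cmult_0_l, Cplus_0_r. reflexivity.
  - intros i Hi. rewrite divc_zero by lia. ring.
Qed.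

Lemma Csum_divc_bound M N : Cmod (Csum (fun n => RtoC (divc n N)) M) <= INR N * INR N.
Proof.
  assert (H : forall K, Cmod (Csum (fun n => RtoC (divc n N)) K) <= INR K * INR N).
  { induction K. simpl. rewrite Cmod_0. lra.
    simpl Csum. eapply Rle_trans; [apply Cmod_triangle|]. rewrite Cmod_R, S_INR.
    destruct (divc_bound K N). rewrite Rabs_pos_eq; lra. }
  destruct (le_dec M N) as [L|L].
  - eapply Rle_trans; [apply H|]. apply Rmult_le_compat_r. apply pos_INR. apply le_INR; auto.
  - rewrite Csum_divc_sig by lia. unfold sig. apply H.
Qed.

Lemma sig_bound N : Cmod (sig N) <= INR N * INR N.
Proof. apply Csum_divc_bound. Qed.

Lemma sig_Im N : Im (sig N) = 0.
Proof.
  unfold sig. assert (H : forall K, Im (Csum (fun n => RtoC (divc n N)) K) = 0).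
  { induction K; simpl; auto. unfold Im in IHK. rewrite IHK. ring. }
  apply H.
Qed.

Lemma sig_0 : sig 0 = 0%C.
Proof. reflexivity. Qed.

Lemma sig_1 : sig 1 = 1%C.
Proof. unfold sig, divc; simpl. ring. Qed.

Lemma qgood_sig : qgood sig.
Proof.
  apply qgood_le with (fun n => INR n * INR n)%C; [|apply qgood_INR, qgood_id].
  intros n. rewrite <- RtoC_mult, Cmod_R, Rabs_pos_eq. apply sig_bound. apply Rmult_le_pos; apply pos_INR.
Qed.

(** By homogeneity this is [inv_shift_bound] at the shift [m / (n + 1)]. *)
Lemma lattice_bound z : inH z -> exists K, 0 < K /\
  forall (n : nat) (m : R), Cmod (/ (INR (S n) * z + m))%C <= K / (INR (S n) + Rabs m).
Proof.
  intros Hz. destruct (inv_shift_bound z Hz) as (K & HK & H). exists K; split; auto.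
  intros n m. assert (P : 0 < INR (S n)) by (apply lt_0_INR; lia).
  assert (NP : RtoC (INR (S n)) <> 0%C) by (apply RtoC_neq0; lra).
  specialize (H (m / INR (S n))).
  assert (Nz := inH_shift_neq0 z (m / INR (S n)) Hz).
  replace (INR (S n) * z + m)%C with (INR (S n) * (z + (m / INR (S n))%R))%C.
  2:{ rewrite RtoC_div by lra. field. auto. }
  rewrite Cmod_inv in * by (auto; apply Cmult_neq_0; auto).
  rewrite Cmod_mult, Cmod_R, Rabs_pos_eq by lra. rewrite Rinv_mult.
  replace (K / (INR (S n) + Rabs m)) with (/ INR (S n) * (K / (1 + Rabs (m / INR (S n))))).
  - apply Rmult_le_compat_l; auto. left; apply Rinv_0_lt_compat; auto.
  - unfold Rdiv. rewrite Rabs_mult, Rabs_inv, (Rabs_pos_eq (INR (S n))) by lra.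
    assert (0 <= Rabs m) by apply Rabs_pos. field. repeat split; lra.
Qed.

(** The rows with a positive multiple of [z] in Eisenstein's iterated sum. The negative multiples
    double it and the row of the integers adds twice [zeta2]. *)
Definition G2s (z : C) : C := CS (fun n => LS 2 (INR (S n) * z)%C).

Lemma LS2_qs w : inH w -> LS 2 w = (- (4 * PI ^ 2) * qs (fun N => INR N : C) w)%C.
Proof. intros. rewrite lipschitz2, qs_INR by auto. unfold kern. ring. Qed.

Lemma inH_mulS n z : inH z -> inH (INR (S n) * z)%C.
Proof. intros. apply inH_scal; auto. apply lt_0_INR; lia. Qed.

Lemma G2s_summable z : inH z -> summable (fun n => LS 2 (INR (S n) * z)%C).
Proof.
  intros Hz. set (r := Cmod (qq z)). assert (Hr := qq_lt1 z Hz). fold r in Hr.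
  apply summable_le with (fun n => (4 * PI ^ 2 / (1 - r) ^ 2 * r) * r ^ n).
  2:{ apply ex_series_scalR, ex_series_geom. rewrite Rabs_pos_eq; lra. }
  intros n. rewrite lipschitz2, Cmod_opp by (apply inH_mulS; auto). unfold kern.
  assert (N := one_minus_qq _ (inH_mulS n z Hz)). assert (HP := PI_bounds).
  rewrite !Cmod_mult, Cmod_div, !Cmod_pow, !Cmod_R, !Rabs_pos_eq by (try apply Cpow_nz; auto; lra).
  assert (E : Cmod (qq (INR (S n) * z)) = r * r ^ n).
  { rewrite qq_mul, Cmod_pow. reflexivity. }
  rewrite E. assert (0 <= r ^ n <= 1).
  { split. apply pow_le; lra. rewrite <- (pow1 n). apply pow_incr; lra. }
  assert (L : 1 - r <= Cmod (1 - qq (INR (S n) * z))%C).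
  { eapply Rle_trans; [|apply Cmod_ge_minus]. rewrite Cmod_1, E.
    assert (r * r ^ n <= r * 1) by (apply Rmult_le_compat_l; lra). lra. }
  replace (4 * PI ^ 2 / (1 - r) ^ 2 * r * r ^ n) with (4 * PI ^ 2 * (r * r ^ n / (1 - r) ^ 2)) by (field; lra).
  apply Rmult_le_compat_l; [generalize (pow2_ge_0 PI); lra|].
  apply Rmult_le_compat_l; [apply Rmult_le_pos; lra|].
  apply Rinv_le_contravar. apply pow_lt; lra. apply pow_incr; lra.
Qed.

(** Each row is a Lambert series. In the partial sums over rows, the coefficient of q^N stabilises
    at [sig N] and is dominated by N^2, so the limit can be taken inside. *)
Lemma G2s_sig z : inH z -> G2s z = (- (4 * PI ^ 2) * qs sig z)%C.
Proof.
  intros Hz. eapply Clim_unique. apply CS_lim, G2s_summable; auto.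
  apply Clim_ext with (fun M => - (4 * PI ^ 2) * CS (fun N => Csum (fun n => divc n N * qq z ^ N)%C M))%C.
  - intros M. destruct (CS_Csum (fun n N => divc n N * qq z ^ N)%C M) as [S E].
    { intros. apply qgood_summable; auto. apply qgood_divc. }
    rewrite E, <- Csum_scal. apply Csum_ext. intros n Hn.
    rewrite LS2_qs by (apply inH_mulS; auto). rewrite <- qs_divc by auto. reflexivity.
  - apply Clim_scal. apply (CS_dominated _ _ (fun N => (INR N * INR N) * Cmod (qq z) ^ N)).
    + intros N eps He. exists N. intros M HM.
      replace (Csum (fun n => divc n N * qq z ^ N) M - sig N * qq z ^ N)%C with (RtoC 0).
      rewrite Cmod_0; auto. rewrite <- (Csum_divc_sig M N HM).
      rewrite (Csum_ext (fun n => divc n N * qq z ^ N)%C (fun n => qq z ^ N * divc n N)%C) by (intros; ring).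
      rewrite Csum_scal. ring.
    + intros M N. rewrite (Csum_ext (fun n => divc n N * qq z ^ N)%C (fun n => qq z ^ N * divc n N)%C) by (intros; ring).
      rewrite Csum_scal, Cmod_mult, Cmod_pow, Rmult_comm. apply Rmult_le_compat_r. apply pow_le, Cmod_ge_0.
      apply Csum_divc_bound.
    + assert (Q := qgood_INR _ qgood_id (Cmod (qq z))). destruct (qq_lt1 z Hz).
      eapply ex_series_extR; [|apply Q; lra]. intros n. simpl.
      rewrite <- RtoC_mult, Cmod_R, Rabs_pos_eq; auto. apply Rmult_le_pos; apply pos_INR.
Qed.

(* The partial fraction expansion of [PI cot (PI v)]. *)
Definition cotC (v : C) : C := (/ v + CS (lterm 1 v))%C.

Lemma lterm1_summable v : inH v -> summable (lterm 1 v).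
Proof.
  intros Hv. destruct (inv_shift_bound v Hv) as (K & HK & H).
  apply summable_le with (fun n => (2 * Cmod v * K ^ 2) * / INR (S n) ^ 2).
  2:{ apply ex_series_scalR, ex_series_inv2. }
  intros n. unfold lterm. assert (P : 0 < INR (S n)) by (apply lt_0_INR; lia).
  assert (N1 := inH_shift_neq0 v (INR (S n)) Hv). assert (N2 := inH_shift_neq0 v (- INR (S n)) Hv).
  assert (H1 := H (INR (S n))). assert (H2 := H (- INR (S n))).
  rewrite Rabs_Ropp in H2. rewrite Rabs_pos_eq in H1, H2 by lra.
  rewrite RtoC_opp in *.
  replace (/ (v + INR (S n)) ^ 1 + / (v - INR (S n)) ^ 1)%C with (2 * v * (/ (v + INR (S n)) * / (v + - INR (S n))))%C.
  2:{ field. auto. }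
  rewrite !Cmod_mult, Cmod_R, Rabs_pos_eq by lra. rewrite (Rmult_assoc (2 * Cmod v)).
  apply Rmult_le_compat_l. generalize (Cmod_ge_0 v); lra.
  apply Rle_trans with ((K / (1 + INR (S n))) * (K / (1 + INR (S n)))).
  apply Rmult_le_compat; auto; apply Cmod_ge_0.
  replace (K / (1 + INR (S n)) * (K / (1 + INR (S n)))) with (K ^ 2 * / (1 + INR (S n)) ^ 2) by (field; lra).
  apply Rmult_le_compat_l. apply pow2_ge_0. apply Rinv_le_contravar. apply pow_lt; lra. apply pow_incr; lra.
Qed.

Lemma cotC_deriv v : inH v -> cderiv cotC v (- LS 2 v)%C.
Proof.
  intros Hv. unfold cotC.
  destruct (lterm_quad v 1 Hv ltac:(lia)) as (K & HK & H).
  eapply cderiv_eq; [|apply cderiv_plus].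
  2: apply cderiv_inv_id, inH_neq0; auto.
  2: apply (CS_deriv (fun n w => lterm 1 w n) (fun n => - INR 1 * lterm 2 v n)%C v (Im v / 2)
     (fun n => K * / INR (S n) ^ 2)).
  - rewrite CS_scal by (apply lterm_summable; auto). unfold LS. simpl INR. ring.
  - unfold inH in Hv; lra.
  - apply H.
  - apply ex_series_scalR, ex_series_inv2.
  - intros h Hh. apply lterm1_summable. apply inH_half; auto.
  - apply summable_scal, lterm_summable; auto.
Qed.

Lemma atan_le x : 0 <= x -> atan x <= x.
Proof.
  intros Hx. assert (atan x - x <= atan 0 - 0).
  { apply (nonincr_of_deriv (fun t => atan t - t) (fun t => / (1 + t ^ 2) - 1)); auto.
    - intros t _. apply (is_derive_minus atan (fun t => t)). apply is_derive_Reals, derivable_pt_lim_atan. 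
      auto_derive; auto.
    - intros t _. assert (1 <= 1 + t ^ 2) by (generalize (pow2_ge_0 t); lra).
      assert (/ (1 + t ^ 2) <= / 1) by (apply Rinv_le_contravar; lra). lra. }
  rewrite atan_0 in H. lra.
Qed.

Lemma is_derive_scalR (c x : R) : is_derive (fun x => c * x) x c.
Proof. auto_derive; auto. ring. Qed.

(** Compares the decreasing function [t / (t^2 + x^2)] with its primitive [atan (x / t)], in place
    of an integral. *)
Lemma atan_step t a b : 0 < t -> 0 <= a <= b ->
  t / (t ^ 2 + b ^ 2) * (b - a) <= atan (b / t) - atan (a / t) <= t / (t ^ 2 + a ^ 2) * (b - a).
Proof.
  intros Ht Hab.
  assert (D : forall x, is_derive (fun x => atan (x / t)) x (t / (t ^ 2 + x ^ 2))).
  { intros x. auto_derive; auto. assert (0 < t ^ 2 + x ^ 2) by (generalize (pow2_ge_0 x) (pow_lt t 2 Ht); lra).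
    field. repeat split; nra. }
  assert (P : forall x, 0 < t ^ 2 + x ^ 2) by (intros; generalize (pow2_ge_0 x) (pow_lt t 2 Ht); lra).
  assert (M : forall x y, 0 <= x <= y -> t / (t ^ 2 + y ^ 2) <= t / (t ^ 2 + x ^ 2)).
  { intros x y H. apply Rmult_le_compat_l; [lra|]. apply Rinv_le_contravar; auto.
    assert (x ^ 2 <= y ^ 2) by (apply pow_incr; lra). lra. }
  split.
  - assert (t / (t ^ 2 + b ^ 2) * b - atan (b / t) <= t / (t ^ 2 + b ^ 2) * a - atan (a / t)); [|lra].
    apply (nonincr_of_deriv (fun x => t / (t ^ 2 + b ^ 2) * x - atan (x / t))
      (fun x => t / (t ^ 2 + b ^ 2) - t / (t ^ 2 + x ^ 2))); [lra| |].
    + intros x _. apply (is_derive_minus (fun x => t / (t ^ 2 + b ^ 2) * x) (fun x => atan (x / t))); auto.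
      apply is_derive_scalR.
    + intros x Hx. specialize (M x b). lra.
  - assert (atan (b / t) - t / (t ^ 2 + a ^ 2) * b <= atan (a / t) - t / (t ^ 2 + a ^ 2) * a); [|lra].
    apply (nonincr_of_deriv (fun x => atan (x / t) - t / (t ^ 2 + a ^ 2) * x)
      (fun x => t / (t ^ 2 + x ^ 2) - t / (t ^ 2 + a ^ 2))); [lra| |].
    + intros x _. apply (is_derive_minus (fun x => atan (x / t)) (fun x => t / (t ^ 2 + a ^ 2) * x)); auto.
      apply is_derive_scalR.
    + intros x Hx. specialize (M a x). lra.
Qed.

(** On the imaginary axis the paired terms are [- 2 i t / (t^2 + n^2)], a Riemann sum of the
    arctangent. Its total increase PI/2 gives [- PI i], and the first step accounts for the error in
    1/t. *)
Lemma cotC_imag t : 0 < t -> Cmod (CS (lterm 1 (0, t)) - (- (PI * Ci)))%C <= 2 / t.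
Proof.
  intros Ht.
  set (b := fun n : nat => t / (t ^ 2 + INR (S n) ^ 2)).
  assert (Hi : inH (0, t)) by exact Ht.
  assert (P : forall n, 0 < t ^ 2 + INR (S n) ^ 2).
  { intros n. generalize (pow2_ge_0 (INR (S n))) (pow_lt t 2 Ht); lra. }
  assert (E : forall n, lterm 1 (0, t) n = (0, - 2 * b n)).
  { intros n. unfold lterm, b. assert (N1 := inH_shift_neq0 (0, t) (INR (S n)) Hi).
    assert (N2 := inH_shift_neq0 (0, t) (- INR (S n)) Hi). rewrite RtoC_opp in N2.
    specialize (P n). rewrite !Cpow_1_r.
    unfold Cinv, Cplus, Cminus, Copp, RtoC; simpl. simpl in P. f_equal; field; nra. }
  assert (Lim : Clim (Csum (lterm 1 (0, t))) (CS (lterm 1 (0,t)))) by (apply CS_lim, lterm1_summable; auto).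
  assert (Sum : forall N, exists s, Csum (lterm 1 (0, t)) N = (0, - 2 * s) /\
     atan (INR (S N) / t) - atan (1 / t) <= s <= atan (INR N / t)).
  { induction N.
    - exists 0. split. simpl. unfold RtoC; f_equal; ring. simpl. rewrite Rdiv_0_l, atan_0. lra.
    - destruct IHN as (s & Es & H1 & H2). exists (s + b N). split.
      + simpl. rewrite Es, E. unfold Cplus; simpl. f_equal; ring.
      + assert (A1 := atan_step t (INR N) (INR (S N)) Ht).
        assert (A2 := atan_step t (INR (S N)) (INR (S (S N))) Ht).
        rewrite (S_INR (S N)) in A2 |- *. rewrite (S_INR N) in A1 at 1 3 5 |- *.
        assert (PN := pos_INR N). unfold b. rewrite !S_INR in *. 
        destruct A1 as [A1 _]; [lra|]. destruct A2 as [_ A2]; [lra|].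
        replace (INR N + 1 - INR N) with 1 in A1 by ring.
        replace (INR N + 1 + 1 - (INR N + 1)) with 1 in A2 by ring. lra. }
  assert (B : forall N, Cmod (Csum (lterm 1 (0,t)) N - (- (PI * Ci)))%C <= 2 / t + 2 * t / INR (S N)).
  { intros N. destruct (Sum N) as (s & Es & H1 & H2). rewrite Es.
    assert (PS : 0 < INR (S N)) by (apply lt_0_INR; lia).
    assert (U : atan (INR N / t) < PI / 2) by apply atan_bound.
    assert (V : PI / 2 - t / INR (S N) <= atan (INR (S N) / t)).
    { assert (0 < INR (S N) / t) by (apply Rdiv_lt_0_compat; auto).
      assert (A := atan_inv (INR (S N) / t) H). 
      assert (A2 := atan_le (/ (INR (S N) / t))). 
      assert (0 < / (INR (S N) / t)) by (apply Rinv_0_lt_compat; auto).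
      replace (t / INR (S N)) with (/ (INR (S N) / t)) by (field; lra). lra. }
    assert (W : atan (1 / t) <= 1 / t). { apply atan_le. left; apply Rdiv_lt_0_compat; lra. }
    replace (((0, (-2 * s)%R) : C) - - (PI * Ci))%C with ((0, PI - 2 * s) : C) by (apply Ceq; simpl; ring).
    eapply Rle_trans; [apply Cmod_le_ReIm|]. simpl Re; simpl Im. rewrite Rabs_R0.
    assert (0 <= t / INR (S N)) by (left; apply Rdiv_lt_0_compat; auto).
    assert (0 < 1 / t) by (apply Rdiv_lt_0_compat; lra).
    rewrite Rabs_pos_eq by lra. unfold Rdiv in *. lra. }
  apply Rnot_lt_le. intros Hlt.
  set (e := Cmod (CS (lterm 1 (0, t)) - (- (PI * Ci)))%C - 2 / t) in *.
  assert (He : 0 < e / 2) by (unfold e; lra).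
  destruct (Lim (e / 2) He) as (N & HN).
  assert (L2 := is_lim_seq_KN (2 * t)). apply is_lim_seq_spec in L2.
  destruct (L2 (mkposreal _ He)) as (N' & HN').
  specialize (HN (max N N') ltac:(lia)). specialize (HN' (max N N') ltac:(lia)). simpl in HN'.
  specialize (B (max N N')). rewrite S_INR in B. rewrite Rminus_0_r in HN'.
  replace (INR (max N N') + 1) with (1 + INR (max N N')) in B by ring.
  assert (HN2 := Rle_lt_trans _ _ _ (Rle_abs _) HN').
  assert (T := Cmod_triangle (CS (lterm 1 (0, t)) - Csum (lterm 1 (0, t)) (max N N'))%C
     (Csum (lterm 1 (0, t)) (max N N') - (- (PI * Ci)))%C).
  rewrite Cmod_sub_comm in HN.
  match type of T with Cmod ?X <= _ => replace X with (CS (lterm 1 (0, t)) - (- (PI * Ci)))%C in T by ring end.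
  unfold e in *. lra.
Qed.

Lemma qq_small v : inH v -> Cmod (qq v) <= / (1 + 2 * PI * Im v).
Proof.
  intros Hv. rewrite Cmod_qq. replace (-2 * PI * Im v) with (- (2 * PI * Im v)) by ring.
  assert (0 < PI * Im v) by (apply Rmult_lt_0_compat; [apply PI_pos|apply Hv]).
  rewrite exp_Ropp. apply Rinv_le_contravar. lra. left; apply exp_ineq1. lra.
Qed.

Lemma Clim_sub0 u l : Clim (fun n => u n - l)%C 0%C -> Clim u l.
Proof.
  intros H. assert (E := Clim_plus _ _ _ _ H (Clim_const l)). rewrite Cplus_0_l in E.
  eapply Clim_ext; [|apply E]. intros; simpl; ring.
Qed.

Lemma qs_one_lim (v : nat -> C) c : 0 < c -> (forall M, c * (1 + INR M) <= Im (v M)) ->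
  Clim (fun M => qs (fun _ => 1%C) (v M)) 1%C.
Proof.
  intros Hc Hv. assert (HP := PI_bounds).
  assert (Hi : forall M, inH (v M)).
  { intros M. specialize (Hv M). unfold inH. assert (0 <= INR M) by apply pos_INR. nra. }
  apply Clim_sub0.
  set (r := / (1 + 2 * PI * c)).
  assert (Hpc : 0 < PI * c) by (apply Rmult_lt_0_compat; lra).
  assert (Hr : r < 1). { unfold r. rewrite <- Rinv_1. apply Rinv_lt_contravar; lra. }
  apply Clim_0_le with (fun M => / (2 * PI * c) / (1 - r) / (1 + INR M)).
  { apply is_lim_seq_KN. }
  intros M. specialize (Hv M). specialize (Hi M). rewrite qs_one by auto.
  assert (N := one_minus_qq _ Hi). assert (PM := pos_INR M).
  replace (/ (1 - qq (v M)) - 1)%C with (qq (v M) / (1 - qq (v M)))%C by (field; auto).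
  rewrite Cmod_div by auto. assert (Q := qq_small _ Hi).
  assert (PI * (c * (1 + INR M)) <= PI * Im (v M)) by (apply Rmult_le_compat_l; lra).
  assert (PI * c * 1 <= PI * c * (1 + INR M)) by (apply Rmult_le_compat_l; lra).
  assert (Q1 : Cmod (qq (v M)) <= r).
  { eapply Rle_trans; [apply Q|]. apply Rinv_le_contravar; lra. }
  assert (Q2 : Cmod (qq (v M)) <= / (2 * PI * c * (1 + INR M))).
  { eapply Rle_trans; [apply Q|]. apply Rinv_le_contravar; [|lra]. lra. }
  assert (Q3 : 1 - r <= Cmod (1 - qq (v M))%C).
  { eapply Rle_trans; [|apply Cmod_ge_minus]. rewrite Cmod_1. lra. }
  apply Rle_trans with (/ (2 * PI * c * (1 + INR M)) / (1 - r)).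
  - apply Rmult_le_compat; auto. apply Cmod_ge_0. left; apply Rinv_0_lt_compat; lra.
    apply Rinv_le_contravar; lra.
  - right. field. repeat split; lra.
Qed.

(** Both sides have the same derivative by the Lipschitz formula for exponent 2. The constant is
    found by moving up the imaginary axis. *)
Lemma cotC_eq v : inH v -> cotC v = (PI * Ci - 2 * PI * Ci * qs (fun _ => 1%C) v)%C.
Proof.
  set (F := fun v => (cotC v + 2 * PI * Ci * qs (fun _ => 1%C) v)%C).
  assert (D : forall z, inH z -> cderiv F z 0%C).
  { intros z Hz. eapply cderiv_eq; [|apply cderiv_plus; [apply cotC_deriv; auto|apply cderiv_scal, qs_deriv; auto; apply qgood_one]].
    rewrite LS2_qs by auto. 
    rewrite (qs_ext (dq _) (fun n => (2 * PI * Ci) * INR n)%C) by (intros; unfold dq; ring).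
    rewrite qs_scal by (auto; apply qgood_id).
    replace (2 * PI * Ci * (2 * PI * Ci * qs (fun n => INR n) z))%C with
      (4 * PI ^ 2 * (Ci * Ci) * qs (fun n => INR n) z)%C by ring.
    replace (Ci * Ci)%C with (- (1))%C by (apply Ceq; simpl; ring). ring. }
  intros Hv.
  assert (E : F v = (PI * Ci)%C).
  { set (t := fun M : nat => (0, 1 + INR M)).
    assert (Ht : forall M, inH (t M)) by (intros M; unfold inH, t; simpl; generalize (pos_INR M); lra).
    apply Clim_unique with (fun M => F (t M)).
    - apply Clim_ext with (fun _ => F v). intros; apply cderiv0_const; auto. apply Clim_const.
    - unfold F, cotC. replace (PI * Ci)%C with (0 + (- (PI * Ci)) + 2 * PI * Ci * 1)%C by (apply Ceq; simpl; ring).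
      apply Clim_plus. apply Clim_plus.
      + apply Clim_0_le with (fun M => 1 / (1 + INR M)). apply is_lim_seq_KN.
        intros M. rewrite Cmod_inv by (apply inH_neq0; auto). unfold Rdiv. rewrite Rmult_1_l.
        apply Rinv_le_contravar. generalize (pos_INR M); lra. apply (Im_le_Cmod (t M)).
      + apply Clim_sub0.
        apply Clim_0_le with (fun M => 2 / (1 + INR M)). apply is_lim_seq_KN.
        intros M. apply cotC_imag. generalize (pos_INR M); lra.
      + apply Clim_scal. apply (qs_one_lim t 1). lra. intros; unfold t; simpl. lra. }
  unfold F in E. rewrite <- E. ring.
Qed.

(* [1 / (w^2 - 1/4)] telescopes along integer shifts; subtracting it makes the double sum over lattice points absolutely
   convergent, so that the two summations can be exchanged. *)
Definition aterm (w : C) : C := (/ w ^ 2 - / (w ^ 2 - / 4))%C.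
Definition AP (w : C) (M : nat) : C := (aterm w + Csum (fun m => aterm (w + INR (S m)) + aterm (w - INR (S m))) M)%C.

Lemma half_neq w (e : R) : inH w -> (w + e)%C <> 0%C.
Proof. apply inH_shift_neq0. Qed.

Lemma aterm_split w : inH w -> (/ (w ^ 2 - / 4) = / (w + (- / 2)%R) - / (w + (/ 2)%R))%C.
Proof.
  intros Hw. assert (N1 := half_neq w (- / 2) Hw). assert (N2 := half_neq w (/ 2) Hw).
  rewrite RtoC_opp, RtoC_inv in * by lra.
  replace (w ^ 2 - / 4)%C with ((w + - / 2) * (w + / 2))%C by field.
  set (a := (w + - / 2)%C) in *. set (b := (w + / 2)%C) in *.
  assert (E : (b - a)%C = 1%C) by (unfold a, b; field).
  transitivity ((b - a) / (a * b))%C; [rewrite E|]; field; auto.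
Qed.

(** The subtracted terms telescope, which leaves two boundary fractions at distance M + 1/2. *)
Lemma AP_eq w M : inH w -> AP w M = (LSP 2 w M - (/ (w - (INR M + / 2)%R) - / (w + (INR M + / 2)%R)))%C.
Proof.
  intros Hw. induction M.
  - unfold AP, LSP, aterm; simpl Csum. rewrite aterm_split by auto.
    simpl INR. rewrite !Rplus_0_l, RtoC_opp. unfold Cminus. ring.
  - assert (CSs : forall a n, Csum a (S n) = (Csum a n + a n)%C) by reflexivity.
    unfold AP, LSP in *. rewrite !CSs, !Cplus_assoc, IHM. unfold aterm, lterm at 3. rewrite S_INR.
    assert (S1 : inH (w + (INR M + 1)%R)%C) by (apply inH_shift; auto).
    assert (S2 : inH (w - (INR M + 1)%R)%C) by (rewrite RtoC_neg_shift; apply inH_shift; auto).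
    rewrite !aterm_split by auto.
    replace (w + (INR M + 1)%R + (- / 2)%R)%C with (w + (INR M + / 2)%R)%C.
    2:{ rewrite <- Cplus_assoc, <- RtoC_plus. do 2 f_equal. lra. }
    replace (w + (INR M + 1)%R + (/ 2)%R)%C with (w + (INR M + 1 + / 2)%R)%C.
    2:{ rewrite <- Cplus_assoc, <- RtoC_plus. do 2 f_equal. }
    replace (w - (INR M + 1)%R + (- / 2)%R)%C with (w - (INR M + 1 + / 2)%R)%C.
    2:{ rewrite !RtoC_plus, !RtoC_opp. ring. }
    replace (w - (INR M + 1)%R + (/ 2)%R)%C with (w - (INR M + / 2)%R)%C.
    2:{ replace (INR M + / 2) with (INR M + 1 - / 2) by lra. rewrite !RtoC_minus. ring. }
    ring.
Qed.

(** [aterm] is of order w^-4: two factors are spent on the sum over [m], the other two give the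
    decay in [n]. *)
Lemma AP_bound z : inH z -> exists B, 0 <= B /\ forall M n, Cmod (AP (INR (S n) * z) M) <= B * / INR (S n) ^ 2.
Proof.
  intros Hz. destruct (lattice_bound z Hz) as (K & HK & H).
  set (y := Im z). assert (Hy : 0 < y) by exact Hz.
  assert (T : forall n (m : R), Cmod (aterm (INR (S n) * z + m)) <= (K ^ 2 / y ^ 2 * / INR (S n) ^ 2) * / (1 + Rabs m) ^ 2).
  { intros n m. set (w := (INR (S n) * z + m)%C).
    assert (P1 : 1 <= INR (S n)) by (apply (le_INR 1); lia). assert (Pm := Rabs_pos m).
    assert (Hw : inH w) by (apply inH_shift, inH_mulS; auto).
    assert (N0 := inH_neq0 w Hw).
    assert (Iw : Im w = INR (S n) * y). { unfold w, y. destruct z; simpl. ring. }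
    assert (N1 := half_neq w (- / 2) Hw). assert (N2 := half_neq w (/ 2) Hw).
    assert (L1 : INR (S n) * y <= Cmod (w + (- / 2)%R)%C).
    { rewrite <- Iw. replace (Im w) with (Im (w + (- / 2)%R)%C) by (simpl; unfold Im; ring). apply Im_le_Cmod. }
    assert (L2 : INR (S n) * y <= Cmod (w + (/ 2)%R)%C).
    { rewrite <- Iw. replace (Im w) with (Im (w + (/ 2)%R)%C) by (simpl; unfold Im; ring). apply Im_le_Cmod. }
    assert (PY : 0 < INR (S n) * y) by (apply Rmult_lt_0_compat; lra).
    assert (E : aterm w = (- / 4 * ((/ w) ^ 2 * (/ (w + (- / 2)%R) * / (w + (/ 2)%R))))%C).
    { unfold aterm. rewrite RtoC_opp, RtoC_inv in * by lra.
      replace (w ^ 2 - / 4)%C with ((w + - / 2) * (w + / 2))%C by field.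
      set (a := (w + - / 2)%C) in *. set (b := (w + / 2)%C) in *.
      replace (- / 4)%C with (a * b - w ^ 2)%C by (unfold a, b; field). field. auto. }
    rewrite E, !Cmod_mult, Cmod_pow, Cmod_opp.
    replace (Cmod (/ 4)%C) with (/ 4).
    2:{ rewrite <- RtoC_inv by lra. rewrite Cmod_R, Rabs_pos_eq; lra. }
    rewrite (Cmod_inv (w + _)%C), (Cmod_inv (w + _)%C) by auto.
    assert (I1 : / Cmod (w + (- / 2)%R)%C <= / (INR (S n) * y)) by (apply Rinv_le_contravar; lra).
    assert (I2 : / Cmod (w + (/ 2)%R)%C <= / (INR (S n) * y)) by (apply Rinv_le_contravar; lra).
    assert (J1 : 0 < / Cmod (w + (- / 2)%R)%C) by (apply Rinv_0_lt_compat; lra).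
    assert (J2 : 0 < / Cmod (w + (/ 2)%R)%C) by (apply Rinv_0_lt_compat; lra).
    assert (I3 : Cmod (/ w)%C ^ 2 <= (K / (1 + Rabs m)) ^ 2).
    { apply pow_incr. split; [apply Cmod_ge_0|]. eapply Rle_trans; [apply H|].
      apply Rmult_le_compat_l; [lra|]. apply Rinv_le_contravar; lra. }
    assert (Q0 : 0 <= Cmod (/ w)%C ^ 2) by apply pow2_ge_0.
    apply Rle_trans with (Cmod (/ w)%C ^ 2 * (/ Cmod (w + (- / 2)%R)%C * / Cmod (w + (/ 2)%R)%C)).
    { assert (0 <= Cmod (/ w)%C ^ 2 * (/ Cmod (w + (- / 2)%R)%C * / Cmod (w + (/ 2)%R)%C)).
      apply Rmult_le_pos; auto. apply Rmult_le_pos; lra. lra. }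
    apply Rle_trans with ((K / (1 + Rabs m)) ^ 2 * (/ (INR (S n) * y) * / (INR (S n) * y))).
    { apply Rmult_le_compat; auto. apply Rmult_le_pos; lra. apply Rmult_le_compat; lra. }
    right. field. lra. }
  assert (T0 : forall n, 0 <= K ^ 2 / y ^ 2 * / INR (S n) ^ 2).
  { intros n. assert (0 < INR (S n)) by (apply lt_0_INR; lia). apply Rmult_le_pos.
    apply Rdiv_le_0_compat. apply pow2_ge_0. apply pow_lt; auto. left; apply Rinv_0_lt_compat, pow_lt; auto. }
  exists (K ^ 2 / y ^ 2 * 5). split.
  { apply Rmult_le_pos; [|lra]. apply Rdiv_le_0_compat. apply pow2_ge_0. apply pow_lt; auto. }
  intros M n. set (w := (INR (S n) * z)%C). set (c := K ^ 2 / y ^ 2 * / INR (S n) ^ 2) in *.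
  assert (Ex : ex_series (fun m => 2 * c * / INR (S m) ^ 2)) by apply ex_series_scalR, ex_series_inv2.
  assert (TT : forall m, Cmod (aterm (w + INR (S m)) + aterm (w - INR (S m)))%C <= 2 * c * / INR (S m) ^ 2).
  { intros m. eapply Rle_trans; [apply Cmod_triangle|]. rewrite RtoC_neg_shift.
    assert (A1 := T n (INR (S m))). assert (A2 := T n (- INR (S m))). fold w in A1, A2.
    assert (PS : 0 < INR (S m)) by (apply lt_0_INR; lia).
    rewrite Rabs_Ropp in A2. rewrite Rabs_pos_eq in A1, A2 by lra. fold c in A1, A2.
    assert (/ (1 + INR (S m)) ^ 2 <= / INR (S m) ^ 2).
    { apply Rinv_le_contravar. apply pow_lt; lra. apply pow_incr; lra. }
    specialize (T0 n). fold c in T0.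
    assert (c * / (1 + INR (S m)) ^ 2 <= c * / INR (S m) ^ 2) by (apply Rmult_le_compat_l; auto). lra. }
  assert (A0 := T n 0). rewrite Cplus_0_r in A0. fold w in A0. fold c in A0.
  rewrite Rabs_R0 in A0. replace (c * / (1 + 0) ^ 2) with c in A0 by field.
  unfold AP. eapply Rle_trans; [apply Cmod_triangle|].
  assert (SB : Cmod (Csum (fun m => aterm (w + INR (S m)) + aterm (w - INR (S m)))%C M) <= Series (fun m => 2 * c * / INR (S m) ^ 2)).
  { apply Cmod_Csum_Series; auto. }
  rewrite Series_scal_l in SB. specialize (T0 n). fold c in T0.
  assert (2 * c * Series (fun n => / INR (S n) ^ 2) <= 2 * c * 2).
  { apply Rmult_le_compat_l; [lra|apply Series_inv2_le]. }
  replace (K ^ 2 / y ^ 2 * 5 * / INR (S n) ^ 2) with (5 * c). lra. unfold c; ring.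
Qed.

Definition zeta2 : R := Series (fun n => / INR (S n) ^ 2).

(** Rows truncated at |m| <= M are summed over [n]. The finite sum over [m] can be exchanged and
    produces the rows for -1/z, while the boundary fractions form a cotangent series at
    [(M + 1/2)(-1/z)]. The limit of the latter is the source of the anomaly [2 PI i / z]. *)
Lemma G2s_transform z : inH z ->
  (2 * G2s z + 2 * zeta2 = / z ^ 2 * (2 * G2s (- / z) + 2 * zeta2) + 2 * PI * Ci / z)%C.
Proof.
  intros Hz. assert (Nz := inH_neq0 z Hz).
  assert (HS := inH_S z Hz). set (s := (- / z)%C) in *. set (c := Im s). assert (Hc : 0 < c) by exact HS.
  destruct (AP_bound z Hz) as (B & HB & HAP).
  assert (Sinv : summable (fun n => RtoC (/ INR (S n) ^ 2))).
  { apply summable_le with (fun n => / INR (S n) ^ 2); [|apply ex_series_inv2].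
    intros n. destruct (inv2_term n). rewrite Cmod_R, Rabs_pos_eq; lra. }
  assert (Ez : CS (fun n => RtoC (/ INR (S n) ^ 2)) = RtoC zeta2).
  { apply Ceq; simpl. reflexivity. transitivity (Series (fun _ => 0 * 0)).
    apply Series_ext; intros; simpl; ring. rewrite Series_scal_l. ring. }
  assert (L1 : Clim (fun M => CS (fun n => AP (INR (S n) * z) M)) (G2s z)).
  { apply (CS_dominated _ _ (fun n => B * / INR (S n) ^ 2)); auto.
    - intros n. assert (Hw := inH_mulS n z Hz).
      eapply Clim_ext; [intros M; symmetry; apply AP_eq; auto|].
      replace (LS 2 (INR (S n) * z)) with (LS 2 (INR (S n) * z) - (0 - 0))%C by ring.
      apply Clim_minus. apply LSP_lim; auto. apply Clim_minus.
      + apply Clim_ext with (fun M => / (INR (S n) * z + (- (INR M + / 2))%R) ^ 1)%C.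
        { intros M. rewrite RtoC_neg_shift, Cpow_1_r. auto. }
        apply shift_inv_lim; auto. intros M. rewrite Rabs_Ropp, Rabs_pos_eq; generalize (pos_INR M); lra.
      + apply Clim_ext with (fun M => / (INR (S n) * z + (INR M + / 2)%R) ^ 1)%C.
        { intros M. rewrite Cpow_1_r. auto. }
        apply shift_inv_lim; auto. intros M. rewrite Rabs_pos_eq; generalize (pos_INR M); lra.
    - apply ex_series_scalR, ex_series_inv2. }
  (* Rows become columns: [z (m s + n) = n z - m] with [s = - / z]. *)
  assert (Es : forall n m, (/ (INR (S n) * z + INR (S m)) ^ 2 + / (INR (S n) * z - INR (S m)) ^ 2
     = / z ^ 2 * lterm 2 (INR (S m) * s) n)%C).
  { intros n m. unfold lterm.
    assert (N1 := inH_shift_neq0 _ (INR (S n)) (inH_mulS m s HS)).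
    assert (N2 := inH_shift_neq0 _ (- INR (S n)) (inH_mulS m s HS)).
    assert (N3 := inH_shift_neq0 _ (INR (S m)) (inH_mulS n z Hz)).
    assert (N4 := inH_shift_neq0 _ (- INR (S m)) (inH_mulS n z Hz)).
    rewrite RtoC_opp in N2, N4.
    assert (Q1 : (z * (INR (S m) * s + INR (S n)) = INR (S n) * z - INR (S m))%C) by (unfold s; field; auto).
    assert (Q2 : (z * (INR (S m) * s - INR (S n)) = - (INR (S n) * z + INR (S m)))%C) by (unfold s; field; auto).
    rewrite Cmult_plus_distr_l.
    assert (R1 : (/ z ^ 2 * / (INR (S m) * s + INR (S n)) ^ 2 = / (INR (S n) * z - INR (S m)) ^ 2)%C).
    { rewrite <- Q1, Cpow_mult_l. field. auto. }
    assert (R2 : (/ z ^ 2 * / (INR (S m) * s - INR (S n)) ^ 2 = / (INR (S n) * z + INR (S m)) ^ 2)%C).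
    { replace ((INR (S n) * z + INR (S m)) ^ 2)%C with ((- (INR (S n) * z + INR (S m))) ^ 2)%C by ring.
      rewrite <- Q2, Cpow_mult_l. field. auto. }
    rewrite R1, R2. ring. }
  assert (S1 : forall M, summable (fun n => Csum (fun m => lterm 2 (INR (S n) * z) m) M) /\
     CS (fun n => Csum (fun m => lterm 2 (INR (S n) * z) m) M) =
     Csum (fun m => / z ^ 2 * LS 2 (INR (S m) * s) - RtoC (/ INR (S m) ^ 2))%C M).
  { intros M. destruct (CS_Csum (fun m n => lterm 2 (INR (S n) * z) m) M) as [U V].
    - intros m _. apply summable_ext with (fun n => / z ^ 2 * lterm 2 (INR (S m) * s) n)%C.
      intros n. rewrite <- Es. reflexivity. apply summable_scal, lterm_summable; auto. apply inH_mulS; auto.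
    - split; auto. rewrite V. apply Csum_ext. intros m _.
      rewrite (CS_ext _ (fun n => / z ^ 2 * lterm 2 (INR (S m) * s) n)%C).
      2:{ intros n. rewrite <- Es. reflexivity. }
      rewrite CS_scal by (apply lterm_summable; auto; apply inH_mulS; auto).
      unfold LS. assert (NI : INR (S m) <> 0) by (apply not_0_INR; lia).
      rewrite RtoC_inv, RtoC_pow by (apply pow_nonzero; auto). unfold s. field. 
      split; auto. apply RtoC_neq0; auto. }
  assert (S0 : summable (fun n => / (INR (S n) * z) ^ 2)%C /\ CS (fun n => / (INR (S n) * z) ^ 2)%C = (/ z ^ 2 * zeta2)%C).
  { assert (E : forall n, (/ z ^ 2 * RtoC (/ INR (S n) ^ 2) = / (INR (S n) * z) ^ 2)%C).
    { intros n. assert (NI : INR (S n) <> 0) by (apply not_0_INR; lia).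
      rewrite RtoC_inv, RtoC_pow by (apply pow_nonzero; auto). field. split; auto. apply RtoC_neq0; auto. }
    split. eapply summable_ext; [apply E|]. apply summable_scal; auto.
    rewrite <- Ez, <- CS_scal by auto. apply CS_ext. intros; symmetry; apply E. }
  destruct S0 as [S0 E0].
  assert (ET : forall M, CS (fun n => AP (INR (S n) * z) M) =
     (/ z ^ 2 * zeta2 + (/ z ^ 2 * Csum (fun m => LS 2 (INR (S m) * s)) M - Csum (fun m => RtoC (/ INR (S m) ^ 2)) M)
      - (/ z * cotC ((INR M + / 2)%R * s) + / (INR M + / 2)%R))%C).
  { intros M. set (h := INR M + / 2). assert (Hh : 0 < h) by (unfold h; generalize (pos_INR M); lra).
    assert (Hv : inH (h * s)%C) by (apply inH_scal; auto).
    assert (NH : RtoC h <> 0%C) by (apply RtoC_neq0; lra).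
    assert (EL : forall n, (/ (INR (S n) * z - h) - / (INR (S n) * z + h) = / z * lterm 1 (h * s) n)%C).
    { intros n. unfold lterm. rewrite !Cpow_1_r.
      assert (N1 := inH_shift_neq0 _ (INR (S n)) Hv). assert (N2 := inH_shift_neq0 _ (- INR (S n)) Hv).
      assert (N3 := inH_shift_neq0 _ h (inH_mulS n z Hz)). assert (N4 := inH_shift_neq0 _ (- h) (inH_mulS n z Hz)).
      rewrite RtoC_opp in N2, N4.
      assert (Q1 : (z * (h * s + INR (S n)) = INR (S n) * z - h)%C) by (unfold s; field; auto).
      assert (Q2 : (z * (h * s - INR (S n)) = - (INR (S n) * z + h))%C) by (unfold s; field; auto).
      assert (R1 : (/ z * / (h * s + INR (S n)) = / (INR (S n) * z - h))%C).
      { rewrite <- Q1. field. auto. }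
      assert (R2 : (/ z * / (h * s - INR (S n)) = - / (INR (S n) * z + h))%C).
      { replace (- / (INR (S n) * z + h))%C with (/ (- (INR (S n) * z + h)))%C by (field; auto).
        rewrite <- Q2. field. auto. }
      rewrite Cmult_plus_distr_l, R1, R2. ring. }
    rewrite (CS_ext _ (fun n => (/ (INR (S n) * z) ^ 2 + Csum (fun m => lterm 2 (INR (S n) * z) m) M) - / z * lterm 1 (h * s) n)%C).
    2:{ intros n. rewrite AP_eq by (apply inH_mulS; auto). fold h. rewrite EL. reflexivity. }
    destruct (S1 M) as [SM EM].
    assert (SL : summable (fun n => / z * lterm 1 (h * s) n)%C) by (apply summable_scal, lterm1_summable; auto).
    rewrite CS_minus; auto. 2: apply summable_plus; auto.
    rewrite CS_plus; auto. rewrite E0, EM. rewrite CS_scal by (apply lterm1_summable; auto).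
    f_equal. f_equal.
    - rewrite <- Csum_scal. apply Csum_minus.
    - unfold cotC. unfold s. field. auto. }
  assert (L2 : Clim (fun M => CS (fun n => AP (INR (S n) * z) M)) (/ z ^ 2 * zeta2 + (/ z ^ 2 * G2s s - zeta2) - (/ z * (PI * Ci - 2 * PI * Ci * 1) + 0))%C).
  { eapply Clim_ext; [intros M; symmetry; apply ET|].
    apply Clim_minus. apply Clim_plus. apply Clim_const. apply Clim_minus.
    - apply Clim_scal. apply CS_lim, G2s_summable; auto.
    - rewrite <- Ez. apply CS_lim; auto.
    - apply Clim_plus.
      + apply Clim_scal.
        assert (Hv : forall M, inH ((INR M + / 2)%R * s)%C).
        { intros M. apply inH_scal; auto. generalize (pos_INR M); lra. }
        eapply Clim_ext; [intros M; symmetry; apply cotC_eq; auto|].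
        apply Clim_minus. apply Clim_const. apply Clim_scal.
        apply (qs_one_lim (fun M => (INR M + / 2)%R * s)%C (c / 2)). lra.
        intros M. replace (Im ((INR M + / 2)%R * s)%C) with ((INR M + / 2) * c).
        generalize (pos_INR M); intros; nra. unfold c. destruct s; simpl; ring.
      + apply Clim_0_le with (fun M => 2 / (1 + INR M)). apply is_lim_seq_KN.
        intros M. assert (PM := pos_INR M). rewrite Cmod_inv, Cmod_R, Rabs_pos_eq by (try apply RtoC_neq0; lra).
        replace (2 / (1 + INR M)) with (/ ((1 + INR M) / 2)) by (field; lra).
        apply Rinv_le_contravar; lra. }
  rewrite (Clim_unique _ _ _ L1 L2). field. auto.
Qed.

(** * The forms E2, E4, E6 and the discriminant *)

(* A priori the constant term of [E2] is a multiple of zeta(2); its value 1 is only found in [a0_eq]. *)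
Definition a0 : R := 6 * zeta2 / PI ^ 2.
Definition e2c (n : nat) : C := match n with O => RtoC a0 | _ => (- (24) * sig n)%C end.
Definition E2 (z : C) : C := qs e2c z.
Definition c2 : C := (- (6) * Ci / PI)%C.

Lemma c2_eq : (2 * PI * Ci * c2)%C = 12%C.
Proof.
  unfold c2. assert (HP := PI_bounds). assert (RtoC PI <> 0%C) by (apply RtoC_neq0; lra).
  replace (2 * PI * Ci * (- (6) * Ci / PI))%C with (- (12) * (Ci * Ci))%C by (field; auto).
  replace (Ci * Ci)%C with (- (1))%C by (apply Ceq; simpl; ring). ring.
Qed.

Lemma qgood_e2c : qgood e2c.
Proof.
  intros r Hr. apply (ex_series_incr_1 (fun n => Cmod (e2c n) * r ^ n)).
  assert (H := qgood_scal (- (24))%C _ qgood_sig r Hr).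
  apply (ex_series_incr_1 (fun n => Cmod (- (24) * sig n)%C * r ^ n)) in H. exact H.
Qed.

Lemma E2_sig z : inH z -> E2 z = (a0 - 24 * qs sig z)%C.
Proof.
  intros Hz. unfold E2.
  rewrite (qs_ext _ (fun n => (match n with O => RtoC a0 | _ => 0%C end) + - (24) * sig n)%C).
  2:{ intros n; destruct n; simpl; [rewrite sig_0|]; ring. }
  assert (Gf : qgood (fun n => match n with O => RtoC a0 | _ => 0%C end)).
  { apply qgood_fin with 1%nat. intros n Hn. destruct n; auto. lia. }
  rewrite qs_plus; auto. 2: apply qgood_scal, qgood_sig.
  rewrite qs_scal; auto. 2: apply qgood_sig.
  replace (qs (fun n => match n with O => RtoC a0 | _ => 0%C end) z) with (RtoC a0). ring.
  unfold qs. rewrite (CS_split _ 1) by (apply qgood_summable; auto).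
  rewrite (CS_ext _ (fun _ => 0%C)), CS_0. simpl. ring.
  intros n. simpl. ring.
Qed.

Lemma E2_S z : inH z -> E2 (- / z)%C = (z ^ 2 * E2 z + c2 * z)%C.
Proof.
  intros Hz. assert (Nz := inH_neq0 z Hz). assert (HP := PI_bounds).
  assert (NP : RtoC PI <> 0%C) by (apply RtoC_neq0; lra).
  assert (T := G2s_transform z Hz). rewrite !G2s_sig in T by (auto using inH_S).
  rewrite !E2_sig by (auto using inH_S).
  set (u := qs sig z) in *. set (v := qs sig (- / z)%C) in *.
  assert (A : RtoC a0 = (6 * zeta2 / PI ^ 2)%C).
  { unfold a0. rewrite RtoC_div, RtoC_mult, RtoC_pow by (apply pow_nonzero; lra). auto. }
  rewrite A. unfold c2.
  transitivity (3 / PI ^ 2 * z ^ 2 * ((/ z ^ 2 * (2 * (- (4 * PI ^ 2) * v) + 2 * zeta2) + 2 * PI * Ci / z) - 2 * PI * Ci / z))%C.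
  - field. auto.
  - rewrite <- T. field. auto.
Qed.

(** Coefficients of the series [- log (1 - q) - log (1 - q^2) - ...]. At index 0 the quotient is 0
    because [sig 0] is. *)
Definition s1 (n : nat) : C := (sig n / INR n)%C.

Lemma s1_INR n : (INR n * s1 n)%C = sig n.
Proof.
  destruct n. rewrite sig_0. simpl. ring. unfold s1. field. apply RtoC_neq0, not_0_INR. lia.
Qed.

Lemma s1_bound n : (1 <= n)%nat -> Cmod (s1 n) <= INR n.
Proof.
  intros Hn. assert (P : 0 < INR n) by (apply lt_0_INR; lia).
  unfold s1. rewrite Cmod_div by (apply RtoC_neq0; lra). rewrite Cmod_R, Rabs_pos_eq by lra.
  apply Rmult_le_reg_r with (INR n); auto. unfold Rdiv. rewrite Rmult_assoc, Rinv_l by lra.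
  generalize (sig_bound n); lra.
Qed.

Lemma s1_0 : s1 0 = 0%C.
Proof. unfold s1. rewrite sig_0. unfold Cdiv. ring. Qed.

Lemma qgood_s1 : qgood s1.
Proof.
  apply qgood_le with (fun n => INR n : C); [|apply qgood_id].
  intros n. rewrite Cmod_R, (Rabs_pos_eq (INR n)) by apply pos_INR.
  destruct n. rewrite s1_0, Cmod_0. simpl; lra. apply s1_bound; lia.
Qed.

(* The product [q prod (1 - q^n)^24] as the exponential of its logarithm, so that [Delta] visibly has no zero. *)
Definition Delta (z : C) : C := Cexp (2 * PI * Ci * a0 * z - 24 * qs s1 z)%C.

Lemma Delta_neq0 z : Delta z <> 0%C.
Proof. apply Cexp_neq0. Qed.

Lemma Delta_deriv z : inH z -> cderiv Delta z (2 * PI * Ci * E2 z * Delta z)%C.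
Proof.
  intros Hz. unfold Delta.
  eapply cderiv_eq; [|apply (cderiv_comp (fun z => 2 * PI * Ci * a0 * z - 24 * qs s1 z)%C Cexp);
    [apply cderiv_minus; [apply cderiv_scal, cderiv_id|apply cderiv_scal, qs_deriv; auto; apply qgood_s1]|apply Cexp_deriv]].
  rewrite E2_sig by auto. rewrite (qs_ext (dq s1) (fun n => (2 * PI * Ci) * sig n)%C).
  2:{ intros n. unfold dq. rewrite s1_INR; auto. }
  rewrite qs_scal by (auto; apply qgood_sig). ring.
Qed.

Lemma S_deriv z : inH z -> cderiv (fun w => - / w)%C z (/ z ^ 2)%C.
Proof.
  intros Hz. eapply cderiv_eq; [|apply cderiv_opp, cderiv_inv_id, inH_neq0; auto]. ring.
Qed.

(** The logarithmic derivatives of both sides agree, the anomaly of [E2] contributing exactly 12.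
    The quotient is therefore constant, and it is 1 at the fixed point [i]. *)
Lemma Delta_S z : inH z -> Delta (- / z)%C = (z ^ 12 * Delta z)%C.
Proof.
  set (F := fun z : C => (Delta (- / z) / (z ^ 12 * Delta z))%C).
  assert (D : forall z, inH z -> cderiv F z 0%C).
  { intros w Hw. assert (Nw := inH_neq0 w Hw). assert (N1 := Delta_neq0 w).
    eapply cderiv_eq; [|apply cderiv_div].
    2: apply Cmult_neq_0; auto; apply Cpow_nz; auto.
    2: apply (cderiv_comp (fun w => - / w)%C Delta); [apply S_deriv; auto|apply Delta_deriv, inH_S; auto].
    2: apply cderiv_mult; [apply cderiv_pow, cderiv_id|apply Delta_deriv; auto].
    cbv beta. rewrite E2_S by auto. 
    replace (RtoC (INR 12)) with (RtoC 12) by (simpl; f_equal; ring). change (12 - 1)%nat with 11%nat.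
    replace (2 * PI * Ci * (w ^ 2 * E2 w + c2 * w))%C with (w ^ 2 * (2 * PI * Ci * E2 w) + (2 * PI * Ci * c2) * w)%C by ring.
    rewrite c2_eq. field. auto. }
  intros Hz. assert (Nz := inH_neq0 z Hz).
  assert (Hi : inH Ci) by (unfold inH; simpl; lra).
  assert (E : F z = F Ci) by (apply cderiv0_const; auto).
  assert (E1 : F Ci = 1%C).
  { unfold F. rewrite Ci_inv. replace (- - Ci)%C with Ci by ring.
    replace (Ci ^ 12)%C with (RtoC 1). field. apply Delta_neq0. apply Ceq; simpl; ring. }
  rewrite E1 in E. unfold F in E.
  transitivity (Delta (- / z) / (z ^ 12 * Delta z) * (z ^ 12 * Delta z))%C.
  - field. split; auto. apply Delta_neq0.
  - rewrite E. ring.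
Qed.

(** * The point rho and the constant term of [E2] *)

Definition rho : C := (- / 2, sqrt 3 / 2).

Lemma sqrt3_sq : sqrt 3 * sqrt 3 = 3.
Proof. apply sqrt_sqrt; lra. Qed.

Lemma sqrt3_bounds : 1.73 < sqrt 3 < 1.74.
Proof.
  assert (H := sqrt3_sq). assert (0 <= sqrt 3) by apply sqrt_pos. split; nra.
Qed.

Lemma inH_rho : inH rho.
Proof. unfold inH, rho; simpl. generalize sqrt3_bounds; lra. Qed.

Lemma rho_quad : (rho * rho + rho + 1 = 0)%C.
Proof. unfold rho. assert (H := sqrt3_sq). apply Ceq; simpl; nra. Qed.

Lemma rho_S : (- / rho)%C = (rho + 1)%C.
Proof.
  assert (N := inH_neq0 _ inH_rho). assert (Q := rho_quad).
  transitivity ((rho + 1) - (rho * rho + rho + 1) / rho)%C. field; auto.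
  rewrite Q. unfold Cdiv. ring.
Qed.

Lemma rho_3 : (rho ^ 3 = 1)%C.
Proof.
  transitivity ((rho * rho + rho + 1) * (rho - 1) + 1)%C. ring. rewrite rho_quad. ring.
Qed.

Lemma zeta2_bounds : 0 < zeta2 <= 2.
Proof.
  split; [|apply Series_inv2_le]. unfold zeta2. rewrite Series_incr_1 by apply ex_series_inv2.
  assert (0 <= Series (fun k => / INR (S (S k)) ^ 2)).
  { apply Series_nonneg. intros n. left. apply Rinv_0_lt_compat, pow_lt, lt_0_INR; lia.
    apply (ex_series_incr_1 (fun n => / INR (S n) ^ 2)), ex_series_inv2. }
  simpl INR at 1. lra.
Qed.

(* The relation between the values at [rho] and [rho + 1 = -1/rho] forces [a0] to be an integer. *)
Lemma a0_eq : a0 = 1.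
Proof.
  assert (HP := PI_bounds). assert (HZ := zeta2_bounds).
  assert (B : 0 < a0 < 2).
  { unfold a0. split. apply Rdiv_lt_0_compat; nra.
    apply Rmult_lt_reg_r with (PI ^ 2); [nra|]. unfold Rdiv. rewrite Rmult_assoc, Rinv_l; nra. }
  assert (E := Delta_S rho inH_rho). rewrite rho_S in E.
  replace (rho ^ 12)%C with ((rho ^ 3) ^ 4)%C in E by ring. rewrite rho_3, Cpow_1_l in E.
  assert (E1 : Delta (rho + 1)%C = (Cexp (2 * PI * Ci * a0) * Delta rho)%C).
  { unfold Delta. rewrite qs_period, <- Cexp_add. f_equal. ring. }
  rewrite E1 in E.
  assert (E2' : Cexp (2 * PI * Ci * a0)%C = 1%C).
  { transitivity ((Cexp (2 * PI * Ci * a0) * Delta rho) / Delta rho)%C. field; apply Delta_neq0.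
    rewrite E. field; apply Delta_neq0. }
  replace (2 * PI * Ci * a0)%C with ((0, 2 * (PI * a0)) : C) in E2' by (apply Ceq; simpl; ring).
  unfold Cexp in E2'. simpl in E2'. rewrite exp_0 in E2'. injection E2'. intros _ EC.
  rewrite cos_2a_sin in EC.
  assert (ES : sin (PI * a0) = 0) by nra.
  destruct (sin_eq_0_0 _ ES) as (k & Hk).
  assert (Ek : a0 = IZR k) by (apply Rmult_eq_reg_l with PI; lra).
  rewrite Ek in B |- *. destruct B as [B1 B2]. apply lt_IZR in B1, B2. replace k with 1%Z by lia. auto.
Qed.

Definition tq (c : nat -> C) (n : nat) : C := (INR n * c n)%C.

Lemma qgood_tq c : qgood c -> qgood (tq c).
Proof. apply qgood_INR. Qed.

Lemma qs_dtq c z : qgood c -> inH z -> cderiv (qs c) z (2 * PI * Ci * qs (tq c) z)%C.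
Proof.
  intros Hc Hz. eapply cderiv_eq; [|apply qs_deriv; auto]. unfold dq.
  rewrite <- qs_scal by (auto; apply qgood_tq; auto). auto.
Qed.

Lemma TPI_neq0 : (2 * PI * Ci)%C <> 0%C.
Proof.
  assert (HP := PI_bounds). repeat apply Cmult_neq_0; try (apply RtoC_neq0; lra). apply Ci_nz.
Qed.

(** The transformation law differentiated; the term in [INR k] is the one that the product with [E2]
    has to cancel. *)
Lemma tq_S c k z : qgood c -> inH z -> (forall w, inH w -> qs c (- / w)%C = (w ^ k * qs c w)%C) ->
  (2 * PI * Ci * qs (tq c) (- / z) = z ^ 2 * (INR k * z ^ (k - 1) * qs c z + z ^ k * (2 * PI * Ci * qs (tq c) z)))%C.
Proof.
  intros Hc Hz H. assert (Nz := inH_neq0 z Hz).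
  assert (D1 := cderiv_comp (fun w => - / w)%C (qs c) z _ _ (S_deriv z Hz) (qs_dtq c _ Hc (inH_S z Hz))).
  assert (D2 := cderiv_mult (fun w => w ^ k)%C (qs c) z _ _ (cderiv_pow _ z _ k (cderiv_id z)) (qs_dtq c z Hc Hz)).
  assert (D3 := cderiv_ext_H _ _ z _ Hz (fun w Hw => eq_sym (H w Hw)) D2).
  assert (E := cderiv_unique _ _ _ _ D1 D3). cbv beta in E.
  transitivity (z ^ 2 * (2 * PI * Ci * qs (tq c) (- / z) * / z ^ 2))%C. field; auto.
  rewrite E. ring.
Qed.

(* Ramanujan's differential equations, read as definitions of [E4] and [E6]. *)
Definition e4c (n : nat) : C := (conv e2c e2c n - 12 * tq e2c n)%C.
Definition E4 (z : C) : C := qs e4c z.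
Definition e6c (n : nat) : C := (conv e2c e4c n - 3 * tq e4c n)%C.
Definition E6 (z : C) : C := qs e6c z.

Lemma qgood_e4c : qgood e4c.
Proof.
  apply qgood_minus. apply qgood_conv; apply qgood_e2c. apply qgood_scal, qgood_tq, qgood_e2c.
Qed.

Lemma qgood_e6c : qgood e6c.
Proof.
  apply qgood_minus. apply qgood_conv. apply qgood_e2c. apply qgood_e4c. apply qgood_scal, qgood_tq, qgood_e4c.
Qed.

Lemma E4_eq z : inH z -> E4 z = (E2 z * E2 z - 12 * qs (tq e2c) z)%C.
Proof.
  intros Hz. assert (G := qgood_e2c). unfold E4, e4c.
  rewrite qs_minus, qs_mult, qs_scal; auto using qgood_tq, qgood_conv, qgood_scal.
Qed.

Lemma E6_eq z : inH z -> E6 z = (E2 z * E4 z - 3 * qs (tq e4c) z)%C.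
Proof.
  intros Hz. assert (G := qgood_e2c). assert (G4 := qgood_e4c). unfold E6, e6c.
  rewrite qs_minus, qs_mult, qs_scal; auto using qgood_tq, qgood_conv, qgood_scal.
Qed.

(** The anomalies of [E2^2] and of the derivative of [E2] cancel because [2 PI i c2 = 12]. *)
Lemma E4_S z : inH z -> E4 (- / z)%C = (z ^ 4 * E4 z)%C.
Proof.
  intros Hz. assert (Nz := inH_neq0 z Hz). assert (G := qgood_e2c).
  rewrite !E4_eq by (auto using inH_S). rewrite E2_S by auto.
  assert (D1 := cderiv_comp (fun w => - / w)%C E2 z _ _ (S_deriv z Hz) (qs_dtq e2c _ G (inH_S z Hz))).
  assert (D2 := cderiv_plus _ _ z _ _
    (cderiv_mult (fun w => w ^ 2)%C E2 z _ _ (cderiv_pow _ z _ 2 (cderiv_id z)) (qs_dtq e2c z G Hz))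
    (cderiv_scal c2 _ z _ (cderiv_id z))).
  assert (D3 := cderiv_ext_H _ _ z _ Hz (fun w Hw => eq_sym (E2_S w Hw)) D2).
  assert (E := cderiv_unique _ _ _ _ D1 D3). cbv beta in E. clear D1 D2 D3.
  set (P := qs (tq e2c) (- / z)) in *. set (P0 := qs (tq e2c) z) in *.
  assert (NT := TPI_neq0). assert (HC := c2_eq). set (t := (2 * PI * Ci)%C) in *.
  assert (EP : P = (z ^ 2 / t * (2 * z * E2 z + z ^ 2 * (t * P0) + c2))%C).
  { transitivity (z ^ 2 / t * (t * P * / z ^ 2))%C. field; auto. rewrite E.
    replace (RtoC (INR 2)) with (RtoC 2) by (simpl; f_equal; ring). change (2 - 1)%nat with 1%nat. ring. }
  rewrite EP. 
  replace ((z ^ 2 * E2 z + c2 * z) * (z ^ 2 * E2 z + c2 * z) - 12 * (z ^ 2 / t * (2 * z * E2 z + z ^ 2 * (t * P0) + c2)))%C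
   with ((z ^ 2 * E2 z + c2 * z) * (z ^ 2 * E2 z + c2 * z) - t * c2 * (z ^ 2 / t * (2 * z * E2 z + z ^ 2 * (t * P0) + c2)) )%C
   by (rewrite HC; ring).
  transitivity (z ^ 4 * (E2 z * E2 z) - t * c2 * z ^ 4 * P0)%C. field; auto. rewrite HC. ring.
Qed.

Lemma E6_S z : inH z -> E6 (- / z)%C = (z ^ 6 * E6 z)%C.
Proof.
  intros Hz. assert (Nz := inH_neq0 z Hz).
  rewrite !E6_eq by (auto using inH_S). rewrite E2_S, E4_S by auto.
  assert (E := tq_S e4c 4 z qgood_e4c Hz E4_S). fold (E4 z) in E.
  set (P := qs (tq e4c) (- / z)) in *. set (P0 := qs (tq e4c) z) in *.
  assert (NT := TPI_neq0). assert (HC := c2_eq). set (t := (2 * PI * Ci)%C) in *.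
  assert (EP : P = (/ t * (z ^ 2 * (4 * z ^ 3 * E4 z + z ^ 4 * (t * P0))))%C).
  { transitivity (/ t * (t * P))%C. field; auto. rewrite E.
    replace (RtoC (INR 4)) with (RtoC 4) by (simpl; f_equal; ring). change (4 - 1)%nat with 3%nat. ring. }
  rewrite EP.
  transitivity (z ^ 6 * (E2 z * E4 z) + (c2 - 12 / t) * z ^ 5 * E4 z - 3 * z ^ 6 * P0)%C. field; auto.
  rewrite <- HC. replace (c2 - t * c2 / t)%C with (RtoC 0) by (field; auto). ring.
Qed.

(** The same construction one step further, in weight 8; it is later identified with [E4^2], which
    completes the differential equations. *)
Definition e8c (n : nat) : C := (conv e2c e6c n - 2 * tq e6c n)%C.

Lemma qgood_e8c : qgood e8c.
Proof.
  apply qgood_minus. apply qgood_conv. apply qgood_e2c. apply qgood_e6c. apply qgood_scal, qgood_tq, qgood_e6c.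
Qed.

Lemma e8c_eq z : inH z -> qs e8c z = (E2 z * E6 z - 2 * qs (tq e6c) z)%C.
Proof.
  intros Hz. assert (G := qgood_e2c). assert (G6 := qgood_e6c). unfold e8c.
  rewrite qs_minus, qs_mult, qs_scal; auto using qgood_tq, qgood_conv, qgood_scal.
Qed.

Lemma e8c_S z : inH z -> qs e8c (- / z)%C = (z ^ 8 * qs e8c z)%C.
Proof.
  intros Hz. assert (Nz := inH_neq0 z Hz).
  rewrite !e8c_eq by (auto using inH_S). rewrite E2_S, E6_S by auto.
  assert (E := tq_S e6c 6 z qgood_e6c Hz E6_S). fold (E6 z) in E.
  set (P := qs (tq e6c) (- / z)) in *. set (P0 := qs (tq e6c) z) in *.
  assert (NT := TPI_neq0). assert (HC := c2_eq). set (t := (2 * PI * Ci)%C) in *.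
  assert (EP : P = (/ t * (z ^ 2 * (6 * z ^ 5 * E6 z + z ^ 6 * (t * P0))))%C).
  { transitivity (/ t * (t * P))%C. field; auto. rewrite E.
    replace (RtoC (INR 6)) with (RtoC 6) by (simpl; f_equal; ring). change (6 - 1)%nat with 5%nat. ring. }
  rewrite EP.
  transitivity (z ^ 8 * (E2 z * E6 z) + (c2 - 12 / t) * z ^ 7 * E6 z - 2 * z ^ 8 * P0)%C. field; auto.
  rewrite <- HC. replace (c2 - t * c2 / t)%C with (RtoC 0) by (field; auto). ring.
Qed.

Lemma e2c_0 : e2c 0 = 1%C.
Proof. simpl. rewrite a0_eq. auto. Qed.
Lemma e2c_1 : e2c 1 = (- (24))%C.
Proof. unfold e2c. rewrite sig_1. ring. Qed.
Lemma tq_0 c : tq c 0 = 0%C.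
Proof. unfold tq. simpl. ring. Qed.
Lemma tq_1 c : tq c 1 = c 1%nat.
Proof. unfold tq. simpl. ring. Qed.
Lemma e4c_0 : e4c 0 = 1%C.
Proof. unfold e4c. rewrite conv_0, tq_0, e2c_0. ring. Qed.
Lemma e4c_1 : e4c 1 = 240%C.
Proof. unfold e4c. rewrite conv_1, tq_1, e2c_0, e2c_1. ring. Qed.
Lemma e6c_0 : e6c 0 = 1%C.
Proof. unfold e6c. rewrite conv_0, tq_0, e2c_0, e4c_0. ring. Qed.
Lemma e6c_1 : e6c 1 = (- (504))%C.
Proof. unfold e6c. rewrite conv_1, tq_1, e2c_0, e2c_1, e4c_0, e4c_1. ring. Qed.
Lemma e8c_0 : e8c 0 = 1%C.
Proof. unfold e8c. rewrite conv_0, tq_0, e2c_0, e6c_0. ring. Qed.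

Definition real_coef (c : nat -> C) : Prop := forall n, Im (c n) = 0.

Lemma real_conv a b : real_coef a -> real_coef b -> real_coef (conv a b).
Proof.
  intros Ha Hb n. unfold conv. induction (S n); [reflexivity|]. simpl Csum.
  replace (Im (Csum (fun k => a k * b (n - k)%nat) n0 + a n0 * b (n - n0)%nat)%C) with
    (Im (Csum (fun k => a k * b (n - k)%nat)%C n0) + (Re (a n0) * Im (b (n - n0)%nat) + Im (a n0) * Re (b (n - n0)%nat)))
    by reflexivity.
  rewrite IHn0, Ha, Hb. ring.
Qed.

Lemma real_minus (r : R) a b : real_coef a -> real_coef b -> real_coef (fun n => a n - r * b n)%C.
Proof. intros Ha Hb n. specialize (Ha n). specialize (Hb n). destruct (a n), (b n); simpl in *; subst. ring. Qed.

Lemma real_tq a : real_coef a -> real_coef (tq a).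
Proof. intros Ha n. specialize (Ha n). unfold tq. destruct (a n); simpl in *; subst. ring. Qed.

Lemma real_e2c : real_coef e2c.
Proof.
  intros n. destruct n; [reflexivity|]. unfold e2c. assert (H := sig_Im (S n)).
  destruct (sig (S n)); simpl in *; subst; ring.
Qed.

Lemma real_e4c : real_coef e4c.
Proof. apply real_minus. apply real_conv; apply real_e2c. apply real_tq, real_e2c. Qed.

Lemma real_e6c : real_coef e6c.
Proof. apply real_minus. apply real_conv. apply real_e2c. apply real_e4c. apply real_tq, real_e4c. Qed.

(** * A maximum principle for modular functions *)

Lemma not_max_of_second_deriv_pos (g g' : R -> R) x0 r p : 0 < r ->
  (forall x, Rabs (x - x0) < r -> is_derive g x (g' x)) -> is_derive g' x0 p ->
  (forall x, Rabs (x - x0) < r -> g x <= g x0) -> p <= 0.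
Proof.
  intros Hr Hg Hp Hm. apply Rnot_lt_le. intros Pp.
  apply is_derive_Reals in Hp. destruct (Hp (p / 2) ltac:(lra)) as (d & Hd).
  set (h0 := Rmin r d / 2).
  assert (Hh0 : 0 < h0 /\ h0 < r /\ h0 < d).
  { assert (0 < Rmin r d) by (apply Rmin_glb_lt; auto; apply cond_pos).
    generalize (Rmin_l r d) (Rmin_r r d). unfold h0; lra. }
  (* the symmetric second difference has nonnegative derivative g'(x0+h) - g'(x0-h) >= p h *)
  assert (HL : forall h, 0 < h < d -> g' x0 + p / 2 * h <= g' (x0 + h) /\ g' (x0 - h) <= g' x0 - p / 2 * h).
  { intros h Hh.
    assert (H1 := Hd h ltac:(lra) ltac:(rewrite Rabs_pos_eq; lra)).
    assert (H2 := Hd (- h) ltac:(lra) ltac:(rewrite Rabs_Ropp, Rabs_pos_eq; lra)).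
    apply Rabs_def2 in H1, H2. destruct H1 as [_ H1]. destruct H2 as [_ H2].
    assert (E1 : g' (x0 + h) - g' x0 = (g' (x0 + h) - g' x0) / h * h) by (field; lra).
    assert (E2 : g' (x0 + - h) - g' x0 = - ((g' (x0 + - h) - g' x0) / - h * h)) by (field; lra).
    replace (x0 - h) with (x0 + - h) by ring.
    assert (p / 2 * h <= (g' (x0 + h) - g' x0) / h * h) by (apply Rmult_le_compat_r; lra).
    assert (p / 2 * h <= (g' (x0 + - h) - g' x0) / - h * h) by (apply Rmult_le_compat_r; lra).
    lra. }
  assert (D : forall t, 0 <= t <= h0 ->
    is_derive (fun t => p / 2 * t ^ 2 - (g (x0 + t) + g (x0 - t))) t (p * t - (g' (x0 + t) - g' (x0 - t)))).
  { intros t Ht.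
    assert (A1 := Hg (x0 + t) ltac:(replace (x0 + t - x0) with t by ring; rewrite Rabs_pos_eq; lra)).
    assert (A2 := Hg (x0 - t) ltac:(replace (x0 - t - x0) with (- t) by ring; rewrite Rabs_Ropp, Rabs_pos_eq; lra)).
    assert (X1 : is_derive (fun t => x0 + t) t 1) by (auto_derive; auto).
    assert (X2 : is_derive (fun t => x0 - t) t (-1)) by (auto_derive; auto; ring).
    assert (X3 : is_derive (fun t => p / 2 * t ^ 2) t (p * t)) by (auto_derive; auto; field).
    assert (C1 := is_derive_comp g _ _ _ _ A1 X1). assert (C2 := is_derive_comp g _ _ _ _ A2 X2).
    assert (C3 := is_derive_minus _ _ _ _ _ X3 (is_derive_plus _ _ _ _ _ C1 C2)).
    replace (p * t - (g' (x0 + t) - g' (x0 - t))) with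
      (minus (p * t) (plus (scal 1 (g' (x0 + t))) (scal (-1) (g' (x0 - t))))).
    exact C3. unfold minus, opp, plus, scal; simpl. unfold mult; simpl. ring. }
  assert (L : p / 2 * h0 ^ 2 - (g (x0 + h0) + g (x0 - h0)) <= p / 2 * 0 ^ 2 - (g (x0 + 0) + g (x0 - 0))).
  { apply (nonincr_of_deriv _ _ _ _ (Rlt_le _ _ (proj1 Hh0)) D).
    intros t Ht. destruct (Req_dec t 0) as [->|Ht0].
    - rewrite Rplus_0_r, Rminus_0_r. lra.
    - destruct (HL t ltac:(lra)). lra. }
  rewrite Rplus_0_r, Rminus_0_r in L.
  assert (M1 := Hm (x0 + h0) ltac:(replace (x0 + h0 - x0) with h0 by ring; rewrite Rabs_pos_eq; lra)).
  assert (M2 := Hm (x0 - h0) ltac:(replace (x0 - h0 - x0) with (- h0) by ring; rewrite Rabs_Ropp, Rabs_pos_eq; lra)).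
  assert (0 < p / 2 * h0 ^ 2) by (apply Rmult_lt_0_compat; [|apply pow_lt]; lra). lra.
Qed.

(* Laplacian argument: [Re (lam W)] is harmonic, so adding a strictly convex function of [Im z] rules out a local maximum. *)
Lemma no_local_max (W W1 : C -> C) W2 (lam z0 : C) (phi phi1 : R -> R) p r : 0 < r ->
  (forall h, Cmod h < r -> cderiv W (z0 + h)%C (W1 (z0 + h)%C)) -> cderiv W1 z0 W2 ->
  (forall y, is_derive phi y (phi1 y)) -> is_derive phi1 (Im z0) p -> 0 < p ->
  (forall h, Cmod h < r -> Re (lam * W (z0 + h))%C + phi (Im (z0 + h)%C) <= Re (lam * W z0)%C + phi (Im z0)) -> False.
Proof.
  intros Hr HW HW1 Hphi Hphi1 Hp Hmax.
  assert (HX : Re (lam * W2)%C <= 0).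
  { apply (not_max_of_second_deriv_pos (fun t => Re (lam * W (z0 + 1 * RtoC t))%C)
      (fun t => Re (lam * (W1 (z0 + 1 * RtoC t) * 1))%C) 0 r); auto.
    - intros t Ht. rewrite Rminus_0_r in Ht. apply (rderiv_Re (fun t => W (z0 + 1 * RtoC t)%C)).
      apply (rderiv_comp W (fun t => z0 + 1 * RtoC t)%C); [apply rderiv_line|]. apply HW.
      rewrite Cmult_1_l, Cmod_R; auto.
    - replace W2 with (W2 * 1 * 1)%C by ring. apply (rderiv_Re (fun t => W1 (z0 + 1 * RtoC t) * 1)%C).
      apply (rderiv_comp (fun w => W1 w * 1)%C (fun t => z0 + 1 * RtoC t)%C); [apply rderiv_line|].
      rewrite Cmult_0_r, Cplus_0_r. apply cderiv_ext with W1. intros; ring. rewrite Cmult_1_r; auto.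
    - intros t Ht. rewrite Rminus_0_r in Ht. specialize (Hmax (1 * t)%C).
      rewrite Cmult_0_r, Cplus_0_r. rewrite Cmult_1_l in *. rewrite Cmod_R in Hmax. specialize (Hmax Ht).
      replace (Im (z0 + t)%C) with (Im z0) in Hmax by (simpl; unfold Im; ring). lra. }
  assert (HY : - Re (lam * W2)%C + p <= 0).
  { apply (not_max_of_second_deriv_pos (fun t => Re (lam * W (z0 + Ci * RtoC t))%C + phi (Im z0 + t))
      (fun t => Re (lam * (W1 (z0 + Ci * RtoC t) * Ci))%C + phi1 (Im z0 + t)) 0 r); auto.
    - intros t Ht. rewrite Rminus_0_r in Ht. apply (is_derive_plus (fun t => Re (lam * W (z0 + Ci * RtoC t))%C)).
      + apply (rderiv_Re (fun t => W (z0 + Ci * RtoC t)%C)).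
        apply (rderiv_comp W (fun t => z0 + Ci * RtoC t)%C); [apply rderiv_line|]. apply HW.
        rewrite Cmod_mult, Cmod_Ci, Cmod_R, Rmult_1_l; auto.
      + rewrite <- (Rmult_1_l (phi1 _)). apply (is_derive_comp phi (fun t => Im z0 + t)). apply Hphi. auto_derive; auto.
    - apply (is_derive_plus (fun t => Re (lam * (W1 (z0 + Ci * RtoC t) * Ci))%C)).
      + replace (- Re (lam * W2)%C) with (Re (lam * (W2 * Ci * Ci))%C).
        2:{ destruct lam, W2; simpl; ring. }
        apply (rderiv_Re (fun t => W1 (z0 + Ci * RtoC t) * Ci)%C).
        apply (rderiv_comp (fun w => W1 w * Ci)%C (fun t => z0 + Ci * RtoC t)%C); [apply rderiv_line|].
        rewrite Cmult_0_r, Cplus_0_r. apply cderiv_ext with (fun w => Ci * W1 w)%C. intros; ring.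
        rewrite (Cmult_comm W2). apply cderiv_scal; auto.
      + rewrite <- (Rmult_1_l p). apply (is_derive_comp phi1 (fun t => Im z0 + t)). rewrite Rplus_0_r; auto. auto_derive; auto.
    - intros t Ht. rewrite Rminus_0_r in Ht. specialize (Hmax (Ci * t)%C).
      rewrite Cmult_0_r, Cplus_0_r, Rplus_0_r. rewrite Cmod_mult, Cmod_Ci, Cmod_R, Rmult_1_l in Hmax. specialize (Hmax Ht).
      replace (Im (z0 + Ci * t)%C) with (Im z0 + t) in Hmax by (simpl; unfold Im; ring). lra. }
  lra.
Qed.

Lemma bounded_seq_cluster (u : nat -> C) B : (forall n, Cmod (u n) <= B) ->
  exists z, forall eps N, 0 < eps -> exists n, (N <= n)%nat /\ Cmod (u n - z)%C < eps.
Proof.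
  intros HB.
  assert (HR : forall n, - B <= Re (u n) <= B).
  { intros n. apply Rabs_le_between. eapply Rle_trans; [apply re_le_Cmod|auto]. }
  assert (HI : forall n, - B <= Im (u n) <= B).
  { intros n. apply Rabs_le_between. eapply Rle_trans; [apply Rabs_Im_le_Cmod|auto]. }
  assert (VA : forall v : nat -> R, (forall n, - B <= v n <= B) ->
    exists l, forall eps N, 0 < eps -> exists n, (N <= n)%nat /\ Rabs (v n - l) < eps).
  { intros v Hv. destruct (Bolzano_Weierstrass v (fun x => - B <= x <= B) (compact_P3 _ _) Hv) as (l & Hl).
    exists l. intros eps N He.
    destruct (Hl (disc l (mkposreal eps He)) N) as (p & Hp1 & Hp2).
    - exists (mkposreal eps He). intros x Hx; exact Hx.
    - exists p; split; auto. }
  destruct (VA _ HR) as (x & Hx).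
  assert (Sub : forall k : nat, exists n, (k <= n)%nat /\ Rabs (Re (u n) - x) < / INR (S k)).
  { intros k. apply Hx. apply Rinv_0_lt_compat, lt_0_INR; lia. }
  set (f := fun k => proj1_sig (ClassicalEpsilon.constructive_indefinite_description _ (Sub k))).
  assert (Hf : forall k, (k <= f k)%nat /\ Rabs (Re (u (f k)) - x) < / INR (S k)).
  { intros k. unfold f. destruct (ClassicalEpsilon.constructive_indefinite_description _ (Sub k)); auto. }
  destruct (VA (fun k => Im (u (f k)))) as (y & Hy). { intros; apply HI. }
  exists (x, y). intros eps N He.
  destruct (archimed_cor1 (eps / 2) ltac:(lra)) as (N0 & HN0 & HN0').
  destruct (Hy (eps / 2) (max N N0) ltac:(lra)) as (k & Hk & Hky).
  destruct (Hf k) as (Hf1 & Hf2). exists (f k). split; [lia|].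
  eapply Rle_lt_trans; [apply Cmod_le_ReIm|].
  replace (Re (u (f k) - (x, y))%C) with (Re (u (f k)) - x) by reflexivity.
  replace (Im (u (f k) - (x, y))%C) with (Im (u (f k)) - y) by reflexivity.
  assert (/ INR (S k) <= / INR N0).
  { apply Rinv_le_contravar. apply lt_0_INR; lia. apply le_INR; lia. }
  lra.
Qed.

(** Compactness in sequential form. A cluster point excludes an unbounded [u] by the same argument
    that produces the maximum. *)
Lemma attains_max (K : C -> Prop) (u : C -> R) B zs : K zs -> (forall z, K z -> Cmod z <= B) ->
  (forall z, (forall eps, 0 < eps -> exists w, K w /\ Cmod (w - z)%C < eps) -> K z) ->
  (forall z, K z -> forall eps, 0 < eps -> exists d, 0 < d /\ forall w, K w -> Cmod (w - z)%C < d -> Rabs (u w - u z) < eps) ->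
  exists z0, K z0 /\ forall z, K z -> u z <= u z0.
Proof.
  intros Hzs HB Hcl Hc.
  assert (Cl : forall v : nat -> C, (forall n, K (v n)) -> exists z0, K z0 /\ forall eps N, 0 < eps -> exists n, (N <= n)%nat /\ Rabs (u (v n) - u z0) < eps).
  { intros v Hv. destruct (bounded_seq_cluster v B) as (z0 & Hz0). { intros; auto. }
    assert (Kz : K z0). { apply Hcl. intros eps He. destruct (Hz0 eps 0%nat He) as (n & _ & Hn). exists (v n); auto. }
    exists z0. split; auto. intros eps N He. destruct (Hc z0 Kz eps He) as (d & Hd & Hd').
    destruct (Hz0 d N Hd) as (n & Hn1 & Hn2). exists n; split; auto. }
  destruct (Classical_Prop.classic (exists M, forall z, K z -> u z <= M)) as [[M HM]|HU].
  - destruct (completeness (fun r => exists z, K z /\ r = u z)) as (s & Hs1 & Hs2).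
    { exists M. intros r (z & Hz & ->); auto. } { exists (u zs), zs; auto. }
    assert (Sq : forall n : nat, exists z, K z /\ s - / INR (S n) < u z).
    { intros n. apply Classical_Prop.NNPP. intros A.
      assert (s <= s - / INR (S n)).
      { apply Hs2. intros r (z & Hz & ->). apply Rnot_lt_le. intros L. apply A; exists z; auto. }
      assert (0 < / INR (S n)) by (apply Rinv_0_lt_compat, lt_0_INR; lia). lra. }
    set (v := fun n => proj1_sig (ClassicalEpsilon.constructive_indefinite_description _ (Sq n))).
    assert (Hv : forall n, K (v n) /\ s - / INR (S n) < u (v n)).
    { intros n. unfold v. destruct (ClassicalEpsilon.constructive_indefinite_description _ (Sq n)); auto. }
    destruct (Cl v) as (z0 & Kz & Hz0). { intros; apply Hv. }
    exists z0. split; auto. intros z Hz.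
    apply Rle_trans with s. { apply Hs1. exists z; auto. }
    apply Rnot_lt_le. intros L.
    destruct (archimed_cor1 ((s - u z0) / 2) ltac:(lra)) as (N0 & HN0 & HN0').
    destruct (Hz0 ((s - u z0) / 2) N0 ltac:(lra)) as (n & Hn1 & Hn2).
    destruct (Hv n) as (_ & Hn3).
    assert (/ INR (S n) <= / INR N0).
    { apply Rinv_le_contravar. apply lt_0_INR; lia. apply le_INR; lia. }
    apply Rabs_def2 in Hn2. lra.
  - assert (Sq : forall n : nat, exists z, K z /\ INR n < u z).
    { intros n. apply Classical_Prop.NNPP. intros A. apply HU. exists (INR n). intros z Hz.
      apply Rnot_lt_le. intros L. apply A; exists z; auto. }
    set (v := fun n => proj1_sig (ClassicalEpsilon.constructive_indefinite_description _ (Sq n))).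
    assert (Hv : forall n, K (v n) /\ INR n < u (v n)).
    { intros n. unfold v. destruct (ClassicalEpsilon.constructive_indefinite_description _ (Sq n)); auto. }
    destruct (Cl v) as (z0 & Kz & Hz0). { intros; apply Hv. }
    destruct (INR_unbounded (u z0 + 1)) as (N & HN).
    destruct (Hz0 1 N Rlt_0_1) as (n & Hn1 & Hn2). destruct (Hv n) as (_ & Hn3).
    apply le_INR in Hn1. apply Rabs_def2 in Hn2. lra.
Qed.

Lemma phi_deriv (e d y : R) : is_derive (fun y => d * exp (- y) - e * y) y (- d * exp (- y) - e).
Proof. auto_derive; auto. ring. Qed.

Lemma phi_deriv2 (e d y : R) : is_derive (fun y => - d * exp (- y) - e) y (d * exp (- y)).
Proof. auto_derive; auto. ring. Qed.

Lemma Im_plus a b : Im (a + b)%C = Im a + Im b.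
Proof. reflexivity. Qed.

Lemma Re_plus a b : Re (a + b)%C = Re a + Re b.
Proof. reflexivity. Qed.

(** Sets cut out by Lipschitz inequalities are closed in the sense required by [attains_max]. *)
Lemma C_closed_le (K : C -> R) (L : R) z : (forall a b, Rabs (K a - K b) <= L * Cmod (a - b)%C) -> 0 < L ->
  (forall eps, 0 < eps -> exists w, 0 <= K w /\ Cmod (w - z)%C < eps) -> 0 <= K z.
Proof.
  intros HL PL H. apply Rnot_lt_le. intros A.
  destruct (H (- K z / L)) as (w & Hw & Hd). apply Rdiv_lt_0_compat; lra.
  assert (Q := HL w z). assert (L * Cmod (w - z)%C < L * (- K z / L)) by (apply Rmult_lt_compat_l; auto).
  replace (L * (- K z / L)) with (- K z) in H0 by (field; lra).
  generalize (Rle_abs (K w - K z)). lra.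
Qed.

Lemma Rabs_Re_sub a b : Rabs (Re a - Re b) <= 1 * Cmod (a - b)%C.
Proof. rewrite Rmult_1_l. apply (re_le_Cmod (a - b)%C). Qed.

Lemma Rabs_Im_sub a b : Rabs (Im a - Im b) <= 1 * Cmod (a - b)%C.
Proof. rewrite Rmult_1_l. apply (Rabs_Im_le_Cmod (a - b)%C). Qed.

Lemma harm_continuous (W : C -> C) l (lam z : C) (phi : R -> R) phi' eps : cderiv W z l ->
  is_derive phi (Im z) phi' -> 0 < eps ->
  exists d, 0 < d /\ forall w, Cmod (w - z)%C < d ->
    Rabs ((Re (lam * W w)%C + phi (Im w)) - (Re (lam * W z)%C + phi (Im z))) < eps.
Proof.
  intros HW Hphi He. assert (P := Cmod_ge_0 lam).
  assert (He' : 0 < eps / 2 / (Cmod lam + 1)) by (repeat apply Rdiv_lt_0_compat; lra).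
  destruct (cderiv_cont _ _ _ HW _ He') as (d & Hd & H).
  assert (Hc : continuity_pt phi (Im z)).
  { apply continuity_pt_filterlim. apply (ex_derive_continuous phi). eexists; apply Hphi. }
  destruct (Hc (eps / 2) ltac:(lra)) as (d2 & Hd2 & H2).
  exists (Rmin d d2). split; [apply Rmin_glb_lt; auto|]. intros w Hw.
  assert (Hw1 := Rlt_le_trans _ _ _ Hw (Rmin_l _ _)). assert (Hw2 := Rlt_le_trans _ _ _ Hw (Rmin_r _ _)).
  specialize (H (w - z)%C Hw1). replace (z + (w - z))%C with w in H by ring.
  assert (A : Rabs (Re (lam * W w)%C - Re (lam * W z)%C) < eps / 2).
  { replace (Re (lam * W w)%C - Re (lam * W z)%C) with (Re (lam * (W w - W z))%C) by (destruct lam, (W w), (W z); simpl; ring).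
    eapply Rle_lt_trans; [apply re_le_Cmod|]. rewrite Cmod_mult.
    apply Rle_lt_trans with ((Cmod lam + 1) * Cmod (W w - W z)%C).
    apply Rmult_le_compat_r; [apply Cmod_ge_0|lra].
    apply Rlt_le_trans with ((Cmod lam + 1) * (eps / 2 / (Cmod lam + 1))).
    apply Rmult_lt_compat_l; lra. right; field; lra. }
  assert (B : Rabs (phi (Im w) - phi (Im z)) < eps / 2).
  { destruct (Req_dec (Im w) (Im z)) as [->|N]. rewrite Rminus_diag, Rabs_R0; lra.
    apply H2. split. split; [exact I|auto]. simpl. unfold Rdist.
    eapply Rle_lt_trans; [apply (Rabs_Im_sub w z)|]. lra. }
  match goal with |- Rabs (?a + ?b - (?c + ?e)) < _ => replace (a + b - (c + e)) with ((a - c) + (b - e)) by ring end.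
  eapply Rle_lt_trans; [apply Rabs_triang|]. lra.
Qed.

(* Periodicity makes every point of a maximizing rectangle interior in the horizontal direction;
   the term [- e y] takes care of the upper end. *)
Lemma strip_max (W W1 W2 : C -> C) A B M : 0 < A ->
  (forall z, inH z -> W (z + 1)%C = W z) ->
  (forall z, inH z -> cderiv W z (W1 z)) -> (forall z, inH z -> cderiv W1 z (W2 z)) ->
  (forall z, A <= Im z -> Cmod (W z) <= B) -> (forall z, Im z = A -> Cmod (W z) <= M) ->
  forall z, A <= Im z -> Cmod (W z) <= M.
Proof.
  intros HA Hper HW HW1 HB HM z1 Hz1.
  assert (HM0 : 0 <= M). { eapply Rle_trans; [apply Cmod_ge_0|apply (HM (0, A)); auto]. }
  assert (HB0 : 0 <= B). { eapply Rle_trans; [apply Cmod_ge_0|apply (HB z1); auto]. }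
  (* Rotation by the conjugate value turns the modulus at [z1] into a real part, which is
     harmonic. *)
  set (lam := Cconj (W z1)). set (L := Cmod lam). assert (HL : 0 <= L) by apply Cmod_ge_0.
  assert (Claim : forall e d, 0 < e -> 0 < d ->
    Re (lam * W z1)%C + (d * exp (- Im z1) - e * Im z1) <= L * M + (d - e * A)).
  { intros e d He Hd. set (phi := fun y => d * exp (- y) - e * y).
    set (u := fun z => Re (lam * W z)%C + phi (Im z)).
    (* At height [Y] the loss [e * y] outweighs the a priori bound [B]. *)
    set (Y := Rmax (Im z1) (A + L * B / e)).
    assert (HY1 : Im z1 <= Y) by apply Rmax_l. assert (HY2 : A + L * B / e <= Y) by apply Rmax_r.
    assert (HYA : A <= Y) by lra.
    set (K := fun z : C => 0 <= 1 - Re z /\ 0 <= 1 + Re z /\ 0 <= Im z - A /\ 0 <= Y - Im z).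
    assert (Ebound : forall y, A <= y -> exp (- y) <= 1).
    { intros y Hy. rewrite <- exp_0. apply exp_le. lra. }
    destruct (attains_max K u (1 + Y) (0, A)) as (z0 & Kz0 & Hz0).
    - unfold K; simpl. lra.
    - intros z (K1 & K2 & K3 & K4). eapply Rle_trans; [apply Cmod_le_ReIm|].
      apply Rplus_le_compat; apply Rabs_le; lra.
    - intros z Hz.
      assert (F : forall f : C -> R, (forall a b, Rabs (f a - f b) <= 1 * Cmod (a - b)%C) ->
        (forall w, K w -> 0 <= f w) -> 0 <= f z).
      { intros f Hf HK. apply (C_closed_le f 1); auto; [lra|]. intros eps He'. destruct (Hz eps He') as (w & Kw & Hw).
        exists w; auto. }
      split; [|split; [|split]].
      + apply (F (fun w => 1 - Re w)). intros a b. replace (1 - Re a - (1 - Re b)) with (- (Re a - Re b)) by ring.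
        rewrite Rabs_Ropp. apply Rabs_Re_sub. intros w Kw; apply Kw.
      + apply (F (fun w => 1 + Re w)). intros a b. replace (1 + Re a - (1 + Re b)) with (Re a - Re b) by ring.
        apply Rabs_Re_sub. intros w Kw; apply Kw.
      + apply (F (fun w => Im w - A)). intros a b. replace (Im a - A - (Im b - A)) with (Im a - Im b) by ring.
        apply Rabs_Im_sub. intros w Kw; apply Kw.
      + apply (F (fun w => Y - Im w)). intros a b. replace (Y - Im a - (Y - Im b)) with (- (Im a - Im b)) by ring.
        rewrite Rabs_Ropp. apply Rabs_Im_sub. intros w Kw; apply Kw.
    - intros z (K1 & K2 & K3 & K4) eps Heps. assert (Hz : inH z) by (unfold inH; lra).
      destruct (harm_continuous W _ lam z phi _ eps (HW z Hz) (phi_deriv e d (Im z)) Heps) as (dd & Hdd & H).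
      exists dd. split; [auto|]. intros w _ Hw. apply H; auto.
    - assert (Per : forall z, A <= Im z <= Y -> u z <= u z0).
      { intros z Hz. assert (Hzi : inH z) by (unfold inH; lra).
        destruct (periodic_int W Hper z Hzi) as (z' & E & X & I').
        assert (u z = u z') by (unfold u; rewrite E, I'; auto). rewrite H. apply Hz0.
        apply Rabs_le_between in X. unfold K. lra. }
      assert (U1 : u z1 <= u z0) by (apply Per; lra).
      assert (Top : u z0 <= L * M + (d - e * A)); [|unfold u, phi in U1, Top |- *; lra].
      destruct Kz0 as (K1 & K2 & K3 & K4).
      assert (Rel : Re (lam * W z0)%C <= L * Cmod (W z0)).
      { eapply Rle_trans; [apply Re_le_Cmod|]. rewrite Cmod_mult. unfold L; lra. }
      assert (E0 := Ebound (Im z0) ltac:(lra)).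
      assert (E1 : d * exp (- Im z0) <= d) by (rewrite <- (Rmult_1_r d) at 2; apply Rmult_le_compat_l; lra).
      destruct (Req_dec (Im z0) A) as [EA|NA].
      { assert (L * Cmod (W z0) <= L * M) by (apply Rmult_le_compat_l; auto).
        unfold u, phi. rewrite EA in *. lra. }
      destruct (Req_dec (Im z0) Y) as [EY|NY].
      { assert (L * Cmod (W z0) <= L * B) by (apply Rmult_le_compat_l; auto; apply HB; lra).
        assert (e * (A + L * B / e) <= e * Y) by (apply Rmult_le_compat_l; lra).
        replace (e * (A + L * B / e)) with (e * A + L * B) in H0 by (field; lra).
        assert (0 <= L * M) by (apply Rmult_le_pos; auto).
        unfold u, phi. rewrite EY in *. lra. }
      exfalso. set (r := Rmin (Im z0 - A) (Y - Im z0)).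
      assert (Hr : 0 < r) by (apply Rmin_glb_lt; lra).
      assert (In : forall h, Cmod h < r -> A < Im (z0 + h)%C < Y).
      { intros h Hh. assert (Q := Rabs_Im_le_Cmod h). rewrite Im_plus.
        assert (r <= Im z0 - A) by apply Rmin_l. assert (r <= Y - Im z0) by apply Rmin_r.
        assert (Rabs (Im h) < r) by lra. apply Rabs_def2 in H1. lra. }
      apply (no_local_max W W1 (W2 z0) lam z0 phi (fun y => - d * exp (- y) - e) (d * exp (- Im z0)) r); auto.
      + intros h Hh. apply HW. specialize (In h Hh). unfold inH; lra.
      + apply HW1. unfold inH; lra.
      + intros y. apply phi_deriv.
      + apply phi_deriv2.
      + apply Rmult_lt_0_compat; auto. apply exp_pos.
      + intros h Hh. apply (Per (z0 + h)%C). specialize (In h Hh). lra. }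
  assert (Fin : Re (lam * W z1)%C <= L * M).
  { apply Rnot_lt_le. intros Lt. set (g := Re (lam * W z1)%C - L * M) in *.
    assert (Pz : 0 < 1 + Im z1) by lra.
    specialize (Claim (g / (2 * (1 + Im z1))) (g / 2)). 
    assert (0 < g) by (unfold g; lra).
    specialize (Claim ltac:(apply Rdiv_lt_0_compat; lra) ltac:(lra)).
    assert (E1 : 0 < g / 2 * exp (- Im z1)) by (apply Rmult_lt_0_compat; [lra|apply exp_pos]).
    assert (E2 : g / (2 * (1 + Im z1)) * (Im z1 - A) < g / 2).
    { replace (g / 2) with (g / (2 * (1 + Im z1)) * (1 + Im z1)) by (field; lra).
      apply Rmult_lt_compat_l. apply Rdiv_lt_0_compat; lra. lra. }
    unfold g in *. lra. }
  assert (E : Re (lam * W z1)%C = Cmod (W z1) ^ 2).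
  { unfold lam. rewrite Cmod2_alt. destruct (W z1); simpl; ring. }
  assert (EL : L = Cmod (W z1)) by (unfold L, lam; apply Cmod_conj).
  rewrite E, EL in Fin. destruct (Req_dec (Cmod (W z1)) 0) as [Z|Z]. rewrite Z; auto.
  assert (0 < Cmod (W z1)) by (generalize (Cmod_ge_0 (W z1)); lra).
  apply Rmult_le_reg_l with (Cmod (W z1)); auto. simpl in Fin. lra.
Qed.

Lemma exp_ge_pow x n : 0 <= x -> (1 + x / INR (S n)) ^ (S n) <= exp x.
Proof.
  intros Hx. assert (P : 0 < INR (S n)) by (apply lt_0_INR; lia).
  assert (0 <= x / INR (S n)) by (apply Rdiv_le_0_compat; auto).
  apply Rle_trans with ((exp (x / INR (S n))) ^ (S n)).
  - apply pow_incr. split; [lra|]. destruct (Req_dec (x / INR (S n)) 0) as [E|E].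
    rewrite E, exp_0; lra. left; apply exp_ineq1; auto.
  - rewrite <- (Rpower_pow (S n) (exp _)) by apply exp_pos. unfold Rpower. rewrite ln_exp.
    right; f_equal; field; lra.
Qed.

(* The fundamental domain lies above the line [Im z = hA], and [- / z] lies above it for [z] on its segment [|Re z| <= 1/2]. *)
Definition hA : R := 3 / 4.

Lemma Rle_pow_le1 x m n : 0 < x <= 1 -> (m <= n)%nat -> x ^ n <= x ^ m.
Proof.
  intros Hx H. replace n with (m + (n - m))%nat by lia. rewrite pow_add.
  assert (0 < x ^ m) by (apply pow_lt; lra).
  assert (x ^ (n - m) <= 1) by (rewrite <- (pow1 (n - m)); apply pow_incr; lra).
  rewrite <- (Rmult_1_r (x ^ m)) at 2. apply Rmult_le_compat_l; lra.
Qed.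

(** Here [r] is |z|^2 on the line. For [/ r >= 16 / 13] the exponential decays faster than the fifth
    power grows, so the worst case is the corner |Re z| = 1/2, where the product is still below 1.
    The fifth power of [r] corresponds to weight 10. *)
Lemma contraction_bound r : 9 / 16 <= r <= 13 / 16 ->
  / r ^ 5 * exp (- 2 * PI * (hA / r - hA)) <= 98 / 100.
Proof.
  intros Hr. assert (HP := PI_bounds). set (t := / r). set (t0 := 16 / 13).
  assert (Ht : t0 <= t).
  { unfold t, t0. replace (16 / 13) with (/ (13 / 16)) by field. apply Rinv_le_contravar; lra. }
  (* [65 / 16 = 5 / t0]: this is [x <= exp (x - 1)] at [x = t / t0], raised to the fifth power. *)
  assert (E1 : t ^ 5 <= t0 ^ 5 * exp (65 / 16 * (t - t0))).
  { replace t with (t0 * (t / t0)) at 1 by (unfold t0; field). rewrite Rpow_mult_distr.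
    apply Rmult_le_compat_l; [unfold t0; apply pow_le; lra|].
    replace (65 / 16 * (t - t0)) with (INR 5 * (t / t0 - 1)) by (simpl; unfold t0; field).
    assert (B : t / t0 <= exp (t / t0 - 1)).
    { destruct (Req_dec (t / t0 - 1) 0) as [E|E]. rewrite E, exp_0; lra. generalize (exp_ineq1 _ E); lra. }
    assert (0 <= t / t0) by (apply Rdiv_le_0_compat; unfold t0 in *; lra).
    replace (exp (INR 5 * (t / t0 - 1))) with ((exp (t / t0 - 1)) ^ 5).
    apply pow_incr; lra. rewrite <- (Rpower_pow 5) by apply exp_pos. unfold Rpower. rewrite ln_exp. auto. }
  assert (E2 : exp (-2 * PI * (hA / r - hA)) <= exp (- (4.71 * 3 / 13)) * exp (- (65 / 16 * (t - t0)))).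
  { rewrite <- exp_plus. apply exp_le. unfold hA. replace (3 / 4 / r - 3 / 4) with (3 / 4 * (t - 1)) by (unfold t; field; lra).
    replace (t - 1) with ((t - t0) + 3 / 13) by (unfold t0; field). 
    assert (3.14 * (t - t0 + 3 / 13) <= PI * (t - t0 + 3 / 13)) by (apply Rmult_le_compat_r; lra). lra. }
  rewrite <- pow_inv. fold t.
  apply Rle_trans with ((t0 ^ 5 * exp (65 / 16 * (t - t0))) * (exp (- (4.71 * 3 / 13)) * exp (- (65 / 16 * (t - t0))))).
  { apply Rmult_le_compat; auto. apply pow_le; unfold t0 in Ht; lra. left; apply exp_pos. }
  replace (t0 ^ 5 * exp (65 / 16 * (t - t0)) * (exp (- (4.71 * 3 / 13)) * exp (- (65 / 16 * (t - t0))))) with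
    (t0 ^ 5 * exp (- (4.71 * 3 / 13)) * (exp (65 / 16 * (t - t0)) * exp (- (65 / 16 * (t - t0))))) by ring.
  rewrite <- exp_plus, Rplus_opp_r, exp_0, Rmult_1_r, exp_Ropp.
  assert (E3 := exp_ge_pow (4.71 * 3 / 13) 31 ltac:(lra)). 
  replace (INR 32) with 32 in E3 by (simpl; ring).
  assert (E4 : 2.89 <= (1 + 4.71 * 3 / 13 / 32) ^ 32).
  { apply Rle_trans with (1.0339 ^ 32). lra. apply pow_incr. lra. }
  apply Rmult_le_reg_r with (exp (4.71 * 3 / 13)); [apply exp_pos|].
  rewrite Rmult_assoc, Rinv_l, Rmult_1_r by (apply Rgt_not_eq, exp_pos).
  unfold t0. lra.
Qed.

Lemma Im_S z : Im (- / z)%C = Im z / Cmod z ^ 2.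
Proof. rewrite Cmod2_alt. destruct z; simpl. unfold Rdiv. ring. Qed.

Lemma line_norm z : Im z = hA -> Rabs (Re z) <= / 2 -> 9 / 16 <= Cmod z ^ 2 <= 13 / 16.
Proof.
  intros Hi Hr. rewrite Cmod2_alt, Hi. rewrite <- (pow2_abs (Re z)). unfold hA.
  assert (0 <= Rabs (Re z) ^ 2 <= (/ 2) ^ 2). { split. apply pow2_ge_0. apply pow_incr. split; auto. apply Rabs_pos. }
  lra.
Qed.

(** What the Laplacian argument uses of holomorphy. *)
Definition twice_diff (V : C -> C) : Prop := exists V1 V2 : C -> C,
  (forall z, inH z -> cderiv V z (V1 z)) /\ (forall z, inH z -> cderiv V1 z (V2 z)).

Lemma twice_diff_mult V W : twice_diff V -> twice_diff W -> twice_diff (fun z => V z * W z)%C.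
Proof.
  intros (V1 & V2 & HV & HV1) (W1 & W2 & HW & HW1).
  exists (fun z => V1 z * W z + V z * W1 z)%C, (fun z => (V2 z * W z + V1 z * W1 z) + (V1 z * W1 z + V z * W2 z))%C.
  split; intros z Hz. apply cderiv_mult; auto. apply cderiv_plus; apply cderiv_mult; auto.
Qed.

Lemma twice_diff_inv (V : C -> C) : (forall z, V z <> 0%C) -> twice_diff V -> twice_diff (fun z => / V z)%C.
Proof.
  intros HN (V1 & V2 & HV & HV1).
  exists (fun z => - V1 z / (V z ^ 2))%C.
  eexists. split; intros z Hz. apply cderiv_inv; auto.
  apply cderiv_div. apply Cpow_nz; auto. apply cderiv_opp; auto. apply cderiv_pow; auto.
Qed.

Lemma twice_diff_pow V n : twice_diff V -> twice_diff (fun z => V z ^ n)%C.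
Proof.
  intros H. induction n.
  exists (fun _ => 0%C), (fun _ => 0%C). split; intros; [apply (cderiv_const 1%C)|apply cderiv_const].
  apply (twice_diff_mult V (fun z => V z ^ n)%C); auto.
Qed.

Lemma twice_diff_qs c : qgood c -> twice_diff (qs c).
Proof.
  intros H. exists (qs (dq c)), (qs (dq (dq c))). split; intros; apply qs_deriv; auto. apply qgood_dq; auto.
Qed.

Lemma twice_diff_qq : twice_diff qq.
Proof.
  exists (fun z => 2 * PI * Ci * qq z)%C, (fun z => 2 * PI * Ci * (2 * PI * Ci * qq z))%C.
  split; intros; [|apply cderiv_scal]; apply qq_deriv.
Qed.

Lemma twice_diff_Delta : twice_diff Delta.
Proof.
  exists (fun z => 2 * PI * Ci * E2 z * Delta z)%C. eexists. split; intros. apply Delta_deriv; auto.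
  apply cderiv_mult; [apply cderiv_scal, qs_deriv; auto; apply qgood_e2c|apply Delta_deriv; auto].
Qed.

Lemma twice_diff_const c : twice_diff (fun _ => c).
Proof. exists (fun _ => 0%C), (fun _ => 0%C). split; intros; apply cderiv_const. Qed.

Lemma twice_diff_minus V W : twice_diff V -> twice_diff W -> twice_diff (fun z => V z - W z)%C.
Proof.
  intros (V1 & V2 & HV & HV1) (W1 & W2 & HW & HW1).
  exists (fun z => V1 z - W1 z)%C, (fun z => V2 z - W2 z)%C. split; intros; apply cderiv_minus; auto.
Qed.

(* [|V(z)| <= |z|^{-s} |V(-1/z)| + d] and [V = O(q)] with [-1/z] strictly higher than [z]: a contraction. *)
Lemma modular_bound (V : C -> C) B s d : (s <= 10)%nat -> twice_diff V ->
  (forall z, inH z -> V (z + 1)%C = V z) ->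
  (forall z, hA <= Im z -> Cmod (V z) <= B * Cmod (qq z)) ->
  (forall z, Im z = hA -> Rabs (Re z) <= / 2 -> Cmod (V z - / z ^ s * V (- / z))%C <= d) ->
  forall z, hA <= Im z -> Cmod (V z) <= 50 * d.
Proof.
  intros Hs HD Hper HB Hd.
  set (qA := exp (- 2 * PI * hA)). assert (HqA : 0 < qA) by apply exp_pos.
  assert (HQ : forall z, Im z = hA -> Cmod (qq z) = qA) by (intros z E; rewrite Cmod_qq, E; auto).
  destruct (completeness (fun r => exists z, Im z = hA /\ r = Cmod (V z))) as (S & HS1 & HS2).
  { exists (B * qA). intros r (z & Hz & ->). rewrite <- (HQ z Hz). apply HB; lra. }
  { exists (Cmod (V (0, hA))), (0, hA). auto. }
  assert (HS : forall z, Im z = hA -> Cmod (V z) <= S) by (intros z Hz; apply HS1; exists z; auto).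
  (* The maximum principle is applied to [V / q], which gains a factor |q| above the line. *)
  assert (HW : forall z, hA <= Im z -> Cmod (V z) <= S * (Cmod (qq z) / qA)).
  { intros z Hz. assert (Nq := qq_neq0 z). assert (Pq : 0 < Cmod (qq z)) by (apply Cmod_pos; auto).
    destruct (twice_diff_mult V (fun z => / qq z)%C HD (twice_diff_inv qq qq_neq0 twice_diff_qq)) as (W1 & W2 & HW & HW1).
    assert (M := strip_max (fun w => V w * / qq w)%C W1 W2 hA B (S / qA) ltac:(unfold hA; lra)).
    assert (Hz' : Cmod (V z * / qq z)%C <= S / qA).
    { apply M; auto.
      - intros w Hw. rewrite Hper, qq_period; auto.
      - intros w Hw. assert (Pw : 0 < Cmod (qq w)) by (apply Cmod_pos, qq_neq0).
        rewrite Cmod_mult, Cmod_inv by apply qq_neq0. apply Rmult_le_reg_r with (Cmod (qq w)); auto.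
        rewrite Rmult_assoc, Rinv_l, Rmult_1_r by lra. auto.
      - intros w Hw. rewrite Cmod_mult, Cmod_inv, HQ by (auto; apply qq_neq0).
        apply Rmult_le_compat_r; auto. left; apply Rinv_0_lt_compat; auto. }
    rewrite Cmod_mult, Cmod_inv in Hz' by auto. apply Rmult_le_reg_r with (/ Cmod (qq z)).
    apply Rinv_0_lt_compat; auto. eapply Rle_trans; [apply Hz'|]. right; field; lra. }
  assert (HS0 : 0 <= S) by (eapply Rle_trans; [apply Cmod_ge_0|apply (HS (0, hA)); auto]).
  assert (Con : forall z, Im z = hA -> Rabs (Re z) <= / 2 -> Cmod (V z) <= d + 98 / 100 * S).
  { intros z Hz Hx. assert (N := line_norm z Hz Hx). assert (Hzi : inH z) by (unfold inH; rewrite Hz; unfold hA; lra).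
    assert (Nz := inH_neq0 z Hzi).
    set (rr := Cmod z ^ 2) in *. assert (Pz : 0 < Cmod z) by (apply Cmod_pos; auto).
    assert (P1 : Cmod z <= 1). { apply Rsqr_incr_0_var; [|lra]. unfold Rsqr. unfold rr in N. simpl in N. lra. }
    replace (V z) with ((V z - / z ^ s * V (- / z)) + / z ^ s * V (- / z))%C by ring.
    eapply Rle_trans; [apply Cmod_triangle|]. apply Rplus_le_compat; auto.
    rewrite Cmod_mult, Cmod_inv, Cmod_pow by (apply Cpow_nz; auto).
    assert (Hi : Im (- / z)%C = hA / rr) by (rewrite Im_S, Hz; auto).
    assert (Hge : hA <= hA / rr).
    { unfold hA. apply Rmult_le_reg_r with rr; [lra|]. unfold Rdiv at 2. rewrite Rmult_assoc, Rinv_l; lra. }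
    assert (HV := HW (- / z)%C ltac:(lra)).
    assert (C1 := contraction_bound rr N).
    assert (E1 : Cmod (qq (- / z)) / qA = exp (- 2 * PI * (hA / rr - hA))).
    { rewrite Cmod_qq, Hi. unfold qA, Rdiv at 1. rewrite <- exp_Ropp, <- exp_plus. f_equal. ring. }
    rewrite E1 in HV.
    assert (E2 : / Cmod z ^ s <= / rr ^ 5).
    { apply Rinv_le_contravar. apply pow_lt; lra. unfold rr. rewrite <- pow_mult.
      apply Rle_pow_le1; auto. }
    apply Rle_trans with (/ rr ^ 5 * (S * exp (-2 * PI * (hA / rr - hA)))).
    - apply Rmult_le_compat; auto. left; apply Rinv_0_lt_compat, pow_lt; auto. apply Cmod_ge_0.
    - replace (/ rr ^ 5 * (S * exp (-2 * PI * (hA / rr - hA)))) with (/ rr ^ 5 * exp (-2 * PI * (hA / rr - hA)) * S) by ring.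
      apply Rmult_le_compat_r; auto. }
  (* This inequality gives [S <= 50 d], the constant of the statement. *)
  assert (SB : S <= d + 98 / 100 * S).
  { apply HS2. intros r (z & Hz & ->). assert (Hzi : inH z) by (unfold inH; rewrite Hz; unfold hA; lra).
    destruct (periodic_int V Hper z Hzi) as (z' & E & X & I'). rewrite E. apply Con; auto. rewrite I'; auto. }
  intros z Hz. eapply Rle_trans; [apply HW; auto|].
  assert (Cmod (qq z) / qA <= 1).
  { apply Rmult_le_reg_r with qA; auto. unfold Rdiv. rewrite Rmult_assoc, Rinv_l by lra.
    assert (Q := Cmod_qq_le hA z Hz). fold qA in Q. lra. }
  apply Rle_trans with (S * 1); [apply Rmult_le_compat_l; auto|lra].
Qed.

(** * Bounds for approximately modular forms *)

Lemma INR_le_pow2 n : INR (S n) <= 2 ^ n.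
Proof.
  induction n. simpl; lra. rewrite S_INR. simpl pow.
  assert (1 <= 2 ^ n) by (apply pow_R1_Rle; lra). lra.
Qed.

Lemma qs_s1_bound z : inH z -> Cmod (qq z) < / 2 -> Cmod (qs s1 z) <= Cmod (qq z) / (1 - 2 * Cmod (qq z)).
Proof.
  intros Hz Hq. set (r := Cmod (qq z)) in *. assert (Pr := qq_lt1 z Hz). fold r in Pr.
  unfold qs. rewrite CS_incr_1 by (apply qgood_summable; auto; apply qgood_s1).
  rewrite s1_0, Cmult_0_l, Cplus_0_l.
  replace (r / (1 - 2 * r)) with (Series (fun n => r * (2 * r) ^ n)).
  2:{ rewrite Series_scal_l, Series_geom by (rewrite Rabs_pos_eq; lra). reflexivity. }
  apply Cmod_CS_le; [|apply ex_series_scalR, ex_series_geom; rewrite Rabs_pos_eq; lra].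
  intros n. rewrite Cmod_mult, Cmod_pow. fold r. assert (B := s1_bound (S n) ltac:(lia)).
  assert (B2 := INR_le_pow2 n). rewrite Rpow_mult_distr. simpl pow.
  assert (0 < r ^ n) by (apply pow_lt; lra).
  apply Rle_trans with (2 ^ n * (r * r ^ n)); [|lra]. apply Rmult_le_compat_r; [|lra].
  apply Rmult_le_pos; lra.
Qed.

Lemma qq_hA z : hA <= Im z -> Cmod (qq z) <= / 94.
Proof.
  intros Hz. eapply Rle_trans; [apply (Cmod_qq_le hA z Hz)|]. assert (HP := PI_bounds).
  apply Rle_trans with (exp (- (4.71))). apply exp_le. unfold hA; lra.
  rewrite exp_Ropp. apply Rinv_le_contravar; [lra|].
  assert (E := exp_ge_pow 4.71 63 ltac:(lra)). replace (INR 64) with 64 in E by (simpl; ring).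
  assert (94 <= (1 + 4.71 / 64) ^ 64); [|lra].
  replace ((1 + 4.71 / 64) ^ 64) with (((1 + 4.71 / 64) ^ 8) ^ 8) by (rewrite <- pow_mult; reflexivity).
  apply Rle_trans with (1.7648 ^ 8). lra. apply pow_incr. lra.
Qed.

Lemma inH_hA z : hA <= Im z -> inH z.
Proof. unfold inH, hA. lra. Qed.

(** For |q| <= 1/94 the bound is 24/92. Up to sign this is the logarithm of [Delta / q], so [Delta]
    and q are comparable up to [exp 0.3]. *)
Lemma s1_small z : hA <= Im z -> Cmod (24 * qs s1 z)%C <= 0.3.
Proof.
  intros Hz. assert (Q := qq_hA z Hz). assert (P := qq_lt1 z (inH_hA z Hz)).
  rewrite Cmod_mult, Cmod_R, Rabs_pos_eq by lra.
  assert (B := qs_s1_bound z (inH_hA z Hz) ltac:(lra)).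
  assert (Cmod (qq z) / (1 - 2 * Cmod (qq z)) <= / 94 / (1 - 2 * / 94)).
  { unfold Rdiv. apply Rmult_le_compat; try lra. left; apply Rinv_0_lt_compat; lra.
    apply Rinv_le_contravar; lra. }
  lra.
Qed.

Lemma s1_Oq z : hA <= Im z -> Cmod (qs s1 z) <= 2 * Cmod (qq z).
Proof.
  intros Hz. assert (Q := qq_hA z Hz). assert (P := qq_lt1 z (inH_hA z Hz)).
  eapply Rle_trans; [apply qs_s1_bound; [apply inH_hA; auto|lra]|].
  unfold Rdiv. rewrite Rmult_comm. apply Rmult_le_compat_r; [lra|].
  apply Rle_trans with (/ (/ 2)); [apply Rinv_le_contravar; lra|rewrite Rinv_inv; lra].
Qed.

Lemma Cmod_Delta z : Cmod (Delta z) = exp (- 2 * PI * Im z - Re (24 * qs s1 z)%C).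
Proof.
  unfold Delta. rewrite Cmod_Cexp, a0_eq. f_equal. destruct z, (qs s1 _); simpl. ring.
Qed.

Lemma Delta_bounds z : hA <= Im z -> exp (- 2 * PI * Im z - 0.3) <= Cmod (Delta z) <= exp (- 2 * PI * Im z + 0.3).
Proof.
  intros Hz. rewrite Cmod_Delta. assert (B := s1_small z Hz).
  assert (R := re_le_Cmod (24 * qs s1 z)%C). 
  assert (H := proj1 (Rabs_le_between _ _) (Rle_trans _ _ _ R B)).
  split; apply exp_le; lra.
Qed.

Lemma Delta_period z : Delta (z + 1)%C = Delta z.
Proof.
  unfold Delta. rewrite qs_period, a0_eq.
  replace (2 * PI * Ci * 1%R * (z + 1) - 24 * qs s1 z)%C with (2 * PI * Ci * 1%R * z - 24 * qs s1 z + 2 * PI * Ci)%C by ring.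
  rewrite Cexp_add. assert (E := qq_period 0%C). unfold qq in E.
  rewrite Cplus_0_l, Cmult_0_r, Cexp_0 in E. replace (2 * PI * Ci * 1)%C with (2 * PI * Ci)%C in E by ring.
  rewrite E. ring.
Qed.

Lemma Delta_qq z : Delta z = (qq z * Cexp (- (24 * qs s1 z)))%C.
Proof. unfold Delta, qq. rewrite <- Cexp_add, a0_eq. f_equal. ring. Qed.

Lemma Delta_conj z : Cconj (Delta z) = Delta (- Cconj z)%C.
Proof.
  rewrite !Delta_qq, Cmult_conj, qq_conj, Cexp_conj. do 2 f_equal.
  rewrite Copp_conj, Cmult_conj, qs_conj. f_equal. f_equal. apply Ceq; simpl; ring.
  intros n. unfold s1. assert (H := sig_Im n). destruct n. simpl. ring.
  rewrite <- (re_RtoC (INR (S n))). unfold Cdiv. rewrite <- RtoC_inv by (apply not_0_INR; lia).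
  rewrite im_scal_r, H. ring.
Qed.

(** A form is given by its coefficients. Translation invariance is built into [qs], so only the
    inversion remains to be required. *)
Definition is_form (c : nat -> C) (k : nat) : Prop :=
  qgood c /\ forall z, inH z -> qs c (- / z)%C = (z ^ k * qs c z)%C.

Definition lead (c : nat -> C) (i : nat) : Prop := (forall n, (n < i)%nat -> c n = 0%C) /\ c i = 1%C.

Lemma is_form_conv c d j k : is_form c j -> is_form d k -> is_form (conv c d) (j + k).
Proof.
  intros [Gc Hc] [Gd Hd]. split. apply qgood_conv; auto. intros z Hz.
  rewrite !qs_mult, Hc, Hd, Cpow_add_r by (auto using inH_S). ring.
Qed.

Lemma is_form_lin (r : C) c d k : is_form c k -> is_form d k -> is_form (fun n => c n - r * d n)%C k.
Proof.
  intros [Gc Hc] [Gd Hd]. split. apply qgood_minus; auto. apply qgood_scal; auto. intros z Hz.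
  rewrite !qs_minus, !qs_scal, Hc, Hd by (auto using inH_S, qgood_scal). ring.
Qed.

Lemma Csum_zero (a : nat -> C) N : (forall n, (n < N)%nat -> a n = 0%C) -> Csum a N = 0%C.
Proof.
  intros H. rewrite (Csum_ext a (fun _ => 0 * 0)%C) by (intros; rewrite H by auto; ring).
  rewrite Csum_scal. ring.
Qed.

Lemma conv_order (c d : nat -> C) i j n : (forall n, (n < i)%nat -> c n = 0%C) -> (forall n, (n < j)%nat -> d n = 0%C) ->
  (n < i + j)%nat -> conv c d n = 0%C.
Proof.
  intros Hc Hd Hn. unfold conv. apply Csum_zero. intros k Hk.
  destruct (lt_dec k i). rewrite Hc by auto; ring. rewrite (Hd (n - k)%nat) by lia. ring.
Qed.

Lemma conv_lead_eq (c d : nat -> C) i j : (forall n, (n < i)%nat -> c n = 0%C) -> (forall n, (n < j)%nat -> d n = 0%C) ->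
  conv c d (i + j) = (c i * d j)%C.
Proof.
  intros Hc Hd. unfold conv. replace (S (i + j)) with (i + S j)%nat by lia.
  rewrite Csum_add, Csum_zero by (intros k Hk; rewrite Hc by auto; ring).
  rewrite Csum_S, Csum_zero.
  - rewrite Nat.add_0_r. replace (i + j - i)%nat with j by lia. ring.
  - intros k Hk. rewrite (Hd (i + j - (i + S k))%nat) by lia. ring.
Qed.

Lemma lead_conv c d i j : lead c i -> lead d j -> lead (conv c d) (i + j).
Proof.
  intros [Hc Hc'] [Hd Hd']. split. intros; apply (conv_order c d i j); auto.
  rewrite conv_lead_eq by auto. rewrite Hc', Hd'. ring.
Qed.

Definition oneC (n : nat) : C := match n with O => 1%C | _ => 0%C end.

Lemma qgood_oneC : qgood oneC.
Proof. apply qgood_fin with 1%nat. intros n Hn. destruct n; auto; lia. Qed.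

Lemma qs_oneC z : qs oneC z = 1%C.
Proof.
  unfold qs.
  assert (Sm : summable (fun n => oneC n * qq z ^ n)%C).
  { apply summable_incr_1. apply summable_ext with (fun n => 0 * (/ 2)%R ^ n)%C. intros; simpl; ring.
    apply summable_scal. apply summable_le with (fun n => (/ 2) ^ n).
    intros. rewrite Cmod_pow, Cmod_R, Rabs_pos_eq; lra. apply ex_series_geom. rewrite Rabs_pos_eq; lra. }
  rewrite CS_incr_1 by auto. rewrite (CS_ext _ (fun _ => 0%C)), CS_0 by (intros; simpl; ring). simpl. ring.
Qed.

Fixpoint powc (c : nat -> C) (n : nat) : nat -> C :=
  match n with O => oneC | S n => conv c (powc c n) end.

Lemma is_form_pow c k n : is_form c k -> is_form (powc c n) (n * k).
Proof.
  intros H. induction n. split. apply qgood_oneC. intros; rewrite !qs_oneC; simpl; ring.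
  apply is_form_conv; auto.
Qed.

Lemma lead_pow c i n : lead c i -> lead (powc c n) (n * i).
Proof.
  intros H. induction n. split; auto. intros; lia. apply lead_conv; auto.
Qed.

Lemma qgood_powc c n : qgood c -> qgood (powc c n).
Proof. intros. induction n. apply qgood_oneC. apply qgood_conv; auto. Qed.

Lemma qs_powc c n z : qgood c -> inH z -> qs (powc c n) z = (qs c z ^ n)%C.
Proof.
  intros. induction n. apply qs_oneC. simpl. rewrite qs_mult, IHn by (auto; apply qgood_powc; auto). auto.
Qed.

Lemma real_powc c n : real_coef c -> real_coef (powc c n).
Proof. intros. induction n. intros m; destruct m; reflexivity. apply real_conv; auto. Qed.

Lemma form_e4 : is_form e4c 4.
Proof. split. apply qgood_e4c. apply E4_S. Qed.
Lemma form_e6 : is_form e6c 6.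
Proof. split. apply qgood_e6c. apply E6_S. Qed.
Lemma lead_e4 : lead e4c 0.
Proof. split. intros; lia. apply e4c_0. Qed.
Lemma lead_e6 : lead e6c 0.
Proof. split. intros; lia. apply e6c_0. Qed.

(** The discriminant as a polynomial in the Eisenstein series, to be identified with the
    nonvanishing [Delta]. *)
Definition dc (n : nat) : C := (/ 1728 * (powc e4c 3 n - 1%R * powc e6c 2 n))%C.

Lemma form_dc : is_form dc 12.
Proof.
  assert (H := is_form_lin 1%R _ _ 12 (is_form_pow _ _ 3 form_e4) (is_form_pow _ _ 2 form_e6)).
  destruct H as [G H]. split. apply qgood_scal; auto. intros z Hz. unfold dc.
  rewrite !qs_scal, H by (auto using inH_S). ring.
Qed.

Lemma lead_dc : lead dc 1.
Proof.
  assert (O0 : oneC 0 = 1%C) by reflexivity. assert (O1 : oneC 1 = 0%C) by reflexivity.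
  split.
  - intros n Hn. replace n with 0%nat by lia. unfold dc; simpl powc.
    rewrite !conv_0, e4c_0, e6c_0, O0. ring.
  - unfold dc; simpl powc. rewrite !conv_1, !conv_0, e4c_0, e6c_0, e4c_1, e6c_1, O0, O1. field.
Qed.

Lemma real_dc : real_coef dc.
Proof.
  assert (H : real_coef (fun n => powc e4c 3 n - 1%R * powc e6c 2 n)%C).
  { apply real_minus; apply real_powc. apply real_e4c. apply real_e6c. }
  intros n. specialize (H n). unfold dc. rewrite <- RtoC_inv by lra. rewrite im_scal_l, H. ring.
Qed.

Lemma qs_dc z : inH z -> (1728 * qs dc z = E4 z ^ 3 - E6 z ^ 2)%C.
Proof.
  intros Hz. unfold dc. assert (G4 := qgood_powc _ 3 qgood_e4c). assert (G6 := qgood_powc _ 2 qgood_e6c).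
  rewrite qs_scal, qs_minus, qs_scal, !qs_powc by (auto using qgood_scal, qgood_minus, qgood_e4c, qgood_e6c).
  fold (E4 z). fold (E6 z). field.
Qed.

Lemma Cexp_sub1 u : Cmod u <= 1 -> Cmod (Cexp u - 1)%C <= 4 * Cmod u.
Proof.
  intros Hu. replace (Cexp u - 1)%C with ((Cexp u - 1 - u) + u)%C by ring.
  eapply Rle_trans; [apply Cmod_triangle|].
  assert (Q := Cexp_quad u). assert (P := Cmod_ge_0 u).
  assert (exp (Cmod u) <= 3) by (apply Rle_trans with (exp 1); [apply exp_le; auto|apply exp_le_3]).
  assert (Cmod u ^ 2 * exp (Cmod u) <= Cmod u * 3).
  { apply Rmult_le_compat; auto. apply pow2_ge_0. left; apply exp_pos. simpl. rewrite Rmult_1_r.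
    rewrite <- (Rmult_1_r (Cmod u)) at 3. apply Rmult_le_compat_l; auto. }
  lra.
Qed.

(** The quotient minus 1 has weight 0 and no defect, and is O(q) because both leading coefficients
    are 1. The contraction with [d = 0] makes it vanish. *)
Lemma dc_Delta z : hA <= Im z -> qs dc z = Delta z.
Proof.
  set (V := fun z => (qs dc z * / Delta z - 1)%C). destruct form_dc as [G H].
  assert (HV : forall z, hA <= Im z -> Cmod (V z) <= 50 * 0).
  { destruct (qs_Obound (fun n => dc (1 + n)%nat - oneC n)%C 1 hA) as (B & HB0 & HB).
    - apply qgood_minus. apply qgood_shift; auto. apply qgood_oneC.
    - unfold hA; lra.
    - intros n Hn. replace n with 0%nat by lia. change (1 + 0)%nat with 1%nat. rewrite (proj2 lead_dc). simpl. ring.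
    - apply (modular_bound V (B * exp 0.3 + 4 * 48) 0); [lia| | | |].
      + apply twice_diff_minus; [|apply twice_diff_const].
        apply twice_diff_mult. apply twice_diff_qs; auto. apply twice_diff_inv. apply Delta_neq0. apply twice_diff_Delta.
      + intros w Hw. unfold V. rewrite qs_period, Delta_period; auto.
      + intros w Hw. assert (Hwi := inH_hA w Hw). specialize (HB w Hw).
        rewrite qs_minus, qs_oneC in HB by (auto using qgood_oneC; apply qgood_shift; auto).
        assert (E : V w = ((qs (fun n => dc (1 + n)%nat) w - 1) * Cexp (24 * qs s1 w) + (Cexp (24 * qs s1 w) - 1))%C).
        { unfold V. rewrite Delta_qq, Cexp_opp, (qs_shift dc 1) by (auto; apply lead_dc).
          field. split. apply Cexp_neq0. apply qq_neq0. }
        rewrite E. assert (S1 := s1_small w Hw). assert (S2 := s1_Oq w Hw).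
        eapply Rle_trans; [apply Cmod_triangle|]. rewrite Cmod_mult.
        assert (A1 : Cmod (Cexp (24 * qs s1 w)) <= exp 0.3).
        { rewrite Cmod_Cexp. apply exp_le. generalize (Re_le_Cmod (24 * qs s1 w)%C); lra. }
        assert (A2 := Cexp_sub1 (24 * qs s1 w)%C ltac:(lra)).
        rewrite (Cmod_mult 24%C), Cmod_R, Rabs_pos_eq in A2 by lra. rewrite Rmult_plus_distr_r.
        apply Rplus_le_compat; [|lra].
        replace (B * exp 0.3 * Cmod (qq w)) with (B * Cmod (qq w) ^ 1 * exp 0.3) by ring.
        apply Rmult_le_compat; auto; apply Cmod_ge_0.
      + intros w Hw _. assert (Hwi : inH w) by (apply inH_hA; lra). assert (Nw := inH_neq0 w Hwi).
        replace (V w - / w ^ 0 * V (- / w))%C with (RtoC 0). rewrite Cmod_0; lra.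
        unfold V. rewrite H, Delta_S by auto. simpl (w ^ 0)%C. field. split; auto. apply Delta_neq0. }
  intros Hz. specialize (HV z Hz). rewrite Rmult_0_r in HV.
  assert (E : V z = 0%C) by (apply Cmod_eq_0; generalize (Cmod_ge_0 (V z)); lra).
  unfold V in E. transitivity ((qs dc z * / Delta z - 1) * Delta z + Delta z)%C. field. apply Delta_neq0. rewrite E. ring.
Qed.

Lemma Delta_E z : hA <= Im z -> (1728 * Delta z = E4 z ^ 3 - E6 z ^ 2)%C.
Proof. intros Hz. rewrite <- dc_Delta by auto. apply qs_dc, inH_hA; auto. Qed.

Lemma Delta_lower z N : hA <= Im z -> Cmod (qq z) ^ N <= exp 0.3 ^ N * Cmod (Delta z) ^ N.
Proof.
  intros Hz. rewrite <- Rpow_mult_distr. apply pow_incr. split; [apply Cmod_ge_0|].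
  rewrite Cmod_qq. apply Rle_trans with (exp 0.3 * exp (-2 * PI * Im z - 0.3)).
  rewrite <- exp_plus. right; f_equal; ring.
  apply Rmult_le_compat_l. left; apply exp_pos. apply Delta_bounds; auto.
Qed.

Definition defect (c : nat -> C) (k : nat) (z : C) : C := (qs c z - / z ^ k * qs c (- / z))%C.

Lemma form_defect c k z : is_form c k -> inH z -> defect c k z = 0%C.
Proof.
  intros [_ H] Hz. unfold defect. rewrite H by auto. field. apply Cpow_nz, inH_neq0; auto.
Qed.

(* Dividing by [Delta^N] leaves a periodic function of weight [s], small enough for the contraction of [modular_bound]. *)
Lemma form_bound c N s d : qgood c -> (forall n, (n <= N)%nat -> c n = 0%C) -> (s <= 10)%nat ->
  (forall z, Im z = hA -> Rabs (Re z) <= / 2 -> Cmod (defect c (12 * N + s) z) <= d * Cmod (Delta z) ^ N) ->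
  forall z, hA <= Im z -> Cmod (qs c z) <= 50 * d * Cmod (Delta z) ^ N.
Proof.
  intros G H0 Hs Hd z Hz.
  assert (PD : forall z, 0 < Cmod (Delta z) ^ N) by (intros; apply pow_lt, Cmod_pos, Delta_neq0).
  assert (ND : forall z, (Delta z ^ N)%C <> 0%C) by (intros; apply Cpow_nz, Delta_neq0).
  destruct (qs_Obound c (S N) hA G ltac:(unfold hA; lra) ltac:(intros; apply H0; lia)) as (B & HB0 & HB).
  assert (M : Cmod (qs c z * / Delta z ^ N)%C <= 50 * d).
  { apply (modular_bound (fun z => qs c z * / Delta z ^ N)%C (B * exp 0.3 ^ N) s); auto.
    - apply twice_diff_mult. apply twice_diff_qs; auto. apply twice_diff_inv; auto.
      apply twice_diff_pow, twice_diff_Delta.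
    - intros w Hw. rewrite qs_period, Delta_period; auto.
    - intros w Hw. rewrite Cmod_mult, Cmod_inv, Cmod_pow by auto.
      apply Rmult_le_reg_r with (Cmod (Delta w) ^ N); auto.
      rewrite Rmult_assoc, Rinv_l, Rmult_1_r by (apply not_eq_sym, Rlt_not_eq; auto).
      eapply Rle_trans; [apply HB; auto|]. simpl pow.
      replace (B * exp 0.3 ^ N * Cmod (qq w) * Cmod (Delta w) ^ N) with (B * Cmod (qq w) * (exp 0.3 ^ N * Cmod (Delta w) ^ N)) by ring.
      rewrite <- Rmult_assoc. apply Rmult_le_compat_l. apply Rmult_le_pos; auto; apply Cmod_ge_0.
      apply Delta_lower; auto.
    - intros w Hw Hx. assert (Hwi : inH w) by (apply inH_hA; lra). assert (Nw := inH_neq0 w Hwi).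
      replace (qs c w * / Delta w ^ N - / w ^ s * (qs c (- / w) * / Delta (- / w) ^ N))%C with
        (defect c (12 * N + s) w * / Delta w ^ N)%C.
      + rewrite Cmod_mult, Cmod_inv, Cmod_pow by auto. apply Rmult_le_reg_r with (Cmod (Delta w) ^ N); auto.
        rewrite Rmult_assoc, Rinv_l, Rmult_1_r by (apply not_eq_sym, Rlt_not_eq; auto). auto.
      + unfold defect. rewrite Delta_S, Cpow_mult_l by auto. rewrite Cpow_add_r, Cpow_mult_r.
        assert (((w ^ 12) ^ N)%C <> 0%C) by (repeat apply Cpow_nz; auto).
        assert ((w ^ s)%C <> 0%C) by (apply Cpow_nz; auto).
        set (u := ((w ^ 12) ^ N)%C) in *. set (v := (w ^ s)%C) in *. set (D := (Delta w ^ N)%C).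
        assert (D <> 0%C) by apply ND. field. auto. }
  rewrite Cmod_mult, Cmod_inv, Cmod_pow in M by auto.
  apply Rmult_le_reg_r with (/ Cmod (Delta z) ^ N). apply Rinv_0_lt_compat; auto.
  rewrite Rmult_assoc, Rinv_r, Rmult_1_r by (apply not_eq_sym, Rlt_not_eq; auto). auto.
Qed.

(** An exact form has defect zero. This takes the place of the valence formula. *)
Lemma form_zero c N s : is_form c (12 * N + s) -> (forall n, (n <= N)%nat -> c n = 0%C) -> (s <= 10)%nat ->
  forall z, hA <= Im z -> qs c z = 0%C.
Proof.
  intros F H0 Hs z Hz. apply Cmod_eq_0. apply Rle_antisym; [|apply Cmod_ge_0].
  replace 0 with (50 * 0 * Cmod (Delta z) ^ N) by ring.
  apply (form_bound c N s 0); auto. apply F.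
  intros w Hw _. rewrite form_defect; auto. rewrite Cmod_0; lra. apply inH_hA; lra.
Qed.

(** The two sides differ by a form of weight 8 without constant term. *)
Lemma ramanujan_E6 z : hA <= Im z -> (E2 z * E6 z - 2 * qs (tq e6c) z = E4 z ^ 2)%C.
Proof.
  intros Hz. assert (Hzi := inH_hA z Hz).
  assert (F8 : is_form e8c 8) by (split; [apply qgood_e8c|apply e8c_S]).
  assert (F := is_form_lin 1%R _ _ 8 F8 (is_form_pow _ _ 2 form_e4)).
  assert (E := form_zero _ 0 8 F). 
  rewrite <- e8c_eq by auto.
  assert (Z : qs (fun n => e8c n - 1%R * powc e4c 2 n)%C z = 0%C).
  { apply E; auto; try lia. intros n Hn. replace n with 0%nat by lia. rewrite e8c_0. simpl powc.
    rewrite !conv_0, e4c_0. simpl. ring. }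
  assert (G4 := qgood_powc _ 2 qgood_e4c).
  rewrite qs_minus, qs_scal, qs_powc in Z by (auto using qgood_scal, qgood_e8c, qgood_e4c).
  fold (E4 z) in Z. transitivity (qs e8c z - 1 * E4 z ^ 2 + E4 z ^ 2)%C. ring. rewrite Z. ring.
Qed.

Lemma hA_rho : hA <= Im rho.
Proof. unfold rho, hA; simpl. generalize sqrt3_bounds; lra. Qed.

(** As [- / rho = rho + 1] and [rho ^ 4 = rho], the transformation law reads
    [E4 rho = rho * E4 rho]. *)
Lemma E4_rho : E4 rho = 0%C.
Proof.
  assert (E := E4_S rho inH_rho). rewrite rho_S in E. unfold E4 at 1 in E. rewrite qs_period in E. fold (E4 rho) in E.
  replace (rho ^ 4)%C with (rho ^ 3 * rho)%C in E by ring. rewrite rho_3, Cmult_1_l in E.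
  assert (N : (1 - rho)%C <> 0%C).
  { intros A. assert (B : Im (1 - rho)%C = 0) by (rewrite A; auto). unfold rho in B; simpl in B.
    generalize sqrt3_bounds; lra. }
  transitivity ((E4 rho - rho * E4 rho) / (1 - rho))%C. field; auto. rewrite <- E. unfold Cdiv. ring.
Qed.

Lemma E6_rho_neq0 : E6 rho <> 0%C.
Proof.
  intros A. assert (E := Delta_E rho hA_rho). rewrite E4_rho, A in E.
  apply (Delta_neq0 rho). transitivity (/ 1728 * (1728 * Delta rho))%C. field. rewrite E. ring.
Qed.

(* In weight 14 the contraction fails. Subtracting a multiple of [E6 Delta^(N+1)] from the product with [E4] gains one more
   vanishing coefficient, and the multiple is controlled by evaluating at the zero [rho] of [E4]. *)
Lemma form_bound14 : exists B, 0 <= B /\ forall c N d, qgood c -> (forall n, (n <= N)%nat -> c n = 0%C) -> 0 <= d ->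
  (forall z, Im z = hA -> Rabs (Re z) <= / 2 -> Cmod (defect c (12 * N + 14) z) <= d * Cmod (Delta z) ^ N) ->
  forall z, hA <= Im z -> Cmod (qs c z * E4 z)%C <= B * d * Cmod (Delta z) ^ N.
Proof.
  assert (HhA : 0 < hA) by (unfold hA; lra).
  destruct (qs_bounded e4c hA qgood_e4c HhA) as (M4 & HM4 & H4).
  destruct (qs_bounded e6c hA qgood_e6c HhA) as (M6 & HM6 & H6).
  set (mD := exp (- 2 * PI * hA - 0.3)). assert (PmD : 0 < mD) by apply exp_pos.
  assert (P6 : 0 < Cmod (E6 rho)) by (apply Cmod_pos, E6_rho_neq0).
  set (B := 50 * (M4 / mD) * (1 + M6 / Cmod (E6 rho)) * exp 0.3).
  assert (HB1 : 0 <= M4 / mD) by (apply Rdiv_le_0_compat; auto).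
  assert (HB2 : 0 <= M6 / Cmod (E6 rho)) by (apply Rdiv_le_0_compat; auto).
  exists B. split.
  { unfold B. assert (0 < exp 0.3) by apply exp_pos.
    apply Rmult_le_pos; [apply Rmult_le_pos; [apply Rmult_le_pos|]|]; lra. }
  intros c N d G H0 Hd Hdef.
  set (a := c (S N)). set (d6 := conv e6c (powc dc (S N))).
  set (c' := fun n => (conv c e4c n - a * d6 n)%C).
  assert (F6 : is_form d6 (12 * (S N) + 6)).
  { replace (12 * S N + 6)%nat with (6 + S N * 12)%nat by lia. apply is_form_conv. apply form_e6.
    apply is_form_pow, form_dc. }
  assert (Gc : qgood (conv c e4c)) by (apply qgood_conv; auto; apply qgood_e4c).
  assert (G' : qgood c') by (apply qgood_minus; auto; apply qgood_scal, F6).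
  assert (L6 : lead d6 (S N)).
  { assert (L := lead_conv _ _ _ _ lead_e6 (lead_pow _ _ (S N) lead_dc)). rewrite Nat.mul_1_r in L. exact L. }
  assert (Z' : forall n, (n <= S N)%nat -> c' n = 0%C).
  { intros n Hn. unfold c'. assert (Hc0 : forall n, (n < S N)%nat -> c n = 0%C) by (intros; apply H0; lia).
    assert (He0 : forall n, (n < 0)%nat -> e4c n = 0%C) by (intros; lia).
    destruct (Nat.eq_dec n (S N)) as [->|Hne].
    - rewrite <- (Nat.add_0_r (S N)) at 1. rewrite conv_lead_eq by auto. rewrite e4c_0, (proj2 L6). unfold a. ring.
    - rewrite (conv_order c e4c (S N) 0) by (auto; lia). rewrite (proj1 L6) by lia. ring. }
  assert (Eq : forall z, inH z -> qs c' z = (qs c z * E4 z - a * qs d6 z)%C).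
  { intros z Hz. unfold c'. rewrite qs_minus, qs_scal, qs_mult; auto using qgood_e4c. apply F6.
    apply qgood_scal, F6. }
  assert (Bd : forall z, hA <= Im z -> Cmod (qs c' z) <= 50 * (M4 / mD * d) * Cmod (Delta z) ^ S N).
  { apply (form_bound c' (S N) 6 (M4 / mD * d)); auto; try lia.
    intros z Hz Hx. assert (Hzi : inH z) by (apply inH_hA; lra). assert (Nz := inH_neq0 z Hzi).
    assert (E : defect c' (12 * S N + 6) z = (E4 z * defect c (12 * N + 14) z)%C).
    { assert (D6 := form_defect _ _ z F6 Hzi). unfold defect in *. rewrite !Eq by (auto using inH_S). rewrite E4_S by auto.
      replace (12 * S N + 6)%nat with (4 + (12 * N + 14))%nat in * by lia. rewrite (Cpow_add_r z 4) in *.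
      assert ((z ^ (12 * N + 14))%C <> 0%C) by (apply Cpow_nz; auto). set (w := (z ^ (12 * N + 14))%C) in *.
      transitivity (E4 z * (qs c z - / w * qs c (- / z)) - a * (qs d6 z - / (z ^ 4 * w) * qs d6 (- / z)))%C.
      field; auto. rewrite D6. ring. }
    rewrite E, Cmod_mult. assert (B1 := H4 z ltac:(lra)). fold (E4 z) in B1. specialize (Hdef z Hz Hx).
    assert (LD : mD <= Cmod (Delta z)). { unfold mD. rewrite <- Hz. apply Delta_bounds. lra. }
    apply Rle_trans with (M4 * (d * Cmod (Delta z) ^ N)). apply Rmult_le_compat; auto; apply Cmod_ge_0.
    simpl pow. replace (M4 / mD * d * (Cmod (Delta z) * Cmod (Delta z) ^ N)) with (M4 * (d * Cmod (Delta z) ^ N) * (Cmod (Delta z) / mD)) by (field; lra).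
    rewrite <- (Rmult_1_r (M4 * _)) at 1. apply Rmult_le_compat_l.
    repeat apply Rmult_le_pos; auto. apply pow_le, Cmod_ge_0.
    apply Rmult_le_reg_r with mD; auto. unfold Rdiv. rewrite Rmult_assoc, Rinv_l; lra. }
  assert (Ed : forall z, hA <= Im z -> qs d6 z = (E6 z * Delta z ^ S N)%C).
  { intros z Hz. unfold d6. assert (Gd := proj1 form_dc). assert (Hzi := inH_hA z Hz).
    rewrite qs_mult, qs_powc, dc_Delta; auto using qgood_e6c, qgood_powc. }
  assert (PDr : 0 < Cmod (Delta rho) ^ S N) by (apply pow_lt, Cmod_pos, Delta_neq0).
  assert (Ba : Cmod a * Cmod (E6 rho) <= 50 * (M4 / mD * d)).
  { assert (Br := Bd rho hA_rho). rewrite Eq, E4_rho, Ed in Br by (auto using inH_rho, hA_rho).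
    replace (qs c rho * 0 - a * (E6 rho * Delta rho ^ S N))%C with (- (a * E6 rho * Delta rho ^ S N))%C in Br by ring.
    rewrite Cmod_opp, !Cmod_mult, Cmod_pow in Br. apply Rmult_le_reg_r with (Cmod (Delta rho) ^ S N); auto. }
  intros z Hz. assert (Hzi := inH_hA z Hz).
  replace (qs c z * E4 z)%C with (qs c' z + a * (E6 z * Delta z ^ S N))%C.
  2:{ rewrite Eq, Ed by auto. ring. }
  eapply Rle_trans; [apply Cmod_triangle|]. rewrite !Cmod_mult, Cmod_pow.
  assert (B1 := Bd z Hz). assert (B6 := H6 z Hz). fold (E6 z) in B6.
  assert (PD : 0 < Cmod (Delta z) ^ S N) by (apply pow_lt, Cmod_pos, Delta_neq0).
  assert (PN : 0 < Cmod (Delta z) ^ N) by (apply pow_lt, Cmod_pos, Delta_neq0).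
  set (X := 50 * (M4 / mD * d)) in *. assert (HX : 0 <= X).
  { unfold X. apply Rmult_le_pos; [lra|]. apply Rmult_le_pos; auto. }
  assert (Ba' : Cmod a <= X / Cmod (E6 rho)).
  { apply Rmult_le_reg_r with (Cmod (E6 rho)); auto. unfold Rdiv. rewrite Rmult_assoc, Rinv_l; lra. }
  assert (B2 : Cmod a * (Cmod (E6 z) * Cmod (Delta z) ^ S N) <= X / Cmod (E6 rho) * (M6 * Cmod (Delta z) ^ S N)).
  { apply Rmult_le_compat; auto. apply Cmod_ge_0. apply Rmult_le_pos; [apply Cmod_ge_0|lra].
    apply Rmult_le_compat_r; lra. }
  assert (UD : Cmod (Delta z) <= exp 0.3).
  { eapply Rle_trans; [apply Delta_bounds; auto|]. apply exp_le.
    assert (0 < PI * Im z) by (apply Rmult_lt_0_compat; [apply PI_pos|exact Hzi]). lra. }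
  apply Rle_trans with (X * (1 + M6 / Cmod (E6 rho)) * Cmod (Delta z) ^ S N).
  { unfold Rdiv in *. lra. }
  replace (B * d * Cmod (Delta z) ^ N) with (X * (1 + M6 / Cmod (E6 rho)) * (exp 0.3 * Cmod (Delta z) ^ N)) by (unfold B, X; ring).
  apply Rmult_le_compat_l. apply Rmult_le_pos; auto; lra. simpl pow. apply Rmult_le_compat_r; lra.
Qed.

(** * Simple zeros of [E4] and [E6], and forms as polynomials in them *)

Lemma E4_deriv z : inH z -> cderiv E4 z (2 * PI * Ci * ((E2 z * E4 z - E6 z) / 3))%C.
Proof.
  intros Hz. eapply cderiv_eq; [|apply qs_dtq; auto; apply qgood_e4c]. rewrite E6_eq by auto. field.
Qed.

Lemma E6_deriv z : hA <= Im z -> cderiv E6 z (2 * PI * Ci * ((E2 z * E6 z - E4 z ^ 2) / 2))%C.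
Proof.
  intros Hz. eapply cderiv_eq; [|apply qs_dtq; [apply qgood_e6c|apply inH_hA; auto]].
  rewrite <- ramanujan_E6 by auto. field.
Qed.

Lemma E4_E6_neq0 z : hA <= Im z -> E4 z = 0%C -> E6 z = 0%C -> False.
Proof.
  intros Hz H4 H6. assert (E := Delta_E z Hz). rewrite H4, H6 in E.
  apply (Delta_neq0 z). transitivity (/ 1728 * (1728 * Delta z))%C. field. rewrite E. ring.
Qed.

Lemma E4_deriv_at_zero z : hA <= Im z -> E4 z = 0%C ->
  cderiv E4 z (2 * PI * Ci * (- E6 z / 3))%C /\ (2 * PI * Ci * (- E6 z / 3))%C <> 0%C.
Proof.
  intros Hz H. split.
  - eapply cderiv_eq; [|apply E4_deriv, inH_hA; auto]. rewrite H. field.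
  - intros A. apply (E4_E6_neq0 z Hz H). assert (N := TPI_neq0).
    transitivity (- (3) * (2 * PI * Ci * (- E6 z / 3)) / (2 * PI * Ci))%C. field. 
    split; [apply Ci_nz|apply RtoC_neq0; generalize PI_bounds; lra]. rewrite A. unfold Cdiv; ring.
Qed.

Lemma E6_deriv_at_zero z : hA <= Im z -> E6 z = 0%C ->
  cderiv E6 z (2 * PI * Ci * (- E4 z ^ 2 / 2))%C /\ (2 * PI * Ci * (- E4 z ^ 2 / 2))%C <> 0%C.
Proof.
  intros Hz H. split.
  - eapply cderiv_eq; [|apply E6_deriv; auto]. rewrite H. field.
  - apply Cmult_neq_0; [apply TPI_neq0|]. intros A. 
    assert (N4 : E4 z <> 0%C) by (intro B; apply (E4_E6_neq0 z Hz B H)).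
    apply (Cpow_nz (E4 z) 2 N4). transitivity (- (2) * (- E4 z ^ 2 / 2))%C. field. rewrite A. ring.
Qed.

Lemma nonzero_near (f : C -> C) z l : cderiv f z l -> f z = 0%C -> l <> 0%C ->
  exists d, 0 < d /\ forall h : C, h <> 0%C -> Cmod h < d -> f (z + h)%C <> 0%C.
Proof.
  intros H H0 Hl. assert (Pl := Cmod_pos _ Hl).
  destruct (H (Cmod l / 2)) as (d & Hd & Hd'); [lra|]. exists d; split; auto.
  intros h Hh Hhd A. specialize (Hd' h Hhd). rewrite A, H0 in Hd'.
  replace (0 - 0 - l * h)%C with (- (l * h))%C in Hd' by ring. rewrite Cmod_opp, Cmod_mult in Hd'.
  assert (0 < Cmod h) by (apply Cmod_pos; auto). assert (0 < Cmod l * Cmod h) by (apply Rmult_lt_0_compat; auto). lra.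
Qed.

(** For [4 a + 6 b = 14] only the product with [E4] is known to vanish. The zeros of [E4] are
    simple, hence isolated, and continuity from a point slightly above, still in the region
    [hA <= Im z], gives the value there. *)
Lemma form_zero_all c l a b : (a <= 2)%nat -> (b <= 1)%nat -> is_form c (12 * l + (4 * a + 6 * b)) ->
  (forall n, (n <= l)%nat -> c n = 0%C) -> forall z, hA <= Im z -> qs c z = 0%C.
Proof.
  intros Ha Hb F H0. destruct (le_dec (4 * a + 6 * b) 10) as [Hle|Hgt].
  { apply (form_zero c l (4 * a + 6 * b)); auto. }
  replace (4 * a + 6 * b)%nat with 14%nat in F by lia.
  destruct form_bound14 as (B & HB0 & HB).
  assert (HE : forall z, hA <= Im z -> (qs c z * E4 z)%C = 0%C).
  { intros z Hz. apply Cmod_eq_0. apply Rle_antisym; [|apply Cmod_ge_0].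
    replace 0 with (B * 0 * Cmod (Delta z) ^ l) by ring. apply HB; auto. apply F. lra.
    intros w Hw _. rewrite form_defect; auto. rewrite Cmod_0; lra. apply inH_hA; lra. }
  intros z Hz. assert (Hzi := inH_hA z Hz).
  destruct (Classical_Prop.classic (E4 z = 0%C)) as [Z|N].
  2:{ transitivity (qs c z * E4 z / E4 z)%C. field; auto. rewrite HE by auto. unfold Cdiv; ring. }
  destruct (E4_deriv_at_zero z Hz Z) as [D N]. destruct (nonzero_near _ _ _ D Z N) as (d & Hd & Hn).
  apply Cmod_small. intros eps He.
  destruct (cderiv_cont _ _ _ (qs_deriv c z (proj1 F) Hzi) eps He) as (d2 & Hd2 & Hc).
  set (t := Rmin d d2 / 2). assert (Ht : 0 < t /\ t < d /\ t < d2).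
  { assert (0 < Rmin d d2) by (apply Rmin_glb_lt; auto). generalize (Rmin_l d d2) (Rmin_r d d2). unfold t; lra. }
  set (h := (0, t)). assert (Eh : Cmod h = t).
  { replace h with (Ci * t)%C by (apply Ceq; simpl; ring). rewrite Cmod_mult, Cmod_Ci, Cmod_R, Rabs_pos_eq; lra. }
  assert (Nh : (h : C) <> 0%C) by (apply Cmod_neq0; rewrite Eh; lra).
  assert (A := Hn h Nh ltac:(lra)). assert (E := HE (z + h)%C). 
  assert (Z0 : qs c (z + h)%C = 0%C).
  { transitivity (qs c (z + h) * E4 (z + h) / E4 (z + h))%C. field; auto. rewrite E. unfold Cdiv; ring.
    rewrite Im_plus. unfold h; simpl. lra. }
  specialize (Hc h ltac:(lra)). rewrite Z0 in Hc. replace (0 - qs c z)%C with (- qs c z)%C in Hc by ring.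
  rewrite Cmod_opp in Hc. lra.
Qed.

(** Induction on the number [j] of coefficients still to be removed. The product [d] has the same
    weight and leading term q^i, so a multiple of it removes the coefficient [i]; once all
    coefficients up to [l] are gone, the form is zero. Reality of these coefficients makes the
    multipliers real. *)
Lemma form_rep l a b : (a <= 2)%nat -> (b <= 1)%nat ->
  forall j c i, (i + j = S l)%nat -> is_form c (12 * l + (4 * a + 6 * b)) -> (forall n, (n < i)%nat -> c n = 0%C) ->
  (forall n, (n <= l)%nat -> Im (c n) = 0) ->
  exists p : nat -> R, (forall t, (t < i)%nat -> p t = 0) /\ ((i <= l)%nat -> p i = Re (c i)) /\
   forall z, hA <= Im z ->
     qs c z = (E4 z ^ a * E6 z ^ b * Csum (fun t => p t * (Delta z ^ t * (E4 z ^ 3) ^ (l - t))) (S l))%C.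
Proof.
  intros Ha Hb. induction j as [|j IH]; intros c i Hi F H0 Hr.
  - exists (fun _ => 0). split; [auto|split; [lia|]]. intros z Hz.
    rewrite (form_zero_all c l a b) by (auto; intros; apply H0; lia).
    rewrite Csum_zero by (intros; ring). ring.
  - set (d := conv (conv (powc e4c a) (powc e6c b)) (conv (powc dc i) (powc (powc e4c 3) (l - i)))).
    assert (Fd : is_form d (12 * l + (4 * a + 6 * b))).
    { replace (12 * l + (4 * a + 6 * b))%nat with ((a * 4 + b * 6) + (i * 12 + (l - i) * (3 * 4)))%nat by lia.
      repeat apply is_form_conv; repeat apply is_form_pow; auto using form_e4, form_e6, form_dc. }
    assert (Ld : lead d i).
    { assert (L := lead_conv _ _ _ _ (lead_conv _ _ _ _ (lead_pow _ _ a lead_e4) (lead_pow _ _ b lead_e6))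
        (lead_conv _ _ _ _ (lead_pow _ _ i lead_dc) (lead_pow _ _ (l - i) (lead_pow _ _ 3 lead_e4)))).
      replace (a * 0 + b * 0 + (i * 1 + (l - i) * (3 * 0)))%nat with i in L by lia. exact L. }
    assert (Rd : real_coef d).
    { repeat apply real_conv; repeat apply real_powc; auto using real_e4c, real_e6c, real_dc. }
    set (r := Re (c i)).
    destruct (IH (fun n => c n - r * d n)%C (S i)) as (p & P1 & P2 & P3).
    + lia.
    + apply is_form_lin; auto.
    + intros n Hn. destruct (Nat.eq_dec n i) as [->|Hne].
      * rewrite (proj2 Ld). assert (Q := Hr i ltac:(lia)). unfold r. apply Ceq; simpl; [unfold Re; ring|].
        unfold Im in Q. rewrite Q. ring.
      * rewrite H0, (proj1 Ld) by lia. ring.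
    + intros n Hn. assert (Q := Hr n Hn). assert (Q' := Rd n). destruct (c n), (d n). simpl in *. subst. ring.
    + exists (fun t => if Nat.eq_dec t i then r else p t). split; [|split].
      * intros t Ht. destruct (Nat.eq_dec t i); [lia|]. apply P1; lia.
      * intros _. destruct (Nat.eq_dec i i); [auto|lia].
      * intros z Hz. assert (Hzi := inH_hA z Hz). specialize (P3 z Hz).
        assert (G4 := qgood_e4c). assert (G6 := qgood_e6c). assert (Gd := proj1 form_dc).
        rewrite qs_minus, qs_scal in P3 by (auto; try apply qgood_scal; try apply Fd; apply F).
        assert (Ed : qs d z = (E4 z ^ a * E6 z ^ b * (Delta z ^ i * (E4 z ^ 3) ^ (l - i)))%C).
        { unfold d. rewrite !qs_mult, !qs_powc, dc_Delta by (auto using qgood_conv, qgood_powc). reflexivity. }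
        transitivity (qs c z - r * qs d z + r * qs d z)%C; [ring|]. rewrite P3, Ed.
        set (g := fun t => (Delta z ^ t * (E4 z ^ 3) ^ (l - t))%C).
        assert (EC : Csum (fun t => RtoC (if Nat.eq_dec t i then r else p t) * g t)%C (S l) =
          (Csum (fun t => p t * g t) (S l) + r * g i)%C).
        { rewrite (Csum_ext _ (fun t => p t * g t + (if Nat.eq_dec t i then RtoC r else 0%C) * g t)%C).
          2:{ intros t Ht. destruct (Nat.eq_dec t i) as [->|]; [rewrite (P1 i) by lia|]; ring. }
          rewrite Csum_plus. f_equal. replace (S l) with (i + S j)%nat by lia. rewrite Csum_add, Csum_S.
          rewrite Csum_zero. 2:{ intros t Ht. destruct (Nat.eq_dec t i); [lia|ring]. }
          rewrite Csum_zero. 2:{ intros t Ht. destruct (Nat.eq_dec (i + S t) i); [lia|ring]. }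
          rewrite Nat.add_0_r. destruct (Nat.eq_dec i i); [ring|lia]. }
        etransitivity; [|symmetry; apply f_equal; exact EC]. unfold g. ring.
Qed.

(** * Polynomials and their roots *)

Definition Pol (p : nat -> C) (n : nat) (x : C) : C := Csum (fun u => p u * x ^ u)%C (S n).

Lemma Pol_S p n x : Pol p (S n) x = (p 0%nat + x * Pol (fun u => p (S u)) n x)%C.
Proof.
  unfold Pol. rewrite Csum_S. rewrite <- Csum_scal. f_equal. simpl; ring.
  apply Csum_ext. intros; simpl; ring.
Qed.

Lemma Pol_factor n : forall p (r : C), exists p', p' n = p (S n) /\
  forall x, Pol p (S n) x = ((x - r) * Pol p' n x + Pol p (S n) r)%C.
Proof.
  induction n; intros p r.
  - exists (fun _ => p 1%nat). split; auto. intros x. unfold Pol; simpl. ring.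
  - destruct (IHn (fun u => p (S u)) r) as (q & Hq1 & Hq2).
    set (Q := Pol (fun u => p (S u)) (S n) r).
    exists (fun u => match u with O => Q | S u => q u end). split; auto.
    intros x. rewrite !(Pol_S p), (Pol_S (fun u => match u with O => Q | S u => q u end)).
    rewrite (Hq2 x). fold Q. change (fun u : nat => q u) with q. ring.
Qed.

Definition prodl (rs : list C) (x : C) : C := fold_right (fun r acc => (x - r) * acc)%C 1%C rs.

Lemma prodl_neq0 rs x : ~ In x rs -> prodl rs x <> 0%C.
Proof.
  induction rs as [|r rs IH]; simpl; intros H; [apply RtoC_neq0; lra|].
  apply Cmult_neq_0; [|apply IH; tauto]. intros A. apply H. left. symmetry. apply Ceq_minus; auto.
Qed.

Lemma Pol_roots rs : forall p, NoDup rs -> (forall r, In r rs -> Pol p (length rs) r = 0%C) ->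
  forall x, Pol p (length rs) x = (p (length rs) * prodl rs x)%C.
Proof.
  induction rs as [|r rs IH]; intros p Hn Hr x.
  - unfold Pol; simpl. ring.
  - simpl length in *. destruct (Pol_factor (length rs) p r) as (q & Hq1 & Hq2).
    rewrite Hq2. rewrite (Hr r) by (left; auto). rewrite <- Hq1. simpl prodl.
    inversion Hn; subst. rewrite (IH q); auto. ring.
    intros s Hs. assert (E := Hq2 s). rewrite (Hr r), (Hr s) in E by (simpl; auto).
    assert (N : (s - r)%C <> 0%C) by (intros A; apply Ceq_minus in A; subst; contradiction).
    transitivity (((s - r) * Pol q (length rs) s + 0) / (s - r))%C. field; auto. rewrite <- E. unfold Cdiv; ring.
Qed.

(** * The j-invariant on the fundamental domain *)

Definition earc (t : R) : C := (cos t, sin t).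
Definition jinv (z : C) : C := (E4 z ^ 3 * / Delta z)%C.

Lemma jinv_1728 z : hA <= Im z -> (jinv z - 1728)%C = (E6 z ^ 2 * / Delta z)%C.
Proof.
  intros Hz. assert (E := Delta_E z Hz). assert (N := Delta_neq0 z). unfold jinv.
  transitivity ((E4 z ^ 3 - 1728 * Delta z) / Delta z)%C. field; auto. rewrite E. unfold Cdiv. ring.
Qed.

Lemma jinv_deriv z : hA <= Im z -> cderiv jinv z (2 * PI * Ci * (- (E4 z ^ 2 * E6 z) / Delta z))%C.
Proof.
  intros Hz. assert (Hzi := inH_hA z Hz). assert (N := Delta_neq0 z).
  eapply cderiv_eq; [|apply cderiv_mult; [apply cderiv_pow, E4_deriv; auto|apply cderiv_inv; [auto|apply Delta_deriv; auto]]].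
  replace (RtoC (INR 3)) with (RtoC 3) by (simpl; f_equal; ring). change (3 - 1)%nat with 2%nat. field. auto.
Qed.

Lemma jinv_conj z : Cconj (jinv z) = jinv (- Cconj z)%C.
Proof.
  unfold jinv. rewrite Cmult_conj, Cpow_conj, Cinv_conj, Delta_conj by apply Delta_neq0.
  unfold E4. rewrite qs_conj by apply real_e4c. auto.
Qed.

Lemma jinv_S z : inH z -> jinv (- / z)%C = jinv z.
Proof.
  intros Hz. assert (Nz := inH_neq0 z Hz). unfold jinv. rewrite E4_S, Delta_S by auto. field. split; auto. apply Delta_neq0.
Qed.

Lemma jinv_period z : jinv (z + 1)%C = jinv z.
Proof. unfold jinv, E4. rewrite qs_period, Delta_period; auto. Qed.

(** On the unit circle the reflection in the imaginary axis coincides with the inversion; the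
    reality statements on the arc come from this. *)
Lemma unit_conj z : Cmod z = 1 -> (- Cconj z)%C = (- / z)%C.
Proof.
  intros H. assert (N : z <> 0%C) by (apply Cmod_neq0; lra). f_equal.
  assert (E := Cmod2_conj z). rewrite H in E. transitivity (z * Cconj z / z)%C. field; auto.
  rewrite <- E. replace (RtoC (1 ^ 2)) with (RtoC 1) by (f_equal; ring). field; auto.
Qed.

Lemma real_of_conj c : Cconj c = c -> Im c = 0.
Proof. intros H. destruct c as [x y]. injection H. simpl. lra. Qed.

Lemma real_eq c : Im c = 0 -> c = RtoC (Re c).
Proof. intros H. apply Ceq; auto. Qed.

Lemma qs_axis_real c z : real_coef c -> Re z = 0 \/ Re z = - / 2 -> Im (qs c z) = 0.
Proof.
  intros Hc Hx. apply real_of_conj. rewrite qs_conj by auto. destruct Hx as [Hx|Hx].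
  - f_equal. destruct z; simpl in *; subst. apply Ceq; simpl; ring.
  - rewrite <- (qs_period c z). f_equal. destruct z; simpl in *; subst. apply Ceq; simpl; field.
Qed.

Lemma jinv_axis_real z : Re z = 0 \/ Re z = - / 2 -> Im (jinv z) = 0.
Proof.
  intros Hx. apply real_of_conj. rewrite jinv_conj. destruct Hx as [Hx|Hx].
  - f_equal. destruct z; simpl in *; subst. apply Ceq; simpl; ring.
  - rewrite <- (jinv_period z). f_equal. destruct z; simpl in *; subst. apply Ceq; simpl; field.
Qed.

Lemma jinv_unit_real z : inH z -> Cmod z = 1 -> Im (jinv z) = 0.
Proof. intros Hz H. apply real_of_conj. rewrite jinv_conj, unit_conj, jinv_S; auto. Qed.

(** On the unit circle the reflection law for real coefficients meets the inversion law, and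
    [z ^ k], with [k] half of the weight, splits the automorphy factor evenly. *)
Lemma twisted_real c k z : is_form c (2 * k) -> real_coef c -> inH z -> Cmod z = 1 -> Im (z ^ k * qs c z)%C = 0.
Proof.
  intros [G F] Hr Hz H. apply real_of_conj. assert (Nz := inH_neq0 z Hz).
  rewrite Cmult_conj, qs_conj, unit_conj, F, Cpow_conj by auto.
  assert (E : (Cconj z * z = 1)%C).
  { rewrite Cmult_comm, <- Cmod2_conj, H. f_equal. ring. }
  replace (2 * k)%nat with (k + k)%nat by lia. rewrite Cpow_add_r.
  transitivity ((Cconj z * z) ^ k * (z ^ k * qs c z))%C. rewrite Cpow_mult_l. ring.
  rewrite E, Cpow_1_l. ring.
Qed.

(* If every zero of [f] is an upward crossing, [f] cannot return to zero. *)
Lemma up_cross (f f' : R -> R) a b : a < b -> 0 <= f a ->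
  (forall x, a <= x <= b -> is_derive f x (f' x)) -> (forall x, a <= x <= b -> f x = 0 -> 0 < f' x) ->
  forall x, a < x <= b -> 0 < f x.
Proof.
  intros Hab Ha Hd Hz x1 Hx1. apply Rnot_le_lt. intros Hn.
  assert (Cont : forall x, a <= x <= b -> forall eps, 0 < eps -> exists d, 0 < d /\ forall y, Rabs (y - x) < d -> Rabs (f y - f x) < eps).
  { intros x Hx eps He. assert (C : continuity_pt f x).
    { apply continuity_pt_filterlim. apply (ex_derive_continuous f). eexists; apply Hd; auto. }
    destruct (C eps He) as (d & Hd0 & Hd1). exists d. split; auto. intros y Hy.
    destruct (Req_dec y x) as [->|N]. rewrite Rminus_diag, Rabs_R0; auto.
    apply Hd1. split; [split; [exact I|auto]|exact Hy]. }
  assert (Loc : forall x, a <= x <= b -> f x = 0 -> exists d, 0 < d /\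
     forall h, 0 < h < d -> 0 < f (x + h) /\ f (x - h) < 0).
  { intros x Hx H0. specialize (Hd x Hx). apply is_derive_Reals in Hd. specialize (Hz x Hx H0).
    destruct (Hd (f' x) Hz) as (d & Hd1). exists d. split; [apply cond_pos|]. intros h Hh.
    assert (A := Hd1 h ltac:(lra) ltac:(rewrite Rabs_pos_eq; lra)).
    assert (B := Hd1 (- h) ltac:(lra) ltac:(rewrite Rabs_Ropp, Rabs_pos_eq; lra)).
    rewrite H0, Rminus_0_r in A, B. apply Rabs_def2 in A, B. split.
    - replace (f (x + h)) with (f (x + h) / h * h) by (field; lra). apply Rmult_lt_0_compat; lra.
    - replace (x - h) with (x + - h) by ring.
      replace (f (x + - h)) with (- (f (x + - h) / - h * h)) by (field; lra).
      assert (0 < f (x + - h) / - h * h) by (apply Rmult_lt_0_compat; lra). lra. }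
  (* the last point of [[a, x1]] up to which [f] is positive *)
  set (E := fun s => a < s <= x1 /\ forall y, a < y < s -> 0 < f y).
  assert (Start : exists s, E s).
  { destruct (Req_dec (f a) 0) as [H0|H0].
    - destruct (Loc a ltac:(lra) H0) as (d & Hd1 & Hd2). exists (Rmin x1 (a + d)). split.
      split. apply Rmin_glb_lt; lra. apply Rmin_l. intros y Hy.
      assert (y < a + d) by (eapply Rlt_le_trans; [apply Hy|apply Rmin_r]).
      replace y with (a + (y - a)) by ring. apply Hd2. lra.
    - destruct (Cont a ltac:(lra) (f a) ltac:(lra)) as (d & Hd1 & Hd2). exists (Rmin x1 (a + d)). split.
      split. apply Rmin_glb_lt; lra. apply Rmin_l. intros y Hy.
      assert (y < a + d) by (eapply Rlt_le_trans; [apply Hy|apply Rmin_r]).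
      assert (A := Hd2 y ltac:(rewrite Rabs_pos_eq; lra)). apply Rabs_def2 in A. lra. }
  destruct (completeness E) as (s & Hs1 & Hs2).
  { exists x1. intros y Hy; apply Hy. } { auto. }
  destruct Start as (s0 & Hs0).
  assert (Hs : a < s <= x1).
  { split. apply Rlt_le_trans with s0; [apply Hs0|apply Hs1; auto]. apply Hs2. intros y Hy; apply Hy. }
  assert (Pos : forall y, a < y < s -> 0 < f y).
  { intros y Hy. apply Rnot_le_lt. intros A.
    assert (s <= y); [|lra]. apply Hs2. intros w Hw. apply Rnot_lt_le. intros L. destruct Hw as [_ Hw].
    specialize (Hw y ltac:(lra)). lra. }
  assert (Hsb : a <= s <= b) by lra.
  destruct (Rtotal_order (f s) 0) as [L|[Z|G]].
  - destruct (Cont s Hsb (- f s) ltac:(lra)) as (d & Hd1 & Hd2).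
    set (y := Rmax ((a + s) / 2) (s - d / 2)).
    assert (Hy : a < y < s /\ s - d < y).
    { unfold y. generalize (Rmax_l ((a + s) / 2) (s - d / 2)) (Rmax_r ((a + s) / 2) (s - d / 2)); intros.
      split. split. lra. apply Rmax_lub_lt; lra. lra. }
    assert (A := Hd2 y ltac:(rewrite Rabs_left; lra)). apply Rabs_def2 in A. specialize (Pos y (proj1 Hy)). lra.
  - destruct (Loc s Hsb Z) as (d & Hd1 & Hd2).
    set (h := Rmin ((s - a) / 2) (d / 2)).
    assert (Hh : 0 < h < d /\ h < s - a).
    { unfold h. generalize (Rmin_l ((s - a) / 2) (d / 2)) (Rmin_r ((s - a) / 2) (d / 2)); intros.
      split; [split; [apply Rmin_glb_lt; lra|lra]|lra]. }
    destruct (Hd2 h (proj1 Hh)) as [_ A]. specialize (Pos (s - h) ltac:(lra)). lra.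
  - destruct (Req_dec s x1) as [->|N]; [lra|].
    destruct (Cont s Hsb (f s) ltac:(lra)) as (d & Hd1 & Hd2).
    assert (A : E (Rmin x1 (s + d / 2))).
    { split. split. apply Rmin_glb_lt; lra. apply Rmin_l. intros y Hy.
      destruct (Rlt_le_dec y s) as [L|L]; [apply Pos; lra|].
      assert (y < s + d / 2) by (eapply Rlt_le_trans; [apply Hy|apply Rmin_r]).
      assert (B := Hd2 y ltac:(rewrite Rabs_pos_eq; lra)). apply Rabs_def2 in B. lra. }
    assert (s < Rmin x1 (s + d / 2)) by (apply Rmin_glb_lt; lra).
    specialize (Hs1 _ A). lra.
Qed.

(** * [E4], [E6] and the j-invariant along the arc *)

Lemma rderiv_earc t : rderiv earc t (Ci * earc t)%C.
Proof.
  replace (Ci * earc t)%C with ((- sin t, cos t) : C) by (apply Ceq; simpl; ring).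
  apply (rderiv_pair cos sin); auto_derive; auto; ring.
Qed.

Lemma Cmod_earc t : Cmod (earc t) = 1.
Proof.
  unfold Cmod, earc; simpl. replace (cos t * (cos t * 1) + sin t * (sin t * 1)) with ((sin t)² + (cos t)²) by (unfold Rsqr; ring).
  rewrite sin2_cos2. apply sqrt_1.
Qed.

Lemma sin_arc t : PI / 2 <= t <= 2 * PI / 3 -> sqrt 3 / 2 <= sin t.
Proof.
  intros Ht. assert (HP := PI_bounds). rewrite <- sin_PI3.
  replace (sin t) with (sin (PI - t)) by (apply sin_PI_x).
  destruct (Req_dec (PI / 3) (PI - t)) as [E|E]; [rewrite <- E; lra|]. left. apply sin_increasing_1; lra.
Qed.

Lemma cos_arc t : PI / 2 <= t <= 2 * PI / 3 -> - / 2 <= cos t <= 0.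
Proof.
  intros Ht. assert (HP := PI_bounds).
  assert (E : cos t = - cos (PI - t)). { replace (PI - t) with (- (t - PI)) by ring. rewrite cos_neg, cos_minus, cos_PI, sin_PI. ring. }
  assert (cos (PI - t) <= / 2).
  { replace (/ 2) with (1 / 2) by field. rewrite <- cos_PI3. destruct (Req_dec (PI / 3) (PI - t)) as [E1|E1]; [rewrite <- E1; lra|].
    left. apply cos_decreasing_1; lra. }
  assert (0 <= cos (PI - t)) by (apply cos_ge_0; lra). lra.
Qed.

Lemma hA_earc t : PI / 2 <= t <= 2 * PI / 3 -> hA <= Im (earc t).
Proof. intros Ht. assert (S := sin_arc t Ht). unfold hA; simpl. generalize sqrt3_bounds; lra. Qed.

Lemma earc_PI2 : earc (PI / 2) = Ci.
Proof. unfold earc. rewrite cos_PI2, sin_PI2. reflexivity. Qed.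

Lemma earc_rho : earc (2 * PI / 3) = rho.
Proof.
  unfold earc, rho. replace (2 * PI / 3) with (PI - PI / 3) by field. rewrite sin_PI_x, sin_PI3.
  rewrite cos_minus, cos_PI, sin_PI, cos_PI3. f_equal. field.
Qed.

Lemma E6_i : E6 Ci = 0%C.
Proof.
  assert (Hi : inH Ci) by (unfold inH; simpl; lra). assert (E := E6_S Ci Hi).
  rewrite Ci_inv in E. replace (- - Ci)%C with Ci in E by ring.
  replace (Ci ^ 6)%C with (- (1))%C in E by (apply Ceq; simpl; ring).
  transitivity ((E6 Ci - - (1) * E6 Ci) / 2)%C. field. rewrite <- E. unfold Cdiv; ring.
Qed.

(** The factor 1 gives the shape of [rderiv_Re]. By [twisted_real] the real part is the whole
    value. *)
Definition A4 (t : R) : R := Re (1 * (earc t ^ 2 * E4 (earc t)))%C.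
Definition A6 (t : R) : R := Re (1 * (earc t ^ 3 * E6 (earc t)))%C.

Lemma A4_eq t : PI / 2 <= t <= 2 * PI / 3 -> (earc t ^ 2 * E4 (earc t))%C = RtoC (A4 t).
Proof.
  intros Ht. unfold A4. rewrite Cmult_1_l. apply real_eq. apply (twisted_real e4c 2).
  apply form_e4. apply real_e4c. apply inH_hA, hA_earc; auto. apply Cmod_earc.
Qed.

Lemma A6_eq t : PI / 2 <= t <= 2 * PI / 3 -> (earc t ^ 3 * E6 (earc t))%C = RtoC (A6 t).
Proof.
  intros Ht. unfold A6. rewrite Cmult_1_l. apply real_eq. apply (twisted_real e6c 3).
  apply form_e6. apply real_e6c. apply inH_hA, hA_earc; auto. apply Cmod_earc.
Qed.

Lemma earc_neq0 t : earc t <> 0%C.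
Proof. apply Cmod_neq0. rewrite Cmod_earc. lra. Qed.

Lemma twisted_deriv (f : C -> C) (k : nat) t l : cderiv f (earc t) l ->
  is_derive (fun t => Re (1 * (earc t ^ k * f (earc t)))%C) t
    (Re (Ci * (INR k * (earc t ^ k * f (earc t)) + earc t ^ (S k) * l))%C).
Proof.
  intros H. assert (N := earc_neq0 t).
  replace (Re (Ci * (INR k * (earc t ^ k * f (earc t)) + earc t ^ (S k) * l))%C) with
    (Re (1 * ((INR k * earc t ^ (k - 1) * 1 * f (earc t) + earc t ^ k * l) * (Ci * earc t)))%C).
  - apply (rderiv_Re (fun t => earc t ^ k * f (earc t))%C).
    apply (rderiv_comp (fun w => w ^ k * f w)%C earc). apply rderiv_earc.
    apply cderiv_mult; auto. apply cderiv_pow, cderiv_id.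
  - f_equal. destruct k. simpl. ring. replace (S k - 1)%nat with k by lia. rewrite !Cpow_S. ring.
Qed.

(** At a zero of [E6] on the arc the differential equation reduces the derivative to [PI * A4^2],
    which is positive as [E4] and [E6] have no common zero. So [up_cross] applies from the zero at
    [i] on. *)
Lemma A6_pos t : PI / 2 < t <= 2 * PI / 3 -> 0 < A6 t.
Proof.
  assert (HP := PI_bounds).
  apply (up_cross A6 (fun t => Re (Ci * (INR 3 * (earc t ^ 3 * E6 (earc t)) + earc t ^ 4 * 
     (2 * PI * Ci * ((E2 (earc t) * E6 (earc t) - E4 (earc t) ^ 2) / 2))))%C)); [lra| | |].
  - unfold A6. rewrite earc_PI2, E6_i, !Cmult_0_r. simpl. lra.
  - intros x Hx. apply (twisted_deriv E6 3). apply E6_deriv, hA_earc; auto.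
  - intros x Hx H0. assert (E := A6_eq x Hx). rewrite H0 in E.
    assert (Z : E6 (earc x) = 0%C).
    { transitivity (earc x ^ 3 * E6 (earc x) / earc x ^ 3)%C. field. apply earc_neq0. rewrite E. unfold Cdiv; ring. }
    assert (N4 : E4 (earc x) <> 0%C) by (intro B; apply (E4_E6_neq0 _ (hA_earc x Hx) B Z)).
    rewrite Z.
    replace (Ci * (INR 3 * (earc x ^ 3 * 0) + earc x ^ 4 * (2 * PI * Ci * ((E2 (earc x) * 0 - E4 (earc x) ^ 2) / 2))))%C
      with (- (Ci * Ci) * PI * (earc x ^ 2 * E4 (earc x)) ^ 2)%C by field.
    rewrite A4_eq by auto. replace (- (Ci * Ci))%C with (RtoC 1) by (apply Ceq; simpl; ring).
    assert (NA : A4 x <> 0).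
    { intros A. apply N4. assert (E4' := A4_eq x Hx). rewrite A in E4'.
      transitivity (earc x ^ 2 * E4 (earc x) / earc x ^ 2)%C. field. apply earc_neq0. rewrite E4'. unfold Cdiv; ring. }
    rewrite Cmult_1_l, <- RtoC_pow, <- RtoC_mult, re_RtoC. apply Rmult_lt_0_compat; [lra|].
    apply pow2_gt_0; auto.
Qed.

(** The arc is run backwards from the zero at [rho]. At a zero of [E4] the derivative of [A4] is
    [2 PI / 3 * A6], whose sign is known from [A6_pos]. *)
Lemma A4_neg t : PI / 2 <= t < 2 * PI / 3 -> A4 t < 0.
Proof.
  assert (HP := PI_bounds). intros Ht.
  set (d4 := fun t => Re (Ci * (INR 2 * (earc t ^ 2 * E4 (earc t)) + earc t ^ 3 * 
     (2 * PI * Ci * ((E2 (earc t) * E4 (earc t) - E6 (earc t)) / 3))))%C).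
  assert (P : 0 < - A4 (2 * PI / 3 - (2 * PI / 3 - t))).
  2:{ replace (2 * PI / 3 - (2 * PI / 3 - t)) with t in P by ring. lra. }
  apply (up_cross (fun s => - A4 (2 * PI / 3 - s)) (fun s => d4 (2 * PI / 3 - s)) 0 (PI / 6)); [lra| | | |lra].
  - rewrite Rminus_0_r. unfold A4. rewrite earc_rho, E4_rho, !Cmult_0_r. simpl. lra.
  - intros x Hx.
    assert (D : is_derive A4 (2 * PI / 3 - x) (d4 (2 * PI / 3 - x))).
    { apply (twisted_deriv E4 2). apply E4_deriv, inH_hA, hA_earc. lra. }
    assert (X : is_derive (fun s => 2 * PI / 3 - s) x (-1)) by (auto_derive; auto; ring).
    assert (C := is_derive_opp _ _ _ (is_derive_comp A4 _ _ _ _ D X)).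
    replace (d4 (2 * PI / 3 - x)) with (opp (scal (-1) (d4 (2 * PI / 3 - x)))). exact C.
    unfold opp, scal; simpl; unfold mult; simpl. ring.
  - intros s Hs H0. set (x := 2 * PI / 3 - s) in *. assert (Hx : PI / 2 <= x <= 2 * PI / 3) by (unfold x; lra).
    assert (E := A4_eq x Hx). replace (A4 x) with 0 in E by lra.
    assert (Z : E4 (earc x) = 0%C).
    { transitivity (earc x ^ 2 * E4 (earc x) / earc x ^ 2)%C. field. apply earc_neq0. rewrite E. unfold Cdiv; ring. }
    assert (Hx2 : PI / 2 < x).
    { destruct (Req_dec x (PI / 2)) as [Ex|Ex]; [|lra]. exfalso.
      apply (E4_E6_neq0 _ (hA_earc x Hx) Z). rewrite Ex, earc_PI2. apply E6_i. }
    assert (P6 := A6_pos x ltac:(lra)). unfold d4. rewrite Z.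
    replace (Ci * (INR 2 * (earc x ^ 2 * 0) + earc x ^ 3 * (2 * PI * Ci * ((E2 (earc x) * 0 - E6 (earc x)) / 3))))%C
      with (- (Ci * Ci) * (2 * PI / 3) * (earc x ^ 3 * E6 (earc x)))%C by field.
    rewrite A6_eq by auto. replace (- (Ci * Ci))%C with (RtoC 1) by (apply Ceq; simpl; ring).
    rewrite Cmult_1_l. rewrite <- RtoC_mult, <- RtoC_div, <- RtoC_mult, re_RtoC by lra.
    apply Rmult_lt_0_compat; lra.
Qed.

Definition Jarc (t : R) : R := Re (1 * jinv (earc t))%C.

Lemma Jarc_eq t : PI / 2 <= t <= 2 * PI / 3 -> jinv (earc t) = RtoC (Jarc t).
Proof.
  intros Ht. unfold Jarc. rewrite Cmult_1_l. apply real_eq, jinv_unit_real. apply inH_hA, hA_earc; auto. apply Cmod_earc.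
Qed.

(** The derivative is [2 PI * 1728 * A4^2 * A6 / (A4^3 - A6^2)], negative inside the arc by the
    signs of [A4] and [A6]. *)
Lemma Jarc_decr s t : PI / 2 <= s -> s < t -> t <= 2 * PI / 3 -> Jarc t < Jarc s.
Proof.
  assert (HP := PI_bounds). intros Hs Hst Ht.
  set (dJ := fun t => Re (1 * ((2 * PI * Ci * (- (E4 (earc t) ^ 2 * E6 (earc t)) / Delta (earc t))) * (Ci * earc t)))%C).
  assert (D : forall x, PI / 2 <= x <= 2 * PI / 3 -> is_derive Jarc x (dJ x)).
  { intros x Hx. apply (rderiv_Re (fun t => jinv (earc t))). apply (rderiv_comp jinv earc). apply rderiv_earc.
    apply jinv_deriv, hA_earc; auto. }
  destruct (MVT_cor2 Jarc dJ s t Hst) as (c & E & Hc).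
  { intros x Hx. apply is_derive_Reals, D. lra. }
  assert (Hc' : PI / 2 <= c <= 2 * PI / 3) by lra.
  assert (N4 := A4_neg c ltac:(lra)). assert (P6 := A6_pos c ltac:(lra)).
  assert (V : dJ c = 2 * PI * 1728 * ((A4 c) ^ 2 * A6 c) / ((A4 c) ^ 3 - (A6 c) ^ 2)).
  { unfold dJ. set (z := earc c). assert (Nz : z <> 0%C) by apply earc_neq0.
    assert (ED := Delta_E z (hA_earc c Hc')). assert (ND := Delta_neq0 z).
    assert (E4' := A4_eq c Hc'). assert (E6' := A6_eq c Hc'). fold z in E4', E6'.
    assert (Q : (z ^ 6 * (1728 * Delta z))%C = RtoC ((A4 c) ^ 3 - (A6 c) ^ 2)).
    { rewrite ED, RtoC_minus, !RtoC_pow, <- E4', <- E6'. ring. }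
    assert (NQ : (A4 c) ^ 3 - (A6 c) ^ 2 <> 0).
    { intros A. rewrite A in Q. revert Q. apply Cmult_neq_0; [apply Cpow_nz; auto|apply Cmult_neq_0; auto; apply RtoC_neq0; lra]. }
    replace (1 * (2 * PI * Ci * (- (E4 z ^ 2 * E6 z) / Delta z) * (Ci * z)))%C with
      (- (Ci * Ci) * (2 * PI * 1728) * ((z ^ 2 * E4 z) ^ 2 * (z ^ 3 * E6 z)) / (z ^ 6 * (1728 * Delta z)))%C by (field; auto).
    rewrite Q, E4', E6'. replace (- (Ci * Ci))%C with (RtoC 1) by (apply Ceq; simpl; ring).
    rewrite <- RtoC_pow, <- !RtoC_mult, <- RtoC_div, re_RtoC by auto. field; auto. }
  assert (P2 : 0 < A4 c ^ 2) by (apply pow2_gt_0; lra).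
  assert (N3 : (A4 c) ^ 3 - (A6 c) ^ 2 < 0).
  { assert (0 < A6 c ^ 2) by (apply pow_lt; auto). assert (A4 c * A4 c ^ 2 < 0 * A4 c ^ 2) by (apply Rmult_lt_compat_r; auto).
    simpl in *. lra. }
  assert (dJ c < 0).
  { rewrite V. unfold Rdiv. assert (/ (A4 c ^ 3 - A6 c ^ 2) < 0) by (apply Rinv_lt_0_compat; auto).
    assert (0 < 2 * PI * 1728 * (A4 c ^ 2 * A6 c)) by (apply Rmult_lt_0_compat; [lra|apply Rmult_lt_0_compat; auto]). nra. }
  assert (dJ c * (t - s) < 0 * (t - s)) by (apply Rmult_lt_compat_r; lra). lra.
Qed.

Lemma Jarc_PI2 : Jarc (PI / 2) = 1728.
Proof.
  assert (HP := PI_bounds). assert (E := jinv_1728 Ci). rewrite E6_i in E.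
  unfold Jarc. rewrite earc_PI2, Cmult_1_l. 
  replace (jinv Ci) with (jinv Ci - 1728 + 1728)%C by ring. rewrite E. simpl. ring. unfold hA; simpl; lra.
Qed.

Lemma Jarc_rho : Jarc (2 * PI / 3) = 0.
Proof. unfold Jarc, jinv. rewrite earc_rho, E4_rho. simpl. ring. Qed.

(** * Local behaviour of the j-invariant at a real value *)

Lemma Clim_mult u v l m : Clim u l -> Clim v m -> Clim (fun n => u n * v n)%C (l * m)%C.
Proof.
  intros Hu Hv. assert (D : Clim (fun n => (u n - l) * (v n - m))%C 0%C).
  { intros eps He. destruct (Hu eps He) as (N1 & H1). destruct (Hv 1 ltac:(lra)) as (N2 & H2).
    exists (max N1 N2). intros n Hn. specialize (H1 n ltac:(lia)). specialize (H2 n ltac:(lia)).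
    replace ((u n - l) * (v n - m) - 0)%C with ((u n - l) * (v n - m))%C by ring. rewrite Cmod_mult.
    generalize (Cmod_ge_0 (u n - l)%C) (Cmod_ge_0 (v n - m)%C). intros. nra. }
  assert (E := Clim_plus _ _ _ _ D (Clim_plus _ _ _ _ (Clim_scal l v m Hv)
     (Clim_minus _ _ _ _ (Clim_scal m u l Hu) (Clim_const (m * l))))).
  replace (l * m)%C with (0 + (l * m + (m * l - m * l)))%C by ring.
  revert E. apply Clim_ext. intros n. ring.
Qed.

Lemma Clim_pow u l n : Clim u l -> Clim (fun k => u k ^ n)%C (l ^ n)%C.
Proof. intros H. induction n; simpl. apply Clim_const. apply Clim_mult; auto. Qed.

Lemma Clim_inv_INR (v : C) eps : 0 < eps -> exists N, forall k, (N <= k)%nat -> Cmod (v / INR (S k))%C < eps.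
Proof.
  intros He. destruct (is_lim_seq_KN (Cmod v)) with (P := fun x => Rabs x < eps) as (N & HN).
  { exists (mkposreal eps He). intros y Hy. unfold ball in Hy; simpl in Hy. unfold AbsRing_ball, abs, minus, plus, opp in Hy; simpl in Hy.
    rewrite Ropp_0, Rplus_0_r in Hy. auto. }
  exists N. intros k Hk. specialize (HN k Hk). rewrite Cmod_div, Cmod_R by (apply RtoC_neq0, not_0_INR; lia).
  rewrite Rabs_pos_eq by apply pos_INR. rewrite S_INR, Rplus_comm. eapply Rle_lt_trans; [apply Rle_abs|auto].
Qed.

Lemma cderiv_Clim (f : C -> C) z l (v : C) : cderiv f z l ->
  Clim (fun k => (f (z + v / INR (S k)) - f z) * INR (S k))%C (l * v)%C.
Proof.
  intros D eps He.
  assert (Hv := Cmod_ge_0 v). assert (He' : 0 < eps / (Cmod v + 1)) by (apply Rdiv_lt_0_compat; lra).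
  destruct (D _ He') as (d & Hd & HD). destruct (Clim_inv_INR v d Hd) as (N & HN).
  exists N. intros k Hk. specialize (HD _ (HN k Hk)).
  assert (Np : 0 < INR (S k)) by (apply lt_0_INR; lia). assert (Nz : RtoC (INR (S k)) <> 0%C) by (apply RtoC_neq0; lra).
  replace ((f (z + v / INR (S k)) - f z) * INR (S k) - l * v)%C with
    ((f (z + v / INR (S k)) - f z - l * (v / INR (S k))) * INR (S k))%C by (field; auto).
  rewrite Cmod_mult, Cmod_R, Rabs_pos_eq by lra.
  rewrite Cmod_div, Cmod_R, (Rabs_pos_eq (INR (S k))) in HD by (auto; lra).
  apply Rle_lt_trans with (eps / (Cmod v + 1) * Cmod v).
  - replace (eps / (Cmod v + 1) * Cmod v) with (eps / (Cmod v + 1) * (Cmod v / INR (S k)) * INR (S k)) by (field; lra).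
    apply Rmult_le_compat_r; lra.
  - apply Rlt_le_trans with (eps / (Cmod v + 1) * (Cmod v + 1)). apply Rmult_lt_compat_l; lra. right. field. lra.
Qed.

Lemma cont_Clim (f : C -> C) z l v : cderiv f z l -> Clim (fun k => f (z + v / INR (S k))%C) (f z).
Proof.
  intros D eps He. destruct (cderiv_cont f z l D eps He) as (d & Hd & HD). destruct (Clim_inv_INR v d Hd) as (N & HN).
  exists N. intros k Hk. apply HD, HN; auto.
Qed.

(** Directions are exhibited whose n-th powers point along the four half axes. The exponents 3, 2, 1
    occur at zeros of [E4], at zeros of [E6] and elsewhere. *)
Lemma power_direction n (c : C) : (1 <= n <= 3)%nat -> c <> 0%C -> exists v : C, Im (v ^ n * c)%C < 0.
Proof.
  intros Hn Hc.
  assert (Dir : forall u1 u2 u3 u4 : C, (exists x, 0 < x /\ (u1 ^ n = RtoC x)%C) -> (exists x, 0 < x /\ (u2 ^ n = - RtoC x)%C) ->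
     (exists x, 0 < x /\ (u3 ^ n = RtoC x * Ci)%C) -> (exists x, 0 < x /\ (u4 ^ n = - RtoC x * Ci)%C) ->
     exists v : C, Im (v ^ n * c)%C < 0).
  { intros u1 u2 u3 u4 (x1 & P1 & E1) (x2 & P2 & E2) (x3 & P3 & E3) (x4 & P4 & E4).
    destruct (Rtotal_order (Im c) 0) as [L|[Z|G]].
    - exists u1. rewrite E1. simpl. unfold Im, Re in *. nra.
    - destruct (Rtotal_order (Re c) 0) as [L|[Z'|G]].
      + exists u3. rewrite E3. simpl. unfold Im, Re in *. nra.
      + exfalso. apply Hc. apply Ceq; auto.
      + exists u4. rewrite E4. simpl. unfold Im, Re in *. nra.
    - exists u2. rewrite E2. simpl. unfold Im, Re in *. nra. }
  assert (N : (n = 1 \/ n = 2 \/ n = 3)%nat) by lia. destruct N as [->|[->| ->]].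
  - apply (Dir 1 (- (1)) Ci (- Ci))%C; exists 1; (split; [lra|apply Ceq; simpl; ring]).
  - apply (Dir 1 Ci (1 + Ci) (1 - Ci))%C; [exists 1|exists 1|exists 2|exists 2]; (split; [lra|apply Ceq; simpl; ring]).
  - apply (Dir 1 (- (1)) (- Ci) Ci)%C; exists 1; (split; [lra|apply Ceq; simpl; ring]).
Qed.

(** Near the zero the leading term [(g e)^n H(z)] dominates, and [e] is taken small along a
    direction in which its imaginary part is negative. *)
Lemma nearby_neg_im (G H : C -> C) z g h n : (1 <= n <= 3)%nat -> G z = 0%C -> cderiv G z g -> g <> 0%C ->
  cderiv H z h -> H z <> 0%C -> forall eps, 0 < eps -> exists e, Cmod e < eps /\ Im (G (z + e) ^ n * H (z + e))%C < 0.
Proof.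
  intros Hn G0 DG Ng DH NH eps He.
  destruct (power_direction n (g ^ n * H z)%C Hn) as (v & Hv). apply Cmult_neq_0; auto. apply Cpow_nz; auto.
  assert (L := Clim_mult _ _ _ _ (Clim_pow _ _ n (cderiv_Clim G z g v DG)) (cont_Clim H z h v DH)).
  destruct (L (- Im (v ^ n * (g ^ n * H z))%C) ltac:(lra)) as (N1 & H1). destruct (Clim_inv_INR v eps He) as (N2 & H2).
  set (k := max N1 N2). specialize (H1 k ltac:(lia)). specialize (H2 k ltac:(lia)).
  exists (v / INR (S k))%C. split; auto. rewrite G0 in H1. set (y := (z + v / INR (S k))%C) in *.
  assert (Np : 0 < INR (S k)) by (apply lt_0_INR; lia).
  assert (A := Im_le_Cmod ((((G y - 0) * INR (S k)) ^ n * H y - (g * v) ^ n * H z))%C).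
  replace ((((G y - 0) * INR (S k)) ^ n * H y - (g * v) ^ n * H z))%C with
    (RtoC (INR (S k) ^ n) * (G y ^ n * H y) - v ^ n * (g ^ n * H z))%C in *
    by (rewrite RtoC_pow; replace (G y - 0)%C with (G y) by ring; rewrite !Cpow_mult_l; ring).
  assert (B : INR (S k) ^ n * Im (G y ^ n * H y)%C < 0).
  { replace (INR (S k) ^ n * Im (G y ^ n * H y)%C) with 
      (Im (RtoC (INR (S k) ^ n) * (G y ^ n * H y) - v ^ n * (g ^ n * H z))%C + Im (v ^ n * (g ^ n * H z))%C).
    lra. unfold Cminus. rewrite Im_plus. simpl. ring. }
  assert (0 < INR (S k) ^ n) by (apply pow_lt; auto). apply Rnot_le_lt. intros X.
  assert (0 <= INR (S k) ^ n * Im (G y ^ n * H y)%C) by (apply Rmult_le_pos; lra). lra.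
Qed.

(** A substitute for the open mapping theorem: up to its real value at [z], [jinv] is the cube of
    [E4] or the square of [E6] over [Delta], or else has nonzero derivative. *)
Lemma jinv_expand z : hA < Im z -> Im (jinv z) = 0 -> forall eps, 0 < eps -> exists e, Cmod e < eps /\ Im (jinv (z + e)%C) < 0.
Proof.
  intros Hz' H0 eps He'. assert (Hz : hA <= Im z) by lra. assert (HzH := inH_hA z Hz).
  assert (He : 0 < Rmin eps (Im z - hA)) by (apply Rmin_glb_lt; lra).
  assert (DI := cderiv_inv Delta z _ (Delta_neq0 z) (Delta_deriv z HzH)).
  assert (NI : (/ Delta z)%C <> 0%C).
  { intros E. apply C1_nz. transitivity (Delta z * / Delta z)%C. field. apply Delta_neq0. rewrite E. ring. }
  destruct (Ceq_dec (E4 z) 0%C) as [Z4|N4]; [|destruct (Ceq_dec (E6 z) 0%C) as [Z6|N6]].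
  - destruct (E4_deriv_at_zero z Hz Z4) as (D & N).
    exact (nearby_neg_im E4 (fun w => / Delta w)%C z _ _ 3 ltac:(lia) Z4 D N DI NI eps He').
  - destruct (E6_deriv_at_zero z Hz Z6) as (D & N).
    destruct (nearby_neg_im E6 (fun w => / Delta w)%C z _ _ 2 ltac:(lia) Z6 D N DI NI _ He) as (e & E & L).
    exists e. split. eapply Rlt_le_trans; [apply E|apply Rmin_l].
    rewrite <- jinv_1728 in L. unfold Cminus in L. rewrite Im_plus in L. simpl in *. lra.
    assert (E' := Rlt_le_trans _ _ _ E (Rmin_r _ _)). assert (A := Rabs_Im_le_Cmod e).
    rewrite Im_plus. generalize (Rle_abs (- Im e)). rewrite Rabs_Ropp. lra.
  - assert (D := cderiv_minus _ _ _ _ _ (jinv_deriv z Hz) (cderiv_const (jinv z) z)).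
    destruct (nearby_neg_im (fun w => jinv w - jinv z)%C (fun _ => 1%C) z _ 0%C 1 ltac:(lia) ltac:(cbv beta; ring) D) with (4 := He') as (e & E & L).
    + replace (2 * PI * Ci * (- (E4 z ^ 2 * E6 z) / Delta z) - 0)%C with (2 * PI * Ci * (- (1) * (E4 z ^ 2 * E6 z) * / Delta z))%C by (unfold Cdiv; ring).
      apply Cmult_neq_0; [apply TPI_neq0|]. apply Cmult_neq_0; auto. apply Cmult_neq_0. 
      intros X. injection X. lra. apply Cmult_neq_0; auto. apply Cpow_nz; auto.
    + apply cderiv_const.
    + apply C1_nz.
    + exists e. split; auto. replace ((jinv (z + e) - jinv z) ^ 1 * 1)%C with (jinv (z + e) - jinv z)%C in L by ring.
      unfold Cminus in L. rewrite Im_plus in L. simpl in *. lra.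
Qed.

(** The expansion 1/q + c + O(q). The point is that [c] is real and so drops out of the imaginary
    part. *)
Lemma jinv_top : exists B c : R, 0 <= B /\ forall z, hA <= Im z -> Cmod (jinv z - / qq z - c)%C <= B * Cmod (qq z).
Proof.
  set (a1 := Re (powc e4c 3 1 - dc 2%nat)%C).
  set (u := fun n => (powc e4c 3 n - dc (S n) - a1 * dc n)%C).
  assert (Gd := proj1 form_dc). assert (G4 := qgood_powc e4c 3 qgood_e4c).
  assert (GS : qgood (fun n => dc (S n))) by (apply (qgood_shift dc 1); auto).
  assert (Gu : qgood u). { apply qgood_minus; [apply qgood_minus; auto|apply qgood_scal; auto]. }
  destruct lead_dc as [D0 D1]. assert (P0 : powc e4c 3 0 = 1%C) by apply (lead_pow e4c 0 3 lead_e4).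
  assert (Z : forall n, (n < 2)%nat -> u n = 0%C).
  { intros [|[|n]] Hn; [| |lia]; unfold u.
    - rewrite P0, D1, D0 by lia. ring.
    - rewrite D1. unfold a1. set (x := powc e4c 3 1). set (y := dc 2). apply Ceq; simpl; [ring|].
      generalize (real_powc e4c 3 real_e4c 1%nat) (real_dc 2%nat). fold x y. unfold Im. lra. }
  destruct (qs_Obound u 2 hA Gu ltac:(unfold hA; lra) Z) as (B & HB & Hu).
  exists (B * exp 0.3), a1. split. apply Rmult_le_pos; [auto|left; apply exp_pos].
  intros z Hz. assert (HzH := inH_hA z Hz). specialize (Hu z Hz).
  assert (Nq := qq_neq0 z). assert (ND := Delta_neq0 z).
  assert (Eu : qs u z = (E4 z ^ 3 - Delta z / qq z - a1 * Delta z)%C).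
  { unfold u. rewrite qs_minus, qs_minus, qs_scal, qs_powc, dc_Delta by (solve [auto|apply qgood_e4c|apply qgood_minus; auto|apply qgood_scal; auto]).
    f_equal. f_equal. rewrite <- (dc_Delta z Hz), (qs_shift dc 1 z Gd HzH D0). simpl. field; auto. }
  assert (E : (jinv z - / qq z - a1 = qs u z / Delta z)%C). { rewrite Eu. unfold jinv. field. auto. }
  rewrite E, Cmod_div by auto. assert (L := Delta_lower z 1 Hz). rewrite !pow_1 in L.
  assert (Dp := Cmod_pos _ ND). apply Rmult_le_reg_r with (Cmod (Delta z)); auto.
  replace (Cmod (qs u z) / Cmod (Delta z) * Cmod (Delta z)) with (Cmod (qs u z)) by (field; lra).
  eapply Rle_trans; [apply Hu|]. replace (B * exp 0.3 * Cmod (qq z) * Cmod (Delta z)) with (B * (Cmod (qq z) * (exp 0.3 * Cmod (Delta z)))) by ring.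
  apply Rmult_le_compat_l; auto. simpl. rewrite Rmult_1_r. apply Rmult_le_compat_l; auto. apply Cmod_ge_0.
Qed.

(** On these lines q is real, positive for Re z = 0 and negative for Re z = -1/2, while the
    remaining exponential factor is positive. *)
Lemma Delta_axis z : Re z = 0 \/ Re z = - / 2 -> exists r, 0 < r /\
  (Re z = 0 -> Delta z = RtoC r) /\ (Re z = - / 2 -> Delta z = RtoC (- r)).
Proof.
  intros Hz.
  assert (Hs : Im (qs s1 z) = 0).
  { apply qs_axis_real; auto. intros n. unfold s1. assert (H := sig_Im n). destruct n. simpl. ring.
    rewrite <- (re_RtoC (INR (S n))). unfold Cdiv. rewrite <- RtoC_inv by (apply not_0_INR; lia).
    rewrite im_scal_r, H. ring. }
  exists (exp (- (2 * PI * Im z)) * exp (Re (- (24 * qs s1 z))%C)).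
  assert (E : Cexp (- (24 * qs s1 z))%C = RtoC (exp (Re (- (24 * qs s1 z))%C))).
  { unfold Cexp. replace (Im (- (24 * qs s1 z))%C) with 0 by (rewrite (real_eq _ Hs); simpl; ring).
    rewrite cos_0, sin_0. unfold RtoC. f_equal; ring. }
  assert (P := PI_bounds).
  split. apply Rmult_lt_0_compat; apply exp_pos.
  split; intros H; rewrite Delta_qq, E; unfold qq, Cexp;
    replace (Re (2 * PI * Ci * z)%C) with (- (2 * PI * Im z)) by (simpl; unfold Im; ring);
    replace (Im (2 * PI * Ci * z)%C) with (2 * PI * Re z) by (simpl; unfold Re; ring); rewrite H.
  - rewrite Rmult_0_r, cos_0, sin_0. apply Ceq; simpl; ring.
  - replace (2 * PI * - / 2) with (- PI) by field. rewrite cos_neg, sin_neg, cos_PI, sin_PI. apply Ceq; simpl; ring.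
Qed.

Lemma RtoC_Re_neq0 c : Im c = 0 -> c <> 0%C -> Re c <> 0.
Proof. intros H N E. apply N, Ceq; auto. Qed.

Lemma axis_pt x y : (RtoC x + Ci * RtoC y)%C = (x, y).
Proof. apply Ceq; simpl; ring. Qed.

(** The crossing argument on a vertical line: at a zero of [E6] its derivative in [y] is
    [PI * E4^2]. *)
Lemma axis_E6_pos x y0 : x = 0 \/ x = - / 2 -> hA <= y0 -> 0 <= Re (E6 (RtoC x + Ci * RtoC y0)%C) ->
  forall y, y0 < y -> 0 < Re (E6 (RtoC x + Ci * RtoC y)%C).
Proof.
  set (pt := fun y : R => (RtoC x + Ci * RtoC y)%C). fold (pt y0). intros Hx Hy0 H y Hy. fold (pt y). assert (HP := PI_bounds). 
  apply (up_cross (fun t => Re (1 * E6 (pt t))%C) (fun t => Re (1 * (2 * PI * Ci * ((E2 (pt t) * E6 (pt t) - E4 (pt t) ^ 2) / 2) * Ci))%C) y0 y) with (x := y) in Hy.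
  - rewrite Cmult_1_l in Hy. auto.
  - rewrite Cmult_1_l. auto.
  - intros t Ht. apply (rderiv_Re (fun t => E6 (pt t))). apply rderiv_comp. apply rderiv_line.
    fold (pt t). apply E6_deriv. unfold pt; rewrite axis_pt. simpl. lra.
  - intros t Ht. rewrite Cmult_1_l. intros Z. assert (HT : hA <= Im (pt t)) by (unfold pt; rewrite axis_pt; simpl; lra).
    assert (Ax : Re (pt t) = 0 \/ Re (pt t) = - / 2) by (unfold pt; rewrite axis_pt; auto).
    assert (Z6 : E6 (pt t) = 0%C). { apply Ceq; auto. apply qs_axis_real; auto. apply real_e6c. }
    assert (R4 := qs_axis_real e4c (pt t) real_e4c Ax). fold (E4 (pt t)) in R4.
    assert (N4 : E4 (pt t) <> 0%C) by (intros Z4; apply (E4_E6_neq0 (pt t)); auto).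
    rewrite Z6. rewrite (real_eq _ R4).
    replace (1 * (2 * PI * Ci * ((E2 (pt t) * 0 - RtoC (Re (E4 (pt t))) ^ 2) / 2) * Ci))%C with
      (- (Ci * Ci) * (RtoC PI * RtoC (Re (E4 (pt t))) ^ 2))%C by field.
    replace (- (Ci * Ci))%C with (RtoC 1) by (apply Ceq; simpl; ring).
    rewrite Cmult_1_l, <- RtoC_pow, <- RtoC_mult, re_RtoC. apply Rmult_lt_0_compat. lra.
    apply pow2_gt_0. apply RtoC_Re_neq0; auto.
  - lra.
Qed.

(** Likewise, the derivative in [y] at a zero of [E4] is [2 PI / 3 * E6]. *)
Lemma axis_E4_pos x y0 : x = 0 \/ x = - / 2 -> hA <= y0 -> E4 (RtoC x + Ci * RtoC y0)%C = 0%C ->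
  (forall y, y0 <= y -> 0 < Re (E6 (RtoC x + Ci * RtoC y)%C)) ->
  forall y, y0 < y -> 0 < Re (E4 (RtoC x + Ci * RtoC y)%C).
Proof.
  set (pt := fun y : R => (RtoC x + Ci * RtoC y)%C). fold (pt y0). intros Hx Hy0 H H6 y Hy. fold (pt y). assert (HP := PI_bounds).
  apply (up_cross (fun t => Re (1 * E4 (pt t))%C) (fun t => Re (1 * (2 * PI * Ci * ((E2 (pt t) * E4 (pt t) - E6 (pt t)) / 3) * Ci))%C) y0 y) with (x := y) in Hy.
  - rewrite Cmult_1_l in Hy. auto.
  - rewrite H. simpl. lra.
  - intros t Ht. apply (rderiv_Re (fun t => E4 (pt t))). apply rderiv_comp. apply rderiv_line.
    fold (pt t). apply E4_deriv, inH_hA. unfold pt; rewrite axis_pt. simpl. lra.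
  - intros t Ht. rewrite Cmult_1_l. intros Z. 
    assert (Ax : Re (pt t) = 0 \/ Re (pt t) = - / 2) by (unfold pt; rewrite axis_pt; auto).
    assert (Z4 : E4 (pt t) = 0%C). { apply Ceq; auto. apply qs_axis_real; auto. apply real_e4c. }
    assert (R6 := qs_axis_real e6c (pt t) real_e6c Ax). fold (E6 (pt t)) in R6.
    rewrite Z4. rewrite (real_eq _ R6).
    replace (1 * (2 * PI * Ci * ((E2 (pt t) * 0 - RtoC (Re (E6 (pt t)))) / 3) * Ci))%C with
      (- (Ci * Ci) * (2 * PI / 3 * RtoC (Re (E6 (pt t)))))%C by field.
    replace (- (Ci * Ci))%C with (RtoC 1) by (apply Ceq; simpl; ring).
    specialize (H6 t ltac:(lra)).
    rewrite Cmult_1_l, <- RtoC_mult, <- RtoC_div, <- RtoC_mult, re_RtoC by lra. apply Rmult_lt_0_compat; [lra|exact H6].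
  - lra.
Qed.

Lemma jinv_imaginary_axis z : Re z = 0 -> 1 < Im z -> 1728 < Re (jinv z).
Proof.
  intros Hx Hy. assert (Hz : hA <= Im z) by (unfold hA; lra). assert (E := jinv_1728 z Hz).
  assert (P : 0 < Re (E6 z)).
  { assert (Ez : z = (RtoC 0 + Ci * RtoC (Im z))%C) by (rewrite axis_pt; apply Ceq; auto). rewrite Ez.
    apply (axis_E6_pos 0 1); auto. unfold hA; lra.
    replace (RtoC 0 + Ci * RtoC 1)%C with Ci by ring. rewrite E6_i. simpl; lra. }
  destruct (Delta_axis z (or_introl Hx)) as (r & Hr & Hd & _). specialize (Hd Hx).
  assert (R6 := qs_axis_real e6c z real_e6c (or_introl Hx)). fold (E6 z) in R6.
  rewrite Hd, (real_eq _ R6), <- RtoC_pow, <- RtoC_inv, <- RtoC_mult in E by lra.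
  assert (E' : Re (jinv z) - 1728 = Re (E6 z) ^ 2 * / r) by (rewrite <- (re_RtoC (_ * _)), <- E; simpl; unfold Re; ring).
  assert (0 < Re (E6 z) ^ 2 * / r). apply Rmult_lt_0_compat. apply pow_lt; auto. apply Rinv_0_lt_compat; auto. lra.
Qed.

Lemma jinv_left_axis z : Re z = - / 2 -> sqrt 3 / 2 < Im z -> Re (jinv z) < 0.
Proof.
  intros Hx Hy. assert (S3 := sqrt3_bounds). assert (Hz : hA <= Im z) by (unfold hA; lra).
  assert (HP := PI_bounds).
  assert (Pt : forall y, (RtoC (- / 2) + Ci * RtoC y)%C = (- / 2, y)) by (intros y; apply Ceq; simpl; ring).
  assert (E6r : 0 < Re (E6 rho)).
  { assert (A := A6_eq (2 * PI / 3) ltac:(lra)). rewrite earc_rho, rho_3, Cmult_1_l in A. rewrite A, re_RtoC.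
    apply A6_pos; lra. }
  assert (Ez : z = (RtoC (- / 2) + Ci * RtoC (Im z))%C) by (rewrite Pt; apply Ceq; auto).
  assert (P6 : forall y, sqrt 3 / 2 <= y -> 0 < Re (E6 (RtoC (- / 2) + Ci * RtoC y)%C)).
  { intros y Hy'. destruct (Req_dec y (sqrt 3 / 2)) as [->|N]. rewrite Pt; exact E6r.
    apply (axis_E6_pos (- / 2) (sqrt 3 / 2)); auto. unfold hA; lra. rewrite Pt. left. exact E6r. lra. }
  assert (P : 0 < Re (E4 z)).
  { rewrite Ez. apply (axis_E4_pos (- / 2) (sqrt 3 / 2)); auto. unfold hA; lra. rewrite Pt. apply E4_rho. }
  destruct (Delta_axis z (or_intror Hx)) as (r & Hr & _ & Hd). specialize (Hd Hx).
  assert (R4 := qs_axis_real e4c z real_e4c (or_intror Hx)). fold (E4 z) in R4.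
  unfold jinv. rewrite Hd, (real_eq _ R4), <- RtoC_pow, <- RtoC_inv, <- RtoC_mult, re_RtoC by lra.
  assert (0 < Re (E4 z) ^ 3) by (apply pow_lt; auto). assert (/ - r < 0) by (apply Rinv_lt_0_compat; lra). nra.
Qed.

Lemma unit_arc z : inH z -> Cmod z = 1 -> - / 2 <= Re z <= 0 -> exists t, PI / 2 <= t <= 2 * PI / 3 /\ z = earc t.
Proof.
  intros Hz Hm Hx. assert (HP := PI_bounds). exists (acos (Re z)).
  assert (E : Re z * Re z + Im z * Im z = 1).
  { assert (A := Cmod2_alt z). rewrite Hm in A. simpl in A. unfold Re, Im in *. lra. }
  split.
  - assert (B := acos_bound (Re z)). assert (CE := cos_acos (Re z) ltac:(lra)). split.
    + apply Rnot_lt_le. intros L. assert (X := cos_gt_0 (acos (Re z)) ltac:(lra) L). lra.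
    + apply Rnot_lt_le. intros L. assert (X := cos_decreasing_1 (2 * PI / 3) (acos (Re z)) ltac:(lra) ltac:(lra) ltac:(lra) ltac:(lra) L).
      assert (Y : cos (2 * PI / 3) = - / 2) by (change (Re (earc (2 * PI / 3)) = - / 2); rewrite earc_rho; auto). lra.
  - apply Ceq; simpl. rewrite cos_acos; lra. rewrite sin_acos by lra.
    replace (1 - (Re z)²) with ((Im z)²) by (unfold Rsqr; lra). rewrite sqrt_Rsqr; auto. left; exact Hz.
Qed.

Lemma twice_diff_jinv : twice_diff jinv.
Proof.
  apply (twice_diff_mult (fun z => E4 z ^ 3)%C (fun z => / Delta z)%C).
  apply twice_diff_pow, twice_diff_qs, qgood_e4c. apply twice_diff_inv. apply Delta_neq0. apply twice_diff_Delta.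
Qed.

Lemma half_domain_height z : 0 < Im z -> - / 2 <= Re z <= / 2 -> 1 <= Cmod z -> hA < Im z.
Proof.
  intros Hi Hr Hm. unfold hA. apply Rnot_le_lt. intros L.
  assert (A := Cmod2_alt z). assert (1 <= Cmod z ^ 2) by nra. nra.
Qed.

(** If the value were negative, [- Im jinv] plus a small convex term would attain a positive maximum
    of size at least [eta] on the truncated half domain. On the two vertical sides and on the arc
    [jinv] is real, on the top edge 1/q dominates and has nonnegative imaginary part, and the
    interior is excluded by [no_local_max]. *)
Lemma jinv_nonneg z : inH z -> - / 2 <= Re z <= 0 -> 1 <= Cmod z -> 0 <= Im (jinv z).
Proof.
  intros Hz Hr Hm. apply Rnot_lt_le. intros L. set (eta := - Im (jinv z)). assert (He : 0 < eta) by (unfold eta; lra).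
  destruct jinv_top as (B & c & HB & Ht). assert (HP := PI_bounds).
  (* At height [Y] the error term of [jinv_top] is at most [eta / 4]. *)
  assert (HY : exists Y, Im z < Y /\ hA <= Y /\ B * exp (- 2 * PI * Y) <= eta / 4).
  { set (Y := Rmax (Im z + 1) (Rmax 1 (4 * B / eta))). exists Y.
    assert (M1 := Rmax_l (Im z + 1) (Rmax 1 (4 * B / eta))). assert (M2 := Rmax_r (Im z + 1) (Rmax 1 (4 * B / eta))).
    assert (M3 := Rmax_l 1 (4 * B / eta)). assert (M4 := Rmax_r 1 (4 * B / eta)). fold Y in M1, M2.
    split; [lra|]. split; [unfold hA; lra|].
    assert (X : exp (- 2 * PI * Y) <= / Y).
    { replace (- 2 * PI * Y) with (- (2 * PI * Y)) by ring. rewrite exp_Ropp. apply Rinv_le_contravar. lra.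
      apply Rle_trans with (exp Y); [|apply exp_le; nra]. left. generalize (exp_ineq1 Y). lra. }
    apply Rle_trans with (B * / Y). apply Rmult_le_compat_l; auto.
    apply Rmult_le_reg_r with Y; [lra|]. replace (B * / Y * Y) with B by (field; lra).
    apply Rle_trans with (eta / 4 * (4 * B / eta)). right; field; lra. apply Rmult_le_compat_l; lra. }
  destruct HY as (Y & HY1 & HY2 & HY3).
  set (K := fun w => - / 2 <= Re w <= 0 /\ 1 <= Cmod w /\ hA <= Im w <= Y).
  set (phi := fun y => eta / 4 * exp (- y) - 0 * y).
  destruct twice_diff_jinv as (W1 & W2 & D1 & D2).
  destruct (attains_max K (fun w => Re (Ci * jinv w)%C + phi (Im w)) (1 + Y) z) as (z0 & K0 & Mx).
  - split; auto. split; auto. assert (hA < Im z) by (apply half_domain_height; auto; lra). lra.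
  - intros w (A & _ & C). eapply Rle_trans; [apply Cmod_le_ReIm|].
    rewrite (Rabs_left1 (Re w)), (Rabs_pos_eq (Im w)) by (unfold hA in *; lra). lra.
  - intros w Hw.
    assert (Q : forall F : C -> R, (forall a b, Rabs (F a - F b) <= 1 * Cmod (a - b)%C) -> (forall v, K v -> 0 <= F v) -> 0 <= F w).
    { intros F HF Hp. apply (C_closed_le F 1 w HF ltac:(lra)). intros eps He'. destruct (Hw eps He') as (v & Kv & Cv).
      exists v. auto. }
    assert (A1 : forall k a b, Rabs (a + k - (b + k)) = Rabs (a - b)) by (intros; f_equal; ring).
    assert (A2 : forall k a b, Rabs (k - a - (k - b)) = Rabs (a - b)) by (intros; rewrite <- Rabs_Ropp; f_equal; ring).
    assert (Q1 := Q (fun v => Re v + / 2) ltac:(intros; cbv beta; rewrite A1; apply Rabs_Re_sub) ltac:(unfold K; intros; lra)).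
    assert (Q2 := Q (fun v => 0 - Re v) ltac:(intros; cbv beta; rewrite A2; apply Rabs_Re_sub) ltac:(unfold K; intros; lra)).
    assert (Q3 := Q (fun v => Im v + - hA) ltac:(intros; cbv beta; rewrite A1; apply Rabs_Im_sub) ltac:(unfold K; intros; lra)).
    assert (Q4 := Q (fun v => Y - Im v) ltac:(intros; cbv beta; rewrite A2; apply Rabs_Im_sub) ltac:(unfold K; intros; lra)).
    assert (Q5 := Q (fun v => Cmod v + - (1)) ltac:(intros; cbv beta; rewrite A1, Rmult_1_l; apply Rabs_le; split;
       [generalize (Cmod_ge_minus b a); rewrite (Cmod_sub_comm b a); lra|apply Cmod_ge_minus]) ltac:(unfold K; intros; lra)).
    unfold K. cbv beta in *. lra.
  - intros w (_ & _ & Hw) eps He'. destruct (harm_continuous jinv _ Ci w phi _ eps (D1 w (inH_hA w (proj1 Hw))) (phi_deriv _ _ _) He') as (d & Hd & H).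
    exists d. split; auto.
  - assert (U : eta <= Re (Ci * jinv z0)%C + phi (Im z0)).
    { assert (Kz : K z). { split; auto. split; auto. assert (hA < Im z) by (apply half_domain_height; auto; lra). lra. }
      specialize (Mx z Kz). cbv beta in Mx. replace (Re (Ci * jinv z)%C) with eta in Mx by (unfold eta; simpl; unfold Im; ring).
      assert (0 <= phi (Im z)); [|lra]. unfold phi. assert (0 < exp (- Im z)) by apply exp_pos. nra. }
    destruct K0 as (K1 & K2 & K3). unfold hA in K3. assert (Ph : phi (Im z0) <= eta / 4).
    { unfold phi. assert (exp (- Im z0) <= exp 0) by (apply exp_le; lra). rewrite exp_0 in *. nra. }
    replace (Re (Ci * jinv z0)%C) with (- Im (jinv z0)) in U by (simpl; unfold Im; ring).
    destruct (Req_dec (Re z0) 0) as [E|N0]. { rewrite jinv_axis_real in U by auto. lra. }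
    destruct (Req_dec (Re z0) (- / 2)) as [E|N1]. { rewrite jinv_axis_real in U by auto. lra. }
    destruct (Req_dec (Cmod z0) 1) as [E|N2]. { rewrite jinv_unit_real in U by (auto; unfold inH; lra). lra. }
    destruct (Req_dec (Im z0) Y) as [E|N3].
    { specialize (Ht z0 ltac:(unfold hA; lra)). rewrite Cmod_qq, E in Ht.
      assert (A := Rle_trans _ _ _ Ht HY3). assert (Im (/ qq z0)%C >= 0).
      { unfold qq. rewrite <- Cexp_opp. unfold Cexp. cbn [Im snd].
        replace (Im (- (2 * PI * Ci * z0))%C) with (2 * PI * - Re z0) by (simpl; unfold Re, Im; ring).
        apply Rle_ge, Rmult_le_pos. left; apply exp_pos. apply sin_ge_0; nra. }
      assert (X := Rabs_Im_le_Cmod (jinv z0 - / qq z0 - c)%C).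
      replace (Im (jinv z0 - / qq z0 - c)%C) with (Im (jinv z0) - Im (/ qq z0)%C) in X by (unfold Cminus; rewrite !Im_plus; simpl; unfold Im; ring).
      generalize (Rle_abs (- (Im (jinv z0) - Im (/ qq z0)%C))). rewrite Rabs_Ropp. lra. }
    assert (N4 := half_domain_height z0 ltac:(lra) ltac:(lra) K2).
    set (r := Rmin (Rmin (Re z0 + / 2) (- Re z0)) (Rmin (Rmin (Y - Im z0) (Im z0 - hA)) (Cmod z0 - 1))).
    assert (Hr0 : 0 < r) by (unfold r; repeat apply Rmin_glb_lt; lra).
    assert (In : forall h, Cmod h < r -> K (z0 + h)%C).
    { intros h Hh. unfold r in Hh. apply Rmin_Rgt_l in Hh. destruct Hh as [Ha Hb].
      apply Rmin_Rgt_l in Ha. apply Rmin_Rgt_l in Hb. destruct Ha as [Ha1 Ha2]. destruct Hb as [Hb Hb3].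
      apply Rmin_Rgt_l in Hb. destruct Hb as [Hb1 Hb2].
      assert (R1 := Re_le_Cmod h). assert (R2 := Re_le_Cmod (- h)%C). assert (R3 := Im_le_Cmod h). assert (R4 := Im_le_Cmod (- h)%C).
      rewrite Cmod_opp in R2, R4. assert (Re (- h)%C = - Re h) by auto. assert (Im (- h)%C = - Im h) by auto.
      assert (R5 := Cmod_ge_minus_plus z0 h).
      unfold K. rewrite Re_plus, Im_plus. lra. }
    apply (no_local_max jinv W1 (W2 z0) Ci z0 phi (fun y => - (eta / 4) * exp (- y) - 0) (eta / 4 * exp (- Im z0)) r Hr0); auto.
    + intros h Hh. apply D1, inH_hA. apply In; auto.
    + apply D2. unfold inH; lra.
    + intros y. apply phi_deriv.
    + apply phi_deriv2.
    + apply Rmult_lt_0_compat; [lra|apply exp_pos].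
Qed.

(** A real value in the interior would have values with negative imaginary part nearby, by
    [jinv_expand]. *)
Lemma jinv_pos_interior z : inH z -> - / 2 < Re z < 0 -> 1 < Cmod z -> 0 < Im (jinv z).
Proof.
  intros Hz Hr Hm. assert (N := jinv_nonneg z Hz ltac:(lra) ltac:(lra)).
  apply Rnot_le_lt. intros L. assert (Hh := half_domain_height z Hz ltac:(lra) ltac:(lra)).
  set (r := Rmin (Rmin (Re z + / 2) (- Re z)) (Rmin (Im z - hA) (Cmod z - 1))).
  assert (Hr0 : 0 < r) by (unfold r; repeat apply Rmin_glb_lt; lra).
  destruct (jinv_expand z Hh ltac:(lra) r Hr0) as (h & Hh' & X). unfold r in Hh'.
  apply Rmin_Rgt_l in Hh'. destruct Hh' as [Ha Hb]. apply Rmin_Rgt_l in Ha, Hb.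
  assert (R1 := Re_le_Cmod h). assert (R2 := Re_le_Cmod (- h)%C). assert (R4 := Im_le_Cmod (- h)%C).
  rewrite Cmod_opp in R2, R4. assert (Re (- h)%C = - Re h) by auto. assert (Im (- h)%C = - Im h) by auto.
  assert (R5 := Cmod_ge_minus_plus z h). unfold hA in *.
  assert (0 <= Im (jinv (z + h)%C)); [|lra]. apply jinv_nonneg; unfold inH; rewrite ?Re_plus, ?Im_plus; lra.
Qed.

(** The other real values are out of range: above 1728 on the imaginary axis, negative on Re z =
    -1/2. The right half of the domain is reflected into the left half. *)
Lemma jinv_arc z : inF z -> Im (jinv z) = 0 -> 0 <= Re (jinv z) <= 1728 -> exists t, PI / 2 <= t <= 2 * PI / 3 /\ z = earc t.
Proof.
  intros [Hz [[H1 H2]|[H1 H2]]] Hi Hj.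
  - destruct (Req_dec (Cmod z) 1) as [E|N]. { apply unit_arc; auto. lra. }
    exfalso. assert (A := Cmod2_alt z). unfold inH in Hz.
    destruct (Req_dec (Re z) 0) as [E|N0].
    { assert (X := jinv_imaginary_axis z E). rewrite E in A. assert (1 < Im z) by nra. specialize (X ltac:(auto)). lra. }
    destruct (Req_dec (Re z) (- / 2)) as [E|N1].
    { assert (X := jinv_left_axis z E). rewrite E in A. assert (S3 := sqrt3_sq). assert (S4 := sqrt3_bounds).
      assert (sqrt 3 / 2 < Im z) by nra. specialize (X ltac:(auto)). lra. }
    assert (X := jinv_pos_interior z Hz ltac:(lra) ltac:(lra)). lra.
  - exfalso. assert (X := jinv_pos_interior (- Cconj z)%C). rewrite <- jinv_conj in X.
    rewrite Cmod_opp, Cmod_conj in X. 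
    assert (0 < Im (Cconj (jinv z))) by (apply X; unfold inH in *; simpl; unfold Re, Im in *; lra).
    simpl in *. unfold Im in *. lra.
Qed.

Lemma E4_zero_rho z : inF z -> E4 z = 0%C -> z = rho.
Proof.
  intros Hz E. assert (J : jinv z = RtoC 0) by (unfold jinv; rewrite E; simpl; ring).
  destruct (jinv_arc z Hz) as (t & Ht & ->); rewrite ?J; simpl; try lra.
  destruct (Req_dec t (2 * PI / 3)) as [->|N]. apply earc_rho.
  assert (X := Jarc_decr t (2 * PI / 3) ltac:(lra) ltac:(lra) ltac:(lra)). rewrite Jarc_rho in X.
  unfold Jarc in X. rewrite J in X. simpl in X. lra.
Qed.

Lemma E6_zero_i z : inF z -> E6 z = 0%C -> z = Ci.
Proof.
  intros Hz E.
  assert (Hh : hA <= Im z). { destruct Hz as [Hz [[? ?]|[? ?]]]; left; apply half_domain_height; auto; lra. }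
  assert (J : jinv z = RtoC 1728).
  { replace (jinv z) with (jinv z - 1728 + 1728)%C by ring. rewrite jinv_1728, E by auto. simpl. ring. }
  destruct (jinv_arc z Hz) as (t & Ht & ->); rewrite ?J; simpl; try lra.
  destruct (Req_dec t (PI / 2)) as [->|N]. apply earc_PI2.
  assert (X := Jarc_decr (PI / 2) t ltac:(lra) ltac:(lra) ltac:(lra)). rewrite Jarc_PI2 in X.
  unfold Jarc in X. rewrite J in X. simpl in X. lra.
Qed.

(** * Approximation of the form near the arc *)

(* The sum of [(z + d)^-k exp (u / (z + d))] over all integers [d], with the exponential truncated at order [J]: the
   Lipschitz formula gives its q-coefficients [trunc_coef]. Here [k = s + 2]. *)
Definition exp_coef (u : C) (j : nat) : C := (u ^ j / INR (fact j))%C.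
Definition trunc_term (k J : nat) (u v : C) : C := (/ v ^ k * Eser J (u / v))%C.
Definition trunc_coef (u : C) (s J : nat) (n : nat) : C :=
  Csum (fun j => exp_coef u j * (beta (s + j) * INR n ^ S (s + j)))%C J.
Definition trunc_sum (u : C) (s J : nat) (z : C) : C := Csum (fun j => exp_coef u j * LS (S (S (s + j))) z)%C J.

Lemma qs_0 z : qs (fun _ => 0%C) z = 0%C.
Proof. transitivity (CS (fun _ => 0%C)); [|apply CS_0]. apply CS_ext. intros n. ring. Qed.

Lemma qs_Csum (d : nat -> nat -> C) J : (forall j, qgood (d j)) ->
  qgood (fun n => Csum (fun j => d j n) J) /\
  forall z, inH z -> qs (fun n => Csum (fun j => d j n) J) z = Csum (fun j => qs (d j) z) J.
Proof.
  intros Hd. induction J as [|J [G E]]; simpl.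
  - split. apply (qgood_fin _ 0). auto. intros z Hz. apply qs_0.
  - split. apply qgood_plus; auto. intros z Hz. rewrite qs_plus, E; auto.
Qed.

Lemma trunc_coef_good u s J : qgood (trunc_coef u s J) /\ forall z, inH z -> qs (trunc_coef u s J) z = trunc_sum u s J z.
Proof.
  assert (G : forall j, qgood (fun n => exp_coef u j * (beta (s + j) * INR n ^ S (s + j)))%C).
  { intros j. do 2 apply qgood_scal. apply qgood_pow. }
  destruct (qs_Csum (fun j n => exp_coef u j * (beta (s + j) * INR n ^ S (s + j)))%C J G) as [Gq E].
  split. exact Gq. intros z Hz. unfold trunc_coef. rewrite E by auto. apply Csum_ext. intros j _.
  rewrite !qs_scal by (auto; repeat apply qgood_scal; apply qgood_pow). rewrite <- lipschitz by auto. auto.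
Qed.

Lemma exp_coef_trunc_term k J (u v : C) : v <> 0%C -> Csum (fun j => exp_coef u j * / v ^ (k + j))%C J = trunc_term k J u v.
Proof.
  intros Hv. unfold trunc_term, Eser. rewrite <- Csum_scal. apply Csum_ext. intros j _. unfold exp_coef, Cdiv.
  rewrite Cpow_mult_l, Cpow_add_r, Cpow_inv by auto. field. 
  assert (RtoC (INR (fact j)) <> 0%C) by apply RtoC_neq0, INR_fact_neq_0.
  repeat split; auto; apply Cpow_nz; auto.
Qed.

(** Exchanges the finite Taylor sum with the sum over [d]. *)
Lemma trunc_sum_trunc_term u s J z : inH z ->
  summable (fun n => trunc_term (S (S s)) J u (z + INR (S n)) + trunc_term (S (S s)) J u (z - INR (S n)))%C /\
  trunc_sum u s J z = (trunc_term (S (S s)) J u z + CS (fun n => trunc_term (S (S s)) J u (z + INR (S n)) + trunc_term (S (S s)) J u (z - INR (S n))))%C.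
Proof.
  intros Hz.
  assert (X : forall n, Csum (fun j => exp_coef u j * lterm (S (S (s + j))) z n)%C J =
    (trunc_term (S (S s)) J u (z + INR (S n)) + trunc_term (S (S s)) J u (z - INR (S n)))%C).
  { intros n. rewrite <- !exp_coef_trunc_term. rewrite <- Csum_plus. apply Csum_ext. intros j _.
    unfold lterm. change (S (S s) + j)%nat with (S (S (s + j))). ring.
    rewrite RtoC_neg_shift. apply inH_shift_neq0; auto. apply inH_shift_neq0; auto. }
  destruct (CS_Csum (fun j n => exp_coef u j * lterm (S (S (s + j))) z n)%C J) as [S1 E].
  { intros j _. apply summable_scal, lterm_summable; auto. lia. }
  split. revert S1. apply summable_ext. intros n. apply X.
  rewrite <- (CS_ext _ _ X), E, <- exp_coef_trunc_term by (apply inH_neq0; auto). rewrite <- Csum_plus.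
  apply Csum_ext. intros j _. unfold LS. rewrite CS_scal by (apply lterm_summable; auto; lia).
  change (S (S s) + j)%nat with (S (S (s + j))). ring.
Qed.

Lemma ex_series_exp x : ex_series (fun n => x ^ n / INR (fact n)) /\ Series (fun n => x ^ n / INR (fact n)) = exp x.
Proof.
  assert (H := is_exp_Reals x).
  assert (E : is_series (fun n => x ^ n / INR (fact n)) (exp x)).
  { revert H. apply is_series_ext. intros n. unfold scal; simpl; unfold mult; simpl. 
    rewrite pow_n_pow. unfold Rdiv. ring. }
  split. eexists; eauto. apply is_series_unique; auto.
Qed.

Lemma exp_partial x (a : nat -> C) J : (forall j, Cmod (a j) <= x ^ j / INR (fact j)) -> Cmod (Csum a J) <= exp x.
Proof.
  intros Ha. destruct (ex_series_exp x) as [E1 E2]. rewrite <- E2. apply Cmod_Csum_Series; auto.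
Qed.

Lemma pow_fact_le x K : 0 <= x -> x ^ K / INR (fact K) <= exp x.
Proof.
  intros Hx. assert (P : forall j, 0 <= x ^ j / INR (fact j)).
  { intros j. apply Rmult_le_pos. apply pow_le; auto. left. apply Rinv_0_lt_compat, lt_0_INR, lt_O_fact. }
  set (a := fun j => if Nat.eqb j K then RtoC (x ^ j / INR (fact j)) else 0%C).
  assert (H := exp_partial x a (S K)). 
  assert (E : Csum a (S K) = RtoC (x ^ K / INR (fact K))).
  { simpl. rewrite Csum_zero. unfold a. rewrite Nat.eqb_refl. ring.
    intros n Hn. unfold a. destruct (Nat.eqb_spec n K); [lia|auto]. }
  rewrite E, Cmod_R, Rabs_pos_eq in H by auto. apply H. intros j. unfold a. destruct (Nat.eqb j K).
  rewrite Cmod_R, Rabs_pos_eq; auto. lra. rewrite Cmod_0. auto.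
Qed.

Lemma taylor_small X : 0 <= X -> forall eps, 0 < eps -> exists J, forall w, Cmod w <= X -> Cmod (Cexp w - Eser J w)%C <= eps.
Proof.
  intros HX eps He. destruct (ex_series_exp X) as [E _].
  assert (L := ex_series_lim_0 _ E). assert (Hp := exp_pos X).
  destruct (L (fun y => Rabs y < eps / exp X)) as (J & HJ).
  { exists (mkposreal (eps / exp X) (Rdiv_lt_0_compat _ _ He Hp)). intros y Hy.
    unfold ball in Hy; simpl in Hy. unfold AbsRing_ball, abs, minus, plus, opp in Hy; simpl in Hy.
    rewrite Ropp_0, Rplus_0_r in Hy. auto. }
  specialize (HJ J (Nat.le_refl J)). exists J. intros w Hw. eapply Rle_trans. apply Cexp_taylor.
  assert (Fp : 0 < / INR (fact J)) by apply Rinv_0_lt_compat, lt_0_INR, lt_O_fact.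
  apply Rle_trans with (X ^ J / INR (fact J) * exp X).
  - apply Rmult_le_compat. apply Rmult_le_pos; [apply pow_le, Cmod_ge_0|lra]. left; apply exp_pos.
    apply Rmult_le_compat_r. lra. apply pow_incr. split; auto. apply Cmod_ge_0. apply exp_le; auto.
  - apply Rle_trans with (eps / exp X * exp X). apply Rmult_le_compat_r. lra.
    eapply Rle_trans; [apply Rle_abs|]. lra. right. field. lra.
Qed.

(* [exp (freq m / z) = q(-1/z)^m] *)
Definition freq (m : nat) : C := (- (2 * PI * Ci * INR m))%C.

(** The radius 3/4 is [hA]: no point [z + d] with [z] on or above the line is smaller. [tau] shrinks
    with the order [J], while [M] is to be independent of it. *)
Definition eser_good (u : C) (J : nat) (tau M : R) : Prop := forall v : C, 3 / 4 <= Cmod v ->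
  Cmod (Eser J (u / v) - Cexp (u / v))%C <= tau /\ Cmod (Eser J (u / v)) <= M.

Lemma eser_good_ex u : exists M, 0 <= M /\ forall tau, 0 < tau <= 1 -> exists J, eser_good u J tau M.
Proof.
  set (X := Cmod u / (3 / 4)). assert (HX : 0 <= X) by (apply Rmult_le_pos; [apply Cmod_ge_0|lra]).
  exists (exp X + 1). split. generalize (exp_pos X). lra.
  intros tau Ht. destruct (taylor_small X HX tau ltac:(lra)) as (J & HJ). exists J. intros v Hv.
  assert (Nv : v <> 0%C) by (apply Cmod_neq0; lra).
  assert (Hw : Cmod (u / v)%C <= X).
  { rewrite Cmod_div by auto. apply Rmult_le_compat_l. apply Cmod_ge_0. apply Rinv_le_contravar; lra. }
  specialize (HJ _ Hw). rewrite Cmod_sub_comm. split; auto.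
  assert (A := Cmod_ge_minus (Eser J (u / v)) (Cexp (u / v))). rewrite Cmod_sub_comm, Cmod_Cexp in A.
  assert (exp (Re (u / v)%C) <= exp X). { apply exp_le. eapply Rle_trans; [apply Re_le_Cmod|auto]. } lra.
Qed.

Lemma CS_inv2_bound a K : 0 <= K -> (forall n, Cmod (a n) <= K * / INR (S n) ^ 2) -> Cmod (CS a) <= 2 * K.
Proof.
  intros HK H. eapply Rle_trans. apply (Cmod_CS_le a (fun n => K * / INR (S n) ^ 2) H).
  apply ex_series_scalR, ex_series_inv2. rewrite Series_scal_l. generalize Series_inv2_le. nra.
Qed.

Lemma Rinv_pow_pos x n : 0 < x -> 0 < / x ^ n.
Proof. intros. apply Rinv_0_lt_compat, pow_lt; auto. Qed.

(** [s] factors give the geometric decay, the remaining two make the sum over [n] converge. *)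
Lemma inv_pow_bound x c d s n : 0 < c -> 0 < d -> c <= x -> d * INR (S n) <= x ->
  / x ^ (S (S s)) <= (/ c) ^ s * (/ d ^ 2 * / INR (S n) ^ 2).
Proof.
  intros Hc Hd H1 H2. assert (Np : 0 < INR (S n)) by (apply lt_0_INR; lia).
  replace (x ^ S (S s)) with (x ^ s * x ^ 2) by (simpl; ring).
  rewrite pow_inv, <- Rinv_mult, <- Rpow_mult_distr, <- Rinv_mult.
  apply Rinv_le_contravar. apply Rmult_lt_0_compat; apply pow_lt; auto. apply Rmult_lt_0_compat; auto.
  apply Rmult_le_compat. apply pow_le; lra. apply pow_le. apply Rmult_le_pos; lra.
  apply pow_incr; lra. apply pow_incr. split; auto. apply Rmult_le_pos; lra.
Qed.

Lemma trunc_term_bound u J tau M k v : eser_good u J tau M -> 3 / 4 <= Cmod v -> Cmod (trunc_term k J u v) <= / Cmod v ^ k * M.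
Proof.
  intros G Hv. assert (Nv : v <> 0%C) by (apply Cmod_neq0; lra). unfold trunc_term.
  rewrite Cmod_mult, Cmod_inv, Cmod_pow by (apply Cpow_nz; auto).
  apply Rmult_le_compat_l. left. apply Rinv_pow_pos; lra. apply G; auto.
Qed.

Lemma shift_far z n : Rabs (Re z) <= / 2 -> INR n + 3 / 2 <= Cmod (z + INR (S (S n)))%C /\ INR n + 3 / 2 <= Cmod (z - INR (S (S n)))%C.
Proof.
  intros Hz. apply Rabs_le_between in Hz. rewrite !S_INR.
  assert (A := Re_le_Cmod (z + (INR n + 1 + 1)%R)%C). assert (B := Re_le_Cmod (- (z - (INR n + 1 + 1)%R))%C).
  rewrite Cmod_opp in B. simpl in A, B. unfold Re in *. lra.
Qed.

(** The terms with |d| >= 2, for which |z + d| >= 3/2 in the strip |Re z| <= 1/2. *)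
Definition trunc_tail (s J : nat) (u z : C) : C :=
  CS (fun n => trunc_term (S (S s)) J u (z + INR (S (S n))) + trunc_term (S (S s)) J u (z - INR (S (S n))))%C.

Lemma trunc_sum_split u s J z : inH z ->
  trunc_sum u s J z = (trunc_term (S (S s)) J u z + trunc_term (S (S s)) J u (z + 1) + trunc_term (S (S s)) J u (z - 1) + trunc_tail s J u z)%C.
Proof. intros Hz. destruct (trunc_sum_trunc_term u s J z Hz) as [S1 ->]. rewrite CS_incr_1 by auto. unfold trunc_tail. simpl INR. ring. Qed.

Lemma trunc_tail_bound u s J tau M z : eser_good u J tau M -> 0 <= M -> Rabs (Re z) <= / 2 ->
  Cmod (trunc_tail s J u z) <= 4 * M * (2 / 3) ^ s.
Proof.
  intros G HM Hz. replace (4 * M * (2 / 3) ^ s) with (2 * (2 * M * (2 / 3) ^ s)) by ring.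
  assert (P : 0 <= (2 / 3) ^ s) by (apply pow_le; lra).
  apply CS_inv2_bound. apply Rmult_le_pos; lra. intros n.
  assert (Nn := pos_INR n). assert (T : forall v, INR n + 3 / 2 <= Cmod v -> Cmod (trunc_term (S (S s)) J u v) <= M * ((2 / 3) ^ s * / INR (S n) ^ 2)).
  { intros v Hv. eapply Rle_trans. eapply trunc_term_bound; eauto. lra. rewrite Rmult_comm. apply Rmult_le_compat_l; auto.
    eapply Rle_trans. apply (inv_pow_bound _ (3 / 2) 1 s n); try lra. rewrite S_INR; lra.
    right. replace (/ (3 / 2)) with (2 / 3) by field. field. rewrite S_INR. lra. }
  destruct (shift_far z n Hz) as [A B]. eapply Rle_trans. apply Cmod_triangle.
  generalize (T _ A) (T _ B). lra.
Qed.

(** The automorphy factor is moved into the terms: [z (-1/z + d) = d z - 1] has imaginary part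
    [d * hA], of modulus at least 3/2 when |d| >= 2. *)
Lemma trunc_tail_S_bound u s J tau M z : eser_good u J tau M -> 0 <= M -> Im z = hA -> Cmod z <= 1 ->
  Cmod (/ z ^ (S (S s)) * trunc_tail s J u (- / z))%C <= 8 * M * (2 / 3) ^ s.
Proof.
  intros G HM Hz H1. assert (HzH : inH z) by (unfold inH; rewrite Hz; unfold hA; lra).
  assert (Nz := inH_neq0 z HzH). assert (P : 0 <= (2 / 3) ^ s) by (apply pow_le; lra).
  assert (Zp := Cmod_pos z Nz).
  assert (Sm : summable (fun n => trunc_term (S (S s)) J u (- / z + INR (S (S n))) + trunc_term (S (S s)) J u (- / z - INR (S (S n))))%C).
  { destruct (trunc_sum_trunc_term u s J (- / z)%C (inH_S z HzH)) as [S1 _]. apply summable_incr_1 in S1. exact S1. }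
  unfold trunc_tail. rewrite <- CS_scal by auto.
  apply Rle_trans with (2 * (4 * M * (2 / 3) ^ s)); [|right; ring].
  apply CS_inv2_bound. apply Rmult_le_pos; lra. intros n.
  assert (Nn := pos_INR n).
  assert (T : forall v, 3 / 4 * INR (S (S n)) <= Cmod (z * v)%C -> Cmod (/ z ^ S (S s) * trunc_term (S (S s)) J u v)%C <= M * ((2 / 3) ^ s * (16 / 9 * / INR (S n) ^ 2))).
  { intros v Hv. rewrite !S_INR in Hv. rewrite Cmod_mult in Hv.
    assert (Vp := Cmod_ge_0 v).
    assert (V34 : 3 / 4 <= Cmod v) by nra.
    rewrite Cmod_mult, Cmod_inv, Cmod_pow by (apply Cpow_nz; auto).
    eapply Rle_trans. apply Rmult_le_compat_l. left; apply Rinv_pow_pos; auto. eapply trunc_term_bound; eauto.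
    rewrite <- Rmult_assoc, <- Rinv_mult, <- Rpow_mult_distr, Rmult_comm.
    apply Rmult_le_compat_l; auto. 
    eapply Rle_trans. apply (inv_pow_bound _ (3 / 2) (3 / 4) s n); try lra. rewrite S_INR; lra.
    right. replace (/ (3 / 2)) with (2 / 3) by field. field. rewrite S_INR. lra. }
  assert (ImB : forall r : R, INR (S (S n)) = Rabs r -> 3 / 4 * INR (S (S n)) <= Cmod (z * (- / z + r))%C).
  { intros r Hr. replace (z * (- / z + r))%C with (r * z - 1)%C by (field; auto).
    eapply Rle_trans; [|apply Rabs_Im_le_Cmod]. replace (Im (r * z - 1)%C) with (r * Im z) by (simpl; unfold Im, Re; ring).
    rewrite Rabs_mult, Hr, Hz. unfold hA. rewrite (Rabs_pos_eq (3 / 4)) by lra. lra. }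
  rewrite Cmult_plus_distr_l. eapply Rle_trans. apply Cmod_triangle.
  assert (X1 := T _ (ImB (INR (S (S n))) ltac:(rewrite Rabs_pos_eq; auto; apply pos_INR))).
  assert (X2 := ImB (- INR (S (S n))) ltac:(rewrite Rabs_Ropp, Rabs_pos_eq; auto; apply pos_INR)).
  rewrite <- RtoC_neg_shift in X2. specialize (T _ X2).
  assert (Q : 0 <= M * (2 / 3) ^ s * / INR (S n) ^ 2).
  { apply Rmult_le_pos. apply Rmult_le_pos; auto. left. apply Rinv_pow_pos. rewrite S_INR. lra. }
  lra.
Qed.

Lemma Cexp_freq m : Cexp (freq m) = 1%C.
Proof.
  unfold freq. rewrite Cexp_opp. replace (2 * PI * Ci * INR m)%C with (INR m * (2 * PI * Ci))%C by ring.
  rewrite <- Cexp_pow. assert (E : Cexp (2 * PI * Ci)%C = 1%C); [|rewrite E, Cpow_1_l; field; apply C1_nz].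
  unfold Cexp. replace (Re (2 * PI * Ci)%C) with 0 by (simpl; ring).
  replace (Im (2 * PI * Ci)%C) with (2 * PI) by (simpl; ring). rewrite cos_2PI, sin_2PI, exp_0. apply Ceq; simpl; ring.
Qed.

Lemma qq_pow_freq m z : (qq z ^ m)%C = Cexp (- (freq m * z))%C.
Proof. unfold qq, freq. rewrite Cexp_pow. f_equal. ring. Qed.

Lemma Cpow_even_opp (z : C) k : Nat.Even k -> ((- z) ^ k = z ^ k)%C.
Proof.
  intros [j ->]. replace (2 * j)%nat with (j + j)%nat by lia. rewrite !Cpow_add_r, <- !Cpow_mult_l. f_equal. ring.
Qed.

(* The terms [d = 0, 1, -1] of the two sums are exchanged by [z -> - / z] up to the Taylor error
   of the exponential: [d = 0] pairs with the exponentials [qq z ^ m] and [qq (- / z) ^ m], and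
   [d = 1] pairs with [d = -1]. *)
Lemma line_defect m s J tau M z : eser_good (freq m) J tau M -> 0 <= M -> 0 <= tau -> Nat.Even s ->
  Im z = hA -> Rabs (Re z) <= / 2 ->
  Cmod ((qq z ^ m + trunc_sum (freq m) s J z) - / z ^ (S (S s)) * (qq (- / z) ^ m + trunc_sum (freq m) s J (- / z)))%C
    <= 6 * (4 / 3) ^ (S (S s)) * tau + 12 * M * (2 / 3) ^ s.
Proof.
  intros G HM Ht Hev Hi Hr. assert (HzH : inH z) by (unfold inH; rewrite Hi; unfold hA; lra).
  assert (Nz := inH_neq0 z HzH). set (k := S (S s)). assert (Kev : Nat.Even k) by (destruct Hev as [j Hj]; exists (S j); unfold k; lia).
  set (w := (- / z)%C). set (u := freq m). assert (HwH : inH w) by (apply inH_S; auto).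
  assert (N1 : (z + 1)%C <> 0%C) by (apply (inH_shift_neq0 z 1); auto).
  assert (N2 : (z - 1)%C <> 0%C) by (rewrite RtoC_neg_shift; apply inH_shift_neq0; auto).
  assert (W0 := inH_neq0 w HwH).
  assert (W1 : (w + 1)%C <> 0%C) by (apply (inH_shift_neq0 w 1); auto).
  assert (W2 : (w - 1)%C <> 0%C) by (rewrite RtoC_neg_shift; apply inH_shift_neq0; auto).
  assert (E1 : (qq w ^ m)%C = Cexp (u / z)%C). { rewrite qq_pow_freq. f_equal. unfold w, u. field. auto. }
  assert (E2 : (qq z ^ m)%C = Cexp (u / w)%C). { rewrite qq_pow_freq. f_equal. unfold w, u. field. auto. }
  assert (Q1 : (w + 1)%C = ((z - 1) / z)%C) by (unfold w; field; auto).
  assert (Q2 : (w - 1)%C = (- (z + 1) / z)%C) by (unfold w; field; auto).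
  assert (E3 : Cexp (u / (w + 1))%C = Cexp (u / (z - 1))%C).
  { rewrite Q1. replace (u / ((z - 1) / z))%C with (u + u / (z - 1))%C by (field; auto).
    rewrite Cexp_add. unfold u at 1. rewrite Cexp_freq. ring. }
  assert (E4 : Cexp (u / (w - 1))%C = Cexp (u / (z + 1))%C).
  { rewrite Q2. replace (u / (- (z + 1) / z))%C with (- u + u / (z + 1))%C.
    rewrite Cexp_add, Cexp_opp. unfold u at 1. rewrite Cexp_freq. field; auto.
    field. auto. }
  assert (P1 : (/ z ^ k * / w ^ k = 1)%C).
  { unfold w. rewrite Cpow_even_opp, Cpow_inv by auto. field. apply Cpow_nz; auto. }
  assert (P3 : (/ z ^ k * / (w + 1) ^ k = / (z - 1) ^ k)%C).
  { replace (z - 1)%C with (z * (w + 1))%C by (rewrite Q1; field; auto). rewrite Cpow_mult_l. field. split; apply Cpow_nz; auto. }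
  assert (P4 : (/ z ^ k * / (w - 1) ^ k = / (z + 1) ^ k)%C).
  { rewrite <- (Cpow_even_opp (z + 1)) by auto. replace (- (z + 1))%C with (z * (w - 1))%C by (rewrite Q2; field; auto).
    rewrite Cpow_mult_l. field. split; apply Cpow_nz; auto. }
  set (er := fun v => (Eser J (u / v) - Cexp (u / v))%C).
  assert (T : forall v, trunc_term k J u v = (/ v ^ k * (er v + Cexp (u / v)))%C) by (intros v; unfold trunc_term, er; ring).
  assert (D : ((qq z ^ m + trunc_sum u s J z) - / z ^ k * (qq w ^ m + trunc_sum u s J w) =
     (/ z ^ k * er z + / (z + 1) ^ k * er (z + 1) + / (z - 1) ^ k * er (z - 1) + trunc_tail s J u z)
      - (er w + / (z - 1) ^ k * er (w + 1) + / (z + 1) ^ k * er (w - 1) + / z ^ k * trunc_tail s J u w))%C).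
  { rewrite !trunc_sum_split by auto. fold k. rewrite !T, E1, E2, E3, E4.
    transitivity ((Cexp (u / w) + (/ z ^ k * (er z + Cexp (u / z)) + / (z + 1) ^ k * (er (z + 1) + Cexp (u / (z + 1))) +
      / (z - 1) ^ k * (er (z - 1) + Cexp (u / (z - 1))) + trunc_tail s J u z)) -
      (/ z ^ k * Cexp (u / z) + (/ z ^ k * / w ^ k) * (er w + Cexp (u / w)) + (/ z ^ k * / (w + 1) ^ k) * (er (w + 1) + Cexp (u / (z - 1))) +
       (/ z ^ k * / (w - 1) ^ k) * (er (w - 1) + Cexp (u / (z + 1))) + / z ^ k * trunc_tail s J u w))%C. ring.
    rewrite P1, P3, P4. ring. }
  fold u. fold w. fold k. rewrite D.
  assert (Z1 : Cmod z <= 1). { generalize (line_norm z Hi Hr) (Cmod_ge_0 z). nra. }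
  assert (Fz : forall v : C, Im v = hA -> 3 / 4 <= Cmod v).
  { intros v Hv. eapply Rle_trans; [|apply Im_le_Cmod]. rewrite Hv. unfold hA. lra. }
  assert (F0 := Fz z Hi). assert (F1 : 3 / 4 <= Cmod (z + 1)%C) by (apply Fz; rewrite Im_plus, Hi; simpl; ring).
  assert (F2 : 3 / 4 <= Cmod (z - 1)%C) by (apply Fz; unfold Cminus; rewrite Im_plus, Hi; simpl; ring).
  assert (Di : forall a : C, 3 / 4 <= Cmod a -> 3 / 4 <= Cmod (a / z)%C).
  { intros a Ha. rewrite Cmod_div by auto. apply Rle_trans with (Cmod a / 1). lra. apply Rmult_le_compat_l. lra.
    apply Rinv_le_contravar; lra. }
  assert (Fw : 3 / 4 <= Cmod w). { replace w with (- (1) / z)%C by (unfold w; field; auto). apply Di. rewrite Cmod_opp, Cmod_1. lra. }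
  assert (Fw1 : 3 / 4 <= Cmod (w + 1)%C) by (rewrite Q1; auto).
  assert (Fw2 : 3 / 4 <= Cmod (w - 1)%C) by (rewrite Q2; apply Di; rewrite Cmod_opp; auto).
  assert (B1 : forall a b : C, 3 / 4 <= Cmod a -> 3 / 4 <= Cmod b -> Cmod (/ a ^ k * er b)%C <= (4 / 3) ^ k * tau).
  { intros a b Ha Hb. assert (Na : a <> 0%C) by (apply Cmod_neq0; lra).
    rewrite Cmod_mult, Cmod_inv, Cmod_pow by (apply Cpow_nz; auto). apply Rmult_le_compat; try apply Cmod_ge_0.
    left; apply Rinv_pow_pos; lra. replace (4 / 3) with (/ (3 / 4)) by field. rewrite pow_inv.
    apply Rinv_le_contravar. apply pow_lt; lra. apply pow_incr; lra. apply G; auto. }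
  assert (B2 : Cmod (er w) <= (4 / 3) ^ k * tau).
  { apply Rle_trans with (1 * tau). rewrite Rmult_1_l. apply G; auto. apply Rmult_le_compat_r; auto. apply pow_R1_Rle. lra. }
  assert (B3 := trunc_tail_bound u s J tau M z G HM Hr). assert (B4 := trunc_tail_S_bound u s J tau M z G HM Hi Z1). fold k w in B4.
  assert (C1 := B1 z z F0 F0). assert (C2 := B1 _ _ F1 F1). assert (C3 := B1 _ _ F2 F2).
  assert (C4 := B1 _ _ F2 Fw1). assert (C5 := B1 _ _ F1 Fw2).
  eapply Rle_trans. apply Cmod_tri_minus.
  assert (Tr : forall a b c d : C, Cmod (a + b + c + d)%C <= Cmod a + Cmod b + Cmod c + Cmod d).
  { intros a b c d. eapply Rle_trans. apply Cmod_triangle. generalize (Cmod_tri3 a b c). lra. }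
  generalize (Tr (/ z ^ k * er z) (/ (z + 1) ^ k * er (z + 1)) (/ (z - 1) ^ k * er (z - 1)) (trunc_tail s J u z))%C.
  generalize (Tr (er w) (/ (z - 1) ^ k * er (w + 1)) (/ (z + 1) ^ k * er (w - 1)) (/ z ^ k * trunc_tail s J u w))%C. lra.
Qed.

Lemma exp_pow n x : exp (INR n * x) = exp x ^ n.
Proof.
  induction n as [|n IH]. rewrite Rmult_0_l, exp_0; auto.
  rewrite S_INR, Rmult_plus_distr_r, Rmult_1_l, exp_plus, IH. simpl. ring.
Qed.

Lemma Cmod_freq m : Cmod (freq m) = 2 * PI * INR m.
Proof.
  unfold freq. rewrite Cmod_opp, !Cmod_mult, Cmod_Ci, !Cmod_R.
  rewrite !Rabs_pos_eq; try apply pos_INR; try lra. generalize PI_pos; lra.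
Qed.

Lemma Cmod_beta s : Cmod (beta s) = (2 * PI) ^ (S (S s)) / INR (fact (S s)).
Proof.
  unfold beta. assert (HP := PI_pos).
  rewrite Cmod_div, Cmod_pow, Cmod_opp, !Cmod_mult, Cmod_Ci, !Cmod_R by apply RtoC_neq0, INR_fact_neq_0.
  rewrite !Rabs_pos_eq; try lra. rewrite Rmult_1_r. auto. apply pos_INR.
Qed.

(* The factor [(PI/6)^k] comes from [(2 PI n)^K / K! <= (PI/6)^K e^(12 n)]. *)
Lemma trunc_coef_bound m s J n :
  Cmod (trunc_coef (freq m) s J n) <= 2 * PI * exp (12 * INR n) * (PI / 6) ^ (S s) * exp (2 * PI * INR m * (PI / 6)).
Proof.
  assert (HP := PI_bounds). assert (Hn := pos_INR n). assert (Hm := pos_INR m).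
  set (K0 := 2 * PI * exp (12 * INR n) * (PI / 6) ^ (S s)).
  set (x := 2 * PI * INR m * (PI / 6)). destruct (ex_series_exp x) as [E1 E2].
  rewrite <- E2, <- Series_scal_l. unfold trunc_coef. apply Cmod_Csum_Series; [|apply ex_series_scalR; auto].
  intros j. unfold exp_coef. set (K := S (s + j)).
  rewrite !Cmod_mult, Cmod_div, !Cmod_pow, Cmod_beta, Cmod_freq, !Cmod_R by apply RtoC_neq0, INR_fact_neq_0.
  rewrite !Rabs_pos_eq by apply pos_INR. fold K.
  assert (Fj : 0 < / INR (fact j)) by apply Rinv_0_lt_compat, lt_0_INR, lt_O_fact.
  replace ((2 * PI * INR m) ^ j / INR (fact j) * ((2 * PI) ^ S K / INR (fact K) * INR n ^ K))
    with (2 * PI * ((2 * PI * INR m) ^ j * / INR (fact j)) * ((PI / 6) ^ K * ((12 * INR n) ^ K / INR (fact K)))).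
  2:{ replace (2 * PI) with (PI / 6 * 12) at 4 by field. rewrite !Rpow_mult_distr. simpl pow. unfold Rdiv. 
      rewrite !Rpow_mult_distr. field. split; apply INR_fact_neq_0. }
  replace (K0 * (x ^ j / INR (fact j))) with (2 * PI * ((2 * PI * INR m) ^ j * / INR (fact j)) * ((PI / 6) ^ K * exp (12 * INR n))).
  2:{ unfold K0, x, K. replace (S (s + j)) with (S s + j)%nat by lia. rewrite pow_add.
      rewrite (Rpow_mult_distr (2 * PI * INR m) (PI / 6)). unfold Rdiv. ring. }
  apply Rmult_le_compat_l. apply Rmult_le_pos; [lra|]. apply Rmult_le_pos; [|lra]. apply pow_le.
  apply Rmult_le_pos; lra.
  apply Rmult_le_compat_l. apply pow_le; lra. apply pow_fact_le. lra.
Qed.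

(** [PI / 6 <= 0.525 <= 0.99^64] and [0.99 <= exp (- 0.01)], which gives the exponent
    [64 * 12 / 100 = 7.68]. *)
Lemma pow_pi6 : (PI / 6) ^ 12 <= exp (- (7.68)).
Proof.
  assert (HP := PI_bounds). apply Rle_trans with ((0.99 ^ 64) ^ 12).
  - apply pow_incr. split; [lra|]. apply Rle_trans with 0.525; lra.
  - rewrite <- pow_mult. apply Rle_trans with (exp (- 0.01) ^ (64 * 12)).
    + apply pow_incr. generalize (exp_ineq1_le (- 0.01)). lra.
    + rewrite <- exp_pow. right. f_equal. rewrite INR_IZR_INZ. simpl Z.of_nat. lra.
Qed.

(* The modes to be removed so that the approximation agrees with the form up to [q^l]. *)
Definition low_coef (u : C) (s J l n : nat) : C := if (n <=? l)%nat then trunc_coef u s J n else 0%C.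

Lemma CS_fin (a : nat -> C) N : (forall n, (N <= n)%nat -> a n = 0%C) -> CS a = Csum a N.
Proof.
  intros H. assert (S1 : summable a).
  { apply (summable_incr_n a N). apply summable_ext with (fun _ => 0%C). intros n. rewrite H; auto. lia.
    apply ex_series_extR with (fun n => 0 * 0 ^ n). intros n. rewrite Cmod_0. ring. apply ex_series_scalR.
    apply ex_series_geom. rewrite Rabs_R0; lra. }
  rewrite (CS_split a N S1). rewrite (CS_ext _ (fun _ => 0%C)). rewrite CS_0. ring. intros n. apply H. lia.
Qed.

(** A mode [n] is at most a constant times [exp ((12 - 2 PI Im z) n - 7.68 l)]. For
    [2 PI Im z <= 12] the worst case is [n = l], and [4.32 = 12 - 7.68]. *)
Lemma low_bound m : exists Cb, 0 <= Cb /\ forall l s J z, (12 * l <= S (S s))%nat -> inH z -> 2 * PI * Im z <= 12 ->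
  Cmod (qs (low_coef (freq m) s J l) z) <= Cb * (INR l + 1) * exp ((4.32 - 2 * PI * Im z) * INR l).
Proof.
  assert (HP := PI_bounds). assert (Hm := pos_INR m).
  set (Em := exp (2 * PI * INR m * (PI / 6))). assert (HE : 0 < Em) by apply exp_pos.
  exists (2 * PI * 2 * Em). split. apply Rmult_le_pos; lra.
  intros l s J z Hs Hz Hy. assert (Hl := pos_INR l).
  assert (P6 : (PI / 6) ^ (S s) <= 2 * exp (- (7.68 * INR l))).
  { assert (A : (PI / 6) ^ (S (S s)) <= exp (- (7.68 * INR l))).
    { apply Rle_trans with ((PI / 6) ^ (12 * l)). apply Rle_pow_le1; auto; lra.
      rewrite pow_mult. replace (- (7.68 * INR l)) with (INR l * - (7.68)) by ring. rewrite exp_pow.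
      apply pow_incr. split. apply pow_le; lra. apply pow_pi6. }
    change ((PI / 6) ^ S (S s)) with (PI / 6 * (PI / 6) ^ S s) in A.
    assert (0 < (PI / 6) ^ S s) by (apply pow_lt; lra). nra. }
  unfold qs. rewrite (CS_fin _ (S l)).
  2:{ intros n Hn. unfold low_coef. rewrite (proj2 (Nat.leb_gt n l)) by lia. ring. }
  set (B := 2 * PI * 2 * Em * exp ((4.32 - 2 * PI * Im z) * INR l)).
  eapply Rle_trans. apply (Cmod_Csum_le _ (fun _ => B)).
  - intros n Hn. unfold low_coef. rewrite (proj2 (Nat.leb_le n l)) by lia.
    assert (Nn := pos_INR n). assert (NL : INR n <= INR l) by (apply le_INR; lia).
    rewrite Cmod_mult, Cmod_pow, Cmod_qq, <- exp_pow.
    apply Rle_trans with (2 * PI * exp (12 * INR n) * (2 * exp (- (7.68 * INR l))) * Em * exp (INR n * (-2 * PI * Im z))).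
    + apply Rmult_le_compat_r. left; apply exp_pos. eapply Rle_trans. apply trunc_coef_bound. fold Em.
      apply Rmult_le_compat_r. lra. apply Rmult_le_compat_l; auto. apply Rmult_le_pos; [lra|left; apply exp_pos].
    + replace (2 * PI * exp (12 * INR n) * (2 * exp (- (7.68 * INR l))) * Em * exp (INR n * (-2 * PI * Im z))) with
        (2 * PI * 2 * Em * (exp (12 * INR n) * exp (- (7.68 * INR l)) * exp (INR n * (-2 * PI * Im z)))) by ring.
      rewrite <- !exp_plus. unfold B. apply Rmult_le_compat_l. apply Rmult_le_pos; lra. apply exp_le. nra.
  - rewrite sum_n_const, !S_INR. unfold B. right; ring.
Qed.

(** Essentially the tangent of [6 ln x] at 1.27, where the slope is close to 4.71, a lower bound for
    [2 PI * hA]. *)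
Lemma sixth_power_bound x : 1 <= x <= 16 / 9 -> x ^ 6 <= exp (4.71 * x - 4.37).
Proof.
  intros Hx. replace x with (1.27 * (x / 1.27)) at 1 by lra. rewrite Rpow_mult_distr.
  assert (A : (x / 1.27) ^ 6 <= exp (6 * (x / 1.27 - 1))).
  { replace (6 * (x / 1.27 - 1)) with (INR 6 * (x / 1.27 - 1)) by (simpl; ring). rewrite exp_pow. apply pow_incr. split. apply Rmult_le_pos; lra.
    generalize (exp_ineq1_le (x / 1.27 - 1)). lra. }
  assert (B : 1.27 ^ 6 <= exp 1.6).
  { apply Rle_trans with ((1 + 1.6 / INR 16) ^ 16); [|apply (exp_ge_pow 1.6 15); lra]. replace (INR 16) with 16 by (rewrite INR_IZR_INZ; auto). lra. }
  eapply Rle_trans. apply Rmult_le_compat; [|apply pow_le|apply B|apply A]. apply pow_le; lra. apply Rmult_le_pos; lra.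
  rewrite <- exp_plus. apply exp_le. lra.
Qed.

Definition mono_coef (m n : nat) : C := RtoC (if Nat.eqb n m then 1 else 0).
(** Up to index [l] these are exactly the coefficients of [q^m]; beyond, those of the truncated
    sum. *)
Definition approx_coef (m s J l n : nat) : C := (mono_coef m n + trunc_coef (freq m) s J n - 1 * low_coef (freq m) s J l n)%C.
(* The rate 0.05 is the margin 4.37 - 4.32 between [sixth_power_bound] and [low_bound]. *)
Definition decay (l : nat) : R := (INR l + 1) * exp (- (0.05 * INR l)).

Lemma decay_pos l : 0 < decay l.
Proof. apply Rmult_lt_0_compat. generalize (pos_INR l); lra. apply exp_pos. Qed.

Lemma qgood_mono_coef m : qgood (mono_coef m) /\ forall z, qs (mono_coef m) z = (qq z ^ m)%C.
Proof.
  assert (Z : forall n, n <> m -> mono_coef m n = 0%C). { intros n Hn. unfold mono_coef. rewrite (proj2 (Nat.eqb_neq n m)); auto. }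
  split. apply (qgood_fin _ (S m)). intros n Hn. apply Z. lia.
  intros z. unfold qs. rewrite (CS_fin _ (S m)).
  - simpl. rewrite Csum_zero. unfold mono_coef. rewrite Nat.eqb_refl. ring. intros n Hn. rewrite Z by lia. ring.
  - intros n Hn. rewrite Z by lia. ring.
Qed.

Lemma qgood_low_coef u s J l : qgood (low_coef u s J l).
Proof. apply (qgood_fin _ (S l)). intros n Hn. unfold low_coef. rewrite (proj2 (Nat.leb_gt n l)) by lia. auto. Qed.

Lemma approx_coef_good m s J l : qgood (approx_coef m s J l) /\
  forall z, inH z -> qs (approx_coef m s J l) z = (qq z ^ m + trunc_sum (freq m) s J z - qs (low_coef (freq m) s J l) z)%C.
Proof.
  destruct (qgood_mono_coef m) as [G1 E1]. destruct (trunc_coef_good (freq m) s J) as [G2 E2]. assert (G3 := qgood_low_coef (freq m) s J l).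
  assert (G12 : qgood (fun n => mono_coef m n + trunc_coef (freq m) s J n)%C) by (apply qgood_plus; auto).
  assert (G3' : qgood (fun n => 1 * low_coef (freq m) s J l n)%C) by (apply qgood_scal; auto).
  split. apply qgood_minus; auto. intros z Hz. unfold approx_coef. rewrite qs_minus, qs_plus, qs_scal, E1, E2 by auto. ring.
Qed.

Lemma two_thirds_pow s l : (12 * l <= S (S s))%nat -> (2 / 3) ^ s <= 9 / 4 * exp (- (0.05 * INR l)).
Proof.
  intros H. assert (A : (2 / 3) ^ (S (S s)) <= exp (- (0.05 * INR l))).
  { apply Rle_trans with ((2 / 3) ^ (12 * l)). apply Rle_pow_le1; auto; lra.
    apply Rle_trans with ((2 / 3) ^ l). apply Rle_pow_le1; [lra|lia].
    replace (- (0.05 * INR l)) with (INR l * - (0.05)) by ring. rewrite exp_pow. apply pow_incr.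
    generalize (exp_ineq1_le (- (0.05))). lra. }
  simpl in A. lra.
Qed.

Lemma exp_decay l : exp (- (0.05 * INR l)) <= decay l.
Proof. unfold decay. generalize (exp_pos (- (0.05 * INR l))) (pos_INR l). nra. Qed.

(** With [x = |z|^-2] the point -1/z has height [hA x], and |z|^-12 is x^6. The decay of the modes
    at this height pays for the automorphy factor: [4.71 x - 4.37 + 4.32 - 2 PI hA x <= - 0.05]. *)
Lemma low_defect m : exists C0, 0 <= C0 /\ forall l k' s J z, (12 * l + k' = S (S s))%nat -> (k' <= 14)%nat ->
  Im z = hA -> Rabs (Re z) <= / 2 ->
  Cmod (qs (low_coef (freq m) s J l) z - / z ^ (12 * l + k') * qs (low_coef (freq m) s J l) (- / z))%C <= C0 * decay l.
Proof.
  destruct (low_bound m) as (Cb & HC & HB). exists (Cb + Cb * (4 / 3) ^ 14).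
  assert (P14 : 0 < (4 / 3) ^ 14) by (apply pow_lt; lra).
  split. apply Rplus_le_le_0_compat; auto. apply Rmult_le_pos; lra.
  intros l k' s J z Hs Hk Hi Hr. assert (HP := PI_bounds). assert (Hl := pos_INR l).
  assert (HzH : inH z) by (unfold inH; rewrite Hi; unfold hA; lra). assert (Nz := inH_neq0 z HzH).
  assert (LN := line_norm z Hi Hr). assert (Zp := Cmod_pos z Nz).
  assert (Z34 : 3 / 4 <= Cmod z). { eapply Rle_trans; [|apply Im_le_Cmod]. rewrite Hi. unfold hA. lra. }
  set (x := / Cmod z ^ 2). assert (Hx : 1 <= x <= 16 / 9).
  { unfold x. split. rewrite <- Rinv_1. apply Rinv_le_contravar; lra. replace (16 / 9) with (/ (9 / 16)) by field. apply Rinv_le_contravar; lra. }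
  assert (Iw : Im (- / z)%C = hA * x) by (rewrite Im_S, Hi; auto).
  assert (Le : 0 <= Cb * (INR l + 1)) by (apply Rmult_le_pos; lra).
  assert (B1 := HB l s J z ltac:(lia) HzH). assert (B2 := HB l s J (- / z)%C ltac:(lia) (inH_S z HzH)).
  rewrite Hi in B1. rewrite Iw in B2. unfold hA in B1, B2. specialize (B1 ltac:(lra)). specialize (B2 ltac:(nra)).
  eapply Rle_trans. apply Cmod_tri_minus. rewrite Rmult_plus_distr_r. apply Rplus_le_compat.
  - eapply Rle_trans. apply B1. unfold decay. rewrite <- Rmult_assoc. apply Rmult_le_compat_l; auto. apply exp_le. nra.
  - rewrite Cmod_mult, Cmod_inv, Cmod_pow by (apply Cpow_nz; auto).
    assert (K : / Cmod z ^ (12 * l + k') <= (x ^ 6) ^ l * (4 / 3) ^ 14).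
    { rewrite pow_add, Rinv_mult. apply Rmult_le_compat. left; apply Rinv_pow_pos; auto. left; apply Rinv_pow_pos; auto.
      unfold x. right. rewrite !pow_inv, <- !pow_mult. do 2 f_equal. lia.
      apply Rle_trans with ((4 / 3) ^ k'). rewrite <- pow_inv. apply pow_incr. split. left; apply Rinv_0_lt_compat; auto.
      replace (4 / 3) with (/ (3 / 4)) by field. apply Rinv_le_contravar; lra. apply Rle_pow; [lra|auto]. }
    eapply Rle_trans. apply Rmult_le_compat. left; apply Rinv_pow_pos; auto. apply Cmod_ge_0. apply K. apply B2.
    assert (S6 : (x ^ 6) ^ l <= exp (INR l * (4.71 * x - 4.37))).
    { rewrite exp_pow. apply pow_incr. split. apply pow_le; lra. apply sixth_power_bound; auto. }
    apply Rle_trans with (exp (INR l * (4.71 * x - 4.37)) * (4 / 3) ^ 14 * (Cb * (INR l + 1) * exp ((4.32 - 2 * PI * (3 / 4 * x)) * INR l))).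
    apply Rmult_le_compat_r. apply Rmult_le_pos; auto. left; apply exp_pos. apply Rmult_le_compat_r; lra.
    replace (exp (INR l * (4.71 * x - 4.37)) * (4 / 3) ^ 14 * (Cb * (INR l + 1) * exp ((4.32 - 2 * PI * (3 / 4 * x)) * INR l)))
     with (Cb * (4 / 3) ^ 14 * ((INR l + 1) * (exp (INR l * (4.71 * x - 4.37)) * exp ((4.32 - 2 * PI * (3 / 4 * x)) * INR l)))) by ring.
    apply Rmult_le_compat_l. apply Rmult_le_pos; lra. unfold decay. apply Rmult_le_compat_l. lra.
    rewrite <- exp_plus. apply exp_le.
    replace (INR l * (4.71 * x - 4.37) + (4.32 - 2 * PI * (3 / 4 * x)) * INR l) with (INR l * (4.71 * x - 4.37 + 4.32 - 2 * PI * (3 / 4 * x))) by ring.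
    assert (4.71 * x <= 2 * PI * (3 / 4 * x)) by nra. nra.
Qed.

Lemma approx_coef_defect m : exists C0 M, 0 <= C0 /\ 0 <= M /\ forall l k' s, (12 * l + k' = S (S s))%nat -> (k' <= 14)%nat -> Nat.Even s ->
  exists J tau, eser_good (freq m) J tau M /\ 0 <= tau <= (2 / 3) ^ s /\ forall z, Im z = hA -> Rabs (Re z) <= / 2 ->
    Cmod (defect (approx_coef m s J l) (12 * l + k') z) <= C0 * decay l.
Proof.
  destruct (low_defect m) as (C1 & HC1 & H1). destruct (eser_good_ex (freq m)) as (M & HM & HJ).
  exists ((1 + 12 * M) * (9 / 4) + C1), M. split. apply Rplus_le_le_0_compat; auto. apply Rmult_le_pos; lra. split; auto.
  intros l k' s Hs Hk Hev. set (k := S (S s)) in *.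
  assert (Ps : 0 < (2 / 3) ^ s <= 1). { split. apply pow_lt; lra. rewrite <- (pow1 s). apply pow_incr; lra. }
  assert (Pk : 1 <= (4 / 3) ^ k) by (apply pow_R1_Rle; lra).
  (* The Taylor order is chosen so late that it also cancels the factor [6 (4/3)^k] of
     [line_defect]. *)
  set (tau := (2 / 3) ^ s / (6 * (4 / 3) ^ k)).
  assert (Ht : 0 < tau <= (2 / 3) ^ s).
  { unfold tau. split. apply Rdiv_lt_0_compat; lra. apply Rle_trans with ((2 / 3) ^ s / 1); [|lra].
    apply Rmult_le_compat_l. lra. apply Rinv_le_contravar; lra. }
  destruct (HJ tau ltac:(lra)) as (J & G). exists J, tau. split; auto. split. lra.
  intros z Hi Hr. assert (HzH : inH z) by (unfold inH; rewrite Hi; unfold hA; lra).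
  destruct (approx_coef_good m s J l) as [_ E]. unfold defect. rewrite !E by (auto; apply inH_S; auto).
  replace (qq z ^ m + trunc_sum (freq m) s J z - qs (low_coef (freq m) s J l) z -
     / z ^ (12 * l + k') * (qq (- / z) ^ m + trunc_sum (freq m) s J (- / z) - qs (low_coef (freq m) s J l) (- / z)))%C with
    (((qq z ^ m + trunc_sum (freq m) s J z) - / z ^ (12 * l + k') * (qq (- / z) ^ m + trunc_sum (freq m) s J (- / z))) -
     (qs (low_coef (freq m) s J l) z - / z ^ (12 * l + k') * qs (low_coef (freq m) s J l) (- / z)))%C by ring.
  assert (L1 := line_defect m s J tau M z G HM ltac:(lra) Hev Hi Hr). fold k in L1. rewrite <- Hs in L1 at 1.
  assert (L2 := H1 l k' s J z Hs Hk Hi Hr).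
  eapply Rle_trans. apply Cmod_tri_minus. rewrite Rmult_plus_distr_r. apply Rplus_le_compat; auto.
  eapply Rle_trans. apply L1. replace (6 * (4 / 3) ^ k * tau) with ((2 / 3) ^ s) by (unfold tau; field; lra).
  replace ((2 / 3) ^ s + 12 * M * (2 / 3) ^ s) with ((1 + 12 * M) * (2 / 3) ^ s) by ring.
  rewrite Rmult_assoc. apply Rmult_le_compat_l. lra.
  eapply Rle_trans. apply (two_thirds_pow s l). lia. apply Rmult_le_compat_l. lra. apply exp_decay.
Qed.

(** The term d = -1 is absent since |z - 1| >= 1.4 on the left half of the arc, whereas |z + 1|
    comes down to 1 at rho, so d = 1 has to stay. *)
Definition main_term (m k : nat) (z : C) : C :=
  (qq z ^ m + / z ^ k * Cexp (freq m / z) + / (z + 1) ^ k * Cexp (freq m / (z + 1)))%C.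

Definition on_A (z : C) : Prop := Cmod z = 1 /\ - / 2 <= Re z <= 0 /\ sqrt 3 / 2 <= Im z.

Lemma on_A_bounds z : on_A z -> hA <= Im z /\ 0.865 <= Im z <= 1 /\ 1 <= Cmod (z + 1)%C /\ 1.4 <= Cmod (z - 1)%C.
Proof.
  intros (H1 & H2 & H3). assert (S3 := sqrt3_bounds). assert (I1 := Im_le_Cmod z).
  assert (A := Cmod2_alt z). rewrite H1 in A.
  assert (B := Cmod2_alt (z + 1)%C). assert (B' := Cmod2_alt (z - 1)%C).
  assert (E1 : Re (z + 1)%C = Re z + 1) by auto. assert (E2 : Im (z + 1)%C = Im z) by (simpl; unfold Im; ring).
  assert (E3 : Re (z - 1)%C = Re z - 1) by (simpl; unfold Re; ring). assert (E4 : Im (z - 1)%C = Im z) by (simpl; unfold Im; ring).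
  rewrite E1, E2 in B. rewrite E3, E4 in B'. assert (P1 := Cmod_ge_0 (z + 1)%C). assert (P2 := Cmod_ge_0 (z - 1)%C).
  unfold hA. repeat split; try lra; nra.
Qed.

Lemma main_error m l k' s J tau M z : (12 * l + k' = S (S s))%nat -> eser_good (freq m) J tau M -> 0 <= M -> 0 <= tau <= (2 / 3) ^ s ->
  on_A z -> Cmod (qq z ^ m + trunc_sum (freq m) s J z - main_term m (12 * l + k') z)%C <= (9 + 10 * M) * decay l.
Proof.
  intros Hs G HM Ht HA. destruct (on_A_bounds z HA) as (B1 & B2 & B3 & B4). destruct HA as (A1 & A2 & A3).
  assert (HzH := inH_hA z B1). set (u := freq m) in *. rewrite trunc_sum_split by auto. rewrite Hs. set (k := S (S s)) in *.
  set (er := fun v => (Eser J (u / v) - Cexp (u / v))%C).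
  replace (qq z ^ m + (trunc_term k J u z + trunc_term k J u (z + 1) + trunc_term k J u (z - 1) + trunc_tail s J u z) - main_term m k z)%C with
    (/ z ^ k * er z + / (z + 1) ^ k * er (z + 1) + (trunc_term k J u (z - 1) + trunc_tail s J u z))%C
    by (unfold main_term, trunc_term, er; fold u; ring).
  assert (Ee : exp (- (0.05 * INR l)) <= decay l) by apply exp_decay.
  assert (T2 := two_thirds_pow s l ltac:(lia)).
  assert (X : forall a b : C, 1 <= Cmod a -> 1 <= Cmod b -> Cmod (/ a ^ k * er b)%C <= 9 / 4 * decay l).
  { intros a b Ha Hb. assert (Na : a <> 0%C) by (apply Cmod_neq0; lra).
    rewrite Cmod_mult, Cmod_inv, Cmod_pow by (apply Cpow_nz; auto).
    assert (/ Cmod a ^ k <= 1). { rewrite <- Rinv_1. apply Rinv_le_contravar. lra. apply pow_R1_Rle; auto. }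
    assert (Cmod (er b) <= tau) by (apply G; lra).
    apply Rle_trans with (1 * tau). apply Rmult_le_compat; auto. left. apply Rinv_pow_pos; lra. apply Cmod_ge_0. lra. }
  assert (Y : Cmod (trunc_term k J u (z - 1)) <= M * decay l).
  { eapply Rle_trans. eapply trunc_term_bound; eauto. lra. rewrite Rmult_comm. apply Rmult_le_compat_l; auto.
    apply Rle_trans with ((5 / 7) ^ k).
    - rewrite <- pow_inv. apply pow_incr. split. left; apply Rinv_0_lt_compat; lra. replace (5 / 7) with (/ 1.4) by lra.
      apply Rinv_le_contravar; lra.
    - apply Rle_trans with ((5 / 7) ^ l). apply Rle_pow_le1; [lra|unfold k; lia]. eapply Rle_trans; [|apply Ee].
      replace (- (0.05 * INR l)) with (INR l * - (0.05)) by ring. rewrite exp_pow. apply pow_incr.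
      generalize (exp_ineq1_le (- (0.05))). lra. }
  assert (Z := trunc_tail_bound u s J tau M z G HM ltac:(rewrite Rabs_left1; lra)).
  assert (Z' : 4 * M * (2 / 3) ^ s <= 9 * M * decay l).
  { apply Rle_trans with (4 * M * (9 / 4 * decay l)); [|right; field]. apply Rmult_le_compat_l; lra. }
  eapply Rle_trans. apply Cmod_tri3. assert (X1 := X z z ltac:(lra) ltac:(lra)). assert (X2 := X _ _ B3 B3).
  assert (Tr := Cmod_triangle (trunc_term k J u (z - 1)) (trunc_tail s J u z)). generalize (decay_pos l). lra.
Qed.

(** The difference [r] with the approximation has no modes up to [l] and, the form being exact, the
    opposite of the defect of the approximation. [form_bound], or [form_bound14], carries the
    estimate from the line to the arc. *)
Lemma arc_approx m : exists C0, 0 <= C0 /\ forall l k' s c, (12 * l + k' = S (S s))%nat -> Nat.Even s ->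
  is_form c (12 * l + k') -> (forall n, (n <= l)%nat -> c n = mono_coef m n) -> forall z, on_A z ->
  ((k' <= 10)%nat -> Cmod (qs c z - main_term m (12 * l + k') z)%C <= C0 * decay l) /\
  (k' = 14%nat -> Cmod ((qs c z - main_term m (12 * l + k') z) * E4 z)%C <= C0 * decay l).
Proof.
  destruct (approx_coef_defect m) as (C1 & M & HC1 & HM & HG). destruct form_bound14 as (B14 & HB14 & H14).
  destruct (low_bound m) as (Cb & HCb & HL).
  destruct (qs_bounded e4c hA qgood_e4c ltac:(unfold hA; lra)) as (B4 & HB4 & H4).
  set (C2 := 9 + 10 * M + Cb). assert (HC2 : 0 <= C2) by (unfold C2; lra).
  exists (50 * C1 + C2 + (B14 * C1 + C2 * B4)).
  assert (P1 : 0 <= B14 * C1) by (apply Rmult_le_pos; auto). assert (P2 : 0 <= C2 * B4) by (apply Rmult_le_pos; auto).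
  split. lra.
  intros l k' s c Hs Hev Hc Hcn z HA. destruct (on_A_bounds z HA) as (Z1 & Z2 & _ & _).
  assert (HzH := inH_hA z Z1). assert (Ep := decay_pos l). assert (Hl := pos_INR l). assert (HP := PI_bounds).
  destruct (Nat.le_gt_cases k' 14) as [Hk|Hk]; [|split; intros; lia].
  destruct (HG l k' s Hs Hk Hev) as (J & tau & G & Ht & HD).
  destruct (approx_coef_good m s J l) as [Gg Eg].
  set (r := fun n => (c n - 1 * approx_coef m s J l n)%C).
  assert (Gr : qgood r) by (apply qgood_minus; [apply Hc|apply qgood_scal; auto]).
  assert (Er : forall v, inH v -> qs r v = (qs c v - qs (approx_coef m s J l) v)%C).
  { intros v Hv. unfold r. rewrite qs_minus, qs_scal by (auto; try apply Hc; apply qgood_scal; auto). ring. }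
  assert (Z0 : forall n, (n <= l)%nat -> r n = 0%C).
  { intros n Hn. unfold r, approx_coef, low_coef. rewrite Hcn, (proj2 (Nat.leb_le n l)) by auto. ring. }
  (* [5.025] bounds [2 PI hA + 0.3], so [exp (5.025 l)] makes up for the division by [Delta^l] on
     the line. On the arc [|Delta| <= exp (- 5.025)] takes the factor back. *)
  set (d := C1 * decay l * exp (5.025 * INR l)). 
  assert (Hd : 0 <= d). { unfold d. apply Rmult_le_pos. apply Rmult_le_pos; lra. left; apply exp_pos. }
  assert (Df : forall v, Im v = hA -> Rabs (Re v) <= / 2 -> Cmod (defect r (12 * l + k') v) <= d * Cmod (Delta v) ^ l).
  { intros v Hi Hr. assert (HvH : inH v) by (unfold inH; rewrite Hi; unfold hA; lra).
    assert (F0 := form_defect c _ v Hc HvH). unfold defect in F0.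
    assert (Q : defect r (12 * l + k') v = (- defect (approx_coef m s J l) (12 * l + k') v)%C).
    { unfold defect. rewrite !Er by (auto; apply inH_S; auto).
      transitivity ((qs c v - / v ^ (12 * l + k') * qs c (- / v)) - (qs (approx_coef m s J l) v - / v ^ (12 * l + k') * qs (approx_coef m s J l) (- / v)))%C. ring.
      rewrite F0. ring. }
    rewrite Q, Cmod_opp. eapply Rle_trans. apply HD; auto. unfold d. rewrite Rmult_assoc.
    assert (1 <= exp (5.025 * INR l) * Cmod (Delta v) ^ l).
    { destruct (Delta_bounds v ltac:(lra)) as [D1 _]. rewrite Hi in D1. unfold hA in D1.
      apply Rle_trans with (exp (5.025 * INR l) * exp (- (5.025)) ^ l).
      rewrite <- exp_pow, <- exp_plus. replace (5.025 * INR l + INR l * - (5.025)) with 0 by ring. rewrite exp_0. lra.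
      apply Rmult_le_compat_l. left; apply exp_pos. apply pow_incr. split. left; apply exp_pos.
      eapply Rle_trans; [|apply D1]. apply exp_le. lra. }
    assert (0 <= C1 * decay l) by (apply Rmult_le_pos; lra). nra. }
  assert (Dz : d * Cmod (Delta z) ^ l <= C1 * decay l).
  { unfold d. rewrite Rmult_assoc. rewrite <- (Rmult_1_r (C1 * decay l)) at 2. apply Rmult_le_compat_l. apply Rmult_le_pos; lra.
    destruct (Delta_bounds z Z1) as [_ D1].
    apply Rle_trans with (exp (5.025 * INR l) * exp (- (5.025)) ^ l).
    apply Rmult_le_compat_l. left; apply exp_pos. apply pow_incr. split. apply Cmod_ge_0.
    eapply Rle_trans. apply D1. apply exp_le. nra.
    rewrite <- exp_pow, <- exp_plus. replace (5.025 * INR l + INR l * - (5.025)) with 0 by ring. rewrite exp_0. lra. }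
  assert (Rest : Cmod (qs (approx_coef m s J l) z - main_term m (12 * l + k') z)%C <= C2 * decay l).
  { rewrite Eg by auto.
    replace (qq z ^ m + trunc_sum (freq m) s J z - qs (low_coef (freq m) s J l) z - main_term m (12 * l + k') z)%C with
      ((qq z ^ m + trunc_sum (freq m) s J z - main_term m (12 * l + k') z) - qs (low_coef (freq m) s J l) z)%C by ring.
    eapply Rle_trans. apply Cmod_tri_minus. assert (L := HL l s J z ltac:(lia) HzH ltac:(nra)).
    assert (exp ((4.32 - 2 * PI * Im z) * INR l) <= exp (- (0.05 * INR l))).
    { apply exp_le. replace (- (0.05 * INR l)) with (- (0.05) * INR l) by ring. apply Rmult_le_compat_r; auto. nra. }
    assert (Cb * (INR l + 1) * exp ((4.32 - 2 * PI * Im z) * INR l) <= Cb * decay l).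
    { unfold decay. rewrite Rmult_assoc. apply Rmult_le_compat_l; auto. apply Rmult_le_compat_l; lra. }
    assert (Me := main_error m l k' s J tau M z Hs G HM Ht HA). unfold C2. lra. }
  assert (Sp : (qs c z - main_term m (12 * l + k') z = qs r z + (qs (approx_coef m s J l) z - main_term m (12 * l + k') z))%C) by (rewrite Er by auto; ring).
  rewrite Sp. split; intros Hk'.
  - assert (Fb := form_bound r l k' d Gr Z0 Hk' Df z Z1).
    eapply Rle_trans. apply Cmod_triangle. rewrite Rmult_assoc in Fb.
    assert (0 <= (B14 * C1 + C2 * B4) * decay l) by (apply Rmult_le_pos; lra). lra.
  - subst k'. assert (Fb := H14 r l d Gr Z0 Hd Df z Z1).
    rewrite Cmult_plus_distr_r. eapply Rle_trans. apply Cmod_triangle.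
    rewrite Rmult_assoc in Fb. assert (B14 * (d * Cmod (Delta z) ^ l) <= B14 * (C1 * decay l)) by (apply Rmult_le_compat_l; auto).
    assert (Cmod ((qs (approx_coef m s J l) z - main_term m (12 * l + 14) z) * E4 z)%C <= C2 * decay l * B4).
    { rewrite Cmod_mult. apply Rmult_le_compat; try apply Cmod_ge_0; auto. }
    assert (0 <= (50 * C1 + C2) * decay l) by (apply Rmult_le_pos; lra). lra.
Qed.

(** * Sign changes on the arc *)

Definition Psi (h m : nat) (t : R) : R := INR h * t + 2 * PI * INR m * cos t.

Lemma earc_Cexp t : earc t = Cexp (Ci * RtoC t)%C.
Proof.
  unfold earc, Cexp. replace (Re (Ci * t)%C) with 0 by (simpl; ring). replace (Im (Ci * t)%C) with t by (simpl; ring).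
  rewrite exp_0. f_equal; ring.
Qed.

Lemma Cexp_RtoC r : Cexp (RtoC r) = RtoC (exp r).
Proof. unfold Cexp. simpl. rewrite cos_0, sin_0. apply Ceq; simpl; ring. Qed.

Lemma Re_Cexp_Ci r : Re (Cexp (Ci * RtoC r)%C) = cos r.
Proof. unfold Cexp. simpl. replace (0 * r - 1 * 0) with 0 by ring. rewrite exp_0. rewrite Rmult_1_l. f_equal. ring. Qed.

(* The exponentials [d = 0] and [q^m] are complex conjugate; [d = 1] has modulus at most 1 because
   [e^(1 - 1/s) <= s] for [s = |z + 1|^2]. *)
Lemma main_arc h m t : PI / 2 <= t <= 2 * PI / 3 -> 2 * PI * INR m <= INR h ->
  Rabs (Re (earc t ^ h * main_term m (2 * h) (earc t))%C * exp (2 * PI * INR m * sin t) - 2 * cos (Psi h m t)) <= 1.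
Proof.
  intros Ht Hh. assert (HP := PI_bounds). assert (Hm := pos_INR m).
  set (z := earc t). assert (Nz : z <> 0%C) by apply earc_neq0.
  assert (St := sin_arc t Ht). assert (Ct := cos_arc t Ht). assert (S1 := SIN_bound t).
  assert (SC := sin2_cos2 t). unfold Rsqr in SC.
  set (e := exp (2 * PI * INR m * sin t)).
  assert (Inv : (/ z)%C = ((cos t, (- sin t)%R) : C)).
  { assert (Z1 : (z * (cos t, (- sin t)%R))%C = 1%C) by (apply Ceq; simpl; lra).
    transitivity (/ z * (z * (cos t, (- sin t)%R)))%C. rewrite Z1. ring. field. auto. }
  assert (Zh : (z ^ h)%C = Cexp (INR h * (Ci * t))%C) by (unfold z; rewrite earc_Cexp, Cexp_pow; auto).
  assert (M1 : (z ^ h * qq z ^ m * RtoC e)%C = Cexp (Ci * Psi h m t)%C).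
  { rewrite qq_pow_freq, Zh. unfold e. rewrite <- Cexp_RtoC, <- !Cexp_add. f_equal. unfold freq, Psi, z, earc.
    apply Ceq; simpl; ring. }
  assert (M2 : (z ^ h * (/ z ^ (2 * h) * Cexp (freq m / z)) * RtoC e)%C = Cexp (Ci * RtoC (- Psi h m t))%C).
  { replace (z ^ h * (/ z ^ (2 * h) * Cexp (freq m / z)) * RtoC e)%C with (/ z ^ h * Cexp (freq m / z) * RtoC e)%C.
    2:{ replace (2 * h)%nat with (h + h)%nat by lia. rewrite Cpow_add_r. field. apply Cpow_nz; auto. }
    rewrite Zh, <- Cexp_opp. unfold Cdiv. rewrite Inv. unfold e. rewrite <- Cexp_RtoC, <- !Cexp_add. f_equal. unfold freq, Psi.
    apply Ceq; simpl; ring. }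
  set (T3 := (z ^ h * (/ (z + 1) ^ (2 * h) * Cexp (freq m / (z + 1))) * RtoC e)%C).
  assert (M3 : Cmod T3 <= 1).
  { set (s := 2 + 2 * cos t). assert (Hs : 1 <= s) by (unfold s; lra).
    assert (C2 : Cmod (z + 1)%C ^ 2 = s). { rewrite Cmod2_alt. unfold z, earc, s. simpl. nra. }
    assert (N1 : (z + 1)%C <> 0%C). { intros X. rewrite X, Cmod_0 in C2. lra. }
    assert (I1 : (/ (z + 1))%C = ((((1 + cos t) / s)%R, (- sin t / s)%R) : C)).
    { assert (Z1 : ((z + 1) * (((1 + cos t) / s)%R, (- sin t / s)%R))%C = 1%C).
      { apply Ceq; simpl; [|field; lra]. apply Rmult_eq_reg_r with s; [|lra]. field_simplify; [|lra..]. unfold s. nra. }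
      transitivity (/ (z + 1) * ((z + 1) * (((1 + cos t) / s)%R, (- sin t / s)%R)))%C. rewrite Z1. ring. field. auto. }
    assert (X1 : Re (freq m / (z + 1))%C = - (2 * PI * INR m * sin t * / s)).
    { unfold Cdiv. rewrite I1. unfold freq. simpl. unfold Rdiv. ring. }
    unfold T3. rewrite !Cmod_mult, Cmod_inv, !Cmod_pow, (Cmod_earc t : Cmod z = 1), pow1, Cmod_Cexp, X1, Cmod_R by (apply Cpow_nz; auto).
    rewrite Rabs_pos_eq by (left; apply exp_pos). rewrite Rmult_1_l, pow_mult, C2.
    unfold e. rewrite Rmult_assoc, <- exp_plus.
    assert (Is : 0 < / s <= 1). { split. apply Rinv_0_lt_compat; lra. rewrite <- Rinv_1. apply Rinv_le_contravar; lra. }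
    assert (X2 : exp (- (2 * PI * INR m * sin t * / s) + 2 * PI * INR m * sin t) <= exp (1 - / s) ^ h).
    { rewrite <- exp_pow. apply exp_le.
      replace (- (2 * PI * INR m * sin t * / s) + 2 * PI * INR m * sin t) with (2 * PI * INR m * sin t * (1 - / s)) by ring.
      apply Rmult_le_compat_r. lra. apply Rle_trans with (2 * PI * INR m * 1); [|lra].
      apply Rmult_le_compat_l. apply Rmult_le_pos; lra. lra. }
    assert (X3 : exp (1 - / s) <= s).
    { replace (1 - / s) with (- (/ s - 1)) by ring. rewrite exp_Ropp. rewrite <- (Rinv_inv s) at 2.
      apply Rinv_le_contravar. lra. generalize (exp_ineq1_le (/ s - 1)). lra. }
    assert (X4 : exp (1 - / s) ^ h <= s ^ h). { apply pow_incr. split; auto. left; apply exp_pos. }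
    assert (Ps : 0 < s ^ h) by (apply pow_lt; lra).
    apply Rle_trans with (/ s ^ h * s ^ h). apply Rmult_le_compat_l. left; apply Rinv_0_lt_compat; auto. lra.
    right. field. lra. }
  assert (E : Re (z ^ h * main_term m (2 * h) z)%C * e - 2 * cos (Psi h m t) = Re T3).
  { assert (E0 : (z ^ h * main_term m (2 * h) z * RtoC e)%C = (Cexp (Ci * Psi h m t) + Cexp (Ci * RtoC (- Psi h m t)) + T3)%C).
    { rewrite <- M1, <- M2. unfold T3, main_term. ring. }
    assert (E1 := f_equal Re E0). rewrite !Re_plus, !Re_Cexp_Ci, cos_neg in E1. rewrite re_scal_r in E1. rewrite E1. ring. }
  rewrite E. apply Rle_trans with (Cmod T3); auto. apply Rabs_le. split; [|apply Re_le_Cmod].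
  assert (A := Re_le_Cmod (- T3)%C). rewrite Cmod_opp in A. change (Re (- T3)%C) with (- Re T3) in A. lra.
Qed.

(** The factor [l + 2] anticipates the division by [E4] near rho. The exponential is bounded through
    its cubic Taylor term, and [288000 = 36 * 20^3]. *)
Lemma decay_small eps : 0 < eps -> exists L, forall l, (L <= l)%nat -> decay l * (INR l + 2) < eps.
Proof.
  intros He. destruct (nfloor_ex (288000 / eps)) as (N & HN). left; apply Rdiv_lt_0_compat; lra.
  exists (S (S N)). intros l Hl. assert (Ll : INR (S (S N)) <= INR l) by (apply le_INR; auto).
  rewrite !S_INR in Ll. assert (Np := pos_INR N). set (x := INR l) in *.
  assert (Hx : 1 <= x) by lra.
  assert (A := pow_fact_le (0.05 * x) 3 ltac:(lra)). simpl INR in A. 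
  assert (X3 : 0 < (0.05 * x) ^ 3) by (apply pow_lt; lra).
  assert (B : exp (- (0.05 * x)) <= 6 * / (0.05 * x) ^ 3).
  { rewrite exp_Ropp. replace (6 * / (0.05 * x) ^ 3) with (/ ((0.05 * x) ^ 3 / 6)) by (field; lra).
    apply Rinv_le_contravar; lra. }
  apply Rle_lt_trans with (288000 / x).
  - unfold decay. fold x. replace ((x + 1) * exp (- (0.05 * x)) * (x + 2)) with ((x + 1) * (x + 2) * exp (- (0.05 * x))) by ring.
    apply Rle_trans with (6 * x ^ 2 * (6 * / (0.05 * x) ^ 3)).
    apply Rmult_le_compat; [nra|left; apply exp_pos|nra|auto]. right. replace 0.05 with (/ 20) by lra. field. lra.
  - apply Rmult_lt_reg_r with x; [lra|]. replace (288000 / x * x) with 288000 by (field; lra).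
    apply Rle_lt_trans with (eps * (288000 / eps)). right; field; lra. apply Rmult_lt_compat_l; auto. lra.
Qed.

(** Near rho the nonzero derivative of [A4] gives the linear bound, on the rest of the arc
    compactness does. *)
Lemma A4_lower : exists c, 0 < c /\ forall t, PI / 2 <= t <= 2 * PI / 3 -> c * (2 * PI / 3 - t) <= Cmod (E4 (earc t)).
Proof.
  assert (HP := PI_bounds). set (r := 2 * PI / 3).
  assert (CE : forall t, PI / 2 <= t <= r -> Cmod (E4 (earc t)) = - A4 t).
  { intros t Ht. unfold r in Ht. assert (E := A4_eq t ltac:(lra)). assert (M := f_equal Cmod E).
    rewrite Cmod_mult, Cmod_pow, Cmod_earc, pow1, Rmult_1_l, Cmod_R in M. rewrite M. apply Rabs_left1.
    destruct (Req_dec t r) as [->|N]. unfold A4, r. rewrite earc_rho, E4_rho, Cmult_0_r. simpl. lra.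
    left. apply A4_neg. unfold r in N. lra. }
  assert (D : is_derive A4 r (Re (Ci * (INR 2 * (earc r ^ 2 * E4 (earc r)) + earc r ^ 3 * (2 * PI * Ci * ((E2 (earc r) * E4 (earc r) - E6 (earc r)) / 3))))%C)).
  { apply (twisted_deriv E4 2). apply E4_deriv, inH_hA, hA_earc. unfold r; lra. }
  set (dd := Re _) in D.
  assert (Pd : 0 < dd).
  { unfold dd. assert (Z : E4 (earc r) = 0%C) by (unfold r; rewrite earc_rho; apply E4_rho). rewrite Z.
    replace (Ci * (INR 2 * (earc r ^ 2 * 0) + earc r ^ 3 * (2 * PI * Ci * ((E2 (earc r) * 0 - E6 (earc r)) / 3))))%C
      with (- (Ci * Ci) * (2 * PI / 3) * (earc r ^ 3 * E6 (earc r)))%C by field.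
    rewrite A6_eq by (unfold r; lra). replace (- (Ci * Ci))%C with (RtoC 1) by (apply Ceq; simpl; ring).
    rewrite Cmult_1_l. rewrite <- RtoC_mult, <- RtoC_div, <- RtoC_mult, re_RtoC by lra.
    apply Rmult_lt_0_compat; [lra|apply A6_pos; unfold r; lra]. }
  assert (Ar : A4 r = 0). { unfold A4, r. rewrite earc_rho, E4_rho, Cmult_0_r. simpl. ring. }
  apply is_derive_Reals in D. destruct (D (dd / 2) ltac:(lra)) as (d & Hd).
  assert (Dp := cond_pos d). set (g := Rmin (d / 2) (PI / 6)). assert (Hg : 0 < g <= PI / 6 /\ g < d).
  { unfold g. generalize (Rmin_l (d / 2) (PI / 6)) (Rmin_r (d / 2) (PI / 6)); intros. split; [split; [apply Rmin_glb_lt; lra|lra]|lra]. }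
  assert (Cont : forall x, PI / 2 <= x <= r - g -> continuity_pt A4 x).
  { intros x Hx. apply continuity_pt_filterlim. apply (ex_derive_continuous A4). eexists.
    apply (twisted_deriv E4 2). apply E4_deriv, inH_hA, hA_earc. unfold r in Hx. lra. }
  destruct (continuity_ab_maj A4 (PI / 2) (r - g)) as (Mx & HM & HMx); [unfold r; lra|auto|].
  assert (Mneg := A4_neg Mx ltac:(unfold r in HMx; lra)).
  exists (Rmin (dd / 2) (- A4 Mx)). split. apply Rmin_glb_lt; lra.
  intros t Ht. fold r in Ht. rewrite CE by auto. fold r. generalize (Rmin_l (dd / 2) (- A4 Mx)) (Rmin_r (dd / 2) (- A4 Mx)). set (c := Rmin _ _). intros C1 C2.
  destruct (Rle_lt_dec t (r - g)) as [L|L].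
  - specialize (HM t ltac:(lra)). assert (c * (r - t) <= - A4 Mx * 1); [|lra].
    assert (0 <= r - t <= 1) by (unfold r in *; lra). nra.
  - destruct (Req_dec t r) as [->|N]. rewrite Ar. lra.
    assert (Q := Hd (t - r) ltac:(lra) ltac:(rewrite Rabs_left; lra)).
    replace (r + (t - r)) with t in Q by ring. rewrite Ar in Q. apply Rabs_def2 in Q. destruct Q as [_ Q].
    assert (X : (A4 t - 0) / (t - r) * (r - t) = - A4 t) by (field; lra). rewrite <- X.
    apply Rmult_le_compat_r; lra.
Qed.

(* The pair [(a, b)] encodes [k' = 4a + 6b], and the weight is [2 * half_weight l a b]. *)
Definition miller (m l a b : nat) (c : nat -> C) : Prop :=
  (a <= 2)%nat /\ (b <= 1)%nat /\ is_form c (12 * l + (4 * a + 6 * b)) /\ forall n, (n <= l)%nat -> c n = mono_coef m n.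

Definition half_weight (l a b : nat) : nat := (6 * l + 2 * a + 3 * b)%nat.

Lemma cos_nPI n : cos (INR n * PI) = (-1) ^ n.
Proof.
  induction n. rewrite Rmult_0_l, cos_0; auto.
  rewrite S_INR, Rmult_plus_distr_r, Rmult_1_l, neg_cos, IHn. simpl. ring.
Qed.

Lemma pow_m1_cases n : (-1) ^ n = 1 \/ (-1) ^ n = -1.
Proof. induction n as [|n [H|H]]; simpl; [auto| |]; rewrite H; [right|left]; ring. Qed.

Lemma on_A_earc t : PI / 2 <= t <= 2 * PI / 3 -> on_A (earc t).
Proof. intros Ht. split. apply Cmod_earc. split. apply cos_arc; auto. apply sin_arc; auto. Qed.

(** For [4 a + 6 b = 14] the estimate is divided by [E4]. The condition on [n + m] leaves a gap of
    at least [2 PI / 3] to the phase at rho, so [2 PI / 3 - t] is at least of order 1/l and, by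
    [A4_lower], the division costs a factor linear in [l]. *)
Lemma arc_uniform m : exists K, 0 <= K /\ forall l a b c, (1 <= l)%nat -> miller m l a b c ->
  forall n t, PI / 2 <= t <= 2 * PI / 3 -> Psi (half_weight l a b) m t = INR n * PI -> (n + m <= 4 * l + a + 2 * b)%nat ->
  Cmod (qs c (earc t) - main_term m (2 * half_weight l a b) (earc t))%C <= K * (decay l * (INR l + 2)).
Proof.
  destruct (arc_approx m) as (C0 & HC & HA). destruct A4_lower as (cA & Hc & HA4). assert (HP := PI_bounds).
  assert (Q0 : 0 <= 3 * C0 / cA) by (apply Rmult_le_pos; [lra|left; apply Rinv_0_lt_compat; auto]).
  exists (C0 + 3 * C0 / cA). split. lra.
  intros l a b c Hl (Ha & Hb & Hf & Hcn) n t Ht HPsi Hn. assert (Ep := decay_pos l). assert (Lp := pos_INR l).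
  set (z := earc t). assert (Az := on_A_earc t Ht). fold z in Az.
  assert (Hs : (12 * l + (4 * a + 6 * b) = S (S (2 * (half_weight l a b - 1))))%nat) by (unfold half_weight; lia).
  destruct (HA l (4 * a + 6 * b)%nat (2 * (half_weight l a b - 1))%nat c Hs ltac:(eexists; reflexivity) Hf Hcn z Az) as [H1 H2].
  replace (12 * l + (4 * a + 6 * b))%nat with (2 * half_weight l a b)%nat in H1, H2 by (unfold half_weight; lia).
  assert (P1 : 0 <= C0 * decay l) by (apply Rmult_le_pos; lra).
  assert (P2 : 0 <= 3 * C0 / cA * (decay l * (INR l + 2))) by (apply Rmult_le_pos; [auto|apply Rmult_le_pos; lra]).
  assert (P3 : 0 <= C0 * (decay l * (INR l + 2))) by (apply Rmult_le_pos; [auto|apply Rmult_le_pos; lra]).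
  rewrite Rmult_plus_distr_r.
  destruct (Nat.le_gt_cases (4 * a + 6 * b) 10) as [Hk|Hk].
  - specialize (H1 Hk). assert (C0 * decay l * 1 <= C0 * decay l * (INR l + 2)) by (apply Rmult_le_compat_l; lra). lra.
  - assert (E : (4 * a + 6 * b = 14)%nat) by lia. specialize (H2 E). rewrite Cmod_mult in H2.
    set (D := Cmod (qs c z - main_term m (2 * half_weight l a b) z)%C) in *.
    assert (D0 : 0 <= D) by apply Cmod_ge_0. assert (B4 := HA4 t Ht). fold z in B4.
    assert (hE : INR (half_weight l a b) = 6 * INR l + 7).
    { replace (half_weight l a b) with (6 * l + 7)%nat by (unfold half_weight; lia). rewrite plus_INR, mult_INR. simpl. ring. }
    assert (NB : INR n + INR m <= 4 * INR l + 4).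
    { rewrite <- plus_INR. replace (4 * INR l + 4) with (INR (4 * l + 4)) by (rewrite plus_INR, mult_INR; simpl; ring).
      apply le_INR. lia. }
    unfold Psi in HPsi. rewrite hE in HPsi. assert (Ct := cos_arc t Ht). assert (Hm := pos_INR m).
    assert (G : 2 <= (6 * INR l + 7) * (2 * PI / 3 - t)).
    { assert (PI * INR m * (2 * cos t + 1) >= 0). { apply Rle_ge, Rmult_le_pos. apply Rmult_le_pos; lra. lra. }
      assert (PI * (INR n + INR m) <= PI * (4 * INR l + 4)) by (apply Rmult_le_compat_l; lra). lra. }
    assert (cA * 2 <= Cmod (E4 z) * (6 * (INR l + 2))).
    { apply Rle_trans with (cA * ((6 * INR l + 7) * (2 * PI / 3 - t))). apply Rmult_le_compat_l; lra.
      apply Rle_trans with ((cA * (2 * PI / 3 - t)) * (6 * INR l + 7)). right; ring.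
      apply Rmult_le_compat; try lra. apply Rmult_le_pos; lra. }
    assert (X : D * (cA * 2) <= C0 * decay l * (6 * (INR l + 2))).
    { apply Rle_trans with (D * (Cmod (E4 z) * (6 * (INR l + 2)))). apply Rmult_le_compat_l; auto.
      rewrite <- Rmult_assoc. apply Rmult_le_compat_r; lra. }
    assert (D <= 3 * C0 / cA * (decay l * (INR l + 2))); [|lra].
    apply Rmult_le_reg_r with (cA * 2). lra. eapply Rle_trans. apply X. right. field. lra.
Qed.

(** After scaling by [e], the cosine contributes 2 in modulus, the d = 1 term at most 1 and the
    approximation error less than 1. *)
Lemma sample_sign m : exists L, forall l a b c, (L <= l)%nat -> miller m l a b c ->
  2 * PI * INR m < INR (half_weight l a b) /\
  forall n t, PI / 2 <= t <= 2 * PI / 3 -> Psi (half_weight l a b) m t = INR n * PI -> (n + m <= 4 * l + a + 2 * b)%nat ->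
  0 < (-1) ^ n * Re (earc t ^ half_weight l a b * qs c (earc t))%C.
Proof.
  destruct (arc_uniform m) as (K & HK & HU). assert (HP := PI_bounds). assert (Hm := pos_INR m).
  set (Em := exp (2 * PI * INR m)). assert (HE : 0 < Em) by apply exp_pos.
  assert (KE : 0 <= K * Em) by (apply Rmult_le_pos; lra).
  destruct (decay_small (/ (K * Em + 1))) as (L & HL). apply Rinv_0_lt_compat; lra.
  exists (max L (2 * m + 1)). intros l a b c Hl HM.
  assert (Hh : 2 * PI * INR m < INR (half_weight l a b)).
  { apply Rlt_le_trans with (INR (6 * (2 * m + 1))). rewrite mult_INR, plus_INR, mult_INR. simpl. nra.
    apply le_INR. unfold half_weight. lia. }
  split; auto. intros n t Ht HPsi Hn.
  assert (U := HU l a b c ltac:(lia) HM n t Ht HPsi Hn). specialize (HL l ltac:(lia)).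
  assert (MA := main_arc (half_weight l a b) m t Ht ltac:(lra)). set (h := half_weight l a b) in *. set (z := earc t) in *.
  set (e := exp (2 * PI * INR m * sin t)) in *. assert (He : 0 < e <= Em).
  { split. apply exp_pos. apply exp_le. assert (S1 := SIN_bound t).
    rewrite <- (Rmult_1_r (2 * PI * INR m)) at 2. apply Rmult_le_compat_l; [apply Rmult_le_pos|]; lra. }
  set (D := Cmod (qs c z - main_term m (2 * h) z)%C) in *. assert (D0 : 0 <= D) by apply Cmod_ge_0.
  assert (DE : D * e < 1).
  { apply Rle_lt_trans with (K * (decay l * (INR l + 2)) * Em). apply Rmult_le_compat; lra.
    replace (K * (decay l * (INR l + 2)) * Em) with (K * Em * (decay l * (INR l + 2))) by ring.
    apply Rle_lt_trans with (K * Em * / (K * Em + 1)). apply Rmult_le_compat_l; lra.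
    apply Rmult_lt_reg_r with (K * Em + 1); [lra|]. field_simplify; lra. }
  rewrite HPsi, cos_nPI in MA.
  assert (Sp : Re (z ^ h * qs c z)%C = Re (z ^ h * main_term m (2 * h) z)%C + Re (z ^ h * (qs c z - main_term m (2 * h) z))%C).
  { rewrite <- Re_plus. f_equal. ring. }
  assert (Rb : Rabs (Re (z ^ h * (qs c z - main_term m (2 * h) z))%C) <= D).
  { assert (B : Cmod (z ^ h * (qs c z - main_term m (2 * h) z))%C = D) by (rewrite Cmod_mult, Cmod_pow, (Cmod_earc t : Cmod z = 1), pow1; unfold D; ring).
    rewrite <- B. set (x := (z ^ h * _)%C). assert (A := Re_le_Cmod (- x)%C). rewrite Cmod_opp in A. change (Re (- x)%C) with (- Re x) in A.
    apply Rabs_le. generalize (Re_le_Cmod x). lra. }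
  apply Rabs_le_between in MA, Rb. set (A := Re (z ^ h * main_term m (2 * h) z)%C) in *. set (B := Re (z ^ h * (qs c z - main_term m (2 * h) z))%C) in *.
  assert (Be : - (D * e) <= B * e <= D * e) by (split; nra).
  rewrite Sp. apply Rmult_lt_reg_r with e; [lra|]. rewrite Rmult_0_l, Rmult_assoc, Rmult_plus_distr_r.
  destruct (pow_m1_cases n) as [X|X]; rewrite X in *; lra.
Qed.

Lemma Psi_incr h m s t : 2 * PI * INR m < INR h -> s < t -> Psi h m s < Psi h m t.
Proof.
  intros Hh Hst. assert (HP := PI_bounds). assert (Hm := pos_INR m).
  destruct (MVT_cor2 (Psi h m) (fun x => INR h + 2 * PI * INR m * - sin x) s t Hst) as (x & E & _).
  { intros x _. unfold Psi. apply is_derive_Reals. auto_derive; auto. ring. }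
  assert (S1 := SIN_bound x). assert (0 <= 2 * PI * INR m) by (apply Rmult_le_pos; lra).
  assert (0 < (INR h + 2 * PI * INR m * - sin x) * (t - s)) by (apply Rmult_lt_0_compat; nra). lra.
Qed.

Lemma Psi_arc h m : Psi h m (PI / 2) = INR h * PI / 2 /\ Psi h m (2 * PI / 3) = 2 * INR h * PI / 3 - INR m * PI.
Proof.
  unfold Psi. rewrite cos_PI2. replace (cos (2 * PI / 3)) with (- / 2) by (change (- / 2 = Re (earc (2 * PI / 3))); rewrite earc_rho; auto).
  split; field.
Qed.

(** The two conditions place [n PI] between the phases at the ends of the arc. *)
Lemma sample_exists h m n : (h <= 2 * n)%nat -> (3 * (n + m) <= 2 * h)%nat ->
  exists t, PI / 2 <= t <= 2 * PI / 3 /\ Psi h m t = INR n * PI.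
Proof.
  intros H1 H2. assert (HP := PI_bounds). destruct (Psi_arc h m) as [P1 P2].
  assert (I1 : INR h <= 2 * INR n) by (apply le_INR in H1; rewrite mult_INR in H1; simpl in H1; lra).
  assert (I2 : 3 * (INR n + INR m) <= 2 * INR h).
  { apply le_INR in H2. rewrite !mult_INR, plus_INR, (INR_IZR_INZ 3), (INR_IZR_INZ 2) in H2. simpl Z.of_nat in H2. lra. }
  destruct (IVT_cor (fun t => Psi h m t - INR n * PI) (PI / 2) (2 * PI / 3)) as (t & Ht & E).
  - intros x. apply derivable_continuous_pt. exists (INR h + 2 * PI * INR m * - sin x). apply is_derive_Reals. unfold Psi. auto_derive; auto. ring.
  - lra.
  - cbv beta. rewrite P1, P2.
    replace (INR h * PI / 2 - INR n * PI) with (- (PI / 2 * (2 * INR n - INR h))) by field.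
    replace (2 * INR h * PI / 3 - INR m * PI - INR n * PI) with (PI / 3 * (2 * INR h - 3 * (INR n + INR m))) by field.
    assert (0 <= PI / 2 * (2 * INR n - INR h)) by (apply Rmult_le_pos; lra).
    assert (0 <= PI / 3 * (2 * INR h - 3 * (INR n + INR m))) by (apply Rmult_le_pos; lra). nra.
  - exists t. split; auto. lra.
Qed.

(** * The form as a product over the zeros on the arc *)

Lemma Csum_rev (F : nat -> C) N : Csum F (S N) = Csum (fun v => F (N - v)%nat) (S N).
Proof.
  induction N as [|N IH]. auto.
  change (Csum F (S (S N))) with (Csum F (S N) + F (S N))%C. rewrite IH.
  rewrite (Csum_S (fun v => F (S N - v)%nat)). replace (S N - 0)%nat with (S N) by lia.
  change (fun n => F (S N - S n)%nat) with (fun v => F (N - v)%nat). ring.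
Qed.

(** Taking [Delta^l] out of [form_rep] leaves powers of [E4^3 / Delta]. The vanishing modes below
    [m] lower the degree to [l - m], and the coefficient 1 of [q^m] becomes the leading one. *)
Lemma form_product m l a b c : (m <= l)%nat -> miller m l a b c ->
  exists P : nat -> R, P (l - m)%nat = 1 /\ forall z, hA <= Im z ->
    qs c z = (E4 z ^ a * E6 z ^ b * Delta z ^ l * Pol P (l - m) (jinv z))%C.
Proof.
  intros Hml (Ha & Hb & Hf & Hc).
  destruct (form_rep l a b Ha Hb (S l - m) c m ltac:(lia) Hf) as (p & p0 & pm & E).
  { intros n Hn. rewrite Hc by lia. unfold mono_coef. rewrite (proj2 (Nat.eqb_neq n m)) by lia. auto. }
  { intros n Hn. rewrite Hc by lia. unfold mono_coef. auto. }
  exists (fun u => p (l - u)%nat). split.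
  { replace (l - (l - m))%nat with m by lia. rewrite pm, Hc by lia. unfold mono_coef. rewrite Nat.eqb_refl. auto. }
  intros z Hz. rewrite E by auto. assert (N := Delta_neq0 z). rewrite <- !Cmult_assoc. do 2 f_equal.
  replace (S l) with (m + S (l - m))%nat by lia. rewrite Csum_add, Csum_zero.
  2:{ intros n Hn. rewrite p0 by auto. ring. }
  rewrite Cplus_0_l, Csum_rev. unfold Pol. rewrite <- Csum_scal. apply Csum_ext. intros u Hu.
  replace (m + (l - m - u))%nat with (l - u)%nat by lia. replace (l - (l - u))%nat with u by lia.
  unfold jinv. rewrite Cpow_mult_l, Cpow_inv by auto. 
  replace (Delta z ^ l)%C with (Delta z ^ (l - u) * Delta z ^ u)%C by (rewrite <- Cpow_add_r; f_equal; lia).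
  field. apply Cpow_nz; auto.
Qed.

Definition realC (x : C) : Prop := Im x = 0.

Lemma realC_mult x y : realC x -> realC y -> realC (x * y)%C.
Proof. unfold realC. intros Hx Hy. rewrite (real_eq _ Hx), (real_eq _ Hy). simpl. ring. Qed.

Lemma realC_pow x n : realC x -> realC (x ^ n)%C.
Proof. intros H. induction n. reflexivity. simpl. apply realC_mult; auto. Qed.

Lemma realC_Pol (P : nat -> R) N x : realC x -> realC (Pol P N x).
Proof.
  intros Hx. unfold Pol. induction (S N) as [|k IH]. reflexivity.
  simpl. unfold realC in *. rewrite Im_plus, IH. rewrite Rplus_0_l. apply realC_mult. reflexivity. apply realC_pow; auto.
Qed.

Lemma D6_real t : PI / 2 <= t <= 2 * PI / 3 -> realC (earc t ^ 6 * Delta (earc t))%C.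
Proof.
  intros Ht. set (z := earc t). assert (E4' := A4_eq t Ht). assert (E6' := A6_eq t Ht). fold z in E4', E6'.
  assert (Q : (z ^ 6 * Delta z)%C = (RtoC (((A4 t) ^ 3 - (A6 t) ^ 2) / 1728))).
  { transitivity (z ^ 6 * (1728 * Delta z) / 1728)%C. field. rewrite (Delta_E z (hA_earc t Ht)).
    rewrite RtoC_div, RtoC_minus, !RtoC_pow, <- E4', <- E6' by lra. field. }
  rewrite Q. reflexivity.
Qed.

(** Twisted by powers of z, the factors [E4], [E6] and [Delta] are real and nonzero on the open arc,
    and the polynomial is real there; so the real part decides. *)
Lemma arc_root t l a b N (P : nat -> R) (f : C) : PI / 2 < t < 2 * PI / 3 ->
  f = (E4 (earc t) ^ a * E6 (earc t) ^ b * Delta (earc t) ^ l * Pol P N (jinv (earc t)))%C ->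
  Re (earc t ^ half_weight l a b * f)%C = 0 -> Pol P N (jinv (earc t)) = 0%C.
Proof.
  intros Ht Ef Hr. assert (Ht' : PI / 2 <= t <= 2 * PI / 3) by lra. set (z := earc t) in *.
  assert (Nz : z <> 0%C) by apply earc_neq0.
  assert (E4' := A4_eq t Ht'). assert (E6' := A6_eq t Ht'). fold z in E4', E6'.
  assert (N4 := A4_neg t ltac:(lra)). assert (N6 := A6_pos t ltac:(lra)).
  set (q := ((z ^ 2 * E4 z) ^ a * (z ^ 3 * E6 z) ^ b * (z ^ 6 * Delta z) ^ l)%C).
  assert (Nq : q <> 0%C).
  { unfold q. rewrite E4', E6'. repeat apply Cmult_neq_0; apply Cpow_nz. apply RtoC_neq0; lra. apply RtoC_neq0; lra.
    apply Cmult_neq_0. apply Cpow_nz; auto. apply Delta_neq0. }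
  assert (X : (z ^ half_weight l a b * f)%C = (q * Pol P N (jinv z))%C).
  { rewrite Ef. unfold half_weight, q. rewrite !Cpow_add_r, !Cpow_mult_r, !Cpow_mult_l. ring. }
  assert (RP : realC (Pol P N (jinv z))). { apply realC_Pol. unfold z. rewrite Jarc_eq by auto. reflexivity. }
  assert (Rq : realC q).
  { unfold q. rewrite E4', E6'. repeat apply realC_mult; apply realC_pow; try reflexivity. apply D6_real; auto. }
  assert (Z : (q * Pol P N (jinv z))%C = 0%C). { rewrite <- X. apply Ceq; auto. rewrite X. apply realC_mult; auto. }
  transitivity (/ q * (q * Pol P N (jinv z)))%C. field; auto. rewrite Z. ring.
Qed.

Lemma twisted_cont c h t : qgood c -> PI / 2 <= t <= 2 * PI / 3 -> continuity_pt (fun t => Re (earc t ^ h * qs c (earc t))%C) t.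
Proof.
  intros G Ht.
  assert (D := cderiv_mult _ _ _ _ _ (cderiv_pow _ _ _ h (cderiv_id (earc t))) (qs_deriv c (earc t) G (inH_hA _ (hA_earc t Ht)))).
  assert (R := rderiv_Re _ _ _ 1%C (rderiv_comp _ _ _ _ _ (rderiv_earc t) D)). cbv beta in R.
  apply continuity_pt_filterlim.
  apply (continuous_ext (fun t => Re (1 * (earc t ^ h * qs c (earc t)))%C)). intros x. f_equal. ring.
  apply (ex_derive_continuous (fun t => Re (1 * (earc t ^ h * qs c (earc t)))%C)). eexists. apply R.
Qed.

Lemma IVT_sign (g : R -> R) x y : (forall a, x <= a <= y -> continuity_pt g a) -> x < y -> g x * g y < 0 ->
  exists z, x < z < y /\ g z = 0.
Proof.
  intros Hc Hxy Hs. assert (exists z, x <= z <= y /\ g z = 0) as (z & Hz & E).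
  { destruct (Rlt_le_dec (g x) 0) as [L|L].
    - destruct (Ranalysis5.IVT_interv g x y Hc Hxy L ltac:(nra)) as (z & Hz). exists z; auto.
    - assert (g x <> 0) by (intro E; rewrite E in Hs; lra). assert (g y < 0) by nra.
      destruct (Ranalysis5.IVT_interv (fun t => - g t) x y (fun a Ha => continuity_pt_opp g a (Hc a Ha)) Hxy ltac:(lra) ltac:(lra)) as (z & Hz & E).
      exists z. split; auto. lra. }
  exists z. split; auto. split; apply Rnot_le_lt; intros L.
  - replace z with x in E by lra. rewrite E in Hs. lra.
  - replace z with y in E by lra. rewrite E in Hs. lra.
Qed.

Lemma Psi_lt_inv h m s t : 2 * PI * INR m < INR h -> Psi h m s < Psi h m t -> s < t.
Proof.
  intros Hh H. destruct (Rtotal_order s t) as [L|[E|G]]; auto. rewrite E in H; lra.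
  generalize (Psi_incr h m t s Hh G). lra.
Qed.

(** [3 l + a + 2 b] is half of [half_weight] rounded up, and [4 l + a + 2 b - m] still satisfies the
    bound at rho; this leaves [l - m + 1] consecutive sample points. *)
Lemma root_between m l a b c i : (m <= l)%nat -> miller m l a b c -> 2 * PI * INR m < INR (half_weight l a b) ->
  (forall n t, PI / 2 <= t <= 2 * PI / 3 -> Psi (half_weight l a b) m t = INR n * PI -> (n + m <= 4 * l + a + 2 * b)%nat ->
    0 < (-1) ^ n * Re (earc t ^ half_weight l a b * qs c (earc t))%C) -> (i < l - m)%nat ->
  exists t, PI / 2 < t < 2 * PI / 3 /\
    INR (3 * l + a + 2 * b + i) * PI < Psi (half_weight l a b) m t < INR (3 * l + a + 2 * b + S i) * PI /\
    Re (earc t ^ half_weight l a b * qs c (earc t))%C = 0.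
Proof.
  intros Hml HM Hh Hs Hi. assert (HP := PI_bounds). set (n := (3 * l + a + 2 * b + i)%nat).
  replace (3 * l + a + 2 * b + S i)%nat with (S n) by (unfold n; lia).
  destruct (sample_exists (half_weight l a b) m n) as (s & Hs1 & Hs2); [unfold half_weight, n; lia..|].
  destruct (sample_exists (half_weight l a b) m (S n)) as (s' & Hs1' & Hs2'); [unfold half_weight, n; lia..|].
  assert (Lt : s < s'). { apply (Psi_lt_inv (half_weight l a b) m); auto. rewrite Hs2, Hs2', S_INR. lra. }
  set (g := fun t => Re (earc t ^ half_weight l a b * qs c (earc t))%C).
  assert (Q1 := Hs n s Hs1 Hs2 ltac:(unfold n; lia)). assert (Q2 := Hs (S n) s' Hs1' Hs2' ltac:(unfold n; lia)).
  fold (g s) in Q1. fold (g s') in Q2.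
  destruct (IVT_sign g s s') as (t & Ht & E); auto.
  - intros x Hx. apply twisted_cont. apply HM. lra.
  - simpl in Q2. destruct (pow_m1_cases n) as [X|X]; rewrite X in *; nra.
  - exists t. split; [lra|]. split; auto. rewrite <- Hs2, <- Hs2'. split; apply Psi_incr; auto; lra.
Qed.

Definition jroots (th : nat -> R) (N : nat) : list C := map (fun i => jinv (earc (th i))) (seq 0 N).

Lemma Jarc_inj s t : PI / 2 <= s <= 2 * PI / 3 -> PI / 2 <= t <= 2 * PI / 3 -> jinv (earc s) = jinv (earc t) -> s = t.
Proof.
  intros Hs Ht E. assert (J : Jarc s = Jarc t) by (unfold Jarc; rewrite E; auto).
  destruct (Rtotal_order s t) as [L|[Q|G]]; auto.
  - generalize (Jarc_decr s t). lra.
  - generalize (Jarc_decr t s). lra.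
Qed.

Lemma miller_factor m : exists L, forall l a b c, (L <= l)%nat -> (m <= l)%nat -> miller m l a b c ->
  2 * PI * INR m < INR (half_weight l a b) /\ exists th : nat -> R,
  (forall i, (i < l - m)%nat -> PI / 2 < th i < 2 * PI / 3 /\
    INR (3 * l + a + 2 * b + i) * PI < Psi (half_weight l a b) m (th i) < INR (3 * l + a + 2 * b + S i) * PI) /\
  NoDup (map th (seq 0 (l - m))) /\ NoDup (jroots th (l - m)) /\
  forall z, hA <= Im z -> qs c z = (E4 z ^ a * E6 z ^ b * Delta z ^ l * prodl (jroots th (l - m)) (jinv z))%C.
Proof.
  destruct (sample_sign m) as (L & HL). exists L. intros l a b c Hl Hml HM.
  destruct (HL l a b c Hl HM) as [Hh Hs]. split; auto. assert (HP := PI_bounds).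
  destruct (form_product m l a b c Hml HM) as (P & PN & EP).
  (* For indices from [l - m] on the value 0 is a dummy that makes the choice function total. *)
  assert (Ex : forall i, exists t, (i < l - m)%nat -> PI / 2 < t < 2 * PI / 3 /\
    INR (3 * l + a + 2 * b + i) * PI < Psi (half_weight l a b) m t < INR (3 * l + a + 2 * b + S i) * PI /\
    Re (earc t ^ half_weight l a b * qs c (earc t))%C = 0).
  { intros i. destruct (Nat.lt_ge_cases i (l - m)) as [H|H].
    - destruct (root_between m l a b c i Hml HM Hh Hs H) as (t & Ht). exists t. auto.
    - exists 0. lia. }
  set (th := fun i => proj1_sig (ClassicalEpsilon.constructive_indefinite_description _ (Ex i))).
  assert (Hth : forall i, (i < l - m)%nat -> PI / 2 < th i < 2 * PI / 3 /\
    INR (3 * l + a + 2 * b + i) * PI < Psi (half_weight l a b) m (th i) < INR (3 * l + a + 2 * b + S i) * PI /\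
    Re (earc (th i) ^ half_weight l a b * qs c (earc (th i)))%C = 0).
  { intros i. apply (proj2_sig (ClassicalEpsilon.constructive_indefinite_description _ (Ex i))). }
  clearbody th. exists th. split. intros i Hi. destruct (Hth i Hi) as (A & B & _). auto.
  assert (Inj : forall i j, (i < j)%nat -> (j < l - m)%nat -> th i < th j).
  { intros i j Hij Hj. apply (Psi_lt_inv (half_weight l a b) m); auto. destruct (Hth i ltac:(lia)) as (_ & A & _).
    destruct (Hth j Hj) as (_ & B & _). 
    assert (INR (3 * l + a + 2 * b + S i) <= INR (3 * l + a + 2 * b + j)) by (apply le_INR; lia). nra. }
  assert (ND : forall (T : Type) (F : R -> T), (forall i j, (i < l - m)%nat -> (j < l - m)%nat -> F (th i) = F (th j) -> th i = th j) ->
    NoDup (map (fun i => F (th i)) (seq 0 (l - m)))).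
  { intros T F HF. apply NoDup_nth_error. intros i j Hi E. rewrite length_map, length_seq in Hi.
    rewrite !nth_error_map in E. rewrite (nth_error_nth' (seq 0 (l - m)) 0%nat) in E by (rewrite length_seq; auto).
    rewrite seq_nth in E by auto. destruct (Nat.lt_ge_cases j (l - m)) as [Hj|Hj].
    - rewrite (nth_error_nth' (seq 0 (l - m)) 0%nat) in E by (rewrite length_seq; auto). rewrite seq_nth in E by auto.
      simpl in E. injection E as E. apply HF in E; auto.
      destruct (Nat.lt_total i j) as [A|[A|A]]; auto; [specialize (Inj i j A Hj)|specialize (Inj j i A Hi)]; lra.
    - rewrite (proj2 (nth_error_None (seq 0 (l - m)) j)) in E by (rewrite length_seq; auto). discriminate. }
  assert (ND1 : NoDup (map th (seq 0 (l - m)))) by (apply (ND R (fun t => t)); auto).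
  assert (ND2 : NoDup (jroots th (l - m))).
  { apply (ND C (fun t => jinv (earc t))). intros i j Hi Hj E. destruct (Hth i Hi) as (A & _). destruct (Hth j Hj) as (B & _).
    apply Jarc_inj; auto; lra. }
  split; auto. split; auto. intros z Hz. rewrite EP by auto. f_equal.
  assert (Len : length (jroots th (l - m)) = (l - m)%nat) by (unfold jroots; rewrite length_map, length_seq; auto).
  rewrite <- Len at 1. rewrite Pol_roots; auto.
  - rewrite Len, PN. ring.
  - intros r Hr. rewrite Len. unfold jroots in Hr. apply in_map_iff in Hr. destruct Hr as (i & <- & Hi). apply in_seq in Hi.
    destruct (Hth i ltac:(lia)) as (A & _ & B). apply (arc_root (th i) l a b (l - m) P (qs c (earc (th i)))); auto.
    apply EP, hA_earc. lra.
Qed.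

(** * Orders of vanishing and counting *)

(** Each admissible [k'] is [4 a + 6 b] with [a <= 2] and [b <= 1]. The matrix with rows (0, -1) and
    (1, 0) gives the inversion law. *)
Lemma is_g_miller l k' m f : kprime_ok k' -> is_g l k' m f -> (m <= l)%nat /\ exists a b c, miller m l a b c /\
  forall z, inH z -> f z = qs c z.
Proof.
  intros Hk (_ & Hml & (_ & HS & _) & c & Hc & Hser). split; auto.
  assert (Hab : exists a b, (a <= 2)%nat /\ (b <= 1)%nat /\ k' = (4 * a + 6 * b)%nat).
  { destruct Hk as [->|[->|[->|[->|[->| ->]]]]].
    exists 0%nat, 0%nat; lia. exists 1%nat, 0%nat; lia. exists 0%nat, 1%nat; lia. exists 2%nat, 0%nat; lia.
    exists 1%nat, 1%nat; lia. exists 2%nat, 1%nat; lia. }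
  destruct Hab as (a & b & Ha & Hb & ->). exists a, b, c.
  assert (G : qgood c). { apply is_series_C_qgood. intros z Hz. eexists. apply Hser; auto. }
  assert (E : forall z, inH z -> f z = qs c z) by (intros z Hz; apply is_series_C_qs; auto).
  split; auto. split; auto. split; auto. split; [split; auto|].
  - intros z Hz. assert (Nz := inH_neq0 z Hz). assert (S1 := HS 0%Z (-1)%Z 1%Z 0%Z z eq_refl Hz).
    rewrite Cpow_eq in S1.
    replace (IZR 1 * z + IZR 0)%C with z in S1 by ring.
    replace ((IZR 0 * z + IZR (-1)) / z)%C with (- / z)%C in S1.
    2:{ change (IZR (-1)) with (- (1)). rewrite RtoC_opp. field; auto. }
    rewrite !E in S1 by (auto; apply inH_S; auto). exact S1.
  - intros n Hn. rewrite Hc by auto. unfold mono_coef. destruct (Nat.eqb n m); auto.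
Qed.

Lemma arcA_earc t : PI / 2 <= t <= 2 * PI / 3 -> arcA (earc t).
Proof. intros Ht. exists t. auto. Qed.

Lemma inF_earc t : PI / 2 <= t <= 2 * PI / 3 -> inF (earc t).
Proof.
  intros Ht. assert (C := cos_arc t Ht). split. apply inH_hA, hA_earc; auto. left. rewrite Cmod_earc. simpl. lra.
Qed.

Lemma inF_hA z : inF z -> hA <= Im z.
Proof. intros [Hz [[? ?]|[? ?]]]; left; apply half_domain_height; auto; lra. Qed.

Lemma jroots_in th N r : In r (jroots th N) -> exists i, (i < N)%nat /\ r = jinv (earc (th i)).
Proof. unfold jroots. rewrite in_map_iff. intros (i & <- & Hi). apply in_seq in Hi. exists i. split; auto. lia. Qed.

Lemma Jarc_open t : PI / 2 < t < 2 * PI / 3 -> 0 < Jarc t < 1728.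
Proof.
  intros Ht. rewrite <- Jarc_rho, <- Jarc_PI2. split; apply Jarc_decr; lra.
Qed.

Lemma prodl_zero rs x : prodl rs x = 0%C -> In x rs.
Proof.
  intros H. destruct (in_dec Ceq_dec x rs); auto. exfalso. apply (prodl_neq0 rs x); auto.
Qed.

Lemma zeros_cases l a b th N z : (forall i, (i < N)%nat -> PI / 2 < th i < 2 * PI / 3) -> inF z ->
  (E4 z ^ a * E6 z ^ b * Delta z ^ l * prodl (jroots th N) (jinv z))%C = 0%C ->
  (z = rho /\ (1 <= a)%nat) \/ (z = Ci /\ (1 <= b)%nat) \/ exists i, (i < N)%nat /\ z = earc (th i).
Proof.
  intros Hth Hz H.
  destruct (Ceq_dec (E4 z ^ a)%C 0%C) as [Za|Na].
  { left. destruct a. exfalso. apply C1_nz. exact Za. split; [|lia]. apply E4_zero_rho; auto.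
    destruct (Ceq_dec (E4 z) 0%C) as [X|X]; auto. exfalso. apply (Cpow_nz (E4 z) (S a) X Za). }
  destruct (Ceq_dec (E6 z ^ b)%C 0%C) as [Zb|Nb].
  { right; left. destruct b. exfalso. apply C1_nz. exact Zb. split; [|lia]. apply E6_zero_i; auto.
    destruct (Ceq_dec (E6 z) 0%C) as [X|X]; auto. exfalso. apply (Cpow_nz (E6 z) (S b) X Zb). }
  right; right. assert (Nd : (Delta z ^ l)%C <> 0%C) by (apply Cpow_nz, Delta_neq0).
  destruct (Ceq_dec (prodl (jroots th N) (jinv z)) 0%C) as [Zp|Np].
  - apply prodl_zero in Zp. destruct (jroots_in _ _ _ Zp) as (i & Hi & E). exists i. split; auto.
    specialize (Hth i Hi). assert (J := Jarc_open _ Hth). rewrite Jarc_eq in E by lra.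
    destruct (jinv_arc z Hz) as (t & Ht & ->). rewrite E; auto. rewrite E; simpl; lra.
    f_equal. apply Jarc_inj; auto; try lra. rewrite E, Jarc_eq; auto. lra.
  - exfalso. revert H. repeat apply Cmult_neq_0; auto.
Qed.

Lemma Ci_earc_rho : Ci = earc (PI / 2) /\ rho = earc (2 * PI / 3).
Proof. rewrite earc_PI2, earc_rho; auto. Qed.

Lemma zeros_on_arc m : exists L, forall l k' f, (L <= l)%nat -> kprime_ok k' -> is_g l k' m f ->
  forall z, inF z -> f z = (0 : C) -> arcA z.
Proof.
  destruct (miller_factor m) as (L & HL). exists L. intros l k' f Hl Hk Hg z Hz H0. assert (HP := PI_bounds).
  destruct (is_g_miller l k' m f Hk Hg) as (Hml & a & b & c & HM & E).
  destruct (HL l a b c Hl Hml HM) as (_ & th & Hth & _ & _ & EF).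
  rewrite E, EF in H0 by (auto; try apply inF_hA; auto; apply inH_hA, inF_hA; auto).
  destruct (zeros_cases l a b th (l - m) z) as [[-> _]|[[-> _]|(i & Hi & ->)]]; auto.
  - intros i Hi. apply Hth; auto.
  - rewrite (proj2 Ci_earc_rho). apply arcA_earc. lra.
  - rewrite (proj1 Ci_earc_rho). apply arcA_earc. lra.
  - apply arcA_earc. destruct (Hth i Hi). lra.
Qed.

(** [zero_order] with continuity spelled out in terms of the modulus, convenient for products. *)
Definition zord (f : C -> C) (z0 : C) (n : nat) : Prop :=
  exists r, 0 < r /\ exists h : C -> C,
    (forall eps, 0 < eps -> exists d, 0 < d /\ forall w, Cmod (w - z0)%C < d -> Cmod (h w - h z0)%C < eps) /\
    h z0 <> 0%C /\ forall w, Cmod (w - z0)%C < r -> f w = ((w - z0) ^ n * h w)%C.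

Lemma zord_zero_order f z0 n : zord f z0 n -> zero_order f z0 n.
Proof.
  intros (r & Hr & h & Hc & Hn & E). exists r. split; auto. exists h. split; [|split; auto].
  - intros P [eps HP]. destruct (Hc eps (cond_pos eps)) as (d & Hd & H).
    exists (mkposreal (d / 2) ltac:(lra)). intros w [B1 B2]. apply HP.
    unfold ball in B1, B2; simpl in B1, B2. unfold AbsRing_ball, abs, minus, plus, opp in B1, B2; simpl in B1, B2.
    assert (Cw : Cmod (w - z0)%C < d).
    { eapply Rle_lt_trans. apply Cmod_le_ReIm. simpl. unfold Re, Im. simpl. lra. }
    specialize (H w Cw). split.
    + unfold ball; simpl. unfold AbsRing_ball, abs, minus, plus, opp; simpl.
      eapply Rle_lt_trans; [|apply H]. 
      eapply Rle_trans; [|apply (Rmax_Cmod (h w - h z0)%C)]. apply Rmax_l.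
    + exact (Rle_lt_trans _ _ _ (Rabs_Im_le_Cmod (h w - h z0)%C) H).
Qed.

Lemma Ccont_mult (h g : C -> C) z0 :
  (forall eps, 0 < eps -> exists d, 0 < d /\ forall w, Cmod (w - z0)%C < d -> Cmod (h w - h z0)%C < eps) ->
  (forall eps, 0 < eps -> exists d, 0 < d /\ forall w, Cmod (w - z0)%C < d -> Cmod (g w - g z0)%C < eps) ->
  forall eps, 0 < eps -> exists d, 0 < d /\ forall w, Cmod (w - z0)%C < d -> Cmod (h w * g w - h z0 * g z0)%C < eps.
Proof.
  intros Hh Hg eps He. set (K := 1 + Cmod (h z0) + Cmod (g z0)).
  assert (H0 := Cmod_ge_0 (h z0)). assert (G0 := Cmod_ge_0 (g z0)). assert (HK : 0 < K) by (unfold K; lra).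
  set (e := Rmin 1 (eps / K)). assert (He0 : 0 < e) by (apply Rmin_glb_lt; [lra|apply Rdiv_lt_0_compat; auto]).
  assert (e1 := Rmin_l 1 (eps / K)). assert (e2 := Rmin_r 1 (eps / K)). fold e in e1, e2.
  destruct (Hh e He0) as (d1 & D1 & H1). destruct (Hg e He0) as (d2 & D2 & H2).
  exists (Rmin d1 d2). split. apply Rmin_glb_lt; auto. intros w Hw.
  specialize (H1 w (Rlt_le_trans _ _ _ Hw (Rmin_l _ _))). specialize (H2 w (Rlt_le_trans _ _ _ Hw (Rmin_r _ _))).
  replace (h w * g w - h z0 * g z0)%C with ((h w - h z0) * (g w - g z0) + h z0 * (g w - g z0) + (h w - h z0) * g z0)%C by ring.
  eapply Rle_lt_trans. apply Cmod_tri3. rewrite !Cmod_mult.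
  assert (P1 := Cmod_ge_0 (h w - h z0)%C). assert (P2 := Cmod_ge_0 (g w - g z0)%C).
  set (x := Cmod (h w - h z0)%C) in *. set (y := Cmod (g w - g z0)%C) in *.
  assert (e * K <= eps). { apply Rle_trans with (eps / K * K). apply Rmult_le_compat_r; lra. right; field; lra. }
  assert (x * y <= 1 * y) by (apply Rmult_le_compat_r; lra).
  assert (Cmod (h z0) * y <= Cmod (h z0) * e) by (apply Rmult_le_compat_l; lra).
  assert (x * Cmod (g z0) <= e * Cmod (g z0)) by (apply Rmult_le_compat_r; lra).
  unfold K in *. lra.
Qed.

Lemma zord_mult f g z0 n k : zord f z0 n -> zord g z0 k -> zord (fun w => f w * g w)%C z0 (n + k).
Proof.
  intros (r1 & R1 & h1 & C1 & N1 & E1) (r2 & R2 & h2 & C2 & N2 & E2).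
  exists (Rmin r1 r2). split. apply Rmin_glb_lt; auto. exists (fun w => h1 w * h2 w)%C.
  split. apply Ccont_mult; auto. split. apply Cmult_neq_0; auto. intros w Hw.
  rewrite (E1 w (Rlt_le_trans _ _ _ Hw (Rmin_l _ _))), (E2 w (Rlt_le_trans _ _ _ Hw (Rmin_r _ _))), Cpow_add_r. ring.
Qed.

Lemma cderiv_cont_at f z l : cderiv f z l -> forall eps, 0 < eps ->
  exists d, 0 < d /\ forall w, Cmod (w - z)%C < d -> Cmod (f w - f z)%C < eps.
Proof.
  intros D eps He. destruct (cderiv_cont f z l D eps He) as (d & Hd & H). exists d. split; auto. intros w Hw.
  specialize (H _ Hw). replace (z + (w - z))%C with w in H by ring. auto.
Qed.

Lemma zord_0 (f : C -> C) z l : cderiv f z l -> f z <> 0%C -> zord f z 0.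
Proof.
  intros D N. exists 1. split. lra. exists f. split. eapply cderiv_cont_at; eauto. split; auto. intros w _. simpl. ring.
Qed.

Lemma zord_1 (f : C -> C) z (l : C) : cderiv f z l -> f z = 0%C -> l <> 0%C -> zord f z 1.
Proof.
  intros D Z N. exists 1. split. lra.
  exists (fun w => if Ceq_dec w z then l else (f w / (w - z))%C). split; [|split].
  - intros eps He. destruct (D (eps / 2) ltac:(lra)) as (d & Hd & H). exists d. split; auto. intros w Hw.
    destruct (Ceq_dec z z) as [_|X]; [|contradiction]. destruct (Ceq_dec w z) as [->|X].
    + replace (l - l)%C with (RtoC 0) by ring. rewrite Cmod_0. auto.
    + specialize (H _ Hw). replace (z + (w - z))%C with w in H by ring. rewrite Z in H.
      assert (Nw : (w - z)%C <> 0%C). { intros Y. apply X. replace w with (w - z + z)%C by ring. rewrite Y. ring. }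
      assert (Pw := Cmod_pos _ Nw).
      replace (f w / (w - z) - l)%C with ((f w - 0 - l * (w - z)) / (w - z))%C by (field; auto).
      rewrite Cmod_div by auto. apply Rle_lt_trans with (eps / 2); [|lra].
      apply Rmult_le_reg_r with (Cmod (w - z)%C); auto. unfold Rdiv at 1. rewrite Rmult_assoc, Rinv_l by lra. lra.
  - destruct (Ceq_dec z z) as [_|X]; [auto|contradiction].
  - intros w _. destruct (Ceq_dec w z) as [->|X]. rewrite Z. simpl. ring.
    field. intros Y. apply X. replace w with (w - z + z)%C by ring. rewrite Y. ring.
Qed.

Lemma zord_one z : zord (fun _ => 1%C) z 0.
Proof. apply (zord_0 _ z _ (cderiv_const 1%C z)). apply C1_nz. Qed.

Lemma zord_pow f z n k : zord f z n -> zord (fun w => f w ^ k)%C z (k * n).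
Proof. intros H. induction k. apply zord_one. simpl. apply zord_mult; auto. Qed.

Lemma zord_ext (f g : C -> C) z n r : 0 < r -> (forall w, Cmod (w - z)%C < r -> f w = g w) -> zord g z n -> zord f z n.
Proof.
  intros Hr E (r1 & R1 & h & C1 & N1 & E1). exists (Rmin r r1). split. apply Rmin_glb_lt; auto.
  exists h. split; auto. split; auto. intros w Hw. rewrite E, E1; auto.
  eapply Rlt_le_trans; [apply Hw|apply Rmin_r]. eapply Rlt_le_trans; [apply Hw|apply Rmin_l].
Qed.

Lemma Csub_neq0 (a b : C) : a <> b -> (a - b)%C <> 0%C.
Proof. intros H E. apply H. replace a with (a - b + b)%C by ring. rewrite E. ring. Qed.

Lemma zord_prodl_0 rs f z l : cderiv f z l -> ~ In (f z) rs -> zord (fun w => prodl rs (f w)) z 0.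
Proof.
  intros D. induction rs as [|r rs IH]; intros H. apply zord_one.
  simpl. apply (zord_mult (fun w => f w - r)%C (fun w => prodl rs (f w)) z 0 0).
  - apply (zord_0 _ z _ (cderiv_minus _ _ _ _ _ D (cderiv_const r z))). apply Csub_neq0. intros E. apply H. left; auto.
  - apply IH. intros X. apply H. right; auto.
Qed.

Lemma zord_prodl_1 rs f z (l : C) : cderiv f z l -> l <> 0%C -> NoDup rs -> In (f z) rs -> zord (fun w => prodl rs (f w)) z 1.
Proof.
  intros D N. induction rs as [|r rs IH]; intros ND H. destruct H.
  inversion ND as [|? ? Nr ND']. subst. assert (Dr := cderiv_minus _ _ _ _ _ D (cderiv_const r z)).
  simpl. destruct (Ceq_dec (f z) r) as [E|X].
  - apply (zord_mult (fun w => f w - r)%C (fun w => prodl rs (f w)) z 1 0).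
    + apply (zord_1 _ z _ Dr). rewrite E. ring. replace (l - 0)%C with l by ring. auto.
    + apply (zord_prodl_0 rs f z l D). rewrite E. auto.
  - apply (zord_mult (fun w => f w - r)%C (fun w => prodl rs (f w)) z 0 1).
    + apply (zord_0 _ z _ Dr). apply Csub_neq0; auto.
    + apply IH; auto. destruct H; auto. subst. contradiction.
Qed.

Lemma zord_product f z l a b rs n4 n6 nj : sqrt 3 / 2 <= Im z ->
  (forall w, hA <= Im w -> f w = (E4 w ^ a * E6 w ^ b * Delta w ^ l * prodl rs (jinv w))%C) ->
  zord E4 z n4 -> zord E6 z n6 -> zord (fun w => prodl rs (jinv w)) z nj -> zord f z (a * n4 + b * n6 + l * 0 + nj).
Proof.
  intros Hz E Z4 Z6 Zj. assert (S3 := sqrt3_bounds). assert (HzH : inH z) by (unfold inH; lra).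
  assert (Zd : zord Delta z 0) by (apply (zord_0 _ z _ (Delta_deriv z HzH)), Delta_neq0).
  (* The ball of radius 1/10 stays in the region of the product formula, as
     [sqrt 3 / 2 - 1 / 10 > hA]. *)
  apply (zord_ext _ (fun w => E4 w ^ a * E6 w ^ b * Delta w ^ l * prodl rs (jinv w))%C z _ (/ 10)). lra.
  - intros w Hw. apply E. unfold hA. assert (A := Rabs_Im_sub w z). apply Rabs_le_between in A. lra.
  - apply (zord_mult (fun w => E4 w ^ a * E6 w ^ b * Delta w ^ l)%C (fun w => prodl rs (jinv w))); auto.
    apply (zord_mult (fun w => E4 w ^ a * E6 w ^ b)%C (fun w => Delta w ^ l)%C); [|apply zord_pow; auto].
    apply (zord_mult (fun w => E4 w ^ a)%C (fun w => E6 w ^ b)%C); apply zord_pow; auto.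
Qed.

(** At rho and [i] the factor in [jinv] does not vanish, its roots being values at points of the
    open arc. At those points [E4] and [E6] do not vanish, so [jinv] has nonzero derivative and the
    zero is simple. *)
Lemma orders_at l a b th N f : (forall i, (i < N)%nat -> PI / 2 < th i < 2 * PI / 3) -> NoDup (jroots th N) ->
  (forall w, hA <= Im w -> f w = (E4 w ^ a * E6 w ^ b * Delta w ^ l * prodl (jroots th N) (jinv w))%C) ->
  zord f rho a /\ zord f Ci b /\ forall i, (i < N)%nat -> zord f (earc (th i)) 1.
Proof.
  intros Hth ND E. assert (HP := PI_bounds). assert (S3 := sqrt3_bounds).
  assert (Hi : hA <= Im Ci) by (unfold hA; simpl; lra). assert (HiH := inH_hA _ Hi).
  assert (Hr := hA_rho). assert (HrH := inH_rho).
  assert (N4i : E4 Ci <> 0%C) by (intros X; apply (E4_E6_neq0 Ci Hi X E6_i)).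
  assert (NJ : forall t, t = PI / 2 \/ t = 2 * PI / 3 -> ~ In (jinv (earc t)) (jroots th N)).
  { intros t Ht H. apply jroots_in in H. destruct H as (i & Hi' & Ej). specialize (Hth i Hi').
    apply Jarc_inj in Ej; lra. }
  split; [|split].
  - replace a with (a * 1 + b * 0 + l * 0 + 0)%nat by lia. eapply zord_product; eauto.
    + unfold rho; simpl. lra.
    + destruct (E4_deriv_at_zero rho Hr E4_rho) as [D X]. apply (zord_1 _ _ _ D E4_rho X).
    + apply (zord_0 _ _ _ (E6_deriv rho Hr) E6_rho_neq0).
    + apply (zord_prodl_0 _ _ _ _ (jinv_deriv rho Hr)). rewrite <- earc_rho. apply NJ; auto.
  - replace b with (a * 0 + b * 1 + l * 0 + 0)%nat by lia. eapply zord_product; eauto.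
    + simpl; lra.
    + apply (zord_0 _ _ _ (E4_deriv Ci HiH) N4i).
    + destruct (E6_deriv_at_zero Ci Hi E6_i) as [D X]. apply (zord_1 _ _ _ D E6_i X).
    + apply (zord_prodl_0 _ _ _ _ (jinv_deriv Ci Hi)). rewrite <- earc_PI2. apply NJ; auto.
  - intros i Hi'. specialize (Hth i Hi'). set (t := th i) in *. set (z := earc t).
    assert (Hz : hA <= Im z) by (apply hA_earc; lra). assert (HzH := inH_hA z Hz).
    assert (N4 : E4 z <> 0%C).
    { intros X. assert (Q := A4_eq t ltac:(lra)). fold z in Q. rewrite X, Cmult_0_r in Q. assert (A := A4_neg t ltac:(lra)).
      apply RtoC_inj in Q. lra. }
    assert (N6 : E6 z <> 0%C).
    { intros X. assert (Q := A6_eq t ltac:(lra)). fold z in Q. rewrite X, Cmult_0_r in Q. assert (A := A6_pos t ltac:(lra)).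
      apply RtoC_inj in Q. lra. }
    replace 1%nat with (a * 0 + b * 0 + l * 0 + 1)%nat by lia. eapply zord_product; eauto.
    + apply sin_arc. lra.
    + apply (zord_0 _ _ _ (E4_deriv z HzH) N4).
    + apply (zord_0 _ _ _ (E6_deriv z Hz) N6).
    + apply (zord_prodl_1 _ _ _ _ (jinv_deriv z Hz)); auto.
      * apply Cmult_neq_0. apply TPI_neq0. unfold Cdiv. apply Cmult_neq_0.
        -- intros X. assert (Y : (E4 z ^ 2 * E6 z)%C = 0%C) by (transitivity (- - (E4 z ^ 2 * E6 z))%C; [ring|rewrite X; ring]).
           revert Y. apply Cmult_neq_0; auto. apply Cpow_nz; auto.
        -- intros X. apply C1_nz. transitivity (Delta z * / Delta z)%C. field. apply Delta_neq0. rewrite X. ring.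
      * unfold jroots. apply in_map_iff. exists i. split; auto. apply in_seq. lia.
Qed.

(** * Counting points of an interval *)

Fixpoint hits (x : nat -> R) (u v : R) (N : nat) : R :=
  match N with O => 0 | S N => hits x u v N + indicator (u <= x N <= v) end.

Lemma indicator_iff P Q : (P <-> Q) -> indicator P = indicator Q.
Proof. unfold indicator. intros H. do 2 destruct ClassicalEpsilon.excluded_middle_informative; tauto. Qed.

Lemma indicator_01 P : 0 <= indicator P <= 1.
Proof. unfold indicator. destruct ClassicalEpsilon.excluded_middle_informative; lra. Qed.

(** There is one point in each interval (i, i + 1). The bounds are clipped at [N] and at 0 so that
    the induction on [N] goes through. *)
Lemma hits_bounds x u v N : (forall i, (i < N)%nat -> INR i < x i < INR i + 1) ->
  0 <= hits x u v N /\ Rmin (INR N) (v - 1) - Rmax (u + 1) 0 <= hits x u v N /\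
  hits x u v N <= Rmax 0 (Rmin (INR N) (v + 1) - u + 1).
Proof.
  induction N as [|N IH]; intros Hx.
  - cbn [hits INR]. split; [lra|]. split.
    + generalize (Rmin_l 0 (v - 1)) (Rmax_r (u + 1) 0). lra.
    + apply Rmax_l.
  - destruct IH as (I0 & I1 & I2). { intros; apply Hx; lia. }
    specialize (Hx N ltac:(lia)). cbn [hits]. rewrite S_INR. revert I1 I2. set (n := INR N) in *. set (s := hits x u v N) in *.
    unfold indicator. destruct ClassicalEpsilon.excluded_middle_informative as [A|A];
    unfold Rmax, Rmin; repeat destruct Rle_dec; intros I1 I2; try (split; [lra|split; lra]).
    all: exfalso; apply A; lra.
Qed.

Lemma hits_estimate x u v N : (forall i, (i < N)%nat -> INR i < x i < INR i + 1) -> -1 <= u <= v -> v <= INR N + 1 ->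
  Rabs (hits x u v N - (v - u)) <= 2.
Proof.
  intros Hx Hu Hv. destruct (hits_bounds x u v N Hx) as (_ & H1 & H2).
  rewrite Rmin_right, Rmax_left in H1 by lra. 
  assert (Rmax 0 (Rmin (INR N) (v + 1) - u + 1) <= v - u + 2).
  { apply Rmax_lub. lra. generalize (Rmin_r (INR N) (v + 1)). lra. }
  apply Rabs_le. lra.
Qed.

Lemma earc_inj s t : PI / 2 <= s <= 2 * PI / 3 -> PI / 2 <= t <= 2 * PI / 3 -> earc s = earc t -> s = t.
Proof. intros Hs Ht E. apply Jarc_inj; auto. rewrite E; auto. Qed.

Lemma on_arc_earc A B t : PI / 2 <= A -> B <= 2 * PI / 3 -> PI / 2 <= t <= 2 * PI / 3 -> (on_arc A B (earc t) <-> A <= t <= B).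
Proof.
  intros HA HB Ht. split.
  - intros (r & Hr & E). change (earc t = earc r) in E. apply earc_inj in E; auto. lra. lra.
  - intros H. exists t. split; auto.
Qed.

(** The entries at rho and [i] are present only when their order is positive, as [zeros_in_F]
    requires. *)
Definition zlist (a b N : nat) (th : nat -> R) : list (C * nat) :=
  map (fun i => (earc (th i), 1%nat)) (seq 0 N) ++
  ((if Nat.eqb a 0 then nil else (rho, a) :: nil) ++ (if Nat.eqb b 0 then nil else (Ci, b) :: nil)).

Lemma count_mult_app s1 s2 : count_mult (s1 ++ s2) = count_mult s1 + count_mult s2.
Proof. unfold count_mult. induction s1 as [|p s1 IH]; simpl; [ring|rewrite IH; ring]. Qed.

Lemma count_mult_arc_app A B s1 s2 : count_mult_arc A B (s1 ++ s2) = count_mult_arc A B s1 + count_mult_arc A B s2.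
Proof. unfold count_mult_arc. induction s1 as [|p s1 IH]; simpl; [ring|rewrite IH; ring]. Qed.

Lemma count_arc_le A B s : 0 <= count_mult_arc A B s <= count_mult s.
Proof.
  unfold count_mult_arc, count_mult. induction s as [|p s IH]; simpl. lra.
  generalize (indicator_01 (on_arc A B (fst p))) (pos_INR (snd p)). nra.
Qed.

Lemma count_zlist a b N th : count_mult (zlist a b N th) = INR N + INR a + INR b.
Proof.
  unfold zlist. rewrite !count_mult_app.
  assert (E1 : count_mult (map (fun i => (earc (th i), 1%nat)) (seq 0 N)) = INR N).
  { induction N as [|N IH]. auto. rewrite seq_S, map_app, count_mult_app, IH, S_INR. unfold count_mult. simpl. ring. }
  rewrite E1. destruct (Nat.eqb_spec a 0) as [->|_]; destruct (Nat.eqb_spec b 0) as [->|_]; unfold count_mult; simpl fold_right; simpl INR; ring.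
Qed.

Lemma count_arc_zlist A B a b N th : PI / 2 <= A -> B <= 2 * PI / 3 -> (forall i, (i < N)%nat -> PI / 2 < th i < 2 * PI / 3) ->
  hits th A B N <= count_mult_arc A B (zlist a b N th) <= hits th A B N + INR a + INR b.
Proof.
  intros HA HB Hth. unfold zlist. rewrite count_mult_arc_app.
  assert (E1 : count_mult_arc A B (map (fun i => (earc (th i), 1%nat)) (seq 0 N)) = hits th A B N).
  { induction N as [|N IH]. auto. rewrite seq_S, map_app, count_mult_arc_app, IH by (intros; apply Hth; lia).
    unfold count_mult_arc. simpl. rewrite Rmult_1_r, Rplus_0_r. f_equal. apply indicator_iff, on_arc_earc; auto.
    specialize (Hth N ltac:(lia)). lra. }
  rewrite E1. set (s2 := _ ++ _). assert (X := count_arc_le A B s2).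
  assert (E2 : count_mult s2 = INR a + INR b).
  { unfold s2. rewrite count_mult_app. destruct (Nat.eqb_spec a 0) as [->|_]; destruct (Nat.eqb_spec b 0) as [->|_]; unfold count_mult; simpl fold_right; simpl INR; ring. }
  lra.
Qed.

Lemma zlist_zeros l a b N th (f : C -> C) : (forall i, (i < N)%nat -> PI / 2 < th i < 2 * PI / 3) ->
  NoDup (map th (seq 0 N)) -> NoDup (jroots th N) ->
  (forall w, hA <= Im w -> f w = (E4 w ^ a * E6 w ^ b * Delta w ^ l * prodl (jroots th N) (jinv w))%C) ->
  zeros_in_F f (zlist a b N th).
Proof.
  intros Hth ND1 ND2 E. assert (HP := PI_bounds). destruct Ci_earc_rho as [Ei Er].
  destruct (orders_at l a b th N f Hth ND2 E) as (O1 & O2 & O3).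
  assert (Fr : inF rho) by (rewrite Er; apply inF_earc; lra). assert (Fi : inF Ci) by (rewrite Ei; apply inF_earc; lra).
  assert (M1 : map fst (zlist a b N th) = map (fun i => earc (th i)) (seq 0 N) ++
    ((if Nat.eqb a 0 then nil else rho :: nil) ++ (if Nat.eqb b 0 then nil else Ci :: nil))).
  { unfold zlist. rewrite !map_app, map_map. f_equal. destruct (Nat.eqb a 0); destruct (Nat.eqb b 0); auto. }
  assert (Nth : forall t, t = PI / 2 \/ t = 2 * PI / 3 -> ~ In (earc t) (map (fun i => earc (th i)) (seq 0 N))).
  { intros t Ht H. apply in_map_iff in H. destruct H as (i & X & Hi). apply in_seq in Hi. specialize (Hth i ltac:(lia)).
    apply earc_inj in X; lra. }
  split; [|split].
  - rewrite M1. apply NoDup_app.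
    + rewrite <- (map_map th earc). apply NoDup_map_NoDup_ForallPairs; auto.
      intros x y Hx Hy X. apply in_map_iff in Hx, Hy. destruct Hx as (i & <- & Hi). destruct Hy as (j & <- & Hj).
      apply in_seq in Hi, Hj. assert (A := Hth i ltac:(lia)). assert (B := Hth j ltac:(lia)). apply earc_inj; auto; lra.
    + assert (Nir : rho <> Ci). { intros X. rewrite Ei, Er in X. apply earc_inj in X; lra. }
      destruct (Nat.eqb a 0); destruct (Nat.eqb b 0); simpl; repeat constructor; simpl; intuition.
    + intros x Hx Hx'. apply in_app_iff in Hx'. destruct Hx' as [H|H].
      * destruct (Nat.eqb a 0); [destruct H|destruct H as [<-|[]]]. revert Hx. rewrite Er. apply Nth; auto.
      * destruct (Nat.eqb b 0); [destruct H|destruct H as [<-|[]]]. revert Hx. rewrite Ei. apply Nth; auto.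
  - intros p Hp. unfold zlist in Hp. rewrite !in_app_iff in Hp. destruct Hp as [H|[H|H]].
    + apply in_map_iff in H. destruct H as (i & <- & Hi). apply in_seq in Hi. simpl. specialize (Hth i ltac:(lia)).
      split. apply inF_earc; lra. split; auto. apply zord_zero_order, O3. lia.
    + destruct (Nat.eqb_spec a 0); [destruct H|destruct H as [<-|[]]]. simpl. split; auto. split. lia. apply zord_zero_order; auto.
    + destruct (Nat.eqb_spec b 0); [destruct H|destruct H as [<-|[]]]. simpl. split; auto. split. lia. apply zord_zero_order; auto.
  - intros z Hz Z. rewrite E in Z by (apply inF_hA; auto). rewrite M1, !in_app_iff.
    destruct (zeros_cases l a b th N z Hth Hz Z) as [[-> Ha]|[[-> Hb]|(i & Hi & ->)]].
    + right; left. destruct (Nat.eqb_spec a 0). lia. left; auto.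
    + right; right. destruct (Nat.eqb_spec b 0). lia. left; auto.
    + left. apply in_map_iff. exists i. split; auto. apply in_seq. lia.
Qed.

Lemma hits_ext x y u v u' v' N : (forall i, (i < N)%nat -> (u <= x i <= v <-> u' <= y i <= v')) -> hits x u v N = hits y u' v' N.
Proof. intros H. induction N as [|N IH]; auto. cbn [hits]. rewrite IH by (intros; apply H; lia). f_equal. apply indicator_iff, H. lia. Qed.

Lemma Psi_le_iff h m s t : 2 * PI * INR m < INR h -> (s <= t <-> Psi h m s <= Psi h m t).
Proof.
  intros Hh. split; intros H.
  - destruct H as [H| ->]; [left; apply Psi_incr; auto|lra].
  - apply Rnot_lt_le. intros L. generalize (Psi_incr h m t s Hh L). lra.
Qed.

(** In the normalised phase [P] there is one zero in each interval (i, i + 1), so the hits number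
    [P B - P A] up to 2. The main part of this difference is linear in [l]; the contributions of
    [a], [b] and [m cos t] are bounded. *)
Lemma count_arc_estimate m l a b th A B : (m <= l)%nat -> (a <= 2)%nat -> (b <= 1)%nat -> 2 * PI * INR m < INR (half_weight l a b) ->
  (forall i, (i < l - m)%nat -> PI / 2 < th i < 2 * PI / 3 /\
    INR (3 * l + a + 2 * b + i) * PI < Psi (half_weight l a b) m (th i) < INR (3 * l + a + 2 * b + S i) * PI) ->
  PI / 2 <= A -> A < B -> B <= 2 * PI / 3 ->
  Rabs (count_mult_arc A B (zlist a b (l - m) th) - 6 * (B - A) / PI * INR l) <= 12 + 2 * INR m.
Proof.
  intros Hml Ha Hb Hh Hth HA HAB HB. assert (HP := PI_bounds). set (h := half_weight l a b) in *. set (N := (l - m)%nat) in *.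
  set (n0 := (3 * l + a + 2 * b)%nat) in *. set (P := fun t => Psi h m t / PI - INR n0).
  assert (Pm : forall s t, s <= t <-> P s <= P t).
  { intros s t. rewrite (Psi_le_iff h m s t Hh). unfold P. split; intros H.
    - assert (Psi h m s / PI <= Psi h m t / PI); [|lra]. apply Rmult_le_compat_r; auto. left. apply Rinv_0_lt_compat; lra.
    - apply Rmult_le_reg_r with (/ PI). apply Rinv_0_lt_compat; lra. unfold Rdiv in H. lra. }
  assert (C1 := count_arc_zlist A B a b N th HA HB (fun i Hi => proj1 (Hth i Hi))).
  rewrite (hits_ext th (fun i => P (th i)) A B (P A) (P B) N) in C1 by (intros; rewrite <- !Pm; tauto).
  assert (Ia : 0 <= INR a <= 2) by (split; [apply pos_INR|replace 2 with (INR 2) by (simpl; ring); apply le_INR; auto]).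
  assert (Ib : 0 <= INR b <= 1) by (split; [apply pos_INR|replace 1 with (INR 1) by (simpl; ring); apply le_INR; auto]).
  assert (Im := pos_INR m). assert (Il := pos_INR l).
  assert (Eh : INR h = 6 * INR l + 2 * INR a + 3 * INR b).
  { unfold h, half_weight. rewrite !plus_INR, !mult_INR, !INR_IZR_INZ. simpl Z.of_nat. rewrite <- !INR_IZR_INZ. ring. }
  assert (En : INR n0 = 3 * INR l + INR a + 2 * INR b).
  { unfold n0. rewrite !plus_INR, !mult_INR, !INR_IZR_INZ. simpl Z.of_nat. rewrite <- !INR_IZR_INZ. ring. }
  assert (EN : INR N = INR l - INR m) by (unfold N; apply minus_INR; auto).
  destruct (Psi_arc h m) as [Q1 Q2].
  (* [P] equals [- b / 2] at the left end and [N + a / 3] at the right end, hence stays within 1 of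
     [0, N]. *)
  assert (U : -1 <= P A).
  { apply Rle_trans with (P (PI / 2)); [|apply (proj1 (Pm _ _)); auto]. unfold P. rewrite Q1, Eh, En.
    replace ((6 * INR l + 2 * INR a + 3 * INR b) * PI / 2 / PI) with ((6 * INR l + 2 * INR a + 3 * INR b) / 2) by (field; lra).
    lra. }
  assert (V : P B <= INR N + 1).
  { apply Rle_trans with (P (2 * PI / 3)); [apply (proj1 (Pm _ _)); auto|]. unfold P. rewrite Q2, Eh, En, EN.
    replace ((2 * (6 * INR l + 2 * INR a + 3 * INR b) * PI / 3 - INR m * PI) / PI) with (2 * (6 * INR l + 2 * INR a + 3 * INR b) / 3 - INR m) by (field; lra).
    lra. }
  assert (H := hits_estimate (fun i => P (th i)) (P A) (P B) N).
  assert (X : forall i, (i < N)%nat -> INR i < P (th i) < INR i + 1).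
  { intros i Hi. destruct (Hth i Hi) as (_ & K1 & K2). rewrite plus_INR in K1, K2. rewrite S_INR in K2. unfold P.
    assert (K3 : Psi h m (th i) = Psi h m (th i) / PI * PI) by (field; lra). set (y := Psi h m (th i) / PI) in *.
    rewrite K3 in K1, K2. apply Rmult_lt_reg_r in K1, K2; lra. }
  specialize (H X (conj U (proj1 (Pm A B) ltac:(lra))) V).
  assert (Dv : P B - P A = 6 * (B - A) / PI * INR l + (2 * INR a + 3 * INR b) * ((B - A) / PI) + 2 * INR m * (cos B - cos A)).
  { unfold P, Psi. rewrite Eh. field. lra. }
  assert (CA := cos_arc A ltac:(lra)). assert (CB := cos_arc B ltac:(lra)).
  assert (D1 : 0 <= (2 * INR a + 3 * INR b) * ((B - A) / PI) <= 7).
  { assert (0 <= (B - A) / PI <= 1).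
    { split. apply Rmult_le_pos; [lra|left; apply Rinv_0_lt_compat; lra]. apply Rmult_le_reg_r with PI; [lra|].
      unfold Rdiv. rewrite Rmult_assoc, Rinv_l by lra. lra. }
    split. apply Rmult_le_pos; lra. apply Rle_trans with (7 * 1); [|lra]. apply Rmult_le_compat; lra. }
  assert (D2 : - INR m <= 2 * INR m * (cos B - cos A) <= INR m) by (split; nra).
  apply Rabs_le_between in H. apply Rabs_le. lra.
Qed.

Lemma equidistribution m A B : PI / 2 <= A -> A < B -> B <= 2 * PI / 3 -> forall eps, 0 < eps ->
  exists L, forall l k' f, (L <= l)%nat -> kprime_ok k' -> is_g l k' m f ->
    exists s : list (C * nat), zeros_in_F f s /\
      Rabs (count_mult_arc A B s / count_mult s - (B - A) / (2 * PI / 3 - PI / 2)) < eps.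
Proof.
  intros HA HAB HB eps He. assert (HP := PI_bounds). assert (Im := pos_INR m).
  (* [K] collects [12 + 2 m] from the count and [m + 3] from replacing [l] by the total number [T]
     of zeros. *)
  destruct (miller_factor m) as (L1 & HL). set (K := 15 + 3 * INR m).
  destruct (nfloor_ex (K / eps)) as (L2 & HL2). apply Rmult_le_pos; [unfold K; lra|left; apply Rinv_0_lt_compat; auto].
  exists (L1 + (m + S (S L2)))%nat. intros l k' f Hl Hk Hg.
  destruct (is_g_miller l k' m f Hk Hg) as (Hml & a & b & c & HM & E).
  destruct (HL l a b c ltac:(lia) Hml HM) as (Hh & th & Hth & ND1 & ND2 & EF).
  destruct HM as (Ha & Hb & _). exists (zlist a b (l - m) th). split.
  { apply (zlist_zeros l); auto. intros i Hi. apply Hth; auto. intros w Hw. rewrite E, EF; auto. apply inH_hA; auto. }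
  assert (CE := count_arc_estimate m l a b th A B Hml Ha Hb Hh Hth HA HAB HB).
  rewrite count_zlist, minus_INR by auto. set (ca := count_mult_arc _ _ _) in *.
  assert (Ia : 0 <= INR a <= 2) by (split; [apply pos_INR|replace 2 with (INR 2) by (simpl; ring); apply le_INR; auto]).
  assert (Ib : 0 <= INR b <= 1) by (split; [apply pos_INR|replace 1 with (INR 1) by (simpl; ring); apply le_INR; auto]).
  set (T := INR l - INR m + INR a + INR b).
  assert (HT : K / eps < T).
  { assert (INR (m + S (S L2)) <= INR l) by (apply le_INR; lia). rewrite plus_INR, !S_INR in H. unfold T. lra. }
  assert (HK : 0 < K) by (unfold K; lra). assert (Kp : 0 < K / eps) by (apply Rdiv_lt_0_compat; auto).
  set (r := 6 * (B - A) / PI) in *. assert (Hr : 0 <= r <= 1).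
  { unfold r. split. apply Rmult_le_pos; [lra|left; apply Rinv_0_lt_compat; lra]. apply Rmult_le_reg_r with PI; [lra|].
    unfold Rdiv. rewrite Rmult_assoc, Rinv_l by lra. lra. }
  replace ((B - A) / (2 * PI / 3 - PI / 2)) with r by (unfold r; field; lra).
  replace (ca / T - r) with ((ca - r * T) / T) by (field; lra).
  unfold Rdiv at 1. rewrite Rabs_mult, (Rabs_pos_eq (/ T)) by (left; apply Rinv_0_lt_compat; lra).
  assert (X : Rabs (ca - r * T) <= K).
  { apply Rabs_le_between in CE. apply Rabs_le.
    assert (Y : r * T = r * INR l - r * (INR m - INR a - INR b)) by (unfold T; ring).
    assert (- (INR m + 3) <= r * (INR m - INR a - INR b) <= INR m + 3) by (split; nra). unfold K. lra. }
  apply Rle_lt_trans with (K * / T). apply Rmult_le_compat_r; auto. left; apply Rinv_0_lt_compat; lra.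
  apply Rmult_lt_reg_r with T; [lra|]. rewrite Rmult_assoc, Rinv_l by lra.
  apply Rle_lt_trans with (eps * (K / eps)). right; field; lra. apply Rmult_lt_compat_l; auto.
Qed.
Theorem theorem1p1 (m : nat) (hm : (1 <= m)%nat) :
  exists alpha beta : R, 0 < alpha /\ 0 < beta /\
  (forall (l k' : nat) (f : C -> C),
     kprime_ok k' -> alpha * INR m + beta < INR l -> is_g l k' m f ->
     forall z : C, inF z -> f z = (0 : C) -> arcA z) /\
  (forall a b : R, PI / 2 <= a -> a < b -> b <= 2 * PI / 3 ->
     forall eps : R, 0 < eps -> exists L : nat,
       forall (l k' : nat) (f : C -> C),
         kprime_ok k' -> (L <= l)%nat -> is_g l k' m f ->
         exists s : list (C * nat), zeros_in_F f s /\
           Rabs (count_mult_arc a b s / count_mult s - (b - a) / (2 * PI / 3 - PI / 2)) < eps).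

Proof.
  destruct (zeros_on_arc m) as (L & HL). assert (Hm := pos_INR m). assert (HLp := pos_INR L).
  (* As [m] is fixed, the threshold [L] is a constant and goes into [beta]; any positive [alpha]
     will do. *)
  exists 1, (INR L + 1). split; [lra|]. split; [lra|]. split.
  - intros l k' f Hk Hl Hg. apply (HL l k' f); auto. apply INR_le. lra.
  - intros a b Ha Hab Hb eps He. destruct (equidistribution m a b Ha Hab Hb eps He) as (M & HM).
    exists M. intros l k' f Hk Hl Hg. apply (HM l k' f); auto.
Qed.
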